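(* Let $\beta$ be an admissible positive braid with $N$ strands, and let $\Lambda(\beta)$ be its $(-1)$-closure, with one base point on each of the $N$ strands of $\beta$. Then the homotopy Poisson algebra $(\mathcal{A}^{\mathrm{comm}},\{\ell_k\})$ of $\Lambda(\beta)$ is strict: $\ell_k=0$ for all $k\ge3$.
   Context: Braids and $(-1)$-closures. A positive braid on $N$ strands is drawn from left to right in $[0,1]\times\mathbb{R}$, all strands oriented rightwards, with all crossings positive (the upper strand runs from upper left to lower right). It is admissible if this diagram, with ends identified, represents the $xy$-projection of a Legendrian link in $J^1(S^1)=(S^1\times\mathbb{R}\times\mathbb{R},\ker(dz-y\,dx))$, $S^1=[0,1]/(0\sim1)$. Let $\Lambda_0\subset(\mathbb{R}^3,\ker(dz-y\,dx))$ be the standard Legendrian unknot, whose $xy$-projection is a figure-eight curve with a single crossing. A neighborhood of the zero section of $J^1(S^1)$ is identified with a neighborhood of $\Lambda_0$ by a contactomorphism covering an orientation-preserving immersion of an annulus $S^1\times(-\varepsilon,\varepsilon)$ onto a neighborhood of $\Pi_{xy}(\Lambda_0)$ in the $(x,y)$-plane. The $(-1)$-closure $\Lambda(\beta)\subset\mathbb{R}^3$ is the image of the Legendrian link in $J^1(S^1)$ given by $\beta$, after scaling $y,z$ to be small. Its $xy$-projection consists of $N$ strands parallel to the figure-eight, with $\beta$ inserted in a part of the figure-eight, disjoint from its crossing, where it runs in the direction $\partial/\partial x$. If $\beta$ has $k$ crossings, $\Lambda(\beta)$ has $k+N^2$ Reeb chords: $a_1,\dots,a_k$ (the crossings of $\beta$)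 and $\tilde a_{ij}$, $1\le i,j\le N$ (from the crossing of the figure-eight). The $N$ base points are placed immediately to the right of $\beta$, one on each strand, where the tangent direction is $\partial/\partial x$; the Maslov potential is identically $0$. Setting. $\Pi_{xy}:\mathbb{R}^3\to\mathbb{R}^2$ is the projection to the oriented $(x,y)$-plane. Let $\Lambda$ be an oriented Legendrian link with base points $\bullet_1,\dots,\bullet_s$, at least one on each component, such that the only singularities of $\Pi_{xy}(\Lambda)$ are transverse double points away from the base points. The crossings are the Reeb chords $a_1,\dots,a_n$; $a_j^+$ (resp. $a_j^-$) is the endpoint of $a_j$ with larger (resp. smaller) $z$. $\star_i\in\Lambda$ is a marked point immediately preceding $\bullet_i$ along the orientation. To each Reeb chord $a_j$ are associated variables $q_j,p_j$, and to each $\bullet_i$ an invertible variable $t_i$. These are graded by $|v|=\lfloor2(-r(\gamma_v)+m(\bullet_{e_+(v)})-m(\bullet_{e_-(v)}))\rfloor$ as usual in Legendrian contact homology; for $\Lambda(\beta)$ with the Maslov potential $m$ identically $0$ at the $N$ base points placed immediately to the right of $\beta$, $|q_i|=0$, $|p_i|=-1$ for the crossings of $\beta$, $|\tilde q_{ij}|=1$, $|\tilde p_{ij}|=-2$, and $|t_i^{\pm1}|=0$. Algebras (over a field $\Bbbk$ of characteristic $0$). $\mathcal{A}^{\mathrm{comm}}$ is the graded commutative polynomial algebra generated by all $q$-variables and $t_i^{\pm1}$. $\mathcal{A}_{\mathrm{SFT}}^{\mathrm{comm}}$ is the graded commutative algebra generated by all $q$-, $p$-variables and $t_i^{\pm1}$,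 completed with respect to the number of $p$'s. Hamiltonian. $\Delta(\Lambda)$ is the set of maps $\Delta$ from $D^2$ with any number of boundary marked points to $\mathbb{R}^2$, up to reparametrization, that are continuous, orientation-preserving immersions away from the boundary marked points, with $\Delta(\partial D^2)\subset\Pi_{xy}(\Lambda)$, and that send each boundary marked point to a crossing and a neighborhood of it injectively to one of the four quadrants there. A quadrant at $a_j$ is labeled $p_j$ if, following its boundary counterclockwise, one arrives at the crossing along the lower strand and leaves along the upper strand, and is labeled $q_j$ otherwise. Going counterclockwise around $\partial\Delta$, record the labels of the corners, and $t_i$ (resp. $t_i^{-1}$) when passing $\star_i$ along (resp. against) the orientation of $\Lambda$; this gives a cyclic word $v_1\cdots v_k$, written with $v_k$ a $p$ or $q$. Put $\epsilon_i(\Delta)=+1$ if $v_i$ is a $t_j^{\pm1}$; if $v_i$ is a corner at a positive crossing, $\epsilon_i(\Delta)=+1$ if the quadrant lies to the left of both oriented strands and $-1$ for the other three quadrants; if $v_i$ is a corner at a negative crossing, $\epsilon_i(\Delta)=-1$ if the quadrant is the $p$-quadrant whose counterclockwise outgoing edge runs against the orientation of $\Lambda$, and $+1$ for the other three. Put $\epsilon'(\Delta;v_k)=\pm1$ according to whether $\partial\Delta$ right after the corner $v_k$ agrees or disagrees with the orientation of $\Lambda$. Then $\tilde w(\Delta)=\epsilon_1(\Delta)\cdots\epsilon_k(\Delta)\epsilon'(\Delta;v_k)\,v_1\cdots v_k$, and $h_k=\sum\tilde w(\Delta)$ over those $\Delta$ whose word contains exactly $k$ $p$'s. SFT bracket.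 $\{\cdot,\cdot\}$ on $\mathcal{A}_{\mathrm{SFT}}^{\mathrm{comm}}$ is the bilinear map of degree $+1$ with $\{p_i,q_j\}=-\{q_j,p_i\}=\delta_{ij}$, all other brackets of generators $0$, $\{y,x\}=(-1)^{|x||y|+|x|+|y|}\{x,y\}$, $\{x,yz\}=\{x,y\}z+(-1)^{(|x|+1)|y|}y\{x,z\}$ and $\{xy,z\}=x\{y,z\}+(-1)^{|y|(|z|+1)}\{x,z\}y$. Operations. For $k\ge3$ and $x_1,\dots,x_k\in\mathcal{A}^{\mathrm{comm}}$, $\ell_k(x_1,\dots,x_k)=(-1)^{|x_{k-1}|+|x_{k-3}|+\cdots}\{\cdots\{\{h_k,x_1\},x_2\},\dots,x_k\}$. (The operations $\ell_1$, $\ell_2$ of the homotopy Poisson structure do not enter the statement.) *)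

(* Defs.v *)
From HB Require Import structures.
From mathcomp Require Import all_boot all_order all_fingroup all_algebra.
From mathcomp Require Import all_classical all_reals all_analysis.
Set Implicit Arguments.
Unset Strict Implicit.
Unset Printing Implicit Defensive.
Import Order.TTheory GRing.Theory Num.Theory.
Import numFieldNormedType.Exports.
Local Open Scope classical_set_scope.
Local Open Scope ring_scope.

(* For U open this is the usual notion of a C^n map on U. *)
Fixpoint Cn (R : realType) (V W : normedModType R) (n : nat) (f : V -> W)
    (U : set V) : Prop :=
  (forall p, U p -> continuous_at p f) /\
  if n is m.+1 then
    forall v : V, (forall p, U p -> derivable f p v) /\
                  Cn m (fun p => 'D_v f p : W) U
  else True.

Definition smooth_on (R : realType) (V W : normedModType R) (f : V -> W)
    (U : set V) : Prop := forall n, Cn n f U.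

Definition det2 (R : realType) (a b : R * R) : R := a.1 * b.2 - a.2 * b.1.

Definition jacobian (R : realType) (f : R * R -> R * R) (w : R * R) : R :=
  det2 ('D_((1, 0) : R * R) f w) ('D_((0, 1) : R * R) f w).

Definition disk2 (R : realType) : set (R * R) :=
  [set w | w.1 ^+ 2 + w.2 ^+ 2 <= 1].

Definition circle (R : realType) (th : R) : R * R :=
  (cos (2 * pi * th), sin (2 * pi * th)).

Definition plane_diffeo (R : realType) (h : R * R -> R * R) : Prop :=
  smooth_on h setT /\
  (exists h' : R * R -> R * R,
     [/\ smooth_on h' setT, cancel h h' & cancel h' h]) /\
  (forall w, 0 < jacobian h w).

(* A point of R^3 is ((x, y), z), so p.1 is its xy-projection. *)
Definition contact_form (R : realType) (p v : R * R * R) : R :=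
  v.2 - p.1.2 * v.1.1.

(* A link is parametrised by a covering of the circle of degree N: strand i is
   a path R -> R^3 and strand i (x + 1) = strand (monodromy i) x, so that the
   points of the link are the pairs (i, x) with 0 <= x < 1, and increasing x is
   the orientation.  C labels the Reeb chords, with endpoints over c (a_c^+) and
   under c (a_c^-); the s base points are base r, preceded by the marked points
   star r; qdeg c = |q_c|. *)
Record diagram (R : realType) (C : finType) (N s : nat) := Diagram {
  strand : 'I_N -> R -> R * R * R;
  monodromy : {perm 'I_N};
  over : C -> 'I_N * R;
  under : C -> 'I_N * R;
  base : 'I_s -> 'I_N * R;
  star : 'I_s -> 'I_N * R;
  qdeg : C -> int }.

Definition on_link (R : realType) (N : nat) (u : 'I_N * R) : Prop :=
  0 <= u.2 /\ u.2 < 1.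

Definition pt (R : realType) (C : finType) (N s : nat) (L : diagram R C N s)
  (u : 'I_N * R) : R * R * R := strand L u.1 u.2.

Definition xyproj (R : realType) (C : finType) (N s : nat)
  (L : diagram R C N s) : set (R * R) :=
  [set w | exists i x, w = (strand L i x).1].

Definition tangent (R : realType) (C : finType) (N s : nat)
  (L : diagram R C N s) (u : 'I_N * R) : R * R :=
  derive1 (fun x => (strand L u.1 x).1 : R * R) u.2.

(* The link is Legendrian;
   over, under enumerate the Reeb chords, without repetition; the singularities
   of the xy-projection are transverse double points; star r immediately
   precedes base r on the same strand (no crossing in between, ends included). *)
Record generic_diagram (R : realType) (C : finType) (N s : nat)
    (L : diagram R C N s) : Prop := {
  gen_smooth : forall i, smooth_on (strand L i : R -> R * R * R) setT;
  gen_legendrian : forall i x, tangent L (i, x) <> 0 /\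
    contact_form (strand L i x)
      (derive1 (strand L i : R -> R * R * R) x) = 0;
  gen_closed : forall i x, strand L i (x + 1) = strand L (monodromy L i) x;
  gen_on : forall c, on_link (over L c) /\ on_link (under L c);
  gen_chord : forall c, (pt L (over L c)).1 = (pt L (under L c)).1 /\
                        (pt L (under L c)).2 < (pt L (over L c)).2;
  gen_all : forall u v, on_link u -> on_link v -> u <> v ->
    (pt L u).1 = (pt L v).1 ->
    exists c, (over L c = u /\ under L c = v) \/
              (over L c = v /\ under L c = u);
  gen_double : forall c c', (pt L (over L c)).1 = (pt L (over L c')).1 -> c = c';
  gen_transverse : forall c,
    det2 (tangent L (over L c)) (tangent L (under L c)) != 0;
  gen_base : forall r, on_link (base L r) /\ on_link (star L r) /\
    (star L r).1 = (base L r).1 /\ (star L r).2 < (base L r).2;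
  gen_star : forall r c x, (star L r).2 <= x -> x <= (base L r).2 ->
    over L c <> ((base L r).1, x) /\ under L c <> ((base L r).1, x);
  gen_star_inj : injective (star L) }.

Definition dir (R : realType) (o : bool) : R := if o then 1 else -1.

(* Crossing c, in coordinates (u, v) in which the overstrand is v = 0 and the
   understrand is u = 0, both oriented as the link: near (0, 0) this is a local
   diffeomorphism, and the four quadrants at c are the images of the four
   coordinate quadrants. *)
Definition crossing_chart (R : realType) (C : finType) (N s : nat)
    (L : diagram R C N s) (c : C) (u v : R) : R * R :=
  (strand L (over L c).1 ((over L c).2 + u)).1
  + (strand L (under L c).1 ((under L c).2 + v)).1
  - (pt L (over L c)).1.

(* f sends a neighbourhood in D^2 of circle th injectively into the quadrant at
   c bounded by the half of the overstrand leaving c in the direction o (true: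
   along the orientation) and the half of the understrand in the direction u. *)
Definition corner_at (R : realType) (C : finType) (N s : nat)
    (L : diagram R C N s) (f : R * R -> R * R) (th : R) (c : C) (o u : bool) :
    Prop :=
  [/\ f (circle th) = (pt L (over L c)).1,
      (forall d : R, 0 < d -> exists2 r : R, 0 < r &
         forall w, disk2 w -> `|w - circle th| < r ->
         exists a b : R, [/\ 0 <= a < d, 0 <= b < d &
           f w = crossing_chart L c (dir R o * a) (dir R u * b)]) &
      (exists2 r : R, 0 < r & forall w w', disk2 w -> disk2 w' ->
         `|w - circle th| < r -> `|w' - circle th| < r -> f w = f w' -> w = w')].

(* Boundary marked points are given by their parameters in ]0, 1].  Only the
   restriction of dmap to D^2 is meaningful. *)
Record disk (R : realType) := Disk {
  dmap : R * R -> R * R;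
  marks : set R }.

Record is_disk (R : realType) (C : finType) (N s : nat)
    (L : diagram R C N s) (D : disk R) : Prop := {
  disk_marks : finite_set (marks D) /\
    (forall th, marks D th -> 0 < th /\ th <= 1);
  disk_cont : {within @disk2 R, continuous (dmap D)};
  disk_immersion : forall w, disk2 w ->
    (forall th, marks D th -> w <> circle th) ->
    exists (U : set (R * R)) (F : R * R -> R * R),
      [/\ open U /\ U w, smooth_on F U,
          (forall w', disk2 w' -> U w' -> dmap D w' = F w') &
          0 < jacobian F w];
  disk_boundary : forall th, xyproj L (dmap D (circle th));
  disk_corners : forall th, marks D th ->
    exists c o u, corner_at L (dmap D) th c o u }.

(* Reparametrisations are homeomorphisms of D^2 respecting the marked points;
   since dmap is an orientation-preserving immersion elsewhere, they are then
   orientation-preserving diffeomorphisms away from the marked points. *)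
Definition reparam (R : realType) (D D' : disk R) : Prop :=
  exists phi psi : R * R -> R * R,
    [/\ {within @disk2 R, continuous phi} /\ {within @disk2 R, continuous psi},
        (forall w, disk2 w -> disk2 (phi w) /\ disk2 (psi w)),
        (forall w, disk2 w -> psi (phi w) = w /\ phi (psi w) = w),
        (forall w, disk2 w -> dmap D' w = dmap D (phi w)) &
        phi @` (@circle R @` marks D') = @circle R @` marks D].

(* Corner c o u is a corner at the quadrant (o, u) of c (see corner_at);
   Star r o is a passage through star r, along the link iff o. *)
Inductive letter (C : Type) (s : nat) :=
  | Corner of C & bool & bool
  | Star of 'I_s & bool.
Arguments Corner {C s}.
Arguments Star {C s}.

Definition letter_at (R : realType) (C : finType) (N s : nat)
    (L : diagram R C N s) (D : disk R) (th : R) (l : letter C s) : Prop :=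
  match l with
  | Corner c o u => marks D th /\ corner_at L (dmap D) th c o u
  | Star r o => [/\ ~ marks D th, dmap D (circle th) = (pt L (star L r)).1 &
      exists2 a : R, 0 < a &
        derive1 (fun t => dmap D (circle t) : R * R) th
          = (dir R o * a) *: tangent L (star L r)]
  end.

(* w is the word read counterclockwise along ]0, 1]. *)
Definition reads (R : realType) (C : finType) (N s : nat)
    (L : diagram R C N s) (D : disk R) (w : seq (letter C s)) : Prop :=
  exists (n : nat) (t : 'I_n -> R) (l : 'I_n -> letter C s),
    [/\ w = [seq l i | i : 'I_n],
        (forall i j : 'I_n, (i < j)%N -> t i < t j),
        (forall i, 0 < t i <= 1 /\ letter_at L D (t i) (l i)) &
        (forall th l', 0 < th <= 1 -> letter_at L D th l' ->
           exists i, th = t i)].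

Definition ends_with_corner (C : Type) (s : nat) (w : seq (letter C s)) : Prop :=
  exists w' c o u, w = rcons w' (Corner c o u).

(* The quadrant (o, u) lies to the left of its boundary, so one leaves c along
   the half-strand followed counterclockwise, inside the quadrant, by the other
   one: along the overstrand iff the pair (outgoing half of over, outgoing half
   of under) is a positive basis. *)
Definition is_p_quadrant (R : realType) (C : finType) (N s : nat)
    (L : diagram R C N s) (c : C) (o u : bool) : bool :=
  0 < dir R o * dir R u * det2 (tangent L (over L c)) (tangent L (under L c)).

Definition positive_crossing (R : realType) (C : finType) (N s : nat)
    (L : diagram R C N s) (c : C) : bool :=
  0 < det2 (tangent L (over L c)) (tangent L (under L c)).

Definition left_of_both (R : realType) (C : finType) (N s : nat)
    (L : diagram R C N s) (c : C) (o u : bool) : bool :=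
  let vo := tangent L (over L c) in
  let vu := tangent L (under L c) in
  (0 < det2 vo (dir R u *: vu)) && (0 < det2 vu (dir R o *: vo)).

(* Whether the boundary, right after the corner, agrees with the orientation:
   it leaves along the overstrand at a p-corner, along the understrand at a
   q-corner. *)
Definition out_forward (R : realType) (C : finType) (N s : nat)
    (L : diagram R C N s) (c : C) (o u : bool) : bool :=
  if is_p_quadrant L c o u then o else u.

(* true stands for the sign -1 *)
Definition eps_neg (R : realType) (C : finType) (N s : nat)
    (L : diagram R C N s) (l : letter C s) : bool :=
  match l with
  | Star _ _ => false
  | Corner c o u =>
      if positive_crossing L c then ~~ left_of_both L c o u
      else is_p_quadrant L c o u && ~~ out_forward L c o u
  end.

Definition eps'_neg (R : realType) (C : finType) (N s : nat)
    (L : diagram R C N s) (l : letter C s) : bool :=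
  match l with
  | Star _ _ => false
  | Corner c o u => ~~ out_forward L c o u
  end.

Definition is_p_letter (R : realType) (C : finType) (N s : nat)
    (L : diagram R C N s) (l : letter C s) : bool :=
  match l with Star _ _ => false | Corner c o u => is_p_quadrant L c o u end.

Definition gen (C : finType) (s : nat) : finType := (C + C + 'I_s)%type.
Definition qv (C : finType) (s : nat) (c : C) : gen C s := inl (inl c).
Definition pv (C : finType) (s : nat) (c : C) : gen C s := inl (inr c).
Definition tv (C : finType) (s : nat) (r : 'I_s) : gen C s := inr r.

Definition gen_deg (C : finType) (s : nat) (dq : C -> int) (g : gen C s) : int :=
  match g with
  | inl (inl c) => dq c
  | inl (inr c) => - 1 - dq c
  | inr _ => 0
  end.

Definition oddz (d : int) : bool := odd `|d|%N.

(* Exponent vectors.  A valid one stands for the product of the powers of the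
   generators in the order of enum (gen C s). *)
Definition mono (C : finType) (s : nat) := {ffun gen C s -> int}.

Definition valid_mono (C : finType) (s : nat) (dq : C -> int) (m : mono C s) :
    bool :=
  [forall g : gen C s,
     if g is inl _ then (0 <= m g) && (oddz (gen_deg dq g) ==> (m g <= 1))
     else true].

Definition mono_deg (C : finType) (s : nat) (dq : C -> int) (m : mono C s) :
  int := \sum_(g : gen C s) m g * gen_deg dq g.

Definition mono_p (C : finType) (s : nat) (m : mono C s) : int :=
  \sum_(c : C) m (pv s c).

Definition pure (C : finType) (s : nat) (g : gen C s) (e : int) : mono C s :=
  [ffun h => if h == g then e else 0].

(* Number of transpositions of odd generators needed to sort m1 m2. *)
Definition koszul (C : finType) (s : nat) (dq : C -> int) (m1 m2 : mono C s) :
    nat :=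
  #|[pred gh : gen C s * gen C s |
      [&& oddz (gen_deg dq gh.1), oddz (gen_deg dq gh.2), m1 gh.1 == 1,
          m2 gh.2 == 1 & (enum_rank gh.2 < enum_rank gh.1)%N]]|.

Definition sft_series (K : fieldType) (C : finType) (s : nat) := mono C s -> K.

(* The elements of A_SFT^comm. *)
Definition in_sft (K : fieldType) (C : finType) (s : nat) (dq : C -> int)
    (a : sft_series K C s) : Prop :=
  (forall m, a m != 0 -> valid_mono dq m) /\
  (forall d : int, finite_set [set m | a m != 0 /\ mono_p m = d]).

(* The elements of A^comm. *)
Definition in_comm (K : fieldType) (C : finType) (s : nat) (dq : C -> int)
    (a : sft_series K C s) : Prop :=
  [/\ forall m, a m != 0 -> valid_mono dq m,
      finite_set [set m | a m != 0] &
      forall m c, a m != 0 -> m (pv s c) = 0].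

Definition homogeneous (K : fieldType) (C : finType) (s : nat) (dq : C -> int)
    (d : int) (a : sft_series K C s) : Prop :=
  in_sft dq a /\ forall m, a m != 0 -> mono_deg dq m = d.

Definition zeroS (K : fieldType) (C : finType) (s : nat) : sft_series K C s :=
  fun _ => 0.

Definition monoS (K : fieldType) (C : finType) (s : nat) (m : mono C s) :
  sft_series K C s := fun m' => (m' == m)%:R.

Definition genS (K : fieldType) (C : finType) (s : nat) (g : gen C s) :
  sft_series K C s := monoS K (pure g 1).

Definition addS (K : fieldType) (C : finType) (s : nat) (a b : sft_series K C s) :
  sft_series K C s := fun m => a m + b m.

Definition scaleS (K : fieldType) (C : finType) (s : nat) (k : K)
  (a : sft_series K C s) : sft_series K C s := fun m => k * a m.

Definition signS (K : fieldType) (C : finType) (s : nat) (e : bool)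
  (a : sft_series K C s) : sft_series K C s := scaleS ((-1) ^+ e) a.

(* The sum has finite support when a and b are in A_SFT^comm. *)
Definition mulS (K : fieldType) (C : finType) (s : nat) (dq : C -> int)
    (a b : sft_series K C s) : sft_series K C s :=
  fun m => if valid_mono dq m then
    \sum_(m1 \in [set: mono C s])
      (-1) ^+ koszul dq m1 (m - m1) * (a m1 * b (m - m1))
  else 0.

(* These axioms determine the bracket on A_SFT^comm: an element all of whose
   terms contain at least n p's is a finite sum of products with n p's, so the
   Leibniz rules imply continuity.  It is given by
   {a, b} = sum_c (a d/dp_c) (d/dq_c b) - (a d/dq_c) (d/dp_c b),
   with derivatives acting from the right on a and from the left on b. *)
Record is_sft_bracket (K : fieldType) (C : finType) (s : nat) (dq : C -> int)
    (br : sft_series K C s -> sft_series K C s -> sft_series K C s) : Prop := {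
  br_in : forall a b, in_sft dq a -> in_sft dq b -> in_sft dq (br a b);
  br_linl : forall k a a' b, in_sft dq a -> in_sft dq a' -> in_sft dq b ->
    br (addS (scaleS k a) a') b = addS (scaleS k (br a b)) (br a' b);
  br_linr : forall k a b b', in_sft dq a -> in_sft dq b -> in_sft dq b' ->
    br a (addS (scaleS k b) b') = addS (scaleS k (br a b)) (br a b');
  br_deg : forall d e a b, homogeneous dq d a -> homogeneous dq e b ->
    homogeneous dq (d + e + 1) (br a b);
  br_gen : forall g h : gen C s, br (genS K g) (genS K h) =
    match g, h with
    | inl (inr i), inl (inl j) => scaleS (i == j)%:R (monoS K 0)
    | inl (inl j), inl (inr i) => scaleS (- (i == j)%:R) (monoS K 0)
    | _, _ => @zeroS K C s
    end;
  br_sym : forall d e x y, homogeneous dq d x -> homogeneous dq e y ->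
    br y x = signS (oddz (d * e + d + e)) (br x y);
  br_leibr : forall d e f x y z, homogeneous dq d x -> homogeneous dq e y ->
    homogeneous dq f z ->
    br x (mulS dq y z) =
      addS (mulS dq (br x y) z)
           (signS (oddz ((d + 1) * e)) (mulS dq y (br x z)));
  br_leibl : forall d e f x y z, homogeneous dq d x -> homogeneous dq e y ->
    homogeneous dq f z ->
    br (mulS dq x y) z =
      addS (mulS dq x (br y z))
           (signS (oddz (e * (f + 1))) (mulS dq (br x z) y)) }.

Definition letterS (R : realType) (K : fieldType) (C : finType) (N s : nat)
    (L : diagram R C N s) (l : letter C s) : sft_series K C s :=
  match l with
  | Corner c o u => genS K (if is_p_quadrant L c o u then pv s c else qv s c)
  | Star r o => monoS K (pure (tv C r) (if o then 1 else -1))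
  end.

(* The signed word, for a word ending with a corner. *)
Definition signed_word (R : realType) (K : fieldType) (C : finType) (N s : nat)
    (L : diagram R C N s) (w : seq (letter C s)) : sft_series K C s :=
  signS (odd (count (eps_neg L) w) (+)
         (if rev w is l :: _ then eps'_neg L l else false))
    (foldr (fun l a => mulS (qdeg L) (letterS K L l) a) (monoS K 0) w).

Definition disk_class (R : realType) (C : finType) (N s : nat)
    (L : diagram R C N s) (D : disk R) : set (disk R) :=
  [set D' | is_disk L D' /\ reparam D D'].

(* The cyclic word of a class of disks, cut at some corner: all choices of the
   representative and of the cut give the same signed word. *)
Definition class_word (R : realType) (C : finType) (N s : nat)
    (L : diagram R C N s) (cl : set (disk R)) : seq (letter C s) :=
  match pselect (exists w, exists2 D, cl D & reads L D w /\ ends_with_corner w)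
  with
  | left H => projT1 (cid H)
  | right _ => [::]
  end.

Definition disks_with (R : realType) (C : finType) (N s : nat)
    (L : diagram R C N s) (k : nat) : set (set (disk R)) :=
  [set cl | exists D w, [/\ is_disk L D, cl = disk_class L D, reads L D w &
                            count (is_p_letter L) w = k]].

Definition hamiltonian (R : realType) (K : fieldType) (C : finType) (N s : nat)
    (L : diagram R C N s) (k : nat) : sft_series K C s :=
  fun m => \sum_(cl \in disks_with L k) signed_word K L (class_word L cl) m.

(* x |-> (-1)^|x| x *)
Definition parityS (K : fieldType) (C : finType) (s : nat) (dq : C -> int)
  (a : sft_series K C s) : sft_series K C s :=
  fun m => (-1) ^+ oddz (mono_deg dq m) * a m.

(* For homogeneous x_i the factors parityS produce the sign
   (-1)^(|x_(k-1)| + |x_(k-3)| + ...); this is its multilinear extension.  Note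
   that i : 'I_k is the position minus 1. *)
Definition ell (R : realType) (K : fieldType) (C : finType) (N s : nat)
    (L : diagram R C N s)
    (br : sft_series K C s -> sft_series K C s -> sft_series K C s)
    (k : nat) (x : 'I_k -> sft_series K C s) : sft_series K C s :=
  foldl br (hamiltonian K L k)
    [seq (if odd (k - i) then x i else parityS (qdeg L) (x i)) | i : 'I_k].

Definition strict (R : realType) (K : fieldType) (C : finType) (N s : nat)
    (L : diagram R C N s)
    (br : sft_series K C s -> sft_series K C s -> sft_series K C s) : Prop :=
  forall (k : nat) (x : 'I_k -> sft_series K C s), (3 <= k)%N ->
    (forall i, in_comm (qdeg L) (x i)) -> ell L br x = @zeroS K C s.

(* A positive braid on N strands is a word in the generators indexed by
   'I_N.-1 (letter i exchanges the strands in positions i and i + 1, counted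
   from 0 and from the bottom).  A Legendrian link in J^1(S^1) whose
   xy-projection consists of N graphs over the universal cover is the 1-jet of
   an N-valued function: strand i is x |-> (x, z i x, (z i)'(x)) with
   z i (x + 1) = z (mu i) x.  Its k-th crossing is at abscissa xs k.  At a
   positive crossing the overstrand i (larger z) goes from upper left to lower
   right relatively to the understrand j. *)
Record represents (R : realType) (N : nat) (beta : seq 'I_N.-1)
    (z : 'I_N -> R -> R) (mu : {perm 'I_N}) (xs : 'I_(size beta) -> R) : Prop := {
  rep_smooth : forall i, smooth_on (z i : R -> R) setT;
  rep_closed : forall i x, z i (x + 1) = z (mu i) x;
  rep_sorted : forall k l : 'I_(size beta), (k < l)%N -> xs k < xs l;
  rep_range : forall k, 0 < xs k < 1;
  rep_only : forall i j x, 0 <= x < 1 -> i != j ->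
    derive1 (z i) x = derive1 (z j) x -> exists k, x = xs k;
  rep_crossing : forall k, exists i j,
    [/\ i != j /\ derive1 (z i) (xs k) = derive1 (z j) (xs k),
        derive1n 2 (z i) (xs k) < derive1n 2 (z j) (xs k),
        z j (xs k) < z i (xs k),
        (forall i' j', i' != j' ->
           derive1 (z i') (xs k) = derive1 (z j') (xs k) ->
           (i' = i /\ j' = j) \/ (i' = j /\ j' = i)) &
        #|[pred l | derive1 (z l) (xs k) < derive1 (z i) (xs k)]|
          = tnth (in_tuple beta) k :> nat] }.

Arguments represents {R N} beta z mu xs.

Definition admissible (R : realType) (N : nat) (beta : seq 'I_N.-1) : Prop :=
  exists (z : 'I_N -> R -> R) mu xs, represents beta z mu xs.

Definition tube (R : realType) (e : R) : set (R * R * R) :=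
  [set p | `|p.1.2| < e /\ `|p.2| < e].

Definition fig8 (R : realType) (t : R) : R * R :=
  (sin (2 * pi * t), sin (4 * pi * t)).

(* A figure-eight curve with a single crossing, as an oriented closed curve of
   period 1: the image of the standard one by an orientation-preserving
   diffeomorphism of the plane. *)
Definition figure_eight (R : realType) (c : R -> R * R) : Prop :=
  exists (h : R * R -> R * R) (rho : R -> R),
    [/\ plane_diffeo h, smooth_on rho setT,
        (forall x, rho (x + 1) = rho x + 1), (forall x, 0 < derive1 rho x) &
        forall x, c x = h (fig8 (rho x))].

(* Phi is a contactomorphism from the neighbourhood |y|, |z| < e of the zero
   section in J^1(S^1) (lifted to R^3, with period 1 in x) to a neighbourhood of
   the Legendrian unknot Lambda_0 = Phi (zero section), covering the
   orientation-preserving immersion (x, y) |-> (Phi (x, y, 0)).1. *)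
Record unknot_neighborhood (R : realType) (e : R)
    (Phi : R * R * R -> R * R * R) : Prop := {
  nbh_pos : 0 < e;
  nbh_smooth : smooth_on Phi (tube e);
  nbh_period : forall p, tube e p -> Phi (p.1.1 + 1, p.1.2, p.2) = Phi p;
  nbh_inj : forall p p', tube e p -> tube e p' -> Phi p = Phi p' ->
    exists n : int, p' = (p.1.1 + n%:~R, p.1.2, p.2);
  nbh_contact : exists lam : R * R * R -> R, forall p, tube e p ->
    lam p != 0 /\
    forall v, contact_form (Phi p) ('D_v Phi p) = lam p * contact_form p v;
  nbh_cover : forall p, tube e p -> (Phi p).1 = (Phi (p.1, 0)).1;
  nbh_immersion : forall q : R * R, `|q.2| < e ->
    0 < jacobian (fun q' : R * R => (Phi (q', 0)).1 : R * R) q;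
  nbh_fig8 : figure_eight (fun x => (Phi (x, 0, 0)).1) }.

(* beta is inserted over 0 <= x <= b, where the figure-eight is away from its
   crossing and runs in the direction of d/dx; the base points are at x = b and
   the points star at x = b', both after the crossings of beta. *)
Record insertion (R : realType) (k : nat) (Phi : R * R * R -> R * R * R)
    (xs : 'I_k -> R) (b' b : R) : Prop := {
  ins_order : [/\ 0 < b', b' < b, b < 1 & forall l, xs l < b'];
  ins_dir : forall x, 0 <= x <= b -> exists2 a : R, 0 < a &
    derive1 (fun t => (Phi (t, 0, 0)).1 : R * R) x = (a, 0);
  ins_away : forall x x' : R, 0 <= x <= b -> 0 <= x' < 1 ->
    (Phi (x, 0, 0)).1 = (Phi (x', 0, 0)).1 -> x = x' }.

Definition closure_chord (N k : nat) : finType :=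
  ('I_k + 'I_N * 'I_N)%type.

(* The image by Phi of the Legendrian link with fronts z, scaled by sc in the y
   and z directions, with endpoints ov, un of the Reeb chords; |q_i| = 0 for the
   crossings of beta and 1 for the crossings from the figure-eight. *)
Definition closure_diagram (R : realType) (N k : nat)
    (Phi : R * R * R -> R * R * R) (z : 'I_N -> R -> R) (mu : {perm 'I_N})
    (b' b sc : R) (ov un : closure_chord N k -> 'I_N * R) :
    diagram R (closure_chord N k) N N :=
  {| strand := fun i x => Phi (x, sc * derive1 (z i) x, sc * z i x);
     monodromy := mu;
     over := ov;
     under := un;
     base := fun i => (i, b);
     star := fun i => (i, b');
     qdeg := fun c => if c is inl _ then 0 else 1 |}.

(* The labelling of the k + N^2 Reeb chords (chord (i, j) of the figure-eight
   goes from strand j to strand i), and the condition on base points. *)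
Record closure_labels (R : realType) (N k : nat) (xs : 'I_k -> R)
    (L : diagram R (closure_chord N k) N N) : Prop := {
  lab_generic : generic_diagram L;
  lab_braid : forall l : 'I_k,
    (over L (inl l)).2 = xs l /\ (under L (inl l)).2 = xs l;
  lab_fig8 : forall i j : 'I_N,
    (over L (inr (i, j))).1 = i /\ (under L (inr (i, j))).1 = j;
  lab_base : forall i : 'I_N, exists2 a : R, 0 < a &
    tangent L (base L i) = (a, 0) }.

(* Main.v *)
Require Import Defs.
From HB Require Import structures.
From mathcomp Require Import all_boot all_order all_fingroup all_algebra.
From mathcomp Require Import all_classical all_reals all_analysis.
From mathcomp Require Import ring lra zify.
Set Implicit Arguments.
Unset Strict Implicit.
Unset Printing Implicit Defensive.
Import Order.TTheory GRing.Theory Num.Theory.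
Import numFieldNormedType.Exports.
Local Open Scope classical_set_scope.
Local Open Scope ring_scope.

(* No immersed disk has three or more p-corners, so the Hamiltonian has no part
   with three p's.  Two integer identities bound the number of p-corners of a
   disk D.
   (I) Turning.  The tangent of the boundary makes one turn, measured by the
   secants D(c(th + eta)) - D(c(th)), which are homotopic to secants issued from
   an interior point.  Comparing with a continuous angle tau of the tangents of
   the link, each p-corner at a crossing c contributes nc c half turns and each
   q-corner 1 - nc c, and the sum of all contributions is 2.
   (II) Winding.  Let P, Q lie in the two lobes of the figure-eight.  As D is an
   orientation-preserving immersion, its boundary winds a nonnegative number of
   times around P and around Q.  Comparing with a continuous angle W of
   (p - P) (p - Q) along the link (complex multiplication), a p-corner
   contributes om c and a q-corner - om c, so the sum of these is nonnegative.
   A crossing of the braid has nc = 1, om = 0.  At the N^2 crossings near the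
   double point of the figure-eight, the two strands differ by between one half
   turn and one turn for tau and by exactly one turn for W; the overstrand is
   always on the same side, and either nc = 2, om = 1 for all of them, or
   nc = - 1, om = - 1.  So nc = 1 + kappa om with kappa = 1 or 2 for all
   crossings, and (I) - kappa (II) shows that D has at most 2 p-corners. *)

(** At a corner a disk is only continuous and injective into a quadrant, so its boundary may have no
    one-sided derivative there. This is why the turning is read off secants, and why the boundary is
    first analysed through germs: on each side of every parameter it follows monotonically one half
    of a smooth branch of the link, and directions are taken from that branch. The angles [tau] and
    [W] can be chosen periodic because the figure-eight has rotation number 0 and winds around its
    two lobes in opposite senses. The angle around a single lobe would change by a full turn per
    period, hence the product of the two factors. What has to be decided is that the braid keeps its
    over- and understrands, that is, that the conformal factor of [Phi] is positive; this follows
    from the immersion being orientation-preserving. *)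

Local Notation over := Defs.over.
Local Notation under := Defs.under.

(** * Angles in the plane *)

Section PlaneAngles.
Context {R : realType}.
Implicit Types (v w : R * R) (a b x y : R).

Definition dot2 v w : R := v.1 * w.1 + v.2 * w.2.
Definition cmul v w : R * R := (v.1 * w.1 - v.2 * w.2, v.1 * w.2 + v.2 * w.1).
Definition conj2 v : R * R := (v.1, - v.2).
(** A relation rather than a function: no branch of the argument is chosen, and two angles of one
    vector are compared modulo 2 pi by [ang_uniq]. *)
Definition ang a v := exists2 r : R, 0 < r & v = (r * cos a, r * sin a).

Lemma pair_eta v w : v.1 = w.1 -> v.2 = w.2 -> v = w.
Proof. by case: v w => [? ?] [? ?] /= -> ->. Qed.

Lemma cosDint x (n : int) : cos (x + n%:~R * (2 * pi)) = cos x.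
Proof.
have H (m : nat) (y : R) : cos (y + m%:R * (2 * pi)) = cos y.
  by rewrite mulr_natl mulr_natl; apply: periodicn; exact: cosD2pi.
case: n => m; first exact: H.
by rewrite NegzE mulrNz mulNr -(H m.+1 (x - _)) subrK.
Qed.

Lemma sinDint x (n : int) : sin (x + n%:~R * (2 * pi)) = sin x.
Proof.
have H (m : nat) (y : R) : sin (y + m%:R * (2 * pi)) = sin y.
  by rewrite mulr_natl mulr_natl; apply: periodicn; exact: sinD2pi.
case: n => m; first exact: H.
by rewrite NegzE mulrNz mulNr -(H m.+1 (x - _)) subrK.
Qed.

Lemma mod2pi x : exists n : int, - pi <= x - n%:~R * (2 * pi) < pi.
Proof.
have p0 : (0 : R) < 2 * pi by have := @pi_gt0 R; lra.
exists (Num.floor ((x + pi) / (2 * pi))).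
have := Num.Theory.floor_itv ((x + pi) / (2 * pi)).
rewrite ler_pdivlMr// ltr_pdivrMr// => /andP[]; rewrite intrD mulrDl mulrDl.
by move=> h1 h2; apply/andP; split; lra.
Qed.

(** After reduction to [-pi, pi[, the cosine is nonpositive on the two outer quarters, which leaves
    the open middle half. *)
Lemma cos_gt0_near x : 0 < cos x -> exists n : int, `|x - n%:~R * (2 * pi)| < pi / 2.
Proof.
move=> cx; have [n /andP[n1 n2]] := mod2pi x; exists n.
have : 0 < cos (x - n%:~R * (2 * pi)) by rewrite -mulNr -mulrNz cosDint.
move: n1 n2; set y := x - _ => n1 n2 cy; clearbody y.
rewrite ltr_norml; apply/andP; split; rewrite ltNge; apply/negP => h.
- have : 0 <= cos (y + pi).
    by apply: cos_ge0_pihalf; have := @pi_gt0 R; lra.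
  by rewrite cosDpi; lra.
- have : 0 <= cos (y - pi) by apply: cos_ge0_pihalf; have := @pi_gt0 R; lra.
  by rewrite cosB cospi sinpi; lra.
Qed.

Lemma int_between (n m : int) (t : R) :
  0 < t -> n%:~R * t < m%:~R * t -> n + 1 <= m.
Proof. by move=> t0; rewrite ltr_pM2r// ltr_int; lia. Qed.

Lemma int_small (n : int) (t : R) : - t < n%:~R * t -> n%:~R * t < t -> n = 0.
Proof.
move=> h1 h2; have t0 : 0 < t by lra.
have : 0 <= n.
  by have := @int_between (- 1) n t t0; rewrite mulN1r => /(_ h1); lia.
have := @int_between n 1 t t0; rewrite mul1r => /(_ h2); lia.
Qed.

Lemma cos_gt0_lt x : 0 < cos x -> `|x| < 3 * (pi / 2) -> `|x| < pi / 2.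
Proof.
move=> /cos_gt0_near[n]; rewrite !ltr_norml => /andP[h1 h2] /andP[h3 h4].
have n0 : n = 0 by apply: (@int_small n (2 * pi)); lra.
by move: h1 h2; rewrite n0 mul0r subr0 => -> ->.
Qed.

Lemma sin_gt0_lt x : 0 < sin x -> - pi < x -> x < 2 * pi -> 0 < x /\ x < pi.
Proof.
move=> sx h1 h2; have := @cos_gt0_lt (x - pi / 2).
by rewrite cosBpihalf !ltr_norml => /(_ sx); lra.
Qed.

Lemma ang_neq0 a v : ang a v -> v <> 0.
Proof.
case=> r r0 -> [] /eqP; rewrite mulf_eq0 (gt_eqF r0) => /eqP c0.
move=> /eqP; rewrite mulf_eq0 (gt_eqF r0) => /eqP s0.
by have := cos2Dsin2 a; rewrite c0 s0; lra.
Qed.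

Lemma ang_cos a b v w : ang a v -> ang b w ->
  exists2 k, 0 < k & dot2 v w = k * cos (a - b).
Proof.
case=> r r0 -> [s s0 ->]; exists (r * s); first exact: mulr_gt0.
by rewrite /dot2/= cosB; ring.
Qed.

Lemma ang_sin a b v w : ang a v -> ang b w ->
  exists2 k, 0 < k & det2 v w = k * sin (b - a).
Proof.
case=> r r0 -> [s s0 ->]; exists (r * s); first exact: mulr_gt0.
by rewrite /det2/= sinB; ring.
Qed.

Lemma ang_cos_gt0 a b v w : ang a v -> ang b w ->
  (0 < cos (a - b)) = (0 < dot2 v w).
Proof. by move=> av bw; have [k k0 ->] := ang_cos av bw; rewrite pmulr_rgt0. Qed.

Lemma ang_sin_gt0 a b v w : ang a v -> ang b w ->
  (0 < sin (b - a)) = (0 < det2 v w).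
Proof. by move=> av bw; have [k k0 ->] := ang_sin av bw; rewrite pmulr_rgt0. Qed.

Lemma ang_mul a b v w : ang a v -> ang b w -> ang (a + b) (cmul v w).
Proof.
case=> r r0 -> [s s0 ->]; exists (r * s); first exact: mulr_gt0.
by apply: pair_eta; rewrite /= ?cosD ?sinD; ring.
Qed.

Lemma ang_conj a v : ang a v -> ang (- a) (conj2 v).
Proof.
by case=> r r0 ->; exists r => //; rewrite cosN sinN /conj2/= mulrN.
Qed.

Lemma ang_scale k a v : 0 < k -> ang a v -> ang a (k *: v).
Proof.
move=> k0 [r r0 ->]; exists (k * r); first exact: mulr_gt0.
by apply: pair_eta; rewrite /= /GRing.scale/= ?mulrA.
Qed.

Lemma ang_int (n : int) a v : ang a v -> ang (a + n%:~R * (2 * pi)) v.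
Proof. by case=> r r0 ->; exists r => //; rewrite cosDint sinDint. Qed.

Lemma ang_unit a : ang a (cos a, sin a).
Proof. by exists 1 => //; rewrite !mul1r. Qed.

(** The dot product of [v] with itself makes the cosine of a - b positive and its determinant with
    itself makes the sine vanish; near a multiple of 2 pi the sine is injective. *)
Lemma ang_uniq a b v : ang a v -> ang b v -> exists n : int, a - b = n%:~R * (2 * pi).
Proof.
move=> av bv; have v0 := ang_neq0 av.
have dv : 0 < dot2 v v.
  case: v v0 {av bv} => x y v0; rewrite /dot2/= -!expr2.
  rewrite lt_def addr_ge0 ?sqr_ge0// andbT paddr_eq0 ?sqr_ge0// !sqrf_eq0.
  by apply/negP => /andP[/eqP x0 /eqP y0]; apply: v0; rewrite x0 y0.
have : 0 < cos (a - b) by rewrite (ang_cos_gt0 av bv).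
move=> /cos_gt0_near[n nab]; exists n.
have [k k0 e] := ang_sin bv av.
have s0 : sin (a - b) = 0.
  apply/eqP; have /eqP : k * sin (a - b) = 0 by rewrite -e /det2; ring.
  by rewrite mulf_eq0 (gt_eqF k0).
have : sin (a - b - n%:~R * (2 * pi)) = 0 by rewrite -mulNr -mulrNz sinDint.
move: nab; set t := _ - _ * _ => nab st.
suff : t = 0 by rewrite /t => /eqP; rewrite subr_eq0 => /eqP.
move: nab; rewrite ltr_norml => /andP[t1 t2].
apply: (@sin_inj R); rewrite ?sin0// in_itv/= ?ltW//.
all: by have := @pi_gt0 R; lra.
Qed.

Lemma ang_uniq_lt a b v : ang a v -> ang b v -> `|a - b| < 2 * pi -> a = b.
Proof.
move=> av bv; have [n e] := ang_uniq av bv; rewrite e ltr_norml => /andP[h1 h2].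
move: e; rewrite (int_small h1 h2) mul0r => /eqP; rewrite subr_eq0 => /eqP //.
Qed.

Lemma dot2_gt0 v : v <> 0 -> 0 < dot2 v v.
Proof.
case: v => x y v0; rewrite /dot2/= -!expr2.
rewrite lt_def addr_ge0 ?sqr_ge0// andbT paddr_eq0 ?sqr_ge0// !sqrf_eq0.
by apply/negP => /andP[/eqP x0 /eqP y0]; apply: v0; rewrite x0 y0.
Qed.

(** Two vectors in a common open half plane differ by the arctangent of det / dot, a continuous
    increment of less than a quarter turn. All lifts of angles below are built from such
    increments. *)
Lemma ang_atan a v w : 0 < dot2 v w -> ang a v ->
  ang (a + atan (det2 v w / dot2 v w)) w.
Proof.
move=> d0 av; have v0 := ang_neq0 av; have vv := dot2_gt0 v0.
set t := det2 v w / dot2 v w.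
have c0 : 0 < cos (atan t).
  by apply: cos_gt0_pihalf; rewrite atan_gtNpi2 atan_ltpi2.
have st : sin (atan t) = t * cos (atan t).
  by rewrite -{2}(atanK t) /tan divfK// gt_eqF.
case: av => r r0 ev; exists (dot2 v w / (r * cos (atan t))).
  by rewrite divr_gt0// mulr_gt0.
have cs : cos a ^+ 2 + sin a ^+ 2 = 1 := cos2Dsin2 a.
(* Coordinates of [w] in the orthogonal frame formed by [v] and [v] rotated by a quarter turn. *)
have e1 : w = (dot2 v w / dot2 v v) *: v + (det2 v w / dot2 v v) *: (- v.2, v.1).
  move: vv; rewrite /dot2 /det2 => vv.
  by apply: pair_eta; rewrite /= /GRing.scale/=; field; rewrite gt_eqF.
have vvE : dot2 v v = r ^+ 2.
  by rewrite ev /dot2/= -[RHS]mulr1 -cs; ring.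
have v1 : v.1 = r * cos a by rewrite ev.
have v2 : v.2 = r * sin a by rewrite ev.
rewrite cosD sinD st; apply: pair_eta; rewrite [LHS](congr1 _ e1) /= /GRing.scale/= vvE.
  by rewrite /t v1 v2; field; rewrite !gt_eqF.
by rewrite /t v1 v2; field; rewrite !gt_eqF.
Qed.

Lemma ang_ex v : v <> 0 -> exists a, ang a v.
Proof.
move=> v0.
have e1 : ang 0 ((1, 0) : R * R) by exists 1 => //; rewrite cos0 sin0 !mulr1 mulr0.
have e2 : ang (pi / 2) ((0, 1) : R * R).
  by exists 1 => //; rewrite cos_pihalf sin_pihalf mulr1 mulr0.
have [h|h] := ltrP 0 (dot2 (1, 0) v); first by eexists; exact: ang_atan h e1.
have [h'|h'] := ltrP 0 (dot2 (0, 1) v); first by eexists; exact: ang_atan h' e2.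
have e3 : ang (0 + pi) ((-1, 0) : R * R).
  by exists 1 => //; rewrite add0r cospi sinpi mulr0 mul1r.
have [k|k] := ltrP 0 (dot2 (-1, 0) v); first by eexists; exact: ang_atan k e3.
have e4 : ang (- (pi / 2)) ((0, -1) : R * R).
  by exists 1 => //; rewrite cosN sinN cos_pihalf sin_pihalf mulr0 mul1r.
have [l|l] := ltrP 0 (dot2 (0, -1) v); first by eexists; exact: ang_atan l e4.
exfalso; apply: v0; move: h h' k l; rewrite /dot2/=; case: v => x y /= *.
by apply: pair_eta => /=; lra.
Qed.

Lemma dot2C v w : dot2 v w = dot2 w v.
Proof. by rewrite /dot2; ring. Qed.

Lemma det2C v w : det2 v w = - det2 w v.
Proof. by rewrite /det2; ring. Qed.

(** To leave the band of half-width pi / 2 around its multiple of 2 pi, [h] would have to pass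
    through the border of the band, where the cosine vanishes. *)
Lemma branch_const (h : R -> R) (lo hi : R) : lo <= hi ->
  (forall t : R, lo <= t <= hi -> {for t, continuous h}) ->
  (forall t : R, lo <= t <= hi -> 0 < cos (h t)) ->
  exists n : int, forall t : R, lo <= t <= hi -> `|h t - n%:~R * (2 * pi)| < pi / 2.
Proof.
move=> lohi ch cos0.
have lo_in : lo <= lo <= hi by rewrite lexx.
have [n nlo] := cos_gt0_near (cos0 _ lo_in); exists n => t tin.
rewrite ltNge; apply/negP => nt.
pose g (u : R) : R := `|h u - n%:~R * (2 * pi)|.
have cg u : lo <= u <= hi -> {for u, continuous g}.
  move=> uin; apply: (@cvg_norm _ _ _ _ _ (fun x => h x - n%:~R * (2 * pi))).
  by apply: cvgB; [exact: ch|exact: cvg_cst].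
have lot : lo <= t by case/andP: tin.
have : exists2 c, c \in `[lo, t] & g c = pi / 2.
  apply: IVT => //.
    apply: continuous_in_subspaceT => u; rewrite inE/= in_itv/= => /andP[u1 u2].
    by apply: cg; rewrite u1/= (le_trans u2)//; case/andP: tin.
  have := ltW nlo; rewrite -/(g lo) => glo; move: nt; rewrite -/(g t) => nt.
  by rewrite ge_min le_max glo nt orbT.
case=> c; rewrite in_itv/= => /andP[c1 c2] gc.
have cin : lo <= c <= hi by rewrite c1 (le_trans c2)//; case/andP: tin.
have := cos0 _ cin.
have -> : cos (h c) = cos (h c - n%:~R * (2 * pi)) by rewrite -mulNr -mulrNz cosDint.
by rewrite -cos_norm -/(g c) gc cos_pihalf ltxx.
Qed.

End PlaneAngles.

(** * Continuity and continuous angles *)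

Section Continuity.
Context {R : realType}.

Definition cts (V W : normedModType R) (f : V -> W) (x : V) :=
  {for x, continuous f}.

Lemma ctsP (V W : normedModType R) (f : V -> W) (x : V) :
  cts f x <-> forall e : R, 0 < e -> exists2 d : R, 0 < d &
    forall y, `|y - x| < d -> `|f y - f x| < e.
Proof.
split=> [cf e e0|H].
  have /cvgrPdist_lt /(_ e e0) /nbhs_ballP [d /= d0 Hd] := cf.
  exists d => // y yx; rewrite distrC; apply: Hd.
  by rewrite -ball_normE /ball_/= distrC.
apply/cvgrPdist_lt => e e0; have [d d0 Hd] := H e e0.
apply/nbhs_ballP; exists d => //= y; rewrite -ball_normE /ball_/= distrC => yx.
by rewrite distrC; exact: Hd.
Qed.

Lemma branch_cts (h : R -> R) (lo hi : R) : lo <= hi ->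
  (forall t : R, lo <= t <= hi -> cts h t) ->
  (forall t : R, lo <= t <= hi -> 0 < cos (h t)) ->
  exists n : int, forall t : R, lo <= t <= hi -> `|h t - n%:~R * (2 * pi)| < pi / 2.
Proof. exact: branch_const. Qed.

Section Combinators.
Context {V : normedModType R}.
Implicit Types (f g : V -> R) (F G : V -> R * R) (x : V).

Lemma c_cst (W : normedModType R) (c : W) x : cts (fun _ : V => c) x.
Proof. exact: cvg_cst. Qed.
Lemma c_id x : cts (fun y : V => y) x.
Proof. exact: cvg_id. Qed.
Lemma c_add (W : normedModType R) (f g : V -> W) x :
  cts f x -> cts g x -> cts (fun y => f y + g y) x.
Proof. by move=> cf cg; exact: cvgD. Qed.
Lemma c_sub (W : normedModType R) (f g : V -> W) x :
  cts f x -> cts g x -> cts (fun y => f y - g y) x.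
Proof. by move=> cf cg; exact: cvgB. Qed.
Lemma c_opp (W : normedModType R) (f : V -> W) x :
  cts f x -> cts (fun y => - f y) x.
Proof. by move=> cf; exact: cvgN. Qed.
Lemma c_mul f g x : cts f x -> cts g x -> cts (fun y => f y * g y) x.
Proof. by move=> cf cg; exact: cvgM. Qed.
Lemma c_scale (W : normedModType R) (f : V -> R) (g : V -> W) x :
  cts f x -> cts g x -> cts (fun y => f y *: g y) x.
Proof. by move=> cf cg; exact: cvgZ. Qed.
Lemma c_inv f x : f x != 0 -> cts f x -> cts (fun y => (f y)^-1) x.
Proof. by move=> f0 cf; exact: cvgV. Qed.
Lemma c_comp (W X : normedModType R) (g : W -> X) (f : V -> W) x :
  cts f x -> cts g (f x) -> cts (fun y => g (f y)) x.
Proof. by move=> cf cg; exact: (@continuous_comp _ _ _ f g). Qed.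
Lemma c_fst (W X : normedModType R) (F : V -> W * X) x :
  cts F x -> cts (fun y => (F y).1) x.
Proof. by move=> cF; apply: (@cvg_comp _ _ _ F fst) cF _; exact: cvg_fst. Qed.
Lemma c_snd (W X : normedModType R) (F : V -> W * X) x :
  cts F x -> cts (fun y => (F y).2) x.
Proof. by move=> cF; apply: (@cvg_comp _ _ _ F snd) cF _; exact: cvg_snd. Qed.
Lemma c_pair (W X : normedModType R) (f : V -> W) (g : V -> X) x :
  cts f x -> cts g x -> cts (fun y => (f y, g y)) x.
Proof. by move=> cf cg; exact: cvg_pair. Qed.
Lemma c_norm (W : normedModType R) (f : V -> W) x :
  cts f x -> cts (fun y => `|f y|) x.
Proof. by move=> cf; exact: cvg_norm. Qed.
Lemma c_cos f x : cts f x -> cts (fun y => cos (f y)) x.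
Proof. by move=> cf; apply: (c_comp (g := cos) cf); exact: continuous_cos. Qed.
Lemma c_sin f x : cts f x -> cts (fun y => sin (f y)) x.
Proof. by move=> cf; apply: (c_comp (g := sin) cf); exact: continuous_sin. Qed.
Lemma c_atan f x : cts f x -> cts (fun y => atan (f y)) x.
Proof. by move=> cf; apply: (c_comp (g := atan) cf); exact: continuous_atan. Qed.
Lemma c_sqrt f x : cts f x -> cts (fun y => Num.sqrt (f y)) x.
Proof. by move=> cf; apply: (c_comp (g := Num.sqrt) cf); exact: sqrt_continuous. Qed.
Lemma c_max f g x : cts f x -> cts g x -> cts (fun y => Num.max (f y) (g y)) x.
Proof.
move=> cf cg.
have -> : (fun y => Num.max (f y) (g y)) = (fun y => 2^-1 * (f y + g y + `|f y - g y|)).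
  by apply/funext => y; rewrite maxr_absE mulrC.
by apply: c_mul; [exact: c_cst|apply: c_add; [exact: c_add|apply: c_norm; exact: c_sub]].
Qed.
Lemma c_exp f n x : cts f x -> cts (fun y => f y ^+ n) x.
Proof.
move=> cf; elim: n => [|n IH]; first exact: c_cst.
have -> : (fun y => f y ^+ n.+1) = (fun y => f y * f y ^+ n).
  by apply/funext => y; rewrite exprS.
exact: c_mul.
Qed.
Lemma c_sum (I : Type) (r : seq I) (P : pred I) (f : I -> V -> R) x :
  (forall i, P i -> cts (f i) x) -> cts (fun y => \sum_(i <- r | P i) f i y) x.
Proof.
move=> cf; elim: r => [|i r IH].
  have -> : (fun y => \sum_(i <- [::] | P i) f i y) = fun=> 0.
    by apply/funext => y; rewrite big_nil.
  exact: c_cst.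
have -> : (fun y => \sum_(i <- i :: r | P i) f i y) =
  (fun y => (if P i then f i y else 0) + \sum_(i <- r | P i) f i y).
  by apply/funext => y; rewrite big_cons; case: ifP => // _; rewrite add0r.
apply: c_add => //; case: (P i) (cf i) => h; [exact: h|exact: c_cst].
Qed.
Lemma c_dot F G x : cts F x -> cts G x -> cts (fun y => dot2 (F y) (G y)) x.
Proof.
move=> cF cG; rewrite /dot2; apply: c_add; apply: c_mul;
by [exact: c_fst|exact: c_snd].
Qed.
Lemma c_det F G x : cts F x -> cts G x -> cts (fun y => det2 (F y) (G y)) x.
Proof.
move=> cF cG; rewrite /det2; apply: c_sub; apply: c_mul;
by [exact: c_fst|exact: c_snd].
Qed.
Lemma c_cmul F G x : cts F x -> cts G x -> cts (fun y => cmul (F y) (G y)) x.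
Proof.
move=> cF cG; rewrite /cmul; apply: c_pair; [apply: c_sub|apply: c_add]; apply: c_mul;
by [exact: c_fst|exact: c_snd].
Qed.
Lemma c_conj F x : cts F x -> cts (fun y => conj2 (F y)) x.
Proof.
move=> cF; rewrite /conj2; apply: c_pair; [exact: c_fst|apply: c_opp; exact: c_snd].
Qed.
Lemma c_eq (W : normedModType R) (f g : V -> W) x :
  (forall y, f y = g y) -> cts f x -> cts g x.
Proof. by move=> /funext ->. Qed.
Lemma c_pos f x : cts f x -> 0 < f x ->
  exists2 r : R, 0 < r & forall y, `|y - x| < r -> 0 < f y.
Proof.
move=> /ctsP cf f0; have [d d0 Hd] := cf _ f0; exists d => // y /Hd.
by rewrite ltr_norml => /andP[]; lra.
Qed.
End Combinators.

Lemma norm2E (w : R * R) : `|w| = Num.max `|w.1| `|w.2|.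
Proof. by []. Qed.

Lemma norm2_lt (w : R * R) (r : R) : (`|w| < r) = (`|w.1| < r) && (`|w.2| < r).
Proof. by rewrite norm2E gt_max. Qed.

Lemma norm2_le (w : R * R) (r : R) : (`|w| <= r) = (`|w.1| <= r) && (`|w.2| <= r).
Proof. by rewrite norm2E ge_max. Qed.

Lemma norm2_ge (w : R * R) : `|w.1| <= `|w| /\ `|w.2| <= `|w|.
Proof. by rewrite norm2E !le_max !lexx orbT. Qed.

Lemma dot2_le (v w : R * R) : `|dot2 v w| <= 2 * `|v| * `|w|.
Proof.
have [v1 v2] := norm2_ge v; have [w1 w2] := norm2_ge w.
rewrite /dot2 -mulrA mulr_natl mulr2n; apply: (le_trans (ler_normD _ _)).
by rewrite !normrM; apply: lerD; apply: ler_pM.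
Qed.

Lemma det2_le (v w : R * R) : `|det2 v w| <= 2 * `|v| * `|w|.
Proof.
have [v1 v2] := norm2_ge v; have [w1 w2] := norm2_ge w.
rewrite /det2 -mulrA mulr_natl mulr2n; apply: (le_trans (ler_normB _ _)).
by rewrite !normrM; apply: lerD; apply: ler_pM.
Qed.

Lemma dot2_ge (v : R * R) : `|v| ^+ 2 <= dot2 v v.
Proof.
rewrite norm2E /dot2 -!expr2; case: (leP `|v.1| `|v.2|) => _;
by rewrite real_normK ?num_real// ?lerDl ?lerDr sqr_ge0.
Qed.

(** A Lebesgue number principle. One number [r] serves both as radius of the neighborhood of [x] and
    as the value for which [P] holds there; monotonicity in [d] then allows a common value on the
    compact set. *)
Lemma unif_delta (V : normedModType R) (K : set V) (P : V -> R -> Prop) :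
  compact K ->
  (forall x d d', 0 < d' -> d' <= d -> P x d -> P x d') ->
  (forall x, K x -> exists2 r : R, 0 < r & forall y, K y -> `|y - x| < r -> P y r) ->
  exists2 d : R, 0 < d & forall x, K x -> P x d.
Proof.
move=> cK mono loc.
have := (compact_near_coveringP K).1 cK.
move=> /near_covering_withinP /(_ _ (0 : R)^'+ (fun d x => P x d)).
move=> /(_ _)[].
  move=> x Kx; have [r r0 Hr] := loc x Kx.
  exists (ball x r, [set d : R | 0 < d <= r]) => /=.
    split; first exact: nbhsx_ballx.
    rewrite /at_right/= /within/=; apply/nbhs_ballP; exists r => //= d.
    rewrite -ball_normE /ball_/= sub0r normrN => dr d0; rewrite d0/= ltW//.
    exact: le_lt_trans (ler_norm _) dr.
  move=> [y d] [/=]; rewrite -ball_normE /ball_/= distrC => yx /andP[d0 dr] Ky.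
  by apply: (mono _ r) => //; exact: Hr.
move=> e /= e0 He; exists (e / 2); first by rewrite divr_gt0.
move=> x Kx; apply: He => //=; last by rewrite divr_gt0.
rewrite sub0r normrN gtr0_norm ?divr_gt0//.
by rewrite ltr_pdivrMr// mulr_natr mulr2n ltrDl.
Qed.

(* A lift on a compact star-shaped set: sum the small angle increments along
   the segment from the centre; the number of steps is uniform. *)
Lemma star_lift (V : normedModType R) (K : set V) (g : V -> R * R) :
  compact K -> K 0 -> (forall w (t : R), K w -> 0 <= t <= 1 -> K (t *: w)) ->
  (forall w, K w -> cts g w) -> (forall w, K w -> g w <> 0) ->
  exists phi : V -> R, forall w, K w -> cts phi w /\ ang (phi w) (g w).
Proof.
move=> cK K0 Kst cg g0.
have [d d0 Hd] : exists2 d : R, 0 < d & forall w, K w ->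
    forall w', K w' -> `|w' - w| < d -> 0 < dot2 (g w) (g w').
  apply: unif_delta => //.
    by move=> x d d' _ dd H w' Kw' xw'; apply: H => //; exact: lt_le_trans dd.
  move=> x Kx.
  have xx := dot2_gt0 (g0 x Kx).
  have nx : 0 < `|g x| by rewrite normr_gt0; apply/eqP; exact: g0.
  (* Replacing [g x] by two vectors within [e] of it changes the dot product by less than 6 e |g x|,
     while [dot2 (g x) (g x)] is 8 e |g x|. *)
  pose e := dot2 (g x) (g x) / (8 * `|g x|).
  have e0 : 0 < e by rewrite divr_gt0// mulr_gt0.
  have e1 : e <= `|g x|.
    rewrite /e ler_pdivrMr ?mulr_gt0//; apply: (le_trans (ler_norm _)).
    by apply: (le_trans (dot2_le _ _)); nra.
  have [r r0 Hr] := (ctsP _ _).1 (cg x Kx) _ e0.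
  exists (r / 2); first by rewrite divr_gt0.
  move=> y Ky yx w' Kw' wy.
  have gy := Hr y (lt_trans yx (ltac:(lra) : r / 2 < r)).
  have gw : `|g w' - g x| < e.
    apply: Hr; rewrite -(subrK y w') -addrA; apply: (le_lt_trans (ler_normD _ _)).
    by move: yx wy; lra.
  have -> : dot2 (g y) (g w') = dot2 (g x) (g x) + dot2 (g y - g x) (g w')
     + dot2 (g x) (g w' - g x) by rewrite /dot2/=; ring.
  have := dot2_le (g y - g x) (g w'); have := dot2_le (g x) (g w' - g x).
  have ngw : `|g w'| <= 2 * `|g x|.
    rewrite -(subrK (g x) (g w')); apply: (le_trans (ler_normD _ _)).
    by move: gw e1; lra.
  have ed : 8 * (e * `|g x|) = dot2 (g x) (g x).
    by rewrite /e; field; rewrite gt_eqF.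
  rewrite !ler_norml => /andP[h1 _] /andP[h2 _].
  have : `|g y - g x| * `|g w'| <= e * (2 * `|g x|).
    by apply: ler_pM => //; exact: ltW.
  have : `|g w' - g x| * `|g x| < e * `|g x| by rewrite ltr_pM2r.
  move: h1 h2 ed xx; rewrite -!mulrA [`|g x| * `|g w' - _|]mulrC.
  move: (`|g w' - g x| * _) (`|g y - g x| * _) (e * `|g x|) => p q s; lra.
have [M M0 HM] : exists2 M : R, 0 < M & forall w, K w -> `|w| <= M.
  have [M [_ HM]] := compact_bounded cK.
  exists (`|M| + 1); first by have := normr_ge0 M; lra.
  by move=> w Kw; apply: HM => //; have := ler_norm M; lra.
(* With [n] equal steps on the segment from 0 to [w], each step has length at most M / n < d. *)
pose n := (Num.truncn (M / d)).+1.
have nM : M / d < n%:R := truncnS_gt _.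
have n0 : (0 : R) < n%:R by rewrite ltr0n.
pose p (i : nat) (w : V) := g ((i%:R / n%:R) *: w).
have Kp (i : nat) w : (i <= n)%N -> K w -> K ((i%:R / n%:R) *: w).
  move=> ile Kw; apply: Kst => //; apply/andP; split; first by rewrite divr_ge0.
  by rewrite ler_pdivrMr// mul1r ler_nat.
have pd (i : nat) w : (i < n)%N -> K w -> 0 < dot2 (p i w) (p i.+1 w).
  move=> ilt Kw; apply: Hd; [exact: Kp (ltnW _) _|exact: Kp|].
  rewrite -scalerBl -mulrBl -natr1 addrAC subrr add0r mul1r normrZ.
  rewrite gtr0_norm ?invr_gt0// mulrC ltr_pdivrMr//.
  apply: (le_lt_trans (HM _ Kw)); rewrite mulrC -ltr_pdivrMr//.
have [a aa] := ang_ex (g0 0 K0).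
pose phi (m : nat) w := a + \sum_(i < m) atan (det2 (p i w) (p i.+1 w) / dot2 (p i w) (p i.+1 w)).
have cp (i : nat) w : (i <= n)%N -> K w -> cts (p i) w.
  move=> ile Kw; apply: (c_comp (g := g)).
    by apply: c_scale; [exact: c_cst|exact: c_id].
  by apply: cg; exact: Kp.
exists (phi n) => w Kw; split.
  apply: c_add; first exact: c_cst.
  apply: c_sum => i _; apply: c_atan; apply: c_mul.
    by apply: c_det; apply: cp => //; exact: ltnW.
  apply: c_inv; first by rewrite gt_eqF// pd.
  by apply: c_dot; apply: cp => //; exact: ltnW.
have H m : (m <= n)%N -> ang (phi m w) (p m w).
  elim: m => [_|m IH mn].
    by rewrite /phi big_ord0 addr0 /p mul0r scale0r.
  rewrite /phi big_ord_recr/= addrA; apply: ang_atan; first exact: pd.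
  exact: IH (ltnW mn).
by have := H n (leqnn _); rewrite {1}/p divff ?gt_eqF// scale1r.
Qed.

End Continuity.

(** * Strict derivatives *)

Section StrictDerivatives.
Context {R : realType}.

(** Strict derivative: both ends of the chord vary near [x]. This controls secants that do not start
    at the base point, and makes local injectivity a direct estimate. *)
Definition sdr (f : R -> R) (x a : R) := forall e : R, 0 < e ->
  exists2 d : R, 0 < d & forall s t : R, `|s - x| < d -> `|t - x| < d ->
    `|f t - f s - (t - s) * a| <= e * `|t - s|.

Definition sd1 (f : R -> R * R) (x : R) (a : R * R) := forall e : R, 0 < e ->
  exists2 d : R, 0 < d & forall s t : R, `|s - x| < d -> `|t - x| < d ->
    `|f t - f s - (t - s) *: a| <= e * `|t - s|.

Definition sd2r (F : R * R -> R) (p : R * R) (a b : R) := forall e : R, 0 < e ->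
  exists2 d : R, 0 < d & forall w w' : R * R, `|w - p| < d -> `|w' - p| < d ->
    `|F w' - F w - ((w'.1 - w.1) * a + (w'.2 - w.2) * b)| <= e * `|w' - w|.

Definition sd2 (F : R * R -> R * R) (p a b : R * R) := forall e : R, 0 < e ->
  exists2 d : R, 0 < d & forall w w' : R * R, `|w - p| < d -> `|w' - p| < d ->
    `|F w' - F w - ((w'.1 - w.1) *: a + (w'.2 - w.2) *: b)| <= e * `|w' - w|.

Lemma is_deriveQ (V W : normedModType R) (f : V -> W) (a v : V) (df : W) :
  is_derive a v f df <->
  (h^-1 *: (f (h *: v + a) - f a) @[h --> (0 : R)^'] --> df).
Proof.
split=> [[ex <-]|H]; first exact: ex.
by split; [apply/cvg_ex; exists df|exact: cvg_lim].
Qed.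

Lemma is_derive_fst (V W X : normedModType R) (f : V -> W * X) (a v : V) df :
  is_derive a v f df -> is_derive a v (fun x => (f x).1) df.1.
Proof.
move=> /is_deriveQ H; apply/is_deriveQ.
by apply: (@cvg_comp _ _ _ (fun h : R => h^-1 *: (f (h *: v + a) - f a)) fst) H _; exact: cvg_fst.
Qed.

Lemma is_derive_snd (V W X : normedModType R) (f : V -> W * X) (a v : V) df :
  is_derive a v f df -> is_derive a v (fun x => (f x).2) df.2.
Proof.
move=> /is_deriveQ H; apply/is_deriveQ.
by apply: (@cvg_comp _ _ _ (fun h : R => h^-1 *: (f (h *: v + a) - f a)) snd) H _; exact: cvg_snd.
Qed.

Lemma is_derive_affine (V V' W : normedModType R) (f : V -> W) (i : V' -> V)
    (a v : V') (u : V) df :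
  (forall h : R, i (h *: v + a) = h *: u + i a) ->
  is_derive (i a) u f df -> is_derive a v (fun x => f (i x)) df.
Proof.
move=> iE /is_deriveQ H; apply/is_deriveQ.
by under eq_fun do rewrite iE.
Qed.

Lemma is_derive_cts (f : R -> R) (x : R) df : is_derive x 1 f df -> cts f x.
Proof.
by case=> ex _; apply: differentiable_continuous; apply/derivable1_diffP.
Qed.

Lemma norm_between (s t c x d : R) : Num.min s t <= c <= Num.max s t ->
  `|s - x| < d -> `|t - x| < d -> `|c - x| < d.
Proof.
rewrite !ltr_norml; case: (leP s t) => _ /andP[? ?] /andP[? ?] /andP[? ?];
by apply/andP; split; lra.
Qed.

Lemma mvt_between (g dg : R -> R) (x0 r : R) :
  (forall x : R, `|x - x0| < r -> is_derive x 1 g (dg x)) ->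
  forall s t : R, `|s - x0| < r -> `|t - x0| < r ->
  exists c : R, [/\ `|c - x0| < r, Num.min s t <= c <= Num.max s t
    & g t - g s = dg c * (t - s)].
Proof.
move=> H.
have W s t : `|s - x0| < r -> `|t - x0| < r -> s <= t -> exists c : R,
    [/\ `|c - x0| < r, s <= c <= t & g t - g s = dg c * (t - s)].
  move=> sr tr st.
  have I x : s <= x <= t -> `|x - x0| < r.
    by move: sr tr; rewrite !ltr_norml => /andP[? ?] /andP[? ?] /andP[? ?]; apply/andP; split; lra.
  have [|c|c] := @MVT_segment R g dg s t st.
  - by move=> x; rewrite in_itv/= => /andP[? ?]; apply/H/I; rewrite !ltW.
  - apply: continuous_in_subspaceT => x; rewrite inE/= in_itv/= => xst.
    exact/(is_derive_cts (H x _))/I.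
  - by rewrite in_itv/= => cst e; exists c; split => //; exact: I.
move=> s t sr tr; case: (leP s t) => [st|/ltW ts]; first exact: W.
have [c [c1 c2 e]] := W t s tr sr ts; exists c; split=> //.
by rewrite -opprB e -mulrN opprB.
Qed.

Lemma sdr_of (f df : R -> R) (x r : R) : 0 < r ->
  (forall t : R, `|t - x| < r -> is_derive t 1 f (df t)) -> cts df x ->
  sdr f x (df x).
Proof.
move=> r0 H /ctsP cd e /cd[d d0 Hd]; exists (Num.min d r); first by rewrite lt_min d0.
move=> s t; rewrite !lt_min => /andP[s1 s2] /andP[t1 t2].
have [c [cr cst ->]] := mvt_between H s2 t2.
have cd' : `|c - x| < d by exact: norm_between cst s1 t1.
by rewrite [(t - s) * _]mulrC -mulrBl normrM ler_wpM2r// ltW// Hd.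
Qed.

Lemma sdr_is_derive (f : R -> R) (x a : R) : sdr f x a -> is_derive x 1 f a.
Proof.
move=> H; apply/is_deriveQ; apply/cvgrPdist_le => e e0.
have [d d0 Hd] := H e e0.
apply/nbhs_ballP; exists d => //= h; rewrite -ball_normE /ball_/= sub0r normrN => hd h0.
have := Hd x (h + x); rewrite subrr normr0 addrK => /(_ d0 hd) Hx.
rewrite [h *: 1]mulr1 -(ler_pM2l (x := `|h|)) ?normr_gt0//.
rewrite -normrM mulrBr /GRing.scale/= mulrA divff// mul1r distrC.
by rewrite [`|h| * e]mulrC.
Qed.

Lemma sd1P (f : R -> R * R) x a :
  sd1 f x a <-> sdr (fun t => (f t).1) x a.1 /\ sdr (fun t => (f t).2) x a.2.
Proof.
split=> [H|[H1 H2] e e0].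
  by split=> e /H[d d0 Hd]; exists d => // s t sd td;
  have := Hd s t sd td; rewrite norm2_le => /andP[].
have [d1 d10 Hd1] := H1 e e0; have [d2 d20 Hd2] := H2 e e0.
exists (Num.min d1 d2); first by rewrite lt_min d10.
move=> s t; rewrite !lt_min => /andP[s1 s2] /andP[t1 t2].
by rewrite norm2_le /= Hd1// Hd2.
Qed.

Lemma sd2P (F : R * R -> R * R) p a b :
  sd2 F p a b <-> sd2r (fun t => (F t).1) p a.1 b.1 /\ sd2r (fun t => (F t).2) p a.2 b.2.
Proof.
split=> [H|[H1 H2] e e0].
  by split=> e /H[d d0 Hd]; exists d => // s t sd td;
  have := Hd s t sd td; rewrite norm2_le => /andP[].
have [d1 d10 Hd1] := H1 e e0; have [d2 d20 Hd2] := H2 e e0.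
exists (Num.min d1 d2); first by rewrite lt_min d10.
move=> s t; rewrite !lt_min => /andP[s1 s2] /andP[t1 t2].
by rewrite norm2_le /= Hd1// Hd2.
Qed.

(** The increment is split along a vertical and a horizontal segment and the mean value theorem is
    applied to each. As the norm is the maximum norm, balls are squares and contain both
    segments. *)
Lemma sd2r_of (F D1 D2 : R * R -> R) (p : R * R) (r : R) : 0 < r ->
  (forall w : R * R, `|w - p| < r -> is_derive w ((1, 0) : R * R) F (D1 w)) ->
  (forall w : R * R, `|w - p| < r -> is_derive w ((0, 1) : R * R) F (D2 w)) ->
  cts D1 p -> cts D2 p -> sd2r F p (D1 p) (D2 p).
Proof.
move=> r0 H1 H2 /ctsP c1 /ctsP c2 e e0.
have e2 : 0 < e / 2 by rewrite divr_gt0.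
have [d1 d10 Hd1] := c1 _ e2; have [d2 d20 Hd2] := c2 _ e2.
exists (Num.min r (Num.min d1 d2)); first by rewrite !lt_min r0 d10.
move=> [x y] [x' y']; rewrite !lt_min => /and3P[wr wd1 wd2] /and3P[wr' wd1' wd2'].
move: wr wd1 wd2 wr' wd1' wd2'; rewrite !norm2_lt/=.
move=> /andP[xr yr] /andP[xd1 yd1] /andP[xd2 yd2] /andP[xr' yr'] /andP[xd1' yd1'] /andP[xd2' yd2'].
have L1 (t : R) : `|t - p.1| < r -> is_derive t 1 (fun t => F (t, y')) (D1 (t, y')).
  move=> tr; have := H1 (t, y'); rewrite norm2_lt/= tr yr' => /(_ isT) h.
  apply: (@is_derive_affine _ _ _ F (fun t : R => (t, y'))) h => h.
  by apply: pair_eta; rewrite /= /GRing.scale/= ?mulr0 ?add0r.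
have L2 (t : R) : `|t - p.2| < r -> is_derive t 1 (fun t => F (x, t)) (D2 (x, t)).
  move=> tr; have := H2 (x, t); rewrite norm2_lt/= tr xr => /(_ isT) h.
  apply: (@is_derive_affine _ _ _ F (fun t : R => (x, t))) h => h.
  by apply: pair_eta; rewrite /= /GRing.scale/= ?mulr0 ?add0r.
have [c [_ cx e1]] := mvt_between L1 xr xr'.
have [k [_ ky e3]] := mvt_between L2 yr yr'.
have cd : `|c - p.1| < d1 by exact: norm_between cx xd1 xd1'.
have kd : `|k - p.2| < d2 by exact: norm_between ky yd2 yd2'.
have b1 : `|D1 (c, y') - D1 p| < e / 2 by apply: Hd1; rewrite norm2_lt/= cd yd1'.
have b2 : `|D2 (x, k) - D2 p| < e / 2 by apply: Hd2; rewrite norm2_lt/= kd xd2.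
have -> : F (x', y') - F (x, y) - ((x' - x) * D1 p + (y' - y) * D2 p) =
   (D1 (c, y') - D1 p) * (x' - x) + (D2 (x, k) - D2 p) * (y' - y).
  by rewrite !mulrBl -e1 -e3; ring.
have [n1 n2] := norm2_ge ((x', y') - (x, y)).
apply: (le_trans (ler_normD _ _)); rewrite !normrM.
have h1 : `|D1 (c, y') - D1 p| * `|x' - x| <= e / 2 * `|(x', y') - (x, y)|.
  by apply: ler_pM => //; exact: ltW.
have h2 : `|D2 (x, k) - D2 p| * `|y' - y| <= e / 2 * `|(x', y') - (x, y)|.
  by apply: ler_pM => //; exact: ltW.
by apply: (le_trans (lerD h1 h2)); rewrite -mulrDl -splitr.
Qed.

Lemma sd2_of (F D1 D2 : R * R -> R * R) (p : R * R) (r : R) : 0 < r ->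
  (forall w : R * R, `|w - p| < r -> is_derive w ((1, 0) : R * R) F (D1 w)) ->
  (forall w : R * R, `|w - p| < r -> is_derive w ((0, 1) : R * R) F (D2 w)) ->
  cts D1 p -> cts D2 p -> sd2 F p (D1 p) (D2 p).
Proof.
move=> r0 H1 H2 c1 c2; apply/sd2P; split.
  apply: (@sd2r_of _ (fun w => (D1 w).1) (fun w => (D2 w).1) p r r0).
  - by move=> w /H1; exact: is_derive_fst.
  - by move=> w /H2; exact: is_derive_fst.
  - exact: c_fst.
  - exact: c_fst.
apply: (@sd2r_of _ (fun w => (D1 w).2) (fun w => (D2 w).2) p r r0).
- by move=> w /H1; exact: is_derive_snd.
- by move=> w /H2; exact: is_derive_snd.
- exact: c_snd.
- exact: c_snd.
Qed.

Lemma smooth_derive (V W : normedModType R) (f : V -> W) U p v :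
  smooth_on f U -> U p -> is_derive p v f ('D_v f p) /\ cts ('D_v f : V -> W) p.
Proof.
move=> sf Up; have := sf 1%N => /= -[_ /(_ v)[H [c _]]]; split; last exact: c.
by apply: DeriveDef => //; exact: H.
Qed.

Lemma smooth_cts (V W : normedModType R) (f : V -> W) U p :
  smooth_on f U -> U p -> cts f p.
Proof. by move=> /(_ 0%N)/= [c _] Up; exact: c. Qed.

Lemma open_ball (V : normedModType R) (U : set V) p : open U -> U p ->
  exists2 r : R, 0 < r & forall q, `|q - p| < r -> U q.
Proof.
rewrite openE => /[apply]; rewrite /interior => /nbhs_ballP[r /= r0 H].
by exists r => // q qp; apply: H; rewrite -ball_normE /ball_/= distrC.
Qed.

Lemma smooth_sd2 (F : R * R -> R * R) U p : open U -> U p -> smooth_on F U ->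
  sd2 F p ('D_((1, 0) : R * R) F p) ('D_((0, 1) : R * R) F p).
Proof.
move=> oU Up sF; have [r r0 Hr] := open_ball oU Up.
apply: (@sd2_of _ ('D_((1, 0) : R * R) F : _ -> R * R) ('D_((0, 1) : R * R) F : _ -> R * R) p r r0).
- by move=> w /Hr Uw; exact: (smooth_derive _ sF Uw).1.
- by move=> w /Hr Uw; exact: (smooth_derive _ sF Uw).1.
- exact: (smooth_derive _ sF Up).2.
- exact: (smooth_derive _ sF Up).2.
Qed.

Lemma sd1_derive1 (f : R -> R * R) x a : sd1 f x a -> derive1 (f : R -> R * R) x = a.
Proof.
move=> /sd1P[/sdr_is_derive/is_deriveQ h1 /sdr_is_derive/is_deriveQ h2].
rewrite derive1E; apply: (@derive_val _ _ _ _ _ _ _ (_ : is_derive x 1 f a)).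
apply/is_deriveQ; have := cvg_pair h1 h2.
by case: a h1 h2 => a1 a2 h1 h2; apply.
Qed.

Lemma sd1_cts (f : R -> R * R) x a : sd1 f x a -> cts f x.
Proof.
move=> /sd1P[/sdr_is_derive/is_derive_cts h1 /sdr_is_derive/is_derive_cts h2].
by apply: (c_eq _ (c_pair h1 h2)) => y; case: (f y).
Qed.

Lemma sd1_comp (F : R * R -> R * R) (G : R -> R * R) t p a b g :
  G t = p -> sd2 F p a b -> sd1 G t g -> sd1 (fun t => F (G t)) t (g.1 *: a + g.2 *: b).
Proof.
move=> Gt HF HG e e0.
have [M M0 [HMa HMb]] : exists2 M : R, 0 < M & `|a| + `|b| <= M /\ `|g| + 1 <= M.
  exists (`|a| + `|b| + (`|g| + 1)); have := normr_ge0 a; have := normr_ge0 b;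
  by have := normr_ge0 g; lra.
(* Two errors of half size: that of [F] on a chord of length at most M |u - s|, and that of [G]
   multiplied by |a| + |b| <= M. *)
pose e1 := e / (2 * M).
have e10 : 0 < e1 by rewrite divr_gt0// mulr_gt0.
have [d1 d10 Hd1] := HF e1 e10.
pose e2 := Num.min 1 e1.
have e20 : 0 < e2 by rewrite lt_min ltr01.
have [d2 d20 Hd2] := HG e2 e20.
have /ctsP/(_ d1 d10)[d3 d30 Hd3] := sd1_cts HG.
exists (Num.min d2 d3); first by rewrite lt_min d20.
move=> s u; rewrite !lt_min => /andP[s2 s3] /andP[u2 u3].
have h1 := Hd1 (G s) (G u); rewrite -Gt in h1.
have {}h1 := h1 (Hd3 _ s3) (Hd3 _ u3).
have h2 := Hd2 s u s2 u2.
have e21 : e2 <= 1 by rewrite ge_min lexx.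
have e2e1 : e2 <= e1 by rewrite ge_min lexx orbT.
set D := G u - G s - _ in h2.
have nG : `|G u - G s| <= M * `|u - s|.
  have -> : G u - G s = D + (u - s) *: g by rewrite /D subrK.
  apply: (le_trans (ler_normD _ _)); rewrite normrZ.
  apply: (le_trans (lerD h2 (lexx _))); rewrite [`|u - s| * _]mulrC -mulrDl.
  by apply: ler_wpM2r => //; lra.
have -> : F (G u) - F (G s) - (u - s) *: (g.1 *: a + g.2 *: b) =
  (F (G u) - F (G s) - (((G u).1 - (G s).1) *: a + ((G u).2 - (G s).2) *: b))
  + (D.1 *: a + D.2 *: b).
  by apply: pair_eta; rewrite /D /= /GRing.scale/=; ring.
apply: (le_trans (ler_normD _ _)).
have h3 : `|D.1 *: a + D.2 *: b| <= M * `|D|.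
  apply: (le_trans (ler_normD _ _)); rewrite !normrZ.
  have [n1 n2] := norm2_ge D.
  apply: (@le_trans _ _ ((`|a| + `|b|) * `|D|)); last by rewrite ler_wpM2r.
  by rewrite mulrDl ![_ * `|D|]mulrC lerD// ler_wpM2r.
have h4 : `|D| <= e1 * `|u - s| by apply: (le_trans h2); rewrite ler_wpM2r.
have h5 : e1 * `|G u - G s| <= e1 * (M * `|u - s|) by rewrite ler_wpM2l// ltW.
have h6 : M * `|D| <= M * (e1 * `|u - s|) by rewrite ler_wpM2l// ltW.
apply: (le_trans (lerD (le_trans h1 h5) (le_trans h3 h6))).
by rewrite /e1 le_eqVlt; apply/orP; left; apply/eqP; field; rewrite gt_eqF.
Qed.

Lemma smooth_sdr (f : R -> R) (x : R) :
  smooth_on (f : R -> R) setT -> sdr f x (derive1 f x).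
Proof.
move=> sf; rewrite derive1E.
apply: (@sdr_of _ ('D_1 f : R -> R) x 1) => //.
  by move=> t _; exact: (@smooth_derive _ _ f setT t 1 sf I).1.
exact: (@smooth_derive _ _ f setT x 1 sf I).2.
Qed.

Lemma sd2_cts F p a b : sd2 F p a b -> cts F p.
Proof.
move=> H; apply/ctsP => e e0.
have [d d0 Hd] := H 1 ltr01.
pose M := 1 + `|a| + `|b|.
have M0 : 0 < M by rewrite /M; have := normr_ge0 a; have := normr_ge0 b; lra.
exists (Num.min d (e / M)); first by rewrite lt_min d0 divr_gt0.
move=> y; rewrite lt_min ltr_pdivlMr// => /andP[yd ye].
have := Hd p y; rewrite subrr normr0 => /(_ d0 yd) h.
have [n1 n2] := norm2_ge (y - p).
rewrite -(subrK ((y.1 - p.1) *: a + (y.2 - p.2) *: b) (F y - F p)).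
apply: (le_lt_trans (ler_normD _ _)); apply: (le_lt_trans _ ye).
have h2 : `|(y.1 - p.1) *: a + (y.2 - p.2) *: b| <= (`|a| + `|b|) * `|y - p|.
  apply: (le_trans (ler_normD _ _)); rewrite !normrZ mulrDl ![_ * `|y - p|]mulrC.
  by apply: lerD; apply: ler_wpM2r.
apply: (le_trans (lerD h h2)); rewrite /M; lra.
Qed.

(** Cramer's rule bounds each coordinate by the combination. The factor 2 leaves room for the error
    of the strict derivative in [sd2_bilip]. *)
Lemma det_bilip (a b : R * R) : det2 a b != 0 -> exists2 k : R, 0 < k &
  forall x y : R, 2 * k * Num.max `|x| `|y| <= `|x *: a + y *: b|.
Proof.
move=> D0.
pose M := `|a| + `|b| + 1.
have M0 : 0 < M by rewrite /M; have := normr_ge0 a; have := normr_ge0 b; lra.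
have dp : 0 < `|det2 a b| by rewrite normr_gt0.
exists (`|det2 a b| / (4 * M)); first by rewrite divr_gt0// mulr_gt0.
move=> x y.
have hx : `|x| * `|det2 a b| <= 2 * M * `|x *: a + y *: b|.
  rewrite -normrM; have -> : x * det2 a b = det2 (x *: a + y *: b) b.
    by rewrite /det2/= /GRing.scale/=; ring.
  apply: (le_trans (det2_le _ _)); rewrite -!mulrA ler_wpM2l// mulrC ler_wpM2r//.
  by rewrite /M; have := normr_ge0 a; lra.
have hy : `|y| * `|det2 a b| <= 2 * M * `|x *: a + y *: b|.
  rewrite -normrM; have -> : y * det2 a b = det2 a (x *: a + y *: b).
    by rewrite /det2/= /GRing.scale/=; ring.
  apply: (le_trans (det2_le _ _)); rewrite -!mulrA ler_wpM2l// ler_wpM2r//.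
  by rewrite /M; have := normr_ge0 b; lra.
have -> : 2 * (`|det2 a b| / (4 * M)) * Num.max `|x| `|y| =
  (Num.max `|x| `|y| * `|det2 a b|) / (2 * M) by field; rewrite gt_eqF.
rewrite ler_pdivrMr ?mulr_gt0// [leRHS]mulrC.
by case: (leP `|x| `|y|).
Qed.

(** The linear part expands lengths by at least 2 k; the strict derivative with error [k] loses at
    most half of this. It gives local injectivity and continuity of inverse coordinates. *)
Lemma sd2_bilip F p a b : sd2 F p a b -> det2 a b != 0 ->
  exists k d : R, [/\ 0 < k, 0 < d & forall w w' : R * R,
    `|w - p| < d -> `|w' - p| < d -> k * `|w' - w| <= `|F w' - F w|].
Proof.
move=> H /det_bilip[k k0 Hk]; have [d d0 Hd] := H k k0; exists k, d; split=> // w w' wd wd'.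
have h2 := Hd w w' wd wd'; have h1 := Hk (w'.1 - w.1) (w'.2 - w.2).
set L := _ *: a + _ in h1 h2.
have := ler_normB (F w' - F w) (F w' - F w - L); rewrite subKr => h3.
have h4 : 2 * k * `|w' - w| <= `|L| := h1.
lra.
Qed.

End StrictDerivatives.

(** * Winding numbers of immersed disks *)

Section Degree.
Context {R : realType}.
Implicit Types (v w z : R * R).

Lemma dot2_neq0l v w : 0 < dot2 v w -> v <> 0.
Proof. by move=> + v0; rewrite v0 /dot2/= !mul0r addr0 ltxx. Qed.

Lemma dot2_neq0r v w : 0 < dot2 v w -> w <> 0.
Proof. by rewrite dot2C; exact: dot2_neq0l. Qed.

Lemma cmul_neq0 v w : v <> 0 -> w <> 0 -> cmul v w <> 0.
Proof.
by move=> /ang_ex[a av] /ang_ex[b bw]; exact: ang_neq0 (ang_mul av bw).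
Qed.

Lemma conj_neq0 v : v <> 0 -> conj2 v <> 0.
Proof. by move=> /ang_ex[a av]; exact: ang_neq0 (ang_conj av). Qed.

Lemma dot2_conj v w z : dot2 (cmul v (conj2 z)) w = dot2 v (cmul w z).
Proof. by rewrite /dot2/=; ring. Qed.

Lemma dot2_cmul v w z : dot2 (cmul v z) (cmul w z) = dot2 z z * dot2 v w.
Proof. by rewrite /dot2/=; ring. Qed.

Lemma ang_div a b v w : ang a (cmul v w) -> ang b w -> ang (a - b) v.
Proof.
move=> av bw; have w0 := dot2_gt0 (ang_neq0 bw).
have := ang_mul av (ang_conj bw).
have -> : cmul (cmul v w) (conj2 w) = dot2 w w *: v.
  by apply: pair_eta; rewrite /= /GRing.scale/= /dot2; ring.
move=> /(ang_scale (k := (dot2 w w)^-1)); rewrite invr_gt0 => /(_ w0).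
by rewrite scalerA mulVf ?gt_eqF// scale1r.
Qed.

(* The complex-linear part of the real-linear map u |-> u.1 a + u.2 b; it
   dominates the antilinear part when the determinant is positive. *)
Definition alin (a b : R * R) : R * R := ((a.1 + b.2) / 2, (a.2 - b.1) / 2).

(** The left-hand form is quadratic in [u], with trace 2 A and determinant A det2 a b, where A is
    the squared length of [alin a b]. It is therefore positive definite, and bounded below by
    determinant / trace = det2 a b / 2. *)
Lemma lin_pos (a b : R * R) : 0 < det2 a b -> exists2 k : R, 0 < k &
  forall u : R * R, k * `|u| ^+ 2 <= dot2 (u.1 *: a + u.2 *: b) (cmul (alin a b) u).
Proof.
move=> D0; case: a b D0 => a1 a2 [b1 b2]; rewrite /det2/= => D0.
pose A := dot2 (alin (a1, a2) (b1, b2)) (alin (a1, a2) (b1, b2)).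
have A0 : 0 < A.
  have : 4 * A = (a1 - b2) ^+ 2 + (a2 + b1) ^+ 2 + 4 * (a1 * b2 - a2 * b1).
    by rewrite /A /dot2 /=; field.
  by have := sqr_ge0 (a1 - b2); have := sqr_ge0 (a2 + b1); lra.
exists ((a1 * b2 - a2 * b1) / 2); first by rewrite divr_gt0.
move=> [x y].
set u1 := (a1 + b2) / 2; set u2 := (a2 - b1) / 2.
pose p := a1 * u1 + a2 * u2.
pose q := (b1 * u1 + b2 * u2 + a2 * u1 - a1 * u2) / 2.
pose r := b2 * u1 - b1 * u2.
have eQ : dot2 ((x, y).1 *: (a1, a2) + (x, y).2 *: (b1, b2)) (cmul (alin (a1, a2) (b1, b2)) (x, y)) =
  p * x ^+ 2 + 2 * q * (x * y) + r * y ^+ 2.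
  by rewrite /dot2 /p /q /r /u1 /u2 /= /GRing.scale/=; field.
have eT : p + r = 2 * A by rewrite /p /r /A /u1 /u2 /dot2/=; field.
have eD : p * r - q ^+ 2 = A * (a1 * b2 - a2 * b1).
  by rewrite /p /q /r /A /u1 /u2 /dot2/=; field.
rewrite eQ -(ler_pM2l (x := 2 * A)) ?mulr_gt0//.
have -> : 2 * A * ((a1 * b2 - a2 * b1) / 2 * `|(x, y)| ^+ 2) =
  (p * r - q ^+ 2) * `|(x, y)| ^+ 2 by rewrite eD; field.
have D1 : 0 < p * r - q ^+ 2 by rewrite eD mulr_gt0.
apply: (@le_trans _ _ ((p * r - q ^+ 2) * dot2 (x, y) (x, y))).
  by rewrite ler_wpM2l ?(ltW D1)// dot2_ge.
rewrite -eT -subr_ge0 /dot2/=.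
have -> : (p + r) * (p * x ^+ 2 + 2 * q * (x * y) + r * y ^+ 2) -
   (p * r - q ^+ 2) * (x * x + y * y) = (p * x + q * y) ^+ 2 + (q * x + r * y) ^+ 2.
  by ring.
by rewrite addr_ge0 ?sqr_ge0.
Qed.

Lemma lin_pos_gt0 (a b u : R * R) : 0 < det2 a b -> u <> 0 ->
  0 < dot2 (u.1 *: a + u.2 *: b) (cmul (alin a b) u).
Proof.
move=> /lin_pos[k k0 H] /eqP u0; apply: lt_le_trans (H u).
by rewrite mulr_gt0// exprn_gt0// normr_gt0.
Qed.

Lemma cmul_norm v w : `|cmul v w| <= 2 * `|v| * `|w|.
Proof.
rewrite norm2_le/=; apply/andP; split.
  have := dot2_le v (conj2 w); rewrite /dot2/= mulrN.
  by have -> : `|conj2 w| = `|w| by rewrite !norm2E/= normrN.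
have := dot2_le v (w.2, w.1); rewrite /dot2/=.
by have -> : `|(w.2, w.1)| = `|w| by rewrite !norm2E/= maxC.
Qed.

Lemma alin_neq0 a b : 0 < det2 a b -> alin a b <> 0.
Proof.
move=> D0 a0.
have := @lin_pos_gt0 a b (1, 0) D0; rewrite a0 /dot2/=.
rewrite !(mul0r, mulr0, addr0, subr0) ltxx => H; have [] := pselect ((1, 0) = 0 :> R * R).
  by case=> /eqP; rewrite oner_eq0.
by move=> h; have := H h.
Qed.

(** Near [p] the increment of [F] stays within a quarter turn of a fixed complex multiple of w - p,
    so that [F] turns around [F p] exactly as w - p turns around 0. *)
Lemma sd2_pos (F : R * R -> R * R) p a b : sd2 F p a b -> 0 < det2 a b ->
  exists2 r : R, 0 < r & forall w, `|w - p| < r -> w <> p ->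
    0 < dot2 (F w - F p) (cmul (alin a b) (w - p)).
Proof.
move=> HF D0; have [k k0 Hk] := lin_pos D0.
pose M := `|alin a b| + 1.
have M0 : 0 < M by rewrite /M; have := normr_ge0 (alin a b); lra.
pose e := k / (8 * M).
have e0 : 0 < e by rewrite divr_gt0// mulr_gt0.
have [d d0 Hd] := HF e e0; exists d => // w wd /eqP wp.
have := Hd p w; rewrite subrr normr0 => /(_ d0 wd).
set u := w - p; rewrite -/u -[w.1 - p.1]/(u.1) -[w.2 - p.2]/(u.2).
have u0 : 0 < `|u| by rewrite normr_gt0 subr_eq0.
set L := u.1 *: a + u.2 *: b; set E := F w - F p - L => hE.
have -> : dot2 (F w - F p) (cmul (alin a b) u) =
   dot2 L (cmul (alin a b) u) + dot2 E (cmul (alin a b) u).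
  by rewrite /E /dot2/=; ring.
have h1 : k * `|u| ^+ 2 <= dot2 L (cmul (alin a b) u) := Hk u.
have h2 := dot2_le E (cmul (alin a b) u).
have h3 := cmul_norm (alin a b) u.
have h4 : `|E| * `|cmul (alin a b) u| <= e * `|u| * (2 * M * `|u|).
  apply: ler_pM => //; apply: (le_trans h3); rewrite ler_wpM2r//.
  by rewrite ler_wpM2l// /M lerDl.
have h5 : e * `|u| * (2 * M * `|u|) = k / 4 * `|u| ^+ 2.
  by rewrite /e; field; rewrite gt_eqF.
have h6 : 0 < k * `|u| ^+ 2 by rewrite mulr_gt0// exprn_gt0.
move: h2; rewrite -mulrA ler_norml => /andP[h2 _]; lra.
Qed.

(** A conjugate factor acts on angles as division by w - z does, but stays continuous at [z]. *)
Definition prodc (zs : seq (R * R)) w : R * R :=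
  foldr (fun z acc => cmul (conj2 (w - z)) acc) (1, 0) zs.

Lemma cmul1r v : cmul v (1, 0) = v.
Proof. by apply: pair_eta; rewrite /=; ring. Qed.

Lemma cmulA u v w : cmul u (cmul v w) = cmul (cmul u v) w.
Proof. by apply: pair_eta; rewrite /=; ring. Qed.

Lemma seq_gap (zs : seq (R * R)) z (r : R) : z \notin zs -> 0 < r ->
  exists2 p : R, 0 < p <= r & forall z', z' \in zs -> 2 * p <= `|z' - z|.
Proof.
move=> + r0; elim: zs => [_|z' zs IH]; first by exists r; rewrite // r0 lexx.
rewrite inE negb_or => /andP[zz' /IH[p /andP[p0 pr] Hp]].
have n0 : 0 < `|z' - z| by rewrite normr_gt0 subr_eq0 eq_sym.
exists (Num.min p (`|z' - z| / 2)).
  by rewrite lt_min p0 divr_gt0//= ge_min pr.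
move=> z''; rewrite inE => /orP[/eqP ->|/Hp h].
  have : Num.min p (`|z' - z| / 2) <= `|z' - z| / 2 by rewrite ge_min lexx orbT.
  by lra.
have : Num.min p (`|z' - z| / 2) <= p by rewrite ge_min lexx.
by lra.
Qed.

(* A zero z of g is positive when g behaves like a(w) (w - z) near z.  Dividing
   out the positive zeros leaves a nonvanishing function, which has an angle. *)
Definition pos_zero (g : R * R -> R * R) z :=
  exists a : R * R -> R * R, [/\ forall w, cts a w, a z <> 0 &
    exists2 r : R, 0 < r & forall w, `|w - z| < r -> w <> z ->
      0 < dot2 (g w) (cmul (a w) (w - z))].

(** Induction on the zeros. Near [z], the product of [g w] with the conjugate of w - z makes an
    acute angle with [a w]; interpolating to [a w] by the cutoff [chi] removes this zero and changes
    nothing at distance at least [p] from it. The angle is only asserted at distance at least [r0]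
    from all zeros, where every cutoff vanishes. *)
Lemma factor_lift (K : set (R * R)) (zs : seq (R * R)) (r0 : R) :
  compact K -> K 0 -> (forall w (t : R), K w -> 0 <= t <= 1 -> K (t *: w)) ->
  0 < r0 -> uniq zs -> forall g : R * R -> R * R,
  (forall w, K w -> cts g w) -> (forall w, K w -> g w = 0 -> w \in zs) ->
  (forall z, z \in zs -> pos_zero g z) ->
  exists E : R * R -> R, forall w, K w -> cts E w /\
    ((forall z, z \in zs -> r0 <= `|w - z|) -> ang (E w) (cmul (g w) (prodc zs w))).
Proof.
move=> cK K0 Kst r00; elim: zs => [_ g cg g0 _|z zs IH /= /andP[zzs uzs] g cg g0 gz].
  have [w Kw gw|E HE] := star_lift cK K0 Kst cg; first by have := g0 w Kw gw.
  by exists E => w Kw; have [? ?] := HE w Kw; split => // _; rewrite cmul1r.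
have [|a [ca az [r rp Hr]]] := gz z; first by rewrite mem_head.
have mr : 0 < Num.min r r0 by rewrite lt_min rp.
have [p /andP[p0 pr] Hp] := seq_gap zzs mr.
have [pr1 pr2] : p <= r /\ p <= r0.
  by move: pr; rewrite le_min => /andP.
pose chi w : R := Num.max 0 (1 - `|w - z| / p).
have cchi w : cts chi w.
  apply: c_max; first exact: c_cst.
  apply: c_sub; first exact: c_cst.
  apply: c_mul; last exact: c_cst.
  by apply: c_norm; apply: c_sub; [exact: c_id|exact: c_cst].
have chi01 w : 0 <= chi w <= 1.
  rewrite /chi le_max lexx/= ge_max ler01/= lerBlDr lerDl divr_ge0//; exact: ltW.
have chi0 w : p <= `|w - z| -> chi w = 0.
  move=> h; rewrite /chi; apply/max_idPl; rewrite subr_le0 ler_pdivlMr// mul1r//.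
pose u w := cmul (g w) (conj2 (w - z)).
pose g' w := (1 - chi w) *: u w + chi w *: a w.
have [||z' z'zs|E HE] := IH uzs g'.
- move=> w Kw; apply: c_add; apply: c_scale => //.
    by apply: c_sub; [exact: c_cst|].
  apply: c_cmul; first exact: cg.
  by apply: c_conj; apply: c_sub; [exact: c_id|exact: c_cst].
- move=> w Kw g'w.
  have [h|h] := leP p `|w - z|.
    have wz : w <> z by move=> wz; move: h; rewrite wz subrr normr0 leNgt p0.
    move: g'w; rewrite /g' chi0// subr0 scale1r scale0r addr0.
    have [gw|/eqP gw] := eqVneq (g w) 0.
      by have := g0 w Kw gw; rewrite inE => /orP[/eqP//|].
    have wz' : w - z <> 0 by move=> /eqP; rewrite subr_eq0 => /eqP.
    by have := cmul_neq0 gw (conj_neq0 wz').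
  (* At [z] itself [chi] is 1 and [g'] equals [a]. Elsewhere in the ball [u] and [a] both have
     positive dot product with [a], hence so does their convex combination. *)
  exfalso; have [wz|wz] := pselect (w = z).
    move: g'w; rewrite wz /g' /u subrr.
    have -> : chi z = 1 by rewrite /chi subrr normr0 mul0r subr0; apply/max_idPr.
    by rewrite subrr scale0r add0r scale1r.
  have d := Hr w (lt_le_trans h pr1) wz.
  have d1 : 0 < dot2 (u w) (a w) by rewrite dot2_conj.
  have d2 : 0 < dot2 (a w) (a w) by apply/dot2_gt0/dot2_neq0r; exact: d1.
  have : dot2 (g' w) (a w) = 0 by rewrite g'w /dot2/= !mul0r addr0.
  have -> : dot2 (g' w) (a w) = (1 - chi w) * dot2 (u w) (a w) + chi w * dot2 (a w) (a w).
    by rewrite /g' /dot2/= /GRing.scale/=; ring.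
  by have /andP[? ?] := chi01 w; nra.
(* The remaining zeros are at distance at least 2 p from [z], so near them [g'] is [u]: they stay
   positive, with coefficient multiplied by the conjugate of w - z. *)
- have [|a' [ca' az' [r' r'p Hr']]] := gz z'; first by rewrite inE z'zs orbT.
  exists (fun w => cmul (a' w) (conj2 (w - z))); split.
  + move=> w; apply: c_cmul => //.
    by apply: c_conj; apply: c_sub; [exact: c_id|exact: c_cst].
  + apply: cmul_neq0 => //; apply: conj_neq0 => /eqP; rewrite subr_eq0 => /eqP zz'.
    by move: zzs; rewrite -zz' z'zs.
  exists (Num.min r' p); first by rewrite lt_min r'p.
  move=> w; rewrite lt_min => /andP[w1 w2] wz'.
  have wz : p <= `|w - z|.
    have := Hp _ z'zs; have := ler_distD w z' z; rewrite (distrC z' w); lra.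
  rewrite /g' chi0// subr0 scale1r scale0r addr0 /u.
  have -> : cmul (cmul (a' w) (conj2 (w - z))) (w - z') =
     cmul (cmul (a' w) (w - z')) (conj2 (w - z)).
    by apply: pair_eta; rewrite /=; ring.
  rewrite dot2_cmul mulr_gt0//; last exact: Hr'.
  apply: dot2_gt0; apply: conj_neq0 => /eqP; rewrite subr_eq0 => /eqP wz''.
  by move: wz; rewrite wz'' subrr normr0 leNgt p0.
exists E => w Kw; have [cE aE] := HE w Kw; split=> // far.
have wz : p <= `|w - z| by apply: (le_trans pr2); apply: far; rewrite mem_head.
rewrite /= cmulA; have := aE _; rewrite /g' chi0// subr0 scale1r scale0r addr0.
by apply => z' z'zs; apply: far; rewrite inE z'zs orbT.
Qed.

End Degree.

(** * Winding of the boundary and of its secants for maps of the closed disk *)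

Section DiskMaps.
Context {R : realType}.
Implicit Types (v w z : R * R) (th : R).

Lemma half_lt (r : R) : 0 < r -> r / 2 < r.
Proof. by move=> r0; rewrite ltr_pdivrMr// mulr_natr mulr2n ltrDl. Qed.

Lemma c_circle (V : normedModType R) (f : V -> R) x :
  cts f x -> cts (fun y => circle (f y)) x.
Proof.
move=> cf; have c2 : cts (fun y => 2 * pi * f y) x by apply: c_mul => //; exact: c_cst.
by apply: c_pair; [exact: c_cos|exact: c_sin].
Qed.

Lemma circle1 th : circle (th + 1) = circle th.
Proof.
rewrite /circle mulrDr mulr1.
have := cosDint (2 * pi * th) 1; have := sinDint (2 * pi * th) 1.
by rewrite mul1r => -> ->.
Qed.

Lemma circle_ang th : ang (2 * pi * th) (circle th).
Proof. exact: ang_unit. Qed.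

Lemma dot2_circle th : dot2 (circle th) (circle th) = 1.
Proof. by rewrite /dot2/= -!expr2 cos2Dsin2. Qed.

Lemma disk2E w : disk2 w <-> dot2 w w <= 1.
Proof. by rewrite /disk2/= /dot2 -!expr2. Qed.

Lemma circle_disk th : disk2 (circle th).
Proof. by apply/disk2E; rewrite dot2_circle. Qed.

Lemma circle_norm th : `|circle th| <= 1.
Proof. by rewrite norm2_le/= cos_max sin_max. Qed.

(** Radial retraction onto the closed disk. Precomposition with it turns a map continuous on the
    disk into one continuous on the plane. *)
Definition retract w : R * R := (Num.max 1 (Num.sqrt (dot2 w w)))^-1 *: w.

Lemma c_retract w : cts retract w.
Proof.
apply: c_scale; last exact: c_id.
apply: c_inv; first by rewrite gt_eqF// lt_max ltr01.
by apply: c_max; [exact: c_cst|apply: c_sqrt; apply: c_dot; exact: c_id].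
Qed.

Lemma retract_id w : disk2 w -> retract w = w.
Proof.
move=> /disk2E h; rewrite /retract; have -> : Num.max 1 (Num.sqrt (dot2 w w)) = 1.
  by apply/max_idPl; rewrite -sqrtr1 ler_wsqrtr.
by rewrite invr1 scale1r.
Qed.

Lemma retract_disk w : disk2 (retract w).
Proof.
apply/disk2E; rewrite /retract; set m := Num.max _ _.
have m0 : 0 < m by rewrite lt_max ltr01.
have q0 : 0 <= dot2 w w by rewrite /dot2 -!expr2 addr_ge0 ?sqr_ge0.
have qm : dot2 w w <= m ^+ 2.
  have h : Num.sqrt (dot2 w w) <= m by rewrite le_max lexx orbT.
  by rewrite -(sqr_sqrtr q0) lerXn2r// nnegrE ?sqrtr_ge0 ?ltW.
have -> : dot2 (m^-1 *: w) (m^-1 *: w) = dot2 w w / m ^+ 2.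
  by rewrite /dot2/= /GRing.scale/=; field; rewrite gt_eqF.
by rewrite ler_pdivrMr ?exprn_gt0// mul1r.
Qed.

Lemma c_ext (f : R * R -> R * R) w :
  {within @disk2 R, continuous f} -> cts (fun w => f (retract w)) w.
Proof.
move=> /subspace_continuousP cf.
apply: (@cvg_comp _ _ _ retract f _ (within (@disk2 R) (nbhs (retract w)))).
  move=> A /= HA.
  have : nbhs w (retract @^-1` [set y | disk2 y -> A y]) := @c_retract w _ HA.
  by apply: filterS => y; apply; exact: retract_disk.
exact: cf (@retract_disk w).
Qed.

Lemma disk_norm w : disk2 w -> `|w| <= 1.
Proof.
move=> /disk2E h; have := le_trans (dot2_ge w) h.
by rewrite -{1}(expr1n _ 2) ler_sqr ?nnegrE.
Qed.

Lemma compact_disk : compact (@disk2 R).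
Proof.
apply: (@subclosed_compact _ _ (`[(-1), 1] `*` `[(-1), 1] : set (R * R))).
- have -> : @disk2 R = (fun w => dot2 w w) @^-1` [set x | x <= 1].
    by apply/seteqP; split=> w /=; [move=> /disk2E|move=> h; apply/disk2E].
  apply: closed_comp => [w _|]; last exact: closed_le.
  by apply: c_dot; exact: c_id.
- by apply: compact_setX; exact: segment_compact.
- by move=> [x y] /disk_norm; rewrite /= !in_itv/= norm2_le/= !ler_norml => /andP.
Qed.

Lemma disk_star w (t : R) : disk2 w -> 0 <= t <= 1 -> disk2 (t *: w).
Proof.
move=> /disk2E h /andP[t0 t1]; apply/disk2E.
have -> : dot2 (t *: w) (t *: w) = t ^+ 2 * dot2 w w.
  by rewrite /dot2/= /GRing.scale/=; ring.
have q0 : 0 <= dot2 w w by rewrite /dot2 -!expr2 addr_ge0 ?sqr_ge0.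
by apply: mulr_ile1 => //; [exact: sqr_ge0|rewrite exprn_ile1].
Qed.

Lemma disk0 : disk2 (0 : R * R).
Proof. by apply/disk2E; rewrite /dot2/= mulr0 addr0 ler01. Qed.

(** Pigeonhole: the square is cut into cells of side less than [d], and each cell contains at most
    one point of [Z]. *)
Lemma separated_finite (Z : set (R * R)) (d : R) : (forall w, Z w -> `|w| <= 1) ->
  0 < d -> (forall w w', Z w -> Z w' -> `|w' - w| < d -> w' = w) -> finite_set Z.
Proof.
move=> Z1 d0 H.
pose n := (Num.truncn d^-1).+1.
have nd : d^-1 < n%:R := truncnS_gt _.
have n0 : (0 : R) < n%:R by rewrite ltr0n.
pose m := (2 * n)%N.
pose c (x : R) := Num.truncn ((x + 1) * n%:R).
have cm x : `|x| <= 1 -> (c x < m.+1)%N.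
  rewrite ler_norml => /andP[x0 x1]; rewrite ltnS -(ler_nat R).
  have p0 : 0 <= (x + 1) * n%:R by rewrite mulr_ge0//; lra.
  have := truncn_le ((x + 1) * n%:R); rewrite p0 => h; apply: (le_trans h).
  by rewrite /m natrM ler_wpM2r//; lra.
have cc x y : `|x| <= 1 -> `|y| <= 1 -> c x = c y -> `|y - x| < d.
  rewrite !ler_norml => /andP[x0 x1] /andP[y0 y1] e.
  have p0 : 0 <= (x + 1) * n%:R by rewrite mulr_ge0//; lra.
  have q0 : 0 <= (y + 1) * n%:R by rewrite mulr_ge0//; lra.
  have := truncn_itv p0; have := truncn_itv q0; rewrite -/(c x) -/(c y) e.
  rewrite -natr1 => /andP[h1 h2] /andP[h3 h4].
  have : `|y - x| * n%:R < 1.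
    rewrite -[X in _ * X](gtr0_norm n0) -normrM mulrBl; move: h1 h2 h3 h4; rewrite !mulrDl;
    move: (y * _) (x * _) => yn xn *; rewrite ltr_norml; apply/andP; split; lra.
  rewrite -ltr_pdivlMr// div1r => h; apply: (lt_trans h).
  by rewrite -[ltRHS]invrK ltf_pV2 ?posrE ?invr_gt0.
pose F (ij : 'I_m.+1 * 'I_m.+1) := Z `&` [set w | c w.1 = ij.1 /\ c w.2 = ij.2].
have sub : Z `<=` \bigcup_(ij in [set: 'I_m.+1 * 'I_m.+1]) F ij.
  move=> z Zz; have := Z1 z Zz; rewrite norm2_le => /andP[z1 z2].
  by exists (Ordinal (cm _ z1), Ordinal (cm _ z2)).
apply: sub_finite_set sub _; apply: bigcup_finite => [|ij _]; first exact: finite_finset.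
have [->|/set0P[y [Zy [y1 y2]]]] := eqVneq (F ij) set0; first exact: finite_set0.
apply: (@sub_finite_set _ _ [set y]); last exact: finite_set1.
move=> z [Zz [z1 z2]] /=; apply: H => //.
have := Z1 z Zz; have := Z1 y Zy; rewrite !norm2_le norm2_lt/= => /andP[? ?] /andP[? ?].
by rewrite !cc// ?y1 ?y2 ?z1 ?z2.
Qed.

Lemma seq_min (T : eqType) (s : seq T) (h : T -> R) :
  (forall z : T, z \in s -> 0 < h z) ->
  exists2 r : R, 0 < r & forall z : T, z \in s -> r <= h z.
Proof.
elim: s => [_|z s IH H]; first by exists 1.
have [r r0 Hr] := IH (fun (z' : T) h' => H z' (@mem_behead _ (z :: s) z' h')).
exists (Num.min r (h z)); first by rewrite lt_min r0 H// mem_head.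
by move=> z'; rewrite inE => /orP[/eqP ->|/Hr]; rewrite ge_min ?lexx ?orbT// => ->.
Qed.

Lemma circle_far z th : (1 - dot2 z z) / 4 <= `|circle th - z|.
Proof.
have h1 : (1 - dot2 z z) / 2 <= dot2 (circle th) (circle th - z).
  have := dot2_circle th.
  have : 0 <= dot2 (circle th - z) (circle th - z).
    by rewrite /dot2 -!expr2 addr_ge0 ?sqr_ge0.
  by rewrite /dot2/=; lra.
have h2 := le_trans (ler_norm _) (dot2_le (circle th) (circle th - z)).
have h3 : `|circle th| * `|circle th - z| <= `|circle th - z|.
  by rewrite ler_piMl// circle_norm.
by move: h2; rewrite -mulrA; lra.
Qed.

Lemma circle_dot z th : dot2 z z < 1 -> 0 < dot2 (circle th) (circle th - z).
Proof.
move=> z1; have := dot2_circle th.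
have : 0 <= dot2 (circle th - z) (circle th - z).
  by rewrite /dot2 -!expr2 addr_ge0 ?sqr_ge0.
by move: z1; rewrite /dot2/=; lra.
Qed.

(** For [z] inside the disk, circle th - z makes an acute angle with circle th. Each factor thus
    follows the rotation of the circle up to a periodic correction and contributes one full turn,
    with a minus sign because of the conjugate. *)
Lemma prodc_ang (zs : seq (R * R)) : (forall z, z \in zs -> dot2 z z < 1) ->
  exists A : R -> R, forall th, [/\ cts A th, ang (- A th) (prodc zs (circle th))
    & A (th + 1) = A th + (size zs)%:R * (2 * pi)].
Proof.
elim: zs => [_|z zs IH H].
  exists (fun=> 0) => th; split; first exact: c_cst.
    by exists 1; rewrite // oppr0 cos0 sin0 mulr1 mulr0.
  by rewrite mul0r addr0.
have [A HA] := IH (fun z' h => H z' (@mem_behead _ (z :: zs) z' h)).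
have z1 : dot2 z z < 1 by rewrite H// mem_head.
pose B th := 2 * pi * th + atan (det2 (circle th) (circle th - z) / dot2 (circle th) (circle th - z)).
exists (fun th => B th + A th) => th; have [cA aA pA] := HA th.
have cc : cts (fun th => circle th) th by apply: c_circle; exact: c_id.
have ccz : cts (fun th => circle th - z) th by apply: c_sub => //; exact: c_cst.
split.
- apply: c_add => //; apply: c_add.
    by apply: c_mul; [exact: c_cst|exact: c_id].
  apply: c_atan; apply: c_mul; first exact: c_det.
  by apply: c_inv; [rewrite gt_eqF// circle_dot|exact: c_dot].
- rewrite opprD /=; apply: ang_mul => //; apply: ang_conj; apply: ang_atan.
    exact: circle_dot.
  exact: circle_ang.
- by rewrite pA /B circle1 /= -natr1; ring.
Qed.

(* Argument principle for an orientation-preserving immersion. *)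
Lemma winding_pos (f : R * R -> R * R) (P : R * R) :
  (forall w, cts f w) ->
  (forall w, disk2 w -> f w = P -> dot2 w w < 1 /\
    exists a b, sd2 f w a b /\ 0 < det2 a b) ->
  exists psi : R -> R, exists n : nat, forall th, [/\ cts psi th,
    ang (psi th) (f (circle th) - P) & psi (th + 1) = psi th + n%:R * (2 * pi)].
Proof.
move=> cf Hf; pose Z := [set w | disk2 w /\ f w = P].
have pos w : Z w -> exists a b r, [/\ 0 < r, 0 < det2 a b & forall w', `|w' - w| < r ->
    w' <> w -> 0 < dot2 (f w' - P) (cmul (alin a b) (w' - w))].
  move=> [dw fw]; have [_ [a [b [sab D]]]] := Hf w dw fw.
  by have [r r0 Hr] := sd2_pos sab D; exists a, b, r; split=> //; rewrite -fw.
(* Each preimage of [P] is isolated by [pos]; compactness makes the separation uniform, so there are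
   finitely many preimages. *)
have [d d0 Hd] : exists2 d : R, 0 < d & forall w, disk2 w -> forall w', disk2 w' ->
    `|w' - w| < d -> f w = P -> f w' = P -> w' = w.
  apply: (unif_delta compact_disk) => [x d d' _ dd H w' dw' h|x dx].
    by apply: H => //; exact: lt_le_trans dd.
  have [fx|/eqP fx] := eqVneq (f x) P.
    have [a [b [r [r0 D Hr]]]] := pos x (conj dx fx).
    have isol y : `|y - x| < r -> f y = P -> y = x.
      move=> yx fy; apply: contrapT => ne.
      by have := Hr y yx ne; rewrite fy subrr /dot2/= !mul0r addr0 ltxx.
    exists (r / 2); first by rewrite divr_gt0.
    move=> y dy yx w' dw' wy fy fw'.
    rewrite (isol y (lt_trans yx (half_lt r0)) fy) (isol w' _ fw')//.
    apply: (le_lt_trans (ler_distD y w' x)); rewrite [ltRHS](splitr r).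
    exact: ltrD.
  have n0 : 0 < `|f x - P| by rewrite normr_gt0 subr_eq0; apply/eqP.
  have [r r0 Hr] := (ctsP _ _).1 (cf x) _ n0.
  by exists r => // y dy yx w' dw' wy fy; have := Hr y yx; rewrite fy distrC ltxx.
have finZ : finite_set Z.
  apply: (@separated_finite Z d) => //; first by move=> w [/disk_norm].
  by move=> w w' [dw fw] [dw' fw'] ww'; apply: Hd.
have /finite_seqP[s Zs] := finZ.
pose zs := undup s.
have zsP z : z \in zs <-> Z z by rewrite mem_undup Zs.
have z1 z : z \in zs -> dot2 z z < 1.
  by move=> /zsP[dz fz]; have [] := Hf z dz fz.
have [r0 r00 Hr0] : exists2 r : R, 0 < r & forall z, z \in zs -> r <= (1 - dot2 z z) / 4.
  by apply: seq_min => z /z1 ?; rewrite divr_gt0// subr_gt0.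
have [||z /zsP/pos[a [b [r [rp D Hr]]]]|E HE] :=
    @factor_lift R _ zs r0 compact_disk disk0 disk_star r00 (undup_uniq s) (fun w => f w - P).
- by move=> w _; apply: c_sub => //; exact: c_cst.
- by move=> w dw /eqP; rewrite subr_eq0 => /eqP fw; apply/zsP.
- exists (fun=> alin a b); split; [by move=> w; exact: c_cst|exact: alin_neq0|].
  by exists r.
have [A HA] := prodc_ang z1.
(* [E] is a function on the disk and returns to its value after a full turn; only [A] grows, by one
   turn for each preimage of [P]. *)
exists (fun th => E (circle th) + A th), (size zs) => th.
have [cE aE] := HE _ (circle_disk th); have [cA aA pA] := HA th.
split.
- apply: c_add => //; apply: (c_comp (g := E)) => //.
  by apply: c_circle; exact: c_id.
- rewrite -[A th]opprK; apply: ang_div aA; apply: aE => z zzs.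
  by apply: (le_trans (Hr0 z zzs)); exact: circle_far.
- by rewrite circle1 pA addrA.
Qed.

Lemma circle_diff th eta : circle (th + eta) - circle th =
  (2 * sin (pi * eta)) *: circle (th + eta / 2 + 4^-1).
Proof.
have e1 : 2 * pi * (th + eta) = (2 * pi * th + pi * eta) + pi * eta by ring.
have e2 : 2 * pi * th = (2 * pi * th + pi * eta) - pi * eta by ring.
have e3 : 2 * pi * (th + eta / 2 + 4^-1) = (2 * pi * th + pi * eta) + pi / 2 by field.
apply: pair_eta; rewrite /= /GRing.scale/= e1 e3 {2}e2.
  by rewrite cosDpihalf cosD cosB; ring.
by rewrite sinDpihalf sinD sinB; ring.
Qed.

(** The moving end of the homotopy in [secant_lift]. Its squared norm is 1 - (1 - s) (2 cos (2 pi
    eta) - (1 - s)), and the last factor is at least s once the cosine is at least 1 / 2. *)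
Lemma homotopy_disk th eta (s : R) : 0 <= s <= 1 -> 1 / 2 <= cos (2 * pi * eta) ->
  disk2 (circle (th + eta) - (1 - s) *: circle th).
Proof.
move=> /andP[s0 s1] c1; apply/disk2E.
have -> : dot2 (circle (th + eta) - (1 - s) *: circle th)
  (circle (th + eta) - (1 - s) *: circle th) =
  1 - (1 - s) * (2 * cos (2 * pi * eta) - (1 - s)).
  have e : 2 * pi * eta = 2 * pi * (th + eta) - 2 * pi * th by ring.
  have := dot2_circle (th + eta); have := dot2_circle th.
  rewrite e cosB /dot2/= /GRing.scale/=.
  move: (cos _) (sin _) (cos _) (sin _) => a b c d h1 h2.
  apply/eqP; rewrite -subr_eq0; apply/eqP.
  transitivity ((a * a + b * b - 1) + (1 - s) ^+ 2 * (c * c + d * d - 1)); first by ring.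
  by rewrite h1 h2 !subrr mulr0 addr0.
rewrite lerBlDr lerDl mulr_ge0; lra.
Qed.

(* Homotope the secants f(c(th+eta)) - f(c(th)) through pairs of points at the
   same distance to the secants issued from the centre. *)
Lemma secant_lift (f : R * R -> R * R) (d : R) (al : R * R) (r : R) :
  (forall w, cts f w) -> 0 < d ->
  (forall w w', disk2 w -> disk2 w' -> w' <> w -> `|w' - w| < d -> f w' <> f w) ->
  al <> 0 -> 0 < r ->
  (forall v, `|v| < r -> v <> 0 -> 0 < dot2 (f v - f 0) (cmul al v)) ->
  exists2 eta0 : R, 0 < eta0 & forall eta : R, 0 < eta -> eta < eta0 ->
  exists phi : R -> R,
   (forall th, 0 <= th <= 2 -> cts phi th /\
      ang (phi th) (f (circle (th + eta)) - f (circle th))) /\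
   (forall th, 0 <= th <= 1 -> phi (th + 1) = phi th + 2 * pi).
Proof.
move=> cf d0 finj al0 r0 fpos.
have cpi (g : R -> R) x : cts g x -> cts (fun y => pi * g y) x.
  by move=> cg; apply: c_mul => //; exact: c_cst.
have [e1 e10 He1] : exists2 r : R, 0 < r & forall eta, `|eta - 0| < r ->
    0 < cos (2 * pi * eta) - 1 / 2.
  apply: c_pos; last by rewrite mulr0 cos0; lra.
  apply: c_sub; last exact: c_cst.
  by apply: c_cos; apply: c_mul; [exact: c_cst|exact: c_id].
have [e2 e20 He2] : exists2 e : R, 0 < e & forall eta, `|eta - 0| < e ->
    `|2 * sin (pi * eta)| < Num.min d r.
  have : cts (fun eta : R => 2 * sin (pi * eta)) (0 : R).
    by apply: c_mul; [exact: c_cst|apply: c_sin; apply: cpi; exact: c_id].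
  move=> /ctsP /(_ (Num.min d r)); rewrite lt_min d0 r0 => /(_ isT)[e e0 He].
  by exists e => // eta /He; rewrite mulr0 sin0 mulr0 subr0.
exists (Num.min 1 (Num.min e1 e2)); first by rewrite !lt_min ltr01 e10.
move=> eta eta0; rewrite !lt_min => /and3P[eta1 etae1 etae2].
have {He1}cs : 1 / 2 <= cos (2 * pi * eta).
  by have := He1 eta; rewrite subr0 gtr0_norm// => /(_ etae1); lra.
have {He2}rho : `|2 * sin (pi * eta)| < Num.min d r.
  by apply: He2; rewrite subr0 gtr0_norm.
have rho0 : 0 < 2 * sin (pi * eta).
  rewrite mulr_gt0// sin_gt0_pi// mulr_gt0 ?pi_gt0//=.
  by rewrite -[ltRHS]mulr1 ltr_pM2l// pi_gt0.
set q := 2 * sin (pi * eta) in rho rho0.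
pose D th := circle (th + eta) - circle th.
have DE th : D th = q *: circle (th + eta / 2 + 4^-1) by exact: circle_diff.
have Dn th : `|D th| < Num.min d r.
  rewrite DE normrZ; apply: le_lt_trans rho.
  by rewrite ler_piMr// circle_norm.
have Dang th : ang (2 * pi * (th + eta / 2 + 4^-1)) (D th).
  by rewrite DE; apply: ang_scale => //; exact: circle_ang.
have D0 th : D th <> 0 := ang_neq0 (Dang th).
(* In the parameters (s, th), the two end points always differ by [D th]. At s = 0 the secant issues
   from the centre, at s = 1 it is the boundary secant. *)
pose H (w : R * R) := f (circle (w.2 + eta) - (1 - w.1) *: circle w.2) - f (w.1 *: circle w.2).
pose K : set (R * R) := `[0, 1] `*` `[0, 2].
have cK : compact K by apply: compact_setX; exact: segment_compact.
have c1 w : cts (fun w : R * R => w.1) w by apply: c_fst; exact: c_id.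
have c2 w : cts (fun w : R * R => w.2) w by apply: c_snd; exact: c_id.
have cH w : cts H w.
  apply: c_sub; apply: (c_comp (g := f)) => //.
    apply: c_sub; last apply: c_scale.
    + by apply: c_circle; apply: c_add => //; exact: c_cst.
    + by apply: c_sub => //; exact: c_cst.
    + exact: c_circle.
  by apply: c_scale => //; exact: c_circle.
have H0 w : K w -> H w <> 0.
  move=> [] /=; rewrite !in_itv/= => w1 w2 /eqP; rewrite subr_eq0 => /eqP.
  have e : circle (w.2 + eta) - (1 - w.1) *: circle w.2 - w.1 *: circle w.2 = D w.2.
    by apply: pair_eta; rewrite /= /GRing.scale/=; ring.
  apply: finj.
  - by apply: disk_star w1; exact: circle_disk.
  - exact: homotopy_disk.
  - by move=> /eqP; rewrite -subr_eq0 e => /eqP; exact: D0.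
  - by rewrite e; have := Dn w.2; rewrite lt_min => /andP[].
have [| | |w|Phi HPhi] := @star_lift R _ K H cK.
- by split; rewrite /= in_itv/=; lra.
- move=> [x y] t [] /=; rewrite !in_itv/= => /andP[x0 x1] /andP[y0 y1] /andP[t0 t1].
  by split; rewrite /= in_itv/= /GRing.scale/=; apply/andP; split; nra.
- by move=> w _; exact: cH.
- exact: H0.
have Kw s th : 0 <= s <= 1 -> 0 <= th <= 2 -> K (s, th).
  by move=> h1 h2; split; rewrite /= in_itv.
have Hper s th : H (s, th + 1) = H (s, th).
  by rewrite /H/= circle1 addrAC circle1.
have cPhi (g1 g2 : R -> R) x : cts g1 x -> cts g2 x -> K (g1 x, g2 x) ->
    cts (fun y => Phi (g1 y, g2 y)) x.
  move=> h1 h2 h; apply: (c_comp (g := Phi)); first exact: c_pair.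
  exact: (HPhi _ h).1.
(* At s = 0 the secant makes an acute angle with the product of [al] and [D th], and [D th] makes
   exactly one turn. *)
have Phi01 : Phi (0, 1) = Phi (0, 0) + 2 * pi.
  have [a aal] := ang_ex al0.
  pose L th := Phi (0, th) - (a + 2 * pi * (th + eta / 2 + 4^-1)).
  have [||| n Hn] := @branch_cts R L 0 1; first exact: ler01.
  + move=> th /andP[t0 t1]; apply: c_sub.
      apply: (cPhi (fun=> 0) (fun th => th)); [exact: c_cst|exact: c_id|].
      by apply: Kw; lra.
    apply: c_add; first exact: c_cst.
    apply: c_mul; first exact: c_cst.
    by apply: c_add; [apply: c_add; [exact: c_id|exact: c_cst]|exact: c_cst].
  + move=> th /andP[t0 t1].
    have k : K (0, th) by apply: Kw; lra.
    have [_ aP] := HPhi _ k.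
    rewrite (ang_cos_gt0 aP (ang_mul aal (Dang th))).
    rewrite /H/= scale0r subr0 scale1r; apply: fpos; last exact: D0.
    by have := Dn th; rewrite lt_min => /andP[].
  have h0 := Hn 0; have h1 := Hn 1; rewrite /L in h0 h1.
  have [m hm] : exists m : int, Phi (0, 1) - Phi (0, 0) = m%:~R * (2 * pi).
    apply: (@ang_uniq _ _ _ (H (0, 0))); last by apply: (HPhi _ _).2; apply: Kw; lra.
    have := Hper 0 0; rewrite add0r => <-.
    by apply: (HPhi _ _).2; apply: Kw; lra.
  have {}h0 : `|Phi (0, 0) - (a + 2 * pi * (0 + eta / 2 + 4^-1)) - n%:~R * (2 * pi)| < pi / 2.
    by apply: h0; rewrite lexx ler01.
  have {}h1 : `|Phi (0, 1) - (a + 2 * pi * (1 + eta / 2 + 4^-1)) - n%:~R * (2 * pi)| < pi / 2.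
    by apply: h1; rewrite lexx ler01.
  have m1 : m - 1 = 0.
    have e : (m - 1)%:~R * (2 * pi) = Phi (0, 1) - Phi (0, 0) - 2 * pi.
      by rewrite hm intrB mulrBl mul1r.
    apply: (@int_small R _ (2 * pi)); rewrite e;
    by move: h0 h1; rewrite !ltr_norml => /andP[? ?] /andP[? ?]; have := @pi_gt0 R; lra.
  have em : m = 1 := subr0_eq m1.
  by move: hm; rewrite em mul1r; lra.
exists (fun th => Phi (1, th)); split=> th ht.
  have k : K (1, th) by apply: Kw; rewrite ?ler01 ?lexx.
  split; first by apply: (cPhi (fun=> 1) (fun th => th)) => //; exact: c_cst.
  by have := (HPhi _ k).2; rewrite /H/= subrr scale0r subr0 scale1r.
(* The period is carried along the path (t, t th) from (0, 0) to (1, th): [H] is periodic in its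
   second argument, so [G] is continuous with values in multiples of 2 pi. *)
pose G t := Phi (t, t * th + 1) - Phi (t, t * th).
have bd t : 0 <= t <= 1 -> 0 <= t * th <= 2 /\ 0 <= t * th + 1 <= 2.
  by move: ht => /andP[? ?] /andP[? ?]; split; apply/andP; split; nra.
have Gm t : 0 <= t <= 1 -> exists m : int, G t = m%:~R * (2 * pi).
  move=> t01; have [b1 b2] := bd t t01.
  apply: (@ang_uniq _ _ _ (H (t, t * th))); last by apply: (HPhi _ _).2; exact: Kw.
  by rewrite -Hper; apply: (HPhi _ _).2; exact: Kw.
have [||| n Hn] := @branch_cts R G 0 1; first exact: ler01.
- move=> t t01; have [b1 b2] := bd t t01; apply: c_sub.
    apply: (cPhi (fun t => t) (fun t => t * th + 1)); [exact: c_id| |exact: Kw].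
    by apply: c_add; [apply: c_mul; [exact: c_id|exact: c_cst]|exact: c_cst].
  apply: (cPhi (fun t => t) (fun t => t * th)); [exact: c_id| |exact: Kw].
  by apply: c_mul; [exact: c_id|exact: c_cst].
- move=> t /Gm[m ->]; have := cosDint (0 : R) m; rewrite add0r => ->.
  by rewrite cos0 ltr01.
have Gn t : 0 <= t <= 1 -> G t = n%:~R * (2 * pi).
  move=> t01; have [m hm] := Gm t t01; have := Hn t t01; rewrite hm.
  rewrite -mulrBl -intrB => h.
  have : m - n = 0.
    by apply: (@int_small R _ (2 * pi)); move: h; rewrite ltr_norml => /andP[? ?];
    have := @pi_gt0 R; lra.
  by move=> /eqP; rewrite subr_eq0 => /eqP ->.
have g0 : G 0 = 2 * pi by rewrite /G mul0r add0r Phi01; lra.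
have g1 : G 1 = G 0 by rewrite !Gn// ?lexx ?ler01.
by move: g1; rewrite g0 /G mul1r; lra.
Qed.

End DiskMaps.

(** * Germs of the boundary of a disk *)

Section Germs.
Context {R : realType}.
Implicit Types (a b g P : R * R) (A B G : R -> R * R).

(** Continuity relative to a closed interval: a germ starts at 0 and nothing is known to the
    left. *)
Definition ctsw (W : normedModType R) (lo hi : R) (h : R -> W) :=
  forall t, lo <= t <= hi -> forall e : R, 0 < e -> exists2 d : R, 0 < d &
    forall y, lo <= y <= hi -> `|y - t| < d -> `|h y - h t| < e.

Definition clamp (lo hi t : R) : R := Num.max lo (Num.min hi t).

Lemma clamp_in lo hi t : lo <= hi -> lo <= clamp lo hi t <= hi.
Proof.
by move=> h; rewrite /clamp le_max lexx/= ge_max h/= ge_min lexx.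
Qed.

Lemma clamp_id lo hi t : lo <= t <= hi -> clamp lo hi t = t.
Proof. by move=> /andP[h1 h2]; rewrite /clamp (min_idPr h2) (max_idPr h1). Qed.

Lemma clamp_lip lo hi t y : `|clamp lo hi y - clamp lo hi t| <= `|y - t|.
Proof.
have Hmin (c u v : R) : `|Num.min c u - Num.min c v| <= `|u - v|.
  rewrite ler_norml; case: (leP c u) => cu; case: (leP c v) => cv;
  rewrite ?subrr ?lexx; have := ler_norm (u - v); have := ler_norm (v - u);
  rewrite (distrC v u) => h1 h2; have := normr_ge0 (u - v) => h3;
  by apply/andP; split; lra.
apply: le_trans (Hmin hi y t); rewrite /clamp.
have mx (u : R) : Num.max lo u = - Num.min (- lo) (- u) by rewrite oppr_min !opprK.
have sw (u v : R) : `|- u - - v| = `|u - v| by rewrite opprK addrC distrC.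
by rewrite !mx sw -(sw (Num.min hi y)); exact: Hmin.
Qed.

Lemma ctsw_clamp (W : normedModType R) lo hi (h : R -> W) : lo <= hi ->
  ctsw lo hi h -> forall t, cts (fun t => h (clamp lo hi t)) t.
Proof.
move=> lohi ch t; apply/ctsP => e /(ch _ (clamp_in t lohi))[d d0 Hd].
exists d => // y yt; apply: Hd; first exact: clamp_in.
exact: le_lt_trans (clamp_lip _ _ _ _) yt.
Qed.

Lemma cts_ctsw (W : normedModType R) lo hi (h : R -> W) :
  (forall t, lo <= t <= hi -> cts h t) -> ctsw lo hi h.
Proof.
by move=> ch t tin e e0; have [d d0 Hd] := (ctsP _ _).1 (ch t tin) e e0; exists d => // y _; exact: Hd.
Qed.

Lemma ctsw_sub (W : normedModType R) lo hi lo' hi' (h : R -> W) :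
  lo <= lo' -> hi' <= hi -> ctsw lo hi h -> ctsw lo' hi' h.
Proof.
have tr t : lo <= lo' -> hi' <= hi -> lo' <= t <= hi' -> lo <= t <= hi.
  by move=> h1 h2 /andP[h3 h4]; rewrite (le_trans h1)// (le_trans h4).
move=> h1 h2 ch t tin e e0; have [d d0 Hd] := ch t (tr t h1 h2 tin) e e0.
by exists d => // y yin; apply: Hd; exact: tr.
Qed.

Lemma ctsw_comp (W X : normedModType R) lo hi (h : R -> W) (k : W -> X) :
  ctsw lo hi h -> (forall t, lo <= t <= hi -> cts k (h t)) -> ctsw lo hi (fun t => k (h t)).
Proof.
move=> ch ck t tin e e0; have [d d0 Hd] := (ctsP _ _).1 (ck t tin) e e0.
have [d' d'0 Hd'] := ch t tin d d0; exists d' => // y yin yt.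
by apply: Hd; exact: Hd'.
Qed.

Lemma ctsw_add (W : normedModType R) lo hi (h k : R -> W) :
  ctsw lo hi h -> ctsw lo hi k -> ctsw lo hi (fun t => h t + k t).
Proof.
move=> ch ck t tin e e0.
have e2 : 0 < e / 2 by rewrite divr_gt0.
have [d d0 Hd] := ch t tin _ e2; have [d' d'0 Hd'] := ck t tin _ e2.
exists (Num.min d d'); first by rewrite lt_min d0.
move=> y yin; rewrite lt_min => /andP[y1 y2].
rewrite opprD addrACA; apply: (le_lt_trans (ler_normD _ _)).
by rewrite [ltRHS](splitr e) ltrD ?Hd ?Hd'.
Qed.

Lemma ctsw_opp (W : normedModType R) lo hi (h : R -> W) :
  ctsw lo hi h -> ctsw lo hi (fun t => - h t).
Proof.
move=> ch t tin e e0; have [d d0 Hd] := ch t tin _ e0; exists d => // y yin yt.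
by rewrite -opprD normrN; exact: Hd.
Qed.

Lemma branch_w (h : R -> R) (lo hi : R) : lo <= hi -> ctsw lo hi h ->
  (forall t : R, lo <= t <= hi -> 0 < cos (h t)) ->
  exists n : int, forall t : R, lo <= t <= hi -> `|h t - n%:~R * (2 * pi)| < pi / 2.
Proof.
move=> lohi ch hc; have cc := ctsw_clamp lohi ch.
have [t _|t _|n Hn] := @branch_cts R (fun t => h (clamp lo hi t)) lo hi lohi.
- exact: cc.
- by apply: hc; exact: clamp_in.
- by exists n => t tin; have := Hn t tin; rewrite clamp_id.
Qed.

Lemma branch_int (h : R -> R) (lo hi : R) : lo <= hi -> ctsw lo hi h ->
  (forall t : R, lo <= t <= hi -> exists m : int, h t = m%:~R * (2 * pi)) ->
  h lo = h hi.
Proof.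
move=> lohi ch hm; have [|n Hn] := branch_w lohi ch.
  move=> t /hm[m ->]; have := cosDint (0 : R) m; rewrite add0r => ->.
  by rewrite cos0 ltr01.
have hn t : lo <= t <= hi -> h t = n%:~R * (2 * pi).
  move=> tin; have [m e] := hm t tin; have := Hn t tin; rewrite e -mulrBl -intrB => k.
  suff /subr0_eq -> : m - n = 0 by [].
  by apply: (@int_small R _ (2 * pi)); move: k; rewrite ltr_norml => /andP[? ?];
    have := @pi_gt0 R; lra.
by rewrite !hn ?lexx ?lohi.
Qed.

Lemma ctsw_ivt (h : R -> R) (lo hi : R) : lo <= hi -> ctsw lo hi h ->
  (forall t, lo <= t <= hi -> h t <> 0) -> 0 < h hi -> forall t, lo <= t <= hi -> 0 < h t.
Proof.
move=> lohi ch h0 hhi t tin; rewrite ltNge; apply/negP => ht.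
have cc := ctsw_clamp lohi ch.
have /andP[lot thi] := tin.
have : exists2 c, c \in `[t, hi] & h (clamp lo hi c) = 0.
  apply: IVT => //.
    by apply: continuous_subspaceT => u; exact: cc.
  by rewrite !clamp_id ?lohi ?lexx// ge_min le_max ht (ltW hhi) orbT.
case=> c _; apply: h0; exact: clamp_in.
Qed.

Lemma inj_increasing (X : R -> R) (e : R) : 0 < e -> ctsw 0 e X -> X 0 = 0 ->
  (forall t, 0 < t <= e -> 0 < X t) ->
  (forall s t, 0 <= s <= e -> 0 <= t <= e -> X s = X t -> s = t) ->
  forall s t, 0 <= s -> s < t -> t <= e -> X s < X t.
Proof.
move=> e0 cX X0 Xp Xi.
have cc := ctsw_clamp (ltW e0) cX.
have [||H|H] := @itv_continuous_inj_mono R (fun t => X (clamp 0 e t)) `[0, e].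
- by apply: continuous_subspaceT => u; exact: cc.
- by move=> s t; rewrite !in_itv/= => h1 h2; rewrite !clamp_id//; exact: Xi.
- move=> s t s0 st te; have := H s t; rewrite !in_itv/=.
  have h1 : 0 <= s <= e by rewrite s0 (ltW (lt_le_trans st te)).
  have h2 : 0 <= t <= e by rewrite te (le_trans s0 (ltW st)).
  by rewrite !clamp_id// => -> //.
- have := H e 0; rewrite !in_itv/= !lexx (ltW e0) => /(_ isT isT e0).
  by rewrite !clamp_id ?lexx ?(ltW e0)// X0 ltNge ltW// Xp// e0 lexx.
Qed.

(** [crossing_chart] for two arbitrary branches through [P], so that one of them may also be an
    auxiliary line. *)
Definition chart A B P (w : R * R) : R * R := A w.1 + B w.2 - P.

Lemma chart_sd2 A B P a b : sd1 A 0 a -> sd1 B 0 b -> sd2 (chart A B P) 0 a b.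
Proof.
move=> hA hB e e0; have e2 : 0 < e / 2 by rewrite divr_gt0.
have [d d0 Hd] := hA _ e2; have [d' d'0 Hd'] := hB _ e2.
exists (Num.min d d'); first by rewrite lt_min d0.
move=> w w'; rewrite !subr0 !lt_min => /andP[w1 w2] /andP[w1' w2'].
have [n1 n2] := norm2_ge w; have [n1' n2'] := norm2_ge w'.
have [m1 m2] := norm2_ge (w' - w).
have -> : chart A B P w' - chart A B P w - ((w'.1 - w.1) *: a + (w'.2 - w.2) *: b) =
  (A w'.1 - A w.1 - (w'.1 - w.1) *: a) + (B w'.2 - B w.2 - (w'.2 - w.2) *: b).
  by apply: pair_eta; rewrite /chart /= /GRing.scale/=; ring.
apply: (le_trans (ler_normD _ _)); rewrite [leRHS](_ : _ = e / 2 * `|w' - w| + e / 2 * `|w' - w|); last by field.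
apply: lerD.
  apply: (@le_trans _ _ (e / 2 * `|w'.1 - w.1|)); last by rewrite ler_wpM2l ?(ltW e2).
  by apply: Hd; rewrite subr0; [exact: le_lt_trans n1 w1|exact: le_lt_trans n1' w1'].
apply: (@le_trans _ _ (e / 2 * `|w'.2 - w.2|)); last by rewrite ler_wpM2l ?(ltW e2).
by apply: Hd'; rewrite subr0; [exact: le_lt_trans n2 w2|exact: le_lt_trans n2' w2'].
Qed.

(* Half of a path issued from P: it follows the branch Br in the direction s. *)
Record half_germ G (e d : R) (Br : R -> R * R) (s : bool) (X : R -> R) : Prop := {
  hg_eq : forall t, 0 <= t <= e -> G t = Br (dir R s * X t) /\ 0 <= X t < d;
  hg_0 : X 0 = 0;
  hg_mono : forall u t, 0 <= u -> u < t -> t <= e -> X u < X t;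
  hg_cts : ctsw 0 e X }.

(** In the chart coordinates the path lies on the union of the two axes. Being injective it does not
    come back to the origin, so it can neither change axis nor change direction; a continuous
    injective function of [t] is then monotone. *)
Lemma half_germ_ex A B P (k d e : R) G :
  A 0 = P -> B 0 = P -> 0 < k -> 0 < d ->
  (forall w w' : R * R, `|w| < d -> `|w'| < d ->
     k * `|w' - w| <= `|chart A B P w' - chart A B P w|) ->
  0 < e -> ctsw 0 e G -> G 0 = P ->
  (forall s t, 0 <= s <= e -> 0 <= t <= e -> G s = G t -> s = t) ->
  (forall t, 0 <= t <= e -> exists2 u, `|u| < d & G t = A u \/ G t = B u) ->
  exists (br s : bool) X, half_germ G e d (if br then A else B) s X.
Proof.
move=> A0 B0 k0 d0 bil e0 cG G0 Ginj Gstar.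
have [w Hw] : {w : R -> R * R & forall t, 0 <= t <= e ->
    [/\ `|w t| < d, (w t).1 * (w t).2 = 0 & G t = chart A B P (w t)]}.
  apply: (@choice R (R * R)%type (fun t w => 0 <= t <= e ->
    [/\ `|w| < d, w.1 * w.2 = 0 & G t = chart A B P w])) => t.
  have [tin|ntin] := boolP (0 <= t <= e); last by exists 0.
  have [u ud [Gu|Gu]] := Gstar t tin; [exists (u, 0)|exists (0, u)] => _.
    by rewrite norm2_lt/= normr0 ud d0 mulr0; split=> //; rewrite /chart/= B0 addrK.
  by rewrite norm2_lt/= normr0 ud d0 mul0r; split=> //; rewrite /chart/= A0 addrAC subrr add0r.
have Ginj0 t : 0 < t <= e -> w t <> 0.
  move=> /andP[t0 te] wt; have tin : 0 <= t <= e by rewrite ltW.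
  have [_ _ Gt] := Hw t tin; move: Gt; rewrite wt /chart/= A0 B0 addrK => Gt.
  have : t = 0 by apply: Ginj; rewrite ?lexx ?(ltW e0)// G0.
  by move=> t00; rewrite t00 ltxx in t0.
have lip s t : 0 <= s <= e -> 0 <= t <= e -> k * `|w t - w s| <= `|G t - G s|.
  move=> sin tin; have [ws _ ->] := Hw s sin; have [wt _ ->] := Hw t tin.
  exact: bil.
(* The coordinates were chosen pointwise; their continuity comes from the lower bound [lip]. *)
have cw : ctsw 0 e w.
  move=> t tin h h0; have hk : 0 < k * h by rewrite mulr_gt0.
  have [d' d'0 Hd'] := cG t tin _ hk; exists d' => // y yin yt.
  by rewrite -(ltr_pM2l k0); apply: le_lt_trans (Hd' y yin yt); exact: lip.
have w00 : w 0 = 0.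
  have oin : 0 <= (0 : R) <= e by rewrite lexx ltW.
  have [w0 _ Gt] := Hw 0 oin; have := bil 0 (w 0); rewrite normr0 => /(_ d0 w0).
  rewrite -Gt G0 /chart/= A0 B0 addrK subrr normr0 subr0 => h.
  by apply/eqP; rewrite -normr_eq0 eq_le normr_ge0 andbT -(ler_pM2l k0) mulr0.
have cw1 : ctsw 0 e (fun t => (w t).1).
  apply: (@ctsw_comp _ _ 0 e w (fun w : R * R => w.1)) => // t _.
  by apply: c_fst; exact: c_id.
have cw2 : ctsw 0 e (fun t => (w t).2).
  apply: (@ctsw_comp _ _ 0 e w (fun w : R * R => w.2)) => // t _.
  by apply: c_snd; exact: c_id.
have ein : 0 < e <= e by rewrite e0 lexx.
have inj_w s t : 0 <= s <= e -> 0 <= t <= e -> w s = w t -> s = t.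
  move=> sin tin st; apply: Ginj => //.
  by have [_ _ ->] := Hw s sin; have [_ _ ->] := Hw t tin; rewrite st.
(* Here [c1] is the coordinate along the axis that contains the end of the path; the statement is
   symmetric so as to serve for both axes. *)
have main (c1 c2 : R * R -> R) (br : bool) :
    (forall w, w = 0 <-> c1 w = 0 /\ c2 w = 0) ->
    ctsw 0 e (fun t => c1 (w t)) -> ctsw 0 e (fun t => c2 (w t)) ->
    (forall w : R * R, `|c1 w| <= `|w|) ->
    (forall t, 0 <= t <= e -> c1 (w t) * c2 (w t) = 0) ->
    (forall t, 0 <= t <= e -> c2 (w t) = 0 -> G t = (if br then A else B) (c1 (w t))) ->
    (forall w w', c1 w = c1 w' -> c2 w = c2 w' -> w = w') ->
    c1 (w e) != 0 -> exists s X, half_germ G e d (if br then A else B) s X.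
  move=> c0 cc1 cc2 cn c12 GB cinj ce.
  have ce2 : c2 (w e) = 0.
    have := c12 e; rewrite lexx ltW// => /(_ isT) /eqP; rewrite mulf_eq0 (negPf ce).
    by move=> /eqP.
  (* One of the two coordinates vanishes and not both, so the difference of their absolute values
     never vanishes for t > 0 and keeps the sign that it has at [e]. *)
  have pos1 : forall t, 0 < t <= e -> 0 < `|c1 (w t)| - `|c2 (w t)|.
    move=> t /andP[t0 te].
    apply: (@ctsw_ivt (fun t => `|c1 (w t)| - `|c2 (w t)|) t e) => //; last by rewrite lexx.
    - apply: ctsw_add; last apply: ctsw_opp;
        apply: (@ctsw_sub _ 0 e t e) => //; try exact: ltW.
        apply: (@ctsw_comp _ _ 0 e (fun t => c1 (w t)) (fun x : R => `|x|)) => // u _.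
        by apply: c_norm; exact: c_id.
      apply: (@ctsw_comp _ _ 0 e (fun t => c2 (w t)) (fun x : R => `|x|)) => // u _.
      by apply: c_norm; exact: c_id.
    - move=> u /andP[tu ue] /eqP; rewrite subr_eq0 => /eqP h.
      have u0 : 0 < u by exact: lt_le_trans tu.
      apply: (Ginj0 u); first by rewrite u0.
      have := c12 u; rewrite ltW// ue => /(_ isT) /eqP; rewrite mulf_eq0.
      by move=> /orP[] /eqP h'; apply/c0; move: h; rewrite h' normr0 => /esym/eqP;
        rewrite ?normr_eq0 => /eqP; rewrite ?h'// => /esym/eqP; rewrite normr_eq0 => /eqP.
    - by rewrite ce2 normr0 subr0 normr_gt0.
  have z2 t : 0 <= t <= e -> c2 (w t) = 0.
    move=> /andP[]; rewrite le_eqVlt => /orP[/eqP <- _|t0 te].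
      by rewrite w00; apply (c0 0).1.
    have := pos1 t; rewrite t0 te => /(_ isT) h.
    have := c12 t; rewrite ltW// te => /(_ isT) /eqP; rewrite mulf_eq0 => /orP[/eqP h1|/eqP//].
    by move: h; rewrite h1 normr0 sub0r oppr_gt0 ltNge normr_ge0.
  have c10 : c1 (w 0) = 0 by rewrite w00; apply (c0 0).1.
  pose s := 0 < c1 (w e).
  exists s, (fun t => dir R s * c1 (w t)).
  have ds : dir R s * dir R s = 1 by rewrite /dir; case: s; rewrite ?mulr1// mulrNN mulr1.
  have cX : ctsw 0 e (fun t => dir R s * c1 (w t)).
    apply: (@ctsw_comp _ _ 0 e (fun t => c1 (w t)) (fun x : R => dir R s * x)) => // u _.
    by apply: c_mul; [exact: c_cst|exact: c_id].
  have Xp t : 0 < t <= e -> 0 < dir R s * c1 (w t).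
    move=> /andP[t0 te].
    apply: (@ctsw_ivt (fun t => dir R s * c1 (w t)) t e) => //; last by rewrite lexx.
    - by apply: (@ctsw_sub _ 0 e t e) => //; exact: ltW.
    - move=> u /andP[tu ue] /eqP; rewrite mulf_eq0 => /orP[|/eqP h].
        by rewrite /dir; case: (s); rewrite ?oppr_eq0 oner_eq0.
      have u0 : 0 < u by exact: lt_le_trans tu.
      have := pos1 u; rewrite u0 ue => /(_ isT); rewrite h normr0 sub0r oppr_gt0.
      by rewrite ltNge normr_ge0.
    - rewrite /dir /s; case: ifP => [|/negbT]; first by rewrite mul1r.
      by rewrite -leNgt mulN1r oppr_gt0 => h; rewrite lt_neqAle ce.
  have X0 : dir R s * c1 (w 0) = 0 by rewrite c10 mulr0.
  split=> //; last first.
    move=> u t u0 ut te; apply: (@inj_increasing (fun t => dir R s * c1 (w t)) e) => //.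
    move=> x y xin yin h; apply: inj_w => //.
    have h1 : c1 (w x) = c1 (w y).
      by have := congr1 (fun z => dir R s * z) h; rewrite !mulrA ds !mul1r.
    by apply: cinj => //; rewrite !z2.
  move=> t tin; rewrite mulrA ds mul1r GB ?z2//; split=> //.
  have /andP[t0 te] := tin; apply/andP; split.
    move: t0; rewrite le_eqVlt => /orP[/eqP <-|t0]; first by rewrite X0.
    by apply/ltW/Xp; rewrite t0.
  have [wd _ _] := Hw t tin; apply: le_lt_trans (wd); apply: le_trans (cn _).
  apply: (le_trans (ler_norm _)); rewrite normrM /dir; case: (s); rewrite ?normrN normr1 mul1r//.
have w12 (v : R * R) : v = 0 <-> v.1 = 0 /\ v.2 = 0.
  by split=> [->//|[h1 h2]]; apply: pair_eta.
have [we1|we1] := eqVneq (w e).1 0.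
  have [s [X H]] : exists s X, half_germ G e d (if false then A else B) s X.
    apply: (main (fun v => v.2) (fun v => v.1) false) => //.
    - by move=> v; rewrite w12; split=> -[].
    - by move=> v; have [] := norm2_ge v.
    - by move=> t tin; rewrite mulrC; have [] := Hw t tin.
    - by move=> t tin h; have [_ _ ->] := Hw t tin; rewrite /chart h A0 addrAC subrr add0r.
    - by move=> v v' h1 h2; apply: pair_eta.
    - by apply/eqP => h; apply: (Ginj0 e ein); apply/w12.
  by exists false, s, X.
have [s [X H]] : exists s X, half_germ G e d (if true then A else B) s X.
  apply: (main (fun v => v.1) (fun v => v.2) true) => //.
  - by move=> v; have [] := norm2_ge v.
  - by move=> t tin; have [] := Hw t tin.
  - by move=> t tin h; have [_ _ ->] := Hw t tin; rewrite /chart h B0 addrK.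
  - by move=> v v' h1 h2; apply: pair_eta.
by exists true, s, X.
Qed.

End Germs.

(** * Directions of germs, and the side on which the disk lies *)

Section GermDirections.
Context {R : realType}.
Implicit Types (a b g P : R * R) (A B G : R -> R * R).

Lemma small_le0 (x C e0 : R) : 0 < e0 -> 0 <= C ->
  (forall e : R, 0 < e -> e <= e0 -> x <= C * e) -> x <= 0.
Proof.
move=> e00 C0 H; rewrite leNgt; apply/negP => x0.
have C1 : 0 < C + 1 by lra.
have := H (Num.min e0 (x / (2 * (C + 1)))).
rewrite lt_min e00 ge_min lexx divr_gt0 ?mulr_gt0// => /(_ isT isT) h.
have : C * Num.min e0 (x / (2 * (C + 1))) <= C * (x / (2 * (C + 1))).
  by rewrite ler_wpM2l// ge_min lexx orbT.
have : C * (x / (2 * (C + 1))) <= x / 2.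
  have -> : x / 2 = (C + 1) * (x / (2 * (C + 1))) by field; rewrite gt_eqF.
  rewrite ler_wpM2r//; last by lra.
  by rewrite ltW// divr_gt0// mulr_gt0.
lra.
Qed.

Lemma dirK (s : bool) : dir R s * dir R s = 1.
Proof. by rewrite /dir; case: s; rewrite ?mulr1// mulrNN mulr1. Qed.

Lemma dir_norm (s : bool) : `|dir R s| = 1.
Proof. by rewrite /dir; case: s; rewrite ?normrN normr1. Qed.

Lemma dirN (s : bool) : dir R (~~ s) = - dir R s.
Proof. by rewrite /dir; case: s; rewrite ?opprK. Qed.

Lemma dir_neq0 (s : bool) : dir R s != 0.
Proof. by rewrite -normr_eq0 dir_norm oner_eq0. Qed.

Definition rderiv G g := forall e : R, 0 < e -> exists2 d : R, 0 < d &
  forall t : R, 0 <= t -> t < d -> `|G t - G 0 - t *: g| <= e * t.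

Lemma sd1_rderiv G g : sd1 G 0 g -> rderiv G g.
Proof.
move=> H e /H[d d0 Hd]; exists d => // t t0 td.
have := Hd 0 t; rewrite subrr normr0 subr0 ger0_norm// => /(_ d0 td).
by [].
Qed.

Lemma sd1_line (a c : R * R) (x : R) : sd1 (fun t => c + t *: a) x a.
Proof.
move=> e e0; exists 1 => // s t _ _.
have -> : c + t *: a - (c + s *: a) - (t - s) *: a = 0.
  by apply: pair_eta; rewrite /= /GRing.scale/=; ring.
by rewrite normr0 mulr_ge0// ltW.
Qed.

Lemma sd1_affine (G : R -> R * R) (k c x : R) g : sd1 G (k * x + c) g ->
  sd1 (fun t => G (k * t + c)) x (k *: g).
Proof.
move=> H e e0; pose K := `|k| + 1.
have K0 : 0 < K by rewrite /K; have := normr_ge0 k; lra.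
have eK : 0 < e / K by rewrite divr_gt0.
have [d d0 Hd] := H _ eK; exists (d / K); first by rewrite divr_gt0.
have tr u : `|u - x| < d / K -> `|k * u + c - (k * x + c)| < d.
  move=> h; have -> : k * u + c - (k * x + c) = k * (u - x) by ring.
  rewrite normrM; apply: (@le_lt_trans _ _ (K * `|u - x|)).
    by rewrite ler_wpM2r// /K lerDl.
  by rewrite mulrC -ltr_pdivlMr.
move=> s t /tr s1 /tr t1; have := Hd _ _ s1 t1.
have -> : k * t + c - (k * s + c) = k * (t - s) by ring.
rewrite scalerA [(t - s) * k]mulrC => h; apply: (le_trans h).
rewrite normrM mulrA ler_wpM2r// -mulrA ler_piMr ?(ltW e0)//.
by rewrite mulrC ler_pdivrMr// mul1r /K lerDl.
Qed.

(** Both first order expansions are read at the same small [t]: t g equals dir s X(t) a up to o(t),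
    because X(t) = O(t). Dividing by [t] gives [det2 a g = 0] and the sign of the dot product. *)
Lemma germ_dir G e d Br s X a g : half_germ G e d Br s X -> 0 < e ->
  sd1 Br 0 a -> a <> 0 -> rderiv G g -> g <> 0 ->
  exists2 k : R, 0 < k & g = (k * dir R s) *: a.
Proof.
move=> HG e0 Hb a0 Hg g0.
have A0 : 0 < `|a| by rewrite normr_gt0; exact/eqP.
(* Solves |a| X <= |g| t + |a| X / 2 + |a| t for X, the errors being bounded through e1 <= |a| /
   2. *)
pose C0 := 2 * (`|g| + `|a|) / `|a|.
have C00 : 0 <= C0.
  by rewrite /C0 divr_ge0 ?(ltW A0)// mulr_ge0// addr_ge0.
have key (e1 : R) : 0 < e1 -> e1 <= `|a| / 2 ->
    `|det2 a g| <= 2 * `|a| * (C0 + 1) * e1 /\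
    - dot2 (dir R s *: a) g <= 2 * `|a| * (C0 + 1) * e1.
  move=> e10 e1a.
  have [d1 d10 Hd1] := Hb e1 e10; have [d2 d20 Hd2] := Hg e1 e10.
  have oin : 0 <= (0 : R) <= e by rewrite lexx ltW.
  have [d3 d30 Hd3] := hg_cts HG oin d10.
  pose t := Num.min e (Num.min d2 d3) / 2.
  have m0 : 0 < Num.min e (Num.min d2 d3) by rewrite !lt_min e0 d20.
  have t0 : 0 < t by rewrite divr_gt0.
  have tm : t < Num.min e (Num.min d2 d3) by exact: half_lt.
  move: tm; rewrite !lt_min => /and3P[te td2 td3].
  have tin : 0 <= t <= e by rewrite !ltW.
  have [Gt /andP[X0 _]] := hg_eq HG tin; have [G0 _] := hg_eq HG oin.
  rewrite (hg_0 HG) mulr0 in G0.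
  have Xd1 : `|X t| < d1.
    by have := Hd3 t tin; rewrite (hg_0 HG) !subr0 ger0_norm ?(ltW t0)// => /(_ td3).
  have := Hd1 0 (dir R s * X t); rewrite subrr normr0 subr0 normrM dir_norm mul1r.
  move=> /(_ d10 Xd1); rewrite -Gt -G0 (ger0_norm X0).
  set E1 := _ - (_ *: a) => hE1.
  have := Hd2 t (ltW t0) td2; set E2 := _ - _ *: g => hE2.
  have eqg : t *: g = (dir R s * X t) *: a + E1 - E2.
    by apply: pair_eta; rewrite /E1 /E2 /= /GRing.scale/=; ring.
  have Xt : X t <= C0 * t.
    have h1 : `|a| * X t <= `|t *: g| + `|E1| + `|E2|.
      have -> : `|a| * X t = `|t *: g - E1 + E2|.
        rewrite eqg; have -> : (dir R s * X t) *: a + E1 - E2 - E1 + E2 = (dir R s * X t) *: a.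
          by apply: pair_eta; rewrite /= /GRing.scale/=; ring.
        by rewrite normrZ normrM dir_norm mul1r (ger0_norm X0) mulrC.
      apply: (le_trans (ler_normD _ _)); rewrite lerD2r.
      exact: ler_normB.
    rewrite normrZ gtr0_norm// in h1.
    have h2 : e1 * X t <= `|a| / 2 * X t by rewrite ler_wpM2r.
    have h3 : e1 * t <= `|a| * t by rewrite ler_wpM2r ?(ltW t0)//; lra.
    have h4 : `|a| * X t <= 2 * (`|g| + `|a|) * t by lra.
    have -> : C0 * t = (2 * (`|g| + `|a|) * t) / `|a| by rewrite /C0; ring.
    by rewrite ler_pdivlMr// mulrC.
  have B1 : 2 * `|a| * (`|E1| + `|E2|) <= 2 * `|a| * (C0 + 1) * e1 * t.
    rewrite -!mulrA ler_wpM2l// ler_wpM2l// mulrCA.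
    apply: (le_trans (lerD hE1 hE2)); rewrite -mulrDr ler_wpM2l ?(ltW e10)//.
    by rewrite mulrDl mul1r lerD2r.
  split; rewrite -(ler_pM2r t0); apply: le_trans B1; rewrite mulrDr.
    have -> : `|det2 a g| * t = `|det2 a E1 - det2 a E2|.
      rewrite -[X in _ * X](gtr0_norm t0) -normrM; congr `|_|.
      have -> : det2 a g * t = det2 a (t *: g) by rewrite /det2/= /GRing.scale/=; ring.
      by rewrite eqg /det2/= /GRing.scale/=; ring.
    by apply: (le_trans (ler_normB _ _)); apply: lerD; exact: det2_le.
  have -> : - dot2 (dir R s *: a) g * t =
      - (X t * dot2 a a * (dir R s * dir R s)) - dot2 (dir R s *: a) E1 + dot2 (dir R s *: a) E2.
    have -> : - dot2 (dir R s *: a) g * t = - dot2 (dir R s *: a) (t *: g).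
      by rewrite /dot2/= /GRing.scale/=; ring.
    by rewrite eqg /dot2/= /GRing.scale/=; ring.
  rewrite dirK mulr1.
  have nd : `|dir R s *: a| = `|a| by rewrite normrZ dir_norm mul1r.
  have := dot2_le (dir R s *: a) E1; have := dot2_le (dir R s *: a) E2; rewrite nd.
  have : 0 <= X t * dot2 a a by rewrite mulr_ge0// ltW// dot2_gt0.
  by rewrite !ler_norml => h1 /andP[h2 h3] /andP[h4 h5]; lra.
have CC : 0 <= 2 * `|a| * (C0 + 1) by rewrite mulr_ge0//; lra.
have a2 : 0 < `|a| / 2 by rewrite divr_gt0.
have D0 : det2 a g = 0.
  apply/eqP; rewrite -normr_eq0 eq_le normr_ge0 andbT.
  by apply: (small_le0 a2 CC) => e1 h1 h2; have [] := key e1 h1 h2.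
have P0 : 0 <= dot2 (dir R s *: a) g.
  rewrite -oppr_le0; apply: (small_le0 a2 CC) => e1 h1 h2.
  by have [] := key e1 h1 h2.
have aa := dot2_gt0 a0.
have ge : g = (dot2 (dir R s *: a) g / dot2 a a * dir R s) *: a.
  have d2 : (dot2 a a) *: g = dot2 a g *: a.
    move: D0; rewrite /det2 => D0.
    apply: pair_eta; rewrite /= /GRing.scale/= /dot2; apply/eqP; rewrite -subr_eq0; apply/eqP.
      by transitivity (- a.2 * (a.1 * g.2 - a.2 * g.1)); [ring|rewrite D0 mulr0].
    by transitivity (a.1 * (a.1 * g.2 - a.2 * g.1)); [ring|rewrite D0 mulr0].
  have -> : dot2 (dir R s *: a) g = dir R s * dot2 a g.
    by rewrite /dot2/= /GRing.scale/=; ring.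
  have -> : dir R s * dot2 a g / dot2 a a * dir R s = (dot2 a a)^-1 * dot2 a g.
    transitivity (dir R s * dir R s * ((dot2 a a)^-1 * dot2 a g)); first by ring.
    by rewrite dirK mul1r.
  by rewrite -scalerA -d2 scalerA mulVf ?gt_eqF// scale1r.
exists (dot2 (dir R s *: a) g / dot2 a a) => //.
rewrite lt_neqAle divr_ge0 ?(ltW aa)// andbT; apply/eqP => h.
by apply: g0; rewrite ge -h mul0r scale0r.
Qed.

(* At a smooth boundary point the two half germs are opposite halves of one branch. *)
Lemma germ_straight A B a b (Gl Gr : R -> R * R) e d (brl brr sl sr : bool) Xl Xr g :
  0 < e -> sd1 A 0 a -> sd1 B 0 b -> det2 a b != 0 -> g <> 0 ->
  rderiv Gr g -> rderiv Gl (- g) ->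
  half_germ Gl e d (if brl then A else B) sl Xl ->
  half_germ Gr e d (if brr then A else B) sr Xr -> brl = brr /\ sl = ~~ sr.
Proof.
move=> e0 Ha Hb D0 g0 Hr Hl HGl HGr.
have a0 : a <> 0 by move=> a0; move: D0; rewrite a0 /det2/= !mul0r subr0 eqxx.
have b0 : b <> 0 by move=> b0; move: D0; rewrite b0 /det2/= !mulr0 subr0 eqxx.
have ng0 : - g <> 0 by move=> /eqP; rewrite oppr_eq0 => /eqP.
have sdb (br : bool) : sd1 (if br then A else B) 0 (if br then a else b) by case: br.
have nzb (br : bool) : (if br then a else b) <> 0 by case: br.
have [k k0 ek] := germ_dir HGr e0 (sdb brr) (nzb brr) Hr g0.
have [l l0 el] := germ_dir HGl e0 (sdb brl) (nzb brl) Hl ng0.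
have lk : (l * dir R sl) *: (if brl then a else b) = - ((k * dir R sr) *: (if brr then a else b)).
  by rewrite -el -ek.
have kn (s : bool) (x : R) : 0 < x -> x * dir R s != 0.
  by move=> x0; rewrite mulf_neq0 ?dir_neq0// gt_eqF.
have br : brl = brr.
  case: brl brr lk {HGl HGr el ek} => -[] // lk; exfalso; apply/negP: D0; rewrite negbK.
    have := congr1 (fun v => det2 v b) lk.
    have -> : det2 ((l * dir R sl) *: a) b = (l * dir R sl) * det2 a b.
      by rewrite /det2/= /GRing.scale/=; ring.
    have -> : det2 (- ((k * dir R sr) *: b)) b = 0 by rewrite /det2/= /GRing.scale/=; ring.
    by move=> /eqP; rewrite mulf_eq0 (negPf (kn _ _ l0)).
  have := congr1 (fun v => det2 v b) lk.
  have -> : det2 (- ((k * dir R sr) *: a)) b = - ((k * dir R sr) * det2 a b).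
    by rewrite /det2/= /GRing.scale/=; ring.
  have -> : det2 ((l * dir R sl) *: b) b = 0 by rewrite /det2/= /GRing.scale/=; ring.
  by move=> /esym/eqP; rewrite oppr_eq0 mulf_eq0 (negPf (kn _ _ k0)).
split=> //; move: lk; rewrite br => /eqP; rewrite -subr_eq0 opprK -scalerDl.
rewrite scaler_eq0 => /orP[/eqP|/eqP]; last by move: (nzb brr).
by rewrite /dir; case: sl {HGl el}; case: sr {HGr ek} => //= h; exfalso; lra.
Qed.

Lemma circle_sd1 th : sd1 (@circle R) th ((2 * pi) *: (- sin (2 * pi * th), cos (2 * pi * th))).
Proof.
have h (f df : R -> R) : (forall t : R, is_derive t 1 f (df t)) -> (forall t, cts df t) ->
    sdr (fun t => f (2 * pi * t)) th (2 * pi * df (2 * pi * th)).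
  move=> Hf cf; apply: (@sdr_of R _ (fun t => 2 * pi * df (2 * pi * t)) th 1) => //.
    move=> t _; have h := @is_derive1_comp R f (fun t => 2 * pi * t) t (df (2 * pi * t)) (2 * pi) (Hf _).
    have h2 : is_derive t 1 (fun t : R => 2 * pi * t) (2 * pi).
      have -> : (fun t : R => 2 * pi * t) = (2 * pi) \*: (fun t : R => t).
        by apply/funext.
      by apply: is_derive_eq; rewrite /GRing.scale/= mulr1.
    by rewrite [X in is_derive _ _ _ X]mulrC; exact: (h h2).
  apply: c_mul; first exact: c_cst.
  apply: (c_comp (g := df)) => //; apply: c_mul; [exact: c_cst|exact: c_id].
apply/sd1P; split => /=.
  by apply: (h cos (fun x => - sin x) (fun t => is_derive_cos t)) => t; apply: c_opp; exact: continuous_sin.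
by apply: (h sin cos (fun t => is_derive_sin t)) => t; exact: continuous_cos.
Qed.

(* An orientation-preserving immersion has the interior of the disk on its left. *)
Lemma corner_orient A B P (f F : R * R -> R * R) th1 p q a' b (sA sB : bool) x1 d k r e1 eb Y :
  B 0 = P -> 0 < k -> 0 < r -> 0 < e1 ->
  (forall w w' : R * R, `|w| < d -> `|w'| < d ->
     k * `|w' - w| <= `|chart A B P w' - chart A B P w|) ->
  sd2 F (circle th1) p q -> 0 < det2 p q ->
  (forall w, disk2 w -> `|w - circle th1| < r -> f w = F w) ->
  0 <= x1 -> x1 < d -> f (circle th1) = A (dir R sA * x1) ->
  (forall w, disk2 w -> `|w - circle th1| < r -> exists u v : R,
     [/\ 0 <= u < d, 0 <= v < d & f w = chart A B P (dir R sA * u, dir R sB * v)]) ->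
  half_germ (fun t => f (circle (th1 + t))) e1 d (fun u => A (dir R sA * x1 + u)) sA Y ->
  sd1 A (dir R sA * x1) a' -> a' <> 0 -> 0 <= eb ->
  (forall v : R, `|v| < d -> `|B v - B 0 - v *: b| <= eb * `|v|) ->
  2 * `|a'| * eb < `|det2 a' b| ->
  0 < dir R sA * dir R sB * det2 a' b.
Proof.
move=> B0 k0 r0 e10 bil HF Dpq fF x10 x1d fth Hquad HG HA a'0 eb0 HB heb.
(* The corner is not a point of immersion, so the side is tested at [c], a boundary point on the
   branch [A] at parameter dir sA * x1. Below, [g] is the image of the tangent of the circle at [c]
   and [n] that of the inner normal. *)
set c := circle th1.
pose g := (2 * pi) *: ((- sin (2 * pi * th1)) *: p + cos (2 * pi * th1) *: q).
pose n := - (c.1 *: p + c.2 *: q).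
have fc : f c = F c by apply: fF; rewrite ?subrr ?normr0//; exact: circle_disk.
have sc : sin (2 * pi * th1) ^+ 2 + cos (2 * pi * th1) ^+ 2 = 1 by rewrite addrC cos2Dsin2.
have Dgn : det2 g n = 2 * pi * det2 p q.
  transitivity (2 * pi * det2 p q * (sin (2 * pi * th1) ^+ 2 + cos (2 * pi * th1) ^+ 2)).
    by rewrite /g /n /c /det2 /circle /= /GRing.scale/=; ring.
  by rewrite sc mulr1.
have pi0 : (0 : R) < 2 * pi by rewrite mulr_gt0// pi_gt0.
have Dgn0 : 0 < det2 g n by rewrite Dgn mulr_gt0.
have g0 : g <> 0 by move=> g0; move: Dgn0; rewrite g0 /det2/= !mul0r subrr ltxx.
have Hg : rderiv (fun t => f (circle (th1 + t))) g.
  have H1 : sd1 (fun t => F (circle (th1 + t))) 0 g.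
    have hc : sd1 (fun t => circle (th1 + t)) 0
       ((2 * pi) *: (- sin (2 * pi * th1), cos (2 * pi * th1))).
      have := @sd1_affine (@circle R) 1 th1 0.
      rewrite mulr0 add0r => /(_ _ (circle_sd1 th1)); rewrite scale1r.
      by have -> : (fun t : R => circle (1 * t + th1)) = (fun t => circle (th1 + t))
        by apply/funext => t; rewrite mul1r addrC.
    have := @sd1_comp R F (fun t => circle (th1 + t)) 0 c p q _ _ HF hc.
    rewrite addr0 => /(_ erefl).
    have -> : ((2 * pi) *: (- sin (2 * pi * th1), cos (2 * pi * th1))).1 *: p +
     ((2 * pi) *: (- sin (2 * pi * th1), cos (2 * pi * th1))).2 *: q = g.
      by apply: pair_eta; rewrite /g /= /GRing.scale/=; ring.
    exact.
  move=> e e0; have [d1 d10 Hd1] := sd1_rderiv H1 e0.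
  have : cts (fun t => circle (th1 + t)) 0.
    by apply: c_circle; apply: c_add; [exact: c_cst|exact: c_id].
  move=> /ctsP /(_ r r0)[d2 d20 Hd2]; exists (Num.min d1 d2); first by rewrite lt_min d10.
  move=> t t0; rewrite lt_min => /andP[td1 td2].
  have := Hd1 t t0 td1; rewrite -!fF//; try exact: circle_disk.
    by rewrite addr0 subrr normr0.
  by have := Hd2 t; rewrite subr0 ger0_norm// addr0 => /(_ td2).
have HA0 : sd1 (fun u => A (dir R sA * x1 + u)) 0 a'.
  have := @sd1_affine A 1 (dir R sA * x1) 0; rewrite mulr0 add0r => /(_ _ HA).
  rewrite scale1r; have -> // : (fun t => A (1 * t + dir R sA * x1)) = (fun u => A (dir R sA * x1 + u)).
  by apply/funext => t; rewrite mul1r addrC.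
have [kk kk0 gE] := germ_dir HG e10 HA0 a'0 Hg g0.
pose Nn := dir R sA * det2 a' n.
have N0 : 0 < Nn.
  move: Dgn0; have -> : det2 g n = kk * Nn by rewrite gE /Nn /det2/= /GRing.scale/=; ring.
  by rewrite pmulr_rgt0.
pose C := (`|n| + 1) / k.
have C0 : 0 <= C by rewrite /C divr_ge0 ?(ltW k0)// addr_ge0.
(* Makes the errors of [F] and [A] together at most half of t Nn, the normal displacement. *)
pose ee := Num.min 1 (Nn / (4 * (`|a'| + 1) * (C + 1))).
have a'1 : 0 < `|a'| + 1 by have := normr_ge0 a'; lra.
have C1 : 0 < C + 1 by lra.
have ee0 : 0 < ee by rewrite lt_min ltr01 divr_gt0// !mulr_gt0.
have ee1 : ee <= 1 by rewrite ge_min lexx.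
have ee2 : 4 * (`|a'| + 1) * (C + 1) * ee <= Nn.
  have : ee <= Nn / (4 * (`|a'| + 1) * (C + 1)) by rewrite ge_min lexx orbT.
  by rewrite ler_pdivlMr ?mulr_gt0// mulrC.
have [d1 d10 Hd1] := HF ee ee0; have [d2 d20 Hd2] := HA ee ee0.
pose M := Num.min 1 (Num.min r (Num.min d1 (d2 / (C + 1)))).
have M0 : 0 < M by rewrite !lt_min ltr01 r0 d10 divr_gt0.
pose t := M / 2; have t0 : 0 < t by rewrite divr_gt0.
have tM : t < M by exact: half_lt.
move: (tM); rewrite !lt_min => /and4P[t1 tr td1 td2].
(* A point slightly inside the disk. Its image has coordinates near (x1, 0) with [v] nonnegative
   along the half of [B], so the inner normal tells on which side of [A] this half lies. *)
pose w := (1 - t) *: c.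
have wd : disk2 w by apply: disk_star; [exact: circle_disk|lra].
have wc : w - c = (- t) *: c by apply: pair_eta; rewrite /w /= /GRing.scale/=; ring.
have wcn : `|w - c| <= t.
  by rewrite wc normrZ normrN gtr0_norm// ler_piMr ?(ltW t0)// circle_norm.
have wr : `|w - c| < r by exact: le_lt_trans tr.
have [u [v [/andP[u0 ud] /andP[v0 vd] fw]]] := Hquad w wd wr.
have := Hd1 c w; rewrite subrr normr0 => /(_ d10 (le_lt_trans wcn td1)).
rewrite -(fF w wd wr) -fc.
have -> : (w.1 - c.1) *: p + (w.2 - c.2) *: q = t *: n.
  by apply: pair_eta; rewrite /w /n /= /GRing.scale/=; ring.
set E := _ - t *: n => hE.
have {}hE : `|E| <= ee * t by apply: (le_trans hE); rewrite ler_wpM2l ?(ltW ee0).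
have fc' : f c = chart A B P (dir R sA * x1, 0).
  by rewrite /c fth /chart/= B0 addrK.
have dn (s : bool) (x : R) : 0 <= x -> `|dir R s * x| = x.
  by move=> x0; rewrite normrM dir_norm mul1r ger0_norm.
have nb : k * Num.max `|u - x1| v <= `|f w - f c|.
  rewrite fw fc'; have := bil (dir R sA * x1, 0) (dir R sA * u, dir R sB * v).
  rewrite !norm2_lt /= !dn// normr0 x1d ud vd (le_lt_trans u0 ud) => /(_ isT isT).
  rewrite norm2E /= -mulrBr normrM dir_norm mul1r subr0 dn//.
have nD : `|f w - f c| <= t * (`|n| + 1).
  have -> : f w - f c = t *: n + E by apply: pair_eta; rewrite /E /= /GRing.scale/=; ring.
  apply: (le_trans (ler_normD _ _)); rewrite normrZ gtr0_norm// mulrDr mulr1 lerD2l.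
  by apply: (le_trans hE); rewrite ler_piMl ?(ltW t0).
have mC : Num.max `|u - x1| v <= C * t.
  rewrite /C mulrAC ler_pdivlMr// mulrC; apply: (le_trans nb); by rewrite mulrC [(_ + _) * t]mulrC in nD *.
have [uC vC] : `|u - x1| <= C * t /\ v <= C * t.
  by move: mC; rewrite ge_max => /andP.
have ux : `|u - x1| < d2.
  apply: (le_lt_trans uC); apply: (@le_lt_trans _ _ ((C + 1) * t)).
    by rewrite ler_wpM2r ?(ltW t0)//; lra.
  by rewrite mulrC -ltr_pdivlMr.
have := Hd2 (dir R sA * x1) (dir R sA * u); rewrite subrr normr0 -mulrBr normrM dir_norm mul1r.
move=> /(_ d20 ux); set E1 := _ - _ *: a' => hE1.
have := HB (dir R sB * v); rewrite dn// => /(_ vd); set E2 := _ - _ *: b => hE2.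
have DE : f w - f c = (dir R sA * (u - x1)) *: a' + E1 + (dir R sB * v) *: b + E2.
  rewrite fw fc' /E1 /E2 /chart.
  by apply: pair_eta; rewrite /= /GRing.scale/= B0; ring.
have key : dir R sA * dir R sB * v * det2 a' b + dir R sA * det2 a' E2 =
   t * Nn + dir R sA * det2 a' E - dir R sA * det2 a' E1.
  have h : dir R sA * det2 a' (f w - f c) = t * Nn + dir R sA * det2 a' E.
    have -> : f w - f c = t *: n + E by apply: pair_eta; rewrite /E /= /GRing.scale/=; ring.
    by rewrite /Nn /det2/= /GRing.scale/=; ring.
  by rewrite -h DE /det2/= /GRing.scale/=; ring.
have bE : `|dir R sA * det2 a' E| <= 2 * `|a'| * (ee * t).
  rewrite normrM dir_norm mul1r; apply: (le_trans (det2_le _ _)).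
  by rewrite ler_wpM2l// mulr_ge0.
have bE1 : `|dir R sA * det2 a' E1| <= 2 * `|a'| * (ee * (C * t)).
  rewrite normrM dir_norm mul1r; apply: (le_trans (det2_le _ _)).
  rewrite ler_wpM2l ?mulr_ge0//; apply: (le_trans hE1).
  by rewrite ler_wpM2l ?(ltW ee0).
have bE2 : `|dir R sA * det2 a' E2| <= 2 * `|a'| * eb * v.
  rewrite normrM dir_norm mul1r; apply: (le_trans (det2_le _ _)).
  by rewrite -[2 * `|a'| * eb * v]mulrA ler_wpM2l// mulr_ge0.
have tot : 0 < dir R sA * dir R sB * v * det2 a' b + dir R sA * det2 a' E2.
  rewrite key.
  have h1 : 2 * `|a'| * (ee * t) + 2 * `|a'| * (ee * (C * t)) <= Nn / 2 * t.
    have -> : 2 * `|a'| * (ee * t) + 2 * `|a'| * (ee * (C * t)) = 2 * `|a'| * (C + 1) * ee * t by ring.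
    rewrite ler_wpM2r ?(ltW t0)//.
    have : `|a'| * ((C + 1) * ee) <= (`|a'| + 1) * ((C + 1) * ee).
      by rewrite ler_wpM2r ?lerDl// mulr_ge0// ltW.
    set Z := `|a'| * _; set Z' := (`|a'| + 1) * _ => ZZ.
    have -> : 2 * `|a'| * (C + 1) * ee = 2 * Z by rewrite /Z; ring.
    have {}ee2 : 4 * Z' <= Nn by apply: le_trans ee2; rewrite /Z' !mulrA.
    by clearbody Z Z' Nn; lra.
  move: bE bE1; rewrite !ler_norml => /andP[h2 h3] /andP[h4 h5].
  have h6 : 0 < Nn * t by rewrite mulr_gt0.
  lra.
have D0 : 0 < `|det2 a' b| by apply: le_lt_trans heb; rewrite !mulr_ge0.
rewrite ltNge; apply/negP => neg.
have absE : dir R sA * dir R sB * det2 a' b = - `|det2 a' b|.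
  by rewrite -[RHS]opprK -(opprK (_ * det2 a' b)); congr (- _);
  rewrite -[LHS]ger0_norm ?oppr_ge0// normrN !normrM !dir_norm !mul1r opprK.
move: tot; have -> : dir R sA * dir R sB * v * det2 a' b = - `|det2 a' b| * v.
  by rewrite -absE; ring.
have : 2 * `|a'| * eb * v <= `|det2 a' b| * v by rewrite ler_wpM2r// ltW.
by move: bE2; rewrite ler_norml => /andP[h1 h2] h3; lra.
Qed.

End GermDirections.

(** The strand index and parameter in [0, 1[ are the same for every family [F] that obeys the
    monodromy rule. Positions, tangents and angles are thus normalised together. *)
Lemma periodic_norm (R : realType) (N : nat) (mu : {perm 'I_N}) (i : 'I_N) (x : R) :
  exists j y (n : int), [/\ 0 <= y < 1, x = y + n%:~R &
    forall (T : Type) (F : 'I_N -> R -> T), (forall i x, F i (x + 1) = F (mu i) x) ->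
      forall t : R, F i (x + t) = F j (y + t)].
Proof.
have H (n : nat) : (forall i, exists j, forall (T : Type) (F : 'I_N -> R -> T),
    (forall i x, F i (x + 1) = F (mu i) x) -> forall t, F i (t + n%:R) = F j t) /\
  (forall i, exists j, forall (T : Type) (F : 'I_N -> R -> T),
    (forall i x, F i (x + 1) = F (mu i) x) -> forall t, F i (t - n%:R) = F j t).
  elim: n => [|n [IH1 IH2]].
    by split=> k; exists k => T F HF t; rewrite ?addr0 ?subr0.
  split=> k.
    have [j Hj] := IH1 (mu k); exists j => T F HF t.
    by rewrite -natr1 addrA HF Hj.
  have [j Hj] := IH2 ((mu^-1)%g k); exists j => T F HF t.
  by rewrite -Hj // -[k in LHS](permKV mu) -HF; congr F; rewrite -natr1; ring.
pose n := Num.floor x.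
have /andP[n1 n2] := Num.Theory.floor_itv x.
have [j Hj] : exists j, forall (T : Type) (F : 'I_N -> R -> T),
    (forall i x, F i (x + 1) = F (mu i) x) -> forall t : R, F i (t + n%:~R) = F j t.
  case: (n) => m; first exact: (H m).1.
  have [j Hj] := (H m.+1).2 i; exists j => T F HF t.
  by rewrite NegzE mulrNz; exact: Hj.
exists j, (x - n%:~R), n; split.
- by rewrite subr_ge0 n1 ltrBlDr addrC; move: n2; rewrite intrD.
- by rewrite subrK.
- by move=> T F HF t; rewrite -(Hj _ F HF); congr F; ring.
Qed.

(** * Local branches of the link *)

Section Boundary.
Context {R : realType} {C : finType} {N s : nat} (L : diagram R C N s).
Context (gen : generic_diagram L).

Definition xyS (i : 'I_N) (x : R) : R * R := (strand L i x).1.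

Lemma xyS_sd1 i x : sd1 (xyS i) x (tangent L (i, x)) /\
  cts (fun x => tangent L (i, x)) x.
Proof.
have sm := gen_smooth gen i.
have H (t : R) := @smooth_derive R _ _ (strand L i : R -> R * R * R) setT t 1 sm I.
have H1 (t : R) : is_derive t 1 (xyS i) ('D_1 (strand L i : R -> R * R * R) t).1.
  exact: is_derive_fst (H t).1.
have tE (t : R) : tangent L (i, t) = ('D_1 (strand L i : R -> R * R * R) t).1.
  by rewrite /tangent/= derive1E; apply: derive_val; exact: H1.
have tF : (fun x => tangent L (i, x)) = (fun t => ('D_1 (strand L i : R -> R * R * R) t).1).
  by apply/funext.
split; last by rewrite tF; apply: c_fst; exact: (H x).2.
apply/sd1P; rewrite tE; split.
  apply: (@sdr_of R _ (fun t => ('D_1 (strand L i : R -> R * R * R) t).1.1) x 1) => //.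
    by move=> t _; exact: is_derive_fst (H1 t).
  by apply/c_fst/c_fst; exact: (H x).2.
apply: (@sdr_of R _ (fun t => ('D_1 (strand L i : R -> R * R * R) t).1.2) x 1) => //.
  by move=> t _; exact: is_derive_snd (H1 t).
by apply: c_snd; apply: c_fst; exact: (H x).2.
Qed.

Lemma link_norm i x : exists j y, on_link (j, y) /\
  forall t, strand L i (x + t) = strand L j (y + t).
Proof.
have [j [y [n [/andP[y0 y1] _ H]]]] := periodic_norm (monodromy L) i x.
by exists j, y; split => //; apply: H; exact: gen_closed.
Qed.

(** On one period, compactness forces parameters whose points are near [P] to be near parameters of
    [P]; the other periods follow by normalisation. *)
Lemma strands_near (P : R * R) (rho : R) : 0 < rho -> exists2 r : R, 0 < r &
  forall i x, `|xyS i x - P| < r -> exists j y u,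
    [/\ on_link (j, y), xyS j y = P, `|u| < rho & forall t, xyS i (x + t) = xyS j (y + (u + t))].
Proof.
move=> rho0.
have H (i : 'I_N) : exists2 d : R, 0 < d & forall x, x \in `[(0:R), 1] ->
    `|xyS i x - P| < d -> exists2 x', xyS i x' = P & `|x - x'| < rho.
  have := @unif_delta R _ (`[(0:R), 1] : set R) (fun x d => `|xyS i x - P| < d -> exists2 x', xyS i x' = P & `|x - x'| < rho).
  case=> [||x _|d d0 Hd].
  - exact: segment_compact.
  - by move=> x d d' _ dd h h'; apply: h; exact: lt_le_trans dd.
  - have [xP|/eqP xP] := eqVneq (xyS i x) P.
      by exists rho => // y _ yx _; exists x.
    have n0 : 0 < `|xyS i x - P| by rewrite normr_gt0 subr_eq0; exact/eqP.
    have n2 : 0 < `|xyS i x - P| / 2 by rewrite divr_gt0.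
    have [d d0 Hd] := (ctsP _ _).1 (sd1_cts (xyS_sd1 i x).1) _ n2.
    exists (Num.min d (`|xyS i x - P| / 2)); first by rewrite lt_min d0.
    move=> y _; rewrite !lt_min => /andP[/Hd h1 _] /andP[_ h2]; exfalso.
    by have := ler_distD (xyS i y) (xyS i x) P; rewrite (distrC (xyS i x) (xyS i y)); lra.
  - by exists d => // x; rewrite in_itv/= => xin; apply: Hd; rewrite /= in_itv.
have [d Hd] := @choice _ _ (fun (i : 'I_N) (d : R) => 0 < d /\ forall x : R,
    x \in `[(0 : R), 1] -> `|xyS i x - P| < d -> exists2 x', xyS i x' = P & `|x - x'| < rho)
  (fun i => let: ex_intro2 d d0 h := H i in ex_intro _ d (conj d0 h)).
have [r r0 Hr] := @seq_min R _ (enum 'I_N) d (fun i _ => (Hd i).1).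
exists r => // i x ix; have [j [y [[/= y0 y1] Hj]]] := link_norm i x.
have Sij t : xyS i (x + t) = xyS j (y + t) by rewrite /xyS Hj.
have ij : xyS i x = xyS j y by have := Sij 0; rewrite !addr0.
have [||x' jx' yx'] := (Hd j).2 y.
- by rewrite in_itv/= y0 ltW.
- by rewrite -ij; apply: (lt_le_trans ix); apply: Hr; rewrite mem_enum.
have [k [z [zon Hk]]] := link_norm j x'.
exists k, z, (y - x'); split=> //.
- by rewrite -jx'; have := Hk 0; rewrite !addr0 /xyS => ->.
- by move=> t; rewrite Sij /xyS -Hk; congr (strand L j _).1; ring.
Qed.

Record branches (A B A' B' : R -> R * R) (P : R * R) : Prop := {
  br_A0 : A 0 = P;
  br_B0 : B 0 = P;
  br_A : forall u, sd1 A u (A' u);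
  br_B : forall u, sd1 B u (B' u);
  br_cA : cts A' 0;
  br_cB : cts B' 0;
  br_det : det2 (A' 0) (B' 0) != 0 }.

Lemma branches_sym A B A' B' P : branches A B A' B' P -> branches B A B' A' P.
Proof. by case=> *; split=> //; rewrite det2C oppr_eq0. Qed.

Lemma branches_bil A B A' B' P : branches A B A' B' P -> exists k d : R,
  [/\ 0 < k, 0 < d & forall w w' : R * R, `|w| < d -> `|w'| < d ->
     k * `|w' - w| <= `|chart A B P w' - chart A B P w|].
Proof.
case=> A0 B0 HA HB _ _ D0.
have [k [d [k0 d0 H]]] := sd2_bilip (chart_sd2 P (HA 0) (HB 0)) D0.
by exists k, d; split=> // w w' wd wd'; apply: H; rewrite subr0.
Qed.

(** Supplies the quantitative hypotheses of [corner_orient] uniformly for parameters near 0: [eb]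
    makes the error of [B] at most half of [det2 (A' 0) (B' 0)], while moving along [A] changes this
    determinant by at most a quarter and keeps its sign. *)
Lemma branches_orient A B A' B' P : branches A B A' B' P -> exists2 d : R, 0 < d &
  forall x d', `|x| < d -> d' <= d -> exists eb : R, [/\ 0 <= eb, A' x <> 0,
    (forall v : R, `|v| < d' -> `|B v - B 0 - v *: B' 0| <= eb * `|v|),
    2 * `|A' x| * eb < `|det2 (A' x) (B' 0)| &
    forall k : R, `|k| = 1 -> 0 < k * det2 (A' x) (B' 0) -> 0 < k * det2 (A' 0) (B' 0)].
Proof.
case=> A0 B0 HA HB cA cB D0.
set a := A' 0 in D0 *; set b := B' 0 in D0 *.
have Dp : 0 < `|det2 a b| by rewrite normr_gt0.
pose e := Num.min 1 (`|det2 a b| / (8 * (`|b| + 1))).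
have b1 : 0 < `|b| + 1 by have := normr_ge0 b; lra.
have a1 : 0 < `|a| + 1 by have := normr_ge0 a; lra.
have e0 : 0 < e by rewrite lt_min ltr01 divr_gt0// mulr_gt0.
pose eb := `|det2 a b| / (4 * (`|a| + 1)).
have eb0 : 0 < eb by rewrite divr_gt0// mulr_gt0.
have [d1 d10 Hd1] := (ctsP _ _).1 cA _ e0; have [d2 d20 Hd2] := HB 0 _ eb0.
exists (Num.min d1 d2); first by rewrite lt_min d10.
move=> x d'; rewrite lt_min le_min => /andP[x1 x2] /andP[h1 h2].
have ax : `|A' x - a| < e by apply: Hd1; rewrite subr0.
have e1 : e <= 1 by rewrite ge_min lexx.
have eD : 8 * (`|b| + 1) * e <= `|det2 a b|.
  have : e <= `|det2 a b| / (8 * (`|b| + 1)) by rewrite ge_min lexx orbT.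
  by rewrite ler_pdivlMr ?mulr_gt0// mulrC.
have nx : `|A' x| <= `|a| + 1.
  have -> : A' x = (A' x - a) + a by apply: pair_eta; rewrite /=; ring.
  by apply: (le_trans (ler_normD _ _)); rewrite addrC lerD2l; lra.
have dd : `|det2 (A' x) b - det2 a b| <= `|det2 a b| / 4.
  have -> : det2 (A' x) b - det2 a b = det2 (A' x - a) b by rewrite /det2/=; ring.
  apply: (le_trans (det2_le _ _)).
  have h3 : `|A' x - a| * `|b| <= e * (`|b| + 1).
    by apply: ler_pM => //; [exact: ltW|rewrite lerDl].
  have -> : 2 * `|A' x - a| * `|b| = 2 * (`|A' x - a| * `|b|) by ring.
  by move: eD; rewrite [8 * _ * e]mulrAC -[8 * e * _]mulrA; lra.
have big : 3 / 4 * `|det2 a b| <= `|det2 (A' x) b|.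
  have := ler_normB (det2 (A' x) b) (det2 (A' x) b - det2 a b); rewrite subKr; lra.
exists eb; split.
- exact: ltW.
- by move=> h; move: big; rewrite h /det2/= !mul0r subrr normr0; move: Dp; rewrite /det2; lra.
- move=> v vd; have := Hd2 0 v; rewrite !subr0 normr0; apply => //.
  by apply: (lt_le_trans vd).
- apply: (@le_lt_trans _ _ (2 * (`|a| + 1) * eb)).
    by rewrite ler_wpM2r ?(ltW eb0)// ler_wpM2l.
  have -> : 2 * (`|a| + 1) * eb = `|det2 a b| / 2 by rewrite /eb; field; rewrite gt_eqF.
  by move: big Dp; lra.
- move=> k k1 kp; have : `|k * det2 (A' x) b - k * det2 a b| <= `|det2 a b| / 4.
    by rewrite -mulrBr normrM k1 mul1r.
  have : `|k * det2 (A' x) b| = `|det2 (A' x) b| by rewrite normrM k1 mul1r.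
  by rewrite gtr0_norm// => h3; rewrite ler_norml => /andP[h4 h5]; lra.
Qed.

Definition strand_at (i : 'I_N) (x u : R) := xyS i (x + u).

Lemma strand_at_sd1 i x u : sd1 (strand_at i x) u (tangent L (i, x + u)).
Proof.
have := @sd1_affine R (xyS i) 1 x u; rewrite mul1r addrC => /(_ _ (xyS_sd1 i (x + u)).1).
rewrite scale1r; have -> // : (fun t => xyS i (1 * t + x)) = strand_at i x.
by apply/funext => t; rewrite /strand_at mul1r addrC.
Qed.

Lemma strand_at_cts i x : cts (fun u => tangent L (i, x + u)) 0.
Proof.
apply: (c_comp (g := fun x => tangent L (i, x))).
  by apply: c_add; [exact: c_cst|exact: c_id].
exact: (xyS_sd1 i (x + 0)).2.
Qed.

Lemma crossing_branches c : branches
  (strand_at (over L c).1 (over L c).2) (strand_at (under L c).1 (under L c).2)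
  (fun u => tangent L ((over L c).1, (over L c).2 + u))
  (fun u => tangent L ((under L c).1, (under L c).2 + u)) (pt L (over L c)).1.
Proof.
split.
- by rewrite /strand_at addr0.
- by rewrite /strand_at addr0; have [-> _] := gen_chord gen c.
- exact: strand_at_sd1.
- exact: strand_at_sd1.
- exact: strand_at_cts.
- exact: strand_at_cts.
- by rewrite !addr0 -!surjective_pairing; exact: gen_transverse.
Qed.

(** At a simple point of the link the normal line plays the second branch, so that simple points and
    crossings share one analysis. *)
Lemma single_branches i x : branches (strand_at i x)
  (fun u => xyS i x + u *: (- (tangent L (i, x)).2, (tangent L (i, x)).1))
  (fun u => tangent L (i, x + u))
  (fun=> (- (tangent L (i, x)).2, (tangent L (i, x)).1)) (xyS i x).
Proof.
split.
- by rewrite /strand_at addr0.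
- by rewrite scale0r addr0.
- exact: strand_at_sd1.
- by move=> u; exact: sd1_line.
- exact: strand_at_cts.
- exact: c_cst.
- rewrite addr0; have [t0 _] := gen_legendrian gen i x.
  have := dot2_gt0 t0; rewrite /det2 /dot2/=; set a := _.1; set b := _.2 => h.
  by rewrite mulrN opprK gt_eqF.
Qed.

Lemma double_points c i x : on_link (i, x) -> xyS i x = (pt L (over L c)).1 ->
  (i, x) = over L c \/ (i, x) = under L c.
Proof.
move=> ion e; have [h|/eqP h] := eqVneq (i, x) (over L c); first by left.
have [c' Hc'] := gen_all gen ion (gen_on gen c).1 h e.
have cc : c' = c.
  apply: (gen_double gen); case: Hc' => [] [h1 h2]; first by rewrite h1; exact: e.
  by rewrite h1.
by case: Hc' => [] [h1 h2]; rewrite cc in h1 h2; [left|right].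
Qed.

End Boundary.

(** * The boundary path of a disk *)

Section DiskBoundary.
Context {R : realType} {C : finType} {N s : nat} (L : diagram R C N s).
Context (gen : generic_diagram L) (D : disk R) (HD : is_disk L D).

Definition boundary (th : R) : R * R := dmap D (circle th).

Definition unmarked (th : R) := forall m, marks D m -> circle th <> circle m.

Lemma bdry_cts th : cts boundary th.
Proof.
apply: (@c_eq _ _ _ (fun th => dmap D (retract (circle th)))).
  by move=> y; rewrite retract_id//; exact: circle_disk.
apply: (@c_comp _ _ _ _ (fun w => dmap D (retract w)) (@circle R)).
  by apply: c_circle; exact: c_id.
by apply: c_ext; exact: disk_cont HD.
Qed.

Lemma disk_local x : disk2 x -> (forall m, marks D m -> x <> circle m) ->
  exists F p q r, [/\ sd2 F x p q, 0 < det2 p q, 0 < r &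
    forall w, disk2 w -> `|w - x| < r -> dmap D w = F w].
Proof.
move=> dx xm; have [U [F [[oU Ux] sF eF jF]]] := disk_immersion HD dx xm.
have [r r0 Hr] := open_ball oU Ux.
exists F, ('D_((1, 0) : R * R) F x), ('D_((0, 1) : R * R) F x), r; split=> //.
  exact: smooth_sd2 oU Ux sF.
by move=> w dw wx; apply: eF => //; exact: Hr.
Qed.

(** Local injectivity holds at marked points by the corner condition and elsewhere by immersion;
    compactness makes it uniform. *)
Lemma disk_inj : exists2 d : R, 0 < d & forall w w', disk2 w -> disk2 w' ->
  w' <> w -> `|w' - w| < d -> dmap D w' <> dmap D w.
Proof.
have [||x dx|d d0 Hd] := @unif_delta R _ (@disk2 R) (fun w d => forall w', disk2 w' ->
    w' <> w -> `|w' - w| < d -> dmap D w' <> dmap D w).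
- exact: compact_disk.
- by move=> x d d' _ dd H w' dw' ww' h; apply: H => //; exact: lt_le_trans dd.
- have [r r0 Hr] : exists2 r : R, 0 < r & forall w w', disk2 w -> disk2 w' ->
      `|w - x| < r -> `|w' - x| < r -> dmap D w = dmap D w' -> w = w'.
    have [[m [mm xm]]|nm] := pselect (exists m, marks D m /\ x = circle m).
      by have [c [oo [uu [_ _ h]]]] := disk_corners HD mm; rewrite xm.
    have [m mm xm|F [p [q [r [HF D0 r0 fF]]]]] := disk_local dx.
      by apply: nm; exists m.
    have [k [d [k0 d0 Hk]]] := sd2_bilip HF (lt0r_neq0 D0).
    exists (Num.min r d); first by rewrite lt_min r0.
    move=> w w' dw dw'; rewrite !lt_min => /andP[w1 w2] /andP[w1' w2'] e.
    have := Hk w w' w2 w2'; rewrite -!fF// e subrr normr0 => h.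
    have : k * `|w' - w| <= k * 0 by rewrite mulr0.
    by rewrite ler_pM2l// normr_le0 subr_eq0 => /eqP.
  exists (r / 2); first by rewrite divr_gt0.
  move=> y dy yx w' dw' wy wyr e; apply: wy; apply: Hr => //.
    by apply: (le_lt_trans (ler_distD y _ _)); rewrite [ltRHS](splitr r) ltrD.
  by apply: lt_trans yx _; exact: half_lt.
- by exists d => // w w' dw; exact: Hd.
Qed.

Lemma circle_near (d : R) : 0 < d -> exists2 e : R, 0 < e <= 1 & forall th th' : R,
  `|th' - th| < e -> `|circle th' - circle th| < d /\ (th' <> th -> circle th' <> circle th).
Proof.
move=> d0.
have c0 : cts (fun eta : R => 2 * sin (pi * eta)) (0 : R).
  apply: c_mul; [exact: c_cst|apply: c_sin; apply: c_mul; [exact: c_cst|exact: c_id]].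
have [e e0 He] := (ctsP _ _).1 c0 d d0.
exists (Num.min 1 e); first by rewrite lt_min ltr01 e0 ge_min lexx.
move=> th th'; rewrite lt_min => /andP[h1 h2].
have cE : circle th' - circle th = (2 * sin (pi * (th' - th))) *: circle (th + (th' - th) / 2 + 4^-1).
  by rewrite -circle_diff; congr (circle _ - _); ring.
split.
  rewrite cE normrZ; apply: (@le_lt_trans _ _ `|2 * sin (pi * (th' - th))|).
    by rewrite ler_piMr// circle_norm.
  by have := He (th' - th); rewrite subr0 mulr0 sin0 mulr0 subr0 => /(_ h2).
move=> ne /eqP; rewrite -subr_eq0 cE scaler_eq0 => /orP[|/eqP]; last first.
  by apply: ang_neq0; exact: circle_ang.
rewrite mulf_eq0 pnatr_eq0/= => /eqP s0.
have pos (x : R) : 0 < x -> x < 1 -> sin (pi * x) <> 0.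
  move=> x0 x1 h; have : 0 < sin (pi * x).
    by apply: sin_gt0_pi; rewrite mulr_gt0 ?pi_gt0//= -[ltRHS]mulr1 ltr_pM2l ?pi_gt0.
  by rewrite h ltxx.
have n0 : 0 < `|th' - th| by rewrite normr_gt0 subr_eq0; exact/eqP.
apply: (pos _ n0 h1); case: (leP 0 (th' - th)) => k.
  by rewrite ger0_norm.
by rewrite ltr0_norm// mulrN sinN s0 oppr0.
Qed.

Lemma bdry_inj : exists2 e : R, 0 < e & forall th th' : R,
  th' <> th -> `|th' - th| < e -> boundary th' <> boundary th.
Proof.
have [d d0 Hd] := disk_inj; have [e /andP[e0 _] He] := circle_near d0; exists e => // th th' ne h.
have [h1 h2] := He th th' h.
by apply: Hd => //; [exact: circle_disk|exact: circle_disk|exact: h2].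
Qed.

Lemma marks_isolated th0 : exists2 e : R, 0 < e & forall th, th <> th0 ->
  `|th - th0| < e -> unmarked th.
Proof.
have [/finite_seqP[ms Hms] _] := disk_marks HD.
have H m : exists2 e : R, 0 < e & forall th, th <> th0 -> `|th - th0| < e -> circle th <> circle m.
  have [cm|/eqP cm] := eqVneq (circle th0) (circle m).
    have [e /andP[e0 _] He] := circle_near (@ltr01 R); exists e => // th ne h.
    by rewrite -cm; exact: (He th0 th h).2.
  have n0 : 0 < `|circle m - circle th0| by rewrite normr_gt0 subr_eq0 eq_sym; exact/eqP.
  have [e /andP[e0 _] He] := circle_near n0; exists e => // th ne h e1.
  by have [] := He th0 th h; rewrite e1 ltxx.
have [d Hd] := @choice _ _ (fun (m d : R) => 0 < d /\ forall th, th <> th0 ->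
    `|th - th0| < d -> circle th <> circle m)
  (fun i => let: ex_intro2 d d0 h := H i in ex_intro _ d (conj d0 h)).
have [r r0 Hr] := @seq_min R _ ms d (fun i _ => (Hd i).1).
exists r => // th ne h m mm; apply: (Hd m).2 => //; apply: lt_le_trans h _.
by apply: Hr; move: mm; rewrite Hms.
Qed.

Lemma bdry_deriv th0 : unmarked th0 -> exists g, [/\ g <> 0,
  rderiv (fun t => boundary (th0 + t)) g & rderiv (fun t => boundary (th0 - t)) (- g)].
Proof.
move=> um; have [F [p [q [r [HF D0 r0 fF]]]]] := disk_local (circle_disk th0) um.
pose v : R * R := (2 * pi) *: (- sin (2 * pi * th0), cos (2 * pi * th0)).
pose g := v.1 *: p + v.2 *: q.
have pi0 : (0 : R) < 2 * pi by rewrite mulr_gt0// pi_gt0.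
have v0 : v <> 0.
  move=> v0; have : dot2 v v = (2 * pi) ^+ 2 * (cos (2 * pi * th0) ^+ 2 + sin (2 * pi * th0) ^+ 2).
    by rewrite /dot2 /v /= /GRing.scale/=; ring.
  rewrite v0 cos2Dsin2 mulr1 {1}/dot2/= mulr0 addr0 => /esym/eqP.
  by rewrite sqrf_eq0 gt_eqF.
have gx : det2 p g = v.2 * det2 p q /\ det2 g q = v.1 * det2 p q.
  by rewrite /g /det2/= /GRing.scale/=; split; ring.
have g0 : g <> 0.
  move=> g0; move: gx; rewrite g0 /det2/= !(mulr0, mul0r) subrr -/(det2 p q) => -[h1 h2].
  apply: v0; apply: pair_eta => /=; apply/eqP.
    by move/esym/eqP: h2; rewrite mulf_eq0 (gt_eqF D0) orbF.
  by move/esym/eqP: h1; rewrite mulf_eq0 (gt_eqF D0) orbF.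
have hs (k : R) : k = 1 \/ k = -1 -> rderiv (fun t => boundary (th0 + k * t)) (k *: g).
  move=> k1.
  have hc : sd1 (fun t => circle (k * t + th0)) 0 (k *: v).
    by apply: sd1_affine; rewrite mulr0 add0r; exact: circle_sd1.
  have HG := @sd1_comp R F (fun t => circle (k * t + th0)) 0 (circle th0) p q (k *: v).
  rewrite mulr0 add0r in HG; have {}HG := HG erefl HF hc.
  have kg : (k *: v).1 *: p + (k *: v).2 *: q = k *: g.
    by apply: pair_eta; rewrite /g /= /GRing.scale/=; ring.
  rewrite kg in HG.
  have [e /andP[e0 _] He] := circle_near r0.
  move=> h h0; have [d1 d10 Hd1] := sd1_rderiv HG h0.
  exists (Num.min d1 e); first by rewrite lt_min d10.
  move=> t t0; rewrite lt_min => /andP[td te].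
  have := Hd1 t t0 td; rewrite /boundary [th0 + k * t]addrC mulr0 add0r addr0 -!fF//; try exact: circle_disk.
    by rewrite subrr normr0.
  apply: (He _ _ _).1; rewrite addrK normrM.
  by case: k1 => ->; rewrite ?normrN normr1 mul1r ger0_norm.
exists g; split=> //.
  have := hs 1 (or_introl erefl); rewrite scale1r.
  by under eq_fun do rewrite mul1r.
have := hs (-1) (or_intror erefl); rewrite scaleN1r.
by under eq_fun do rewrite mulN1r.
Qed.

Lemma bdry_star th0 (rho : R) : 0 < rho -> exists2 e : R, 0 < e & forall th,
  `|th - th0| < e -> exists j y u, [/\ on_link (j, y), xyS L j y = boundary th0,
    `|u| < rho & boundary th = xyS L j (y + u)].
Proof.
move=> rho0; have [r r0 Hr] := strands_near gen (boundary th0) rho0.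
have [e e0 He] := (ctsP _ _).1 (@bdry_cts th0) r r0; exists e => // th /He h.
have [i [x ix]] := disk_boundary HD th.
have [|j [y [u [jon jy ur Hj]]]] := Hr i x.
  by rewrite /xyS -ix; exact: h.
exists j, y, u; split=> //.
by have := Hj 0; rewrite !addr0 => <-; exact: ix.
Qed.

Lemma two_germs th0 A B A' B' (d1 e1 : R) :
  branches A B A' B' (boundary th0) -> 0 < d1 -> 0 < e1 ->
  (forall rho : R, 0 < rho -> exists2 e : R, 0 < e & forall th, `|th - th0| < e ->
     exists2 u, `|u| < rho & boundary th = A u \/ boundary th = B u) ->
  exists (k d e : R) (brl sl brr sr : bool) Xl Xr,
    [/\ 0 < k, 0 < d <= d1, 0 < e <= e1,
      (forall w w' : R * R, `|w| < d -> `|w'| < d ->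
        k * `|w' - w| <= `|chart A B (boundary th0) w' - chart A B (boundary th0) w|) &
      half_germ (fun t => boundary (th0 - t)) e d (if brl then A else B) sl Xl /\
      half_germ (fun t => boundary (th0 + t)) e d (if brr then A else B) sr Xr].
Proof.
move=> br d10 e10 star; have [k [d2 [k0 d20 Hk]]] := branches_bil br.
pose d := Num.min d1 d2.
have d0 : 0 < d by rewrite lt_min d10.
have [e2 e20 He2] := star d d0; have [e3 e30 He3] := bdry_inj.
pose e := Num.min e1 (Num.min (e2 / 2) (e3 / 2)).
have e0 : 0 < e by rewrite !lt_min e10 !divr_gt0.
have ee1 : e <= e1 by rewrite ge_min lexx.
have ee2 : e < e2.
  by apply: le_lt_trans (half_lt e20); rewrite !ge_min lexx orbT.
have ee3 : e < e3.
  by apply: le_lt_trans (half_lt e30); rewrite !ge_min lexx !orbT.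
have bil (w w' : R * R) : `|w| < d -> `|w'| < d ->
    k * `|w' - w| <= `|chart A B (boundary th0) w' - chart A B (boundary th0) w|.
  by rewrite !lt_min => /andP[_ h1] /andP[_ h2]; exact: Hk.
have H (q : R) : q = 1 \/ q = -1 -> exists (b sg : bool) X,
    half_germ (fun t => boundary (th0 + q * t)) e d (if b then A else B) sg X.
  move=> q1; have qn x : `|q * x| = `|x|.
    by rewrite normrM; case: q1 => ->; rewrite ?normrN normr1 mul1r.
  apply: (half_germ_ex (br_A0 br) (br_B0 br) k0 d0 bil e0).
  - apply: cts_ctsw => t _; apply: (c_comp (g := boundary)); last exact: bdry_cts.
    by apply: c_add; [exact: c_cst|apply: c_mul; [exact: c_cst|exact: c_id]].
  - by rewrite mulr0 addr0.
  - move=> x y /andP[x0 xe] /andP[y0 ye] e'; apply: contrapT => ne.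
    apply: (He3 (th0 + q * y) (th0 + q * x)) e'.
      move=> /addrI h; apply: ne.
      by have : `|q * (x - y)| = 0; [rewrite mulrBr h subrr normr0|rewrite qn => /eqP; rewrite normr_eq0 subr_eq0 => /eqP].
    have -> : th0 + q * x - (th0 + q * y) = q * (x - y) by ring.
    by rewrite qn; apply: le_lt_trans ee3; rewrite ler_norml; apply/andP; split; lra.
  - move=> t /andP[t0 te]; apply: He2; rewrite addrC addKr qn ger0_norm//.
    exact: le_lt_trans ee2.
have [brr [sr [Xr Hr]]] := H 1 (or_introl erefl).
have [brl [sl [Xl Hl]]] := H (-1) (or_intror erefl).
exists k, d, e, brl, sl, brr, sr, Xl, Xr; split=> //.
- by rewrite d0 ge_min lexx.
- by rewrite e0.
split.
  by move: Hl; under eq_fun do rewrite mulN1r.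
by move: Hr; under eq_fun do rewrite mul1r.
Qed.

End DiskBoundary.

(** * Germs of the boundary at smooth points and at corners *)

Section BoundaryGerms.
Context {R : realType} {C : finType} {N s : nat} (L : diagram R C N s).
Context (gen : generic_diagram L) (D : disk R) (HD : is_disk L D).
Local Notation bdry := (boundary D).

Lemma double_star c th0 : bdry th0 = (pt L (over L c)).1 ->
  forall rho : R, 0 < rho -> exists2 e : R, 0 < e & forall th, `|th - th0| < e ->
     exists2 u, `|u| < rho & bdry th = strand_at L (over L c).1 (over L c).2 u \/
       bdry th = strand_at L (under L c).1 (under L c).2 u.
Proof.
move=> thc rho rho0; have [e e0 He] := bdry_star gen HD th0 rho0.
exists e => // th /He[j [y [u [jon jy ur Hu]]]]; exists u => //.
rewrite thc in jy; have [h|h] := double_points gen jon jy; [left|right];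
by rewrite /strand_at -h.
Qed.

(** The two half germs have opposite derivatives, so they continue each other along one branch. At a
    crossing this branch is one of the two strands; elsewhere it has to be told apart from the
    auxiliary line. *)
Lemma smooth_germs th0 (e1 : R) : unmarked D th0 -> 0 < e1 ->
  exists i x sg d e Xl Xr, [/\ 0 < e <= e1,
    half_germ (fun t => bdry (th0 - t)) e d (strand_at L i x) (~~ sg) Xl &
    half_germ (fun t => bdry (th0 + t)) e d (strand_at L i x) sg Xr].
Proof.
move=> um e10; have [g [g0 gr gl]] := bdry_deriv HD um.
have [[c thc]|nd] := pselect (exists c, bdry th0 = (pt L (over L c)).1).
  have br := crossing_branches gen c; rewrite -thc in br.
  have [k [d [e [brl [sl [brr [sr [Xl [Xr [k0 d0 /andP[e0 ee] bil [HL HR]]]]]]]]]]] :=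
    two_germs HD br (@ltr01 R) e10 (double_star thc).
  have [bb ss] := germ_straight e0 (br_A br 0) (br_B br 0) (br_det br) g0 gr gl HL HR.
  rewrite ss bb in HL; rewrite /= in HL HR.
  by case: brr HL HR {bb} => HL HR;
    [exists (over L c).1, (over L c).2|exists (under L c).1, (under L c).2];
    exists sr, d, e, Xl, Xr; rewrite e0 ee.
have [e2 e20 He2] := bdry_star gen HD th0 (@ltr01 R).
have [|i [x [_ [ion ix _ _]]]] := He2 th0; first by rewrite subrr normr0.
have uniq j y : on_link (j, y) -> xyS L j y = bdry th0 -> j = i /\ y = x.
  move=> jon jy; have [[-> ->]//|/eqP ne] := eqVneq (j, y) (i, x).
  have [|c Hc] := gen_all gen jon ion ne; first by rewrite /pt/= -/(xyS L j y) jy -ix.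
  exfalso; apply: nd; exists c.
  by case: Hc => [] [h _]; rewrite h; [rewrite -jy|rewrite -ix].
have starA (rho : R) : 0 < rho -> exists2 e : R, 0 < e & forall th, `|th - th0| < e ->
     exists2 u, `|u| < rho & bdry th = strand_at L i x u.
  move=> rho0; have [e e0 He] := bdry_star gen HD th0 rho0.
  exists e => // th /He[j [y [u [jon jy ur Hu]]]]; exists u => //.
  by rewrite /strand_at; have [<- <-] := uniq j y jon jy.
have br := single_branches gen i x; rewrite ix in br.
set B := (fun u => _ + u *: _) in br.
have [|k [d [e [brl [sl [brr [sr [Xl [Xr [k0 /andP[d0 d1] /andP[e0 ee] bil [HL HR]]]]]]]]]]] :=
    two_germs HD br (@ltr01 R) e10.
  by move=> rho /starA[e e0 He]; exists e => // th /He[u ur ->]; exists u => //; left.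
have [bb ss] := germ_straight e0 (br_A br 0) (br_B br 0) (br_det br) g0 gr gl HL HR.
rewrite ss bb in HL; rewrite /= in HL HR.
(* The auxiliary line is not part of the link: a boundary point on it at a positive parameter would
   also lie on the strand, against the injectivity [bil] of the chart. *)
have brrT : brr = true.
  case: brr HL HR {bb} => // HL HR; exfalso.
  have [e3 e30 He3] := starA d d0.
  pose t := Num.min e (e3 / 2).
  have t0 : 0 < t by rewrite lt_min e0 divr_gt0.
  have te : t <= e by rewrite ge_min lexx.
  have te3 : t < e3 by apply: le_lt_trans (half_lt e30); rewrite ge_min lexx orbT.
  have [|u ud Hu] := He3 (th0 + t); first by rewrite addrC addKr gtr0_norm.
  have tin : 0 <= t <= e by rewrite ltW.
  have [Gt /andP[X0 Xd]] := hg_eq HR tin.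
  have Xp : 0 < Xr t by rewrite -(hg_0 HR); apply: (hg_mono HR).
  have := bil (u, 0) (0, dir R sr * Xr t).
  rewrite !norm2_lt/= normr0 ud d0 normrM dir_norm mul1r ger0_norm// Xd.
  move=> /(_ isT isT); rewrite {1}/chart {1}/chart /= (br_A0 br) (br_B0 br).
  have -> : bdry th0 + B (dir R sr * Xr t) - bdry th0 - (strand_at L i x u + bdry th0 - bdry th0) = 0.
    rewrite -Gt -Hu; apply: pair_eta; rewrite /=; ring.
  rewrite normr0 => h.
  have := (norm2_ge ((0, dir R sr * Xr t) - (u, 0))).2.
  rewrite /= subr0 normrM dir_norm mul1r ger0_norm// => h2.
  have : k * Xr t <= 0 by apply: le_trans h; rewrite ler_wpM2l// ltW.
  by rewrite leNgt mulr_gt0.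
rewrite brrT in HL HR.
by exists i, x, sr, d, e, Xl, Xr; rewrite e0 ee.
Qed.

Lemma ctsw_val (X : R -> R) (e v : R) : 0 < e -> ctsw 0 e X -> X 0 = 0 ->
  0 < v -> v <= X e -> exists2 t, 0 <= t <= e & X t = v.
Proof.
move=> e0 cX X0 v0 ve; have cc := ctsw_clamp (ltW e0) cX.
have : exists2 c, c \in `[0, e] & X (clamp 0 e c) = v.
  apply: IVT; first exact: ltW.
    by apply: continuous_subspaceT => u; exact: cc.
  by rewrite !clamp_id ?lexx ?(ltW e0)// X0 ge_min le_max ve (ltW v0) orbT.
case=> c; rewrite in_itv/= => cin h; exists c => //.
by rewrite clamp_id in h.
Qed.

Lemma half_germ_shift G (e d : R) Br sg X t1 : half_germ G e d Br sg X -> 0 <= t1 -> t1 < e ->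
  half_germ (fun t => G (t1 + t)) (e - t1) d (fun u => Br (dir R sg * X t1 + u)) sg
    (fun t => X (t1 + t) - X t1).
Proof.
move=> HG t10 t1e; have bd t : 0 <= t <= e - t1 -> 0 <= t1 + t <= e.
  by move=> /andP[? ?]; apply/andP; split; lra.
have t1in : 0 <= t1 <= e by rewrite t10 ltW.
have [_ /andP[X10 X1d]] := hg_eq HG t1in.
split.
- move=> t tin; have [-> /andP[h1 h2]] := hg_eq HG (bd t tin).
  split; first by congr Br; ring.
  apply/andP; split; last by lra.
  rewrite subr_ge0; move: tin => /andP[]; rewrite le_eqVlt => /orP[/eqP <- _|t0 te].
    by rewrite addr0.
  by apply/ltW/(hg_mono HG) => //; lra.
- by rewrite addr0 subrr.
- by move=> u t u0 ut te; rewrite ltrD2r; apply: (hg_mono HG); lra.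
- apply: ctsw_add; last by apply: cts_ctsw => t _; exact: c_cst.
  move=> t tin h h0; have [d' d'0 Hd'] := hg_cts HG (bd t tin) h0.
  exists d' => // y yin yt; apply: Hd'; first exact: bd.
  by have -> : t1 + y - (t1 + t) = y - t by ring.
Qed.

Lemma half_germ_inj_sign A B P k d (a b : R) (oo uu : bool) (sg br : bool) (x : R) :
  (forall w w' : R * R, `|w| < d -> `|w'| < d ->
     k * `|w' - w| <= `|chart A B P w' - chart A B P w|) -> 0 < k ->
  A 0 = P -> B 0 = P -> 0 <= a < d -> 0 <= b < d -> 0 < x < d ->
  (if br then A else B) (dir R sg * x) = chart A B P (dir R oo * a, dir R uu * b) ->
  sg = (if br then oo else uu).
Proof.
move=> bil k0 A0 B0 /andP[a0 ad] /andP[b0 bd] /andP[x0 xd] h.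
have d0 : 0 < d by exact: lt_trans xd.
have dn (q : bool) (y : R) : 0 <= y -> `|dir R q * y| = y.
  by move=> y0; rewrite normrM dir_norm mul1r ger0_norm.
have sgn (q q' : bool) (y : R) : 0 <= y -> dir R q * x = dir R q' * y -> q = q'.
  by rewrite /dir; case: q; case: q' => // y0; rewrite ?mul1r ?mulN1r => hh; exfalso; lra.
have wd : `|(dir R oo * a, dir R uu * b)| < d by rewrite norm2_lt/= !dn// ad.
pose w : R * R := if br then (dir R sg * x, 0) else (0, dir R sg * x).
have ww : `|w| < d by rewrite /w; case: (br); rewrite norm2_lt/= normr0 dn ?(ltW x0)// xd d0.
have hw : chart A B P w = (if br then A else B) (dir R sg * x).
  by rewrite /w /chart; case: (br); rewrite /= ?A0 ?B0 ?addrK// addrAC subrr add0r.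
have := bil _ _ ww wd; rewrite hw h subrr normr0 pmulr_rle0// normr_le0 subr_eq0 => /eqP.
by rewrite /w; case: (br) => -[h1 h2]; [exact: sgn a0 (esym h1)|exact: sgn b0 (esym h2)].
Qed.

(** Moves to a nearby unmarked parameter on the germ, applies [corner_orient] there, and carries the
    sign of the determinant back to the vertex. *)
Lemma corner_side A B A' B' P th0 (k d e : R) (sA sB : bool) X :
  branches A B A' B' P -> branches B A B' A' P ->
  0 < k -> 0 < d -> 0 < e ->
  (forall w w' : R * R, `|w| < d -> `|w'| < d ->
     k * `|w' - w| <= `|chart A B P w' - chart A B P w|) ->
  (forall x, `|x| < d -> exists eb : R, [/\ 0 <= eb, A' x <> 0,
    (forall v : R, `|v| < d -> `|B v - B 0 - v *: B' 0| <= eb * `|v|),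
    2 * `|A' x| * eb < `|det2 (A' x) (B' 0)| &
    forall k : R, `|k| = 1 -> 0 < k * det2 (A' x) (B' 0) -> 0 < k * det2 (A' 0) (B' 0)]) ->
  (exists2 r : R, 0 < r & forall w, disk2 w -> `|w - circle th0| < r -> exists a b : R,
     [/\ 0 <= a < d, 0 <= b < d & dmap D w = chart A B P (dir R sA * a, dir R sB * b)]) ->
  half_germ (fun t => bdry (th0 + t)) e d A sA X ->
  0 < dir R sA * dir R sB * det2 (A' 0) (B' 0).
Proof.
move=> br brs k0 d0 e0 bil orient [r r0 Hr] HG.
have [e2 e20 He2] := marks_isolated HD th0.
have r2 : 0 < r / 2 by rewrite divr_gt0.
have [e3 /andP[e30 _] He3] := @circle_near R _ r2.
pose m := Num.min e (Num.min e2 e3).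
have m0 : 0 < m by rewrite !lt_min e0 e20.
pose t1 := m / 2; have t10 : 0 < t1 by rewrite divr_gt0.
have : t1 < m by exact: half_lt.
rewrite !lt_min => /and3P[t1e t1e2 t1e3].
have um : unmarked D (th0 + t1).
  apply: He2; last by rewrite addrC addKr gtr0_norm.
  by move=> h; move: t10; rewrite -(ltrD2l th0) h addr0 ltxx.
have [F1 [p [q [r1 [HF D0 r10 fF]]]]] := disk_local HD (circle_disk (th0 + t1)) um.
have t1in : 0 <= t1 <= e by rewrite !ltW.
have [Gt /andP[X0 Xd]] := hg_eq HG t1in.
have [|eb [eb0 a0 HB heb ho]] := orient (dir R sA * X t1).
  by rewrite normrM dir_norm mul1r ger0_norm.
have cn : `|circle (th0 + t1) - circle th0| < r / 2.
  by apply: (He3 _ _ _).1; rewrite addrC addKr gtr0_norm.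
have rr : 0 < Num.min r1 (r / 2) by rewrite lt_min r10.
apply: (ho (dir R sA * dir R sB)); first by rewrite normrM !dir_norm mulr1.
apply: (@corner_orient R A B P (dmap D) F1 (th0 + t1) p q _ (B' 0) sA sB (X t1) d k
  (Num.min r1 (r / 2)) (e - t1) eb (fun t => X (t1 + t) - X t1)) => //.
- exact: br_B0 br.
- by rewrite subr_gt0.
- by move=> w dw; rewrite lt_min => /andP[h _]; exact: fF.
- move=> w dw; rewrite lt_min => /andP[_ h]; apply: Hr => //.
  by apply: (le_lt_trans (ler_distD (circle (th0 + t1)) _ _)); rewrite [ltRHS](splitr r) ltrD.
- have := half_germ_shift HG (ltW t10) t1e.
  by under eq_fun do rewrite addrA.
- exact: br_A br _.
Qed.

(** The quadrant fixes the direction of a germ on either branch. The two germs use different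
    branches by injectivity, and the orientation of the disk decides which branch is the outgoing
    one. *)
Lemma corner_germs_branches A B A' B' th0 (oo uu : bool) (e1 : R) :
  branches A B A' B' (bdry th0) ->
  (forall rho : R, 0 < rho -> exists2 e : R, 0 < e & forall th, `|th - th0| < e ->
     exists2 u, `|u| < rho & bdry th = A u \/ bdry th = B u) ->
  (forall d : R, 0 < d -> exists2 r : R, 0 < r & forall w, disk2 w ->
    `|w - circle th0| < r -> exists a b : R,
     [/\ 0 <= a < d, 0 <= b < d & dmap D w = chart A B (bdry th0) (dir R oo * a, dir R uu * b)]) ->
  0 < e1 -> let p := 0 < dir R oo * dir R uu * det2 (A' 0) (B' 0) in
  exists d e Xl Xr, [/\ 0 < e <= e1,
    half_germ (fun t => bdry (th0 - t)) e d (if p then B else A) (if p then uu else oo) Xl &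
    half_germ (fun t => bdry (th0 + t)) e d (if p then A else B) (if p then oo else uu) Xr].
Proof.
move=> br star quad e10 p.
have brs := branches_sym br.
have [dA dA0 HdA] := branches_orient br; have [dB dB0 HdB] := branches_orient brs.
have dm0 : 0 < Num.min dA dB by rewrite lt_min dA0.
have [k [d [e [brl [sl [brr [sr [Xl [Xr [k0 /andP[d0 dd] /andP[e0 ee] bil [HL HR]]]]]]]]]]] :=
    two_germs HD br dm0 e10 star.
move: dd; rewrite le_min => /andP[ddA ddB].
have [r r0 Hq] := quad d d0.
have [e3 /andP[e30 _] He3] := @circle_near R _ r0.
have sgn (sg b : bool) X (G : R -> R * R) (q : R) : `|q| = 1 ->
    half_germ G e d (if b then A else B) sg X ->
    (forall t, G t = bdry (th0 + q * t)) -> sg = (if b then oo else uu).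
  move=> q1 HG GE; pose t := Num.min e (e3 / 2).
  have t0 : 0 < t by rewrite lt_min e0 divr_gt0.
  have te : t <= e by rewrite ge_min lexx.
  have te3 : t < e3 by apply: le_lt_trans (half_lt e30); rewrite ge_min lexx orbT.
  have tin : 0 <= t <= e by rewrite ltW.
  have [Gt /andP[X0 Xd]] := hg_eq HG tin.
  have Xp : 0 < X t by rewrite -(hg_0 HG); apply: (hg_mono HG).
  have [||a [b' [ad bd fw]]] := Hq (circle (th0 + q * t)); first exact: circle_disk.
    by apply: (He3 _ _ _).1; rewrite addrC addKr normrM q1 mul1r gtr0_norm.
  apply: (half_germ_inj_sign bil k0 (br_A0 br) (br_B0 br) ad bd (x := X t)).
    by rewrite Xp.
  by rewrite -Gt GE.
have slE : sl = (if brl then oo else uu).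
  by apply: (sgn _ _ _ _ (-1) _ HL) => [|t]; rewrite ?normrN ?normr1 ?mulN1r.
have srE : sr = (if brr then oo else uu).
  by apply: (sgn _ _ _ _ 1 _ HR) => [|t]; rewrite ?normr1 ?mul1r.
(* Two germs on the same branch would run in the same direction; by the intermediate value theorem
   both would reach the point at parameter [v], at two distinct nearby parameters of the
   boundary. *)
have brN : brl = ~~ brr.
  have [h|] := eqVneq brl brr; last by case: (brl); case: (brr).
  exfalso; have [e4 e40 He4] := bdry_inj HD.
  pose e5 := Num.min e (e4 / 4).
  have e50 : 0 < e5 by rewrite lt_min e0 divr_gt0.
  have e5e : e5 <= e by rewrite ge_min lexx.
  have e54 : e5 <= e4 / 4 by rewrite ge_min lexx orbT.
  have cl : ctsw 0 e5 Xl by apply: ctsw_sub (hg_cts HL).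
  have cr : ctsw 0 e5 Xr by apply: ctsw_sub (hg_cts HR).
  have xl : 0 < Xl e5 by rewrite -(hg_0 HL); apply: (hg_mono HL).
  have xr : 0 < Xr e5 by rewrite -(hg_0 HR); apply: (hg_mono HR).
  pose v := Num.min (Xl e5) (Xr e5).
  have v0 : 0 < v by rewrite lt_min xl.
  have [|t /andP[t0 te] Xt] := ctsw_val e50 cl (hg_0 HL) v0; first by rewrite ge_min lexx.
  have [|u /andP[u0 ue] Xu] := ctsw_val e50 cr (hg_0 HR) v0; first by rewrite ge_min lexx orbT.
  have tp : 0 < t.
    by rewrite lt_neqAle t0 andbT; apply/eqP => t00; move: v0; rewrite -Xt -t00 (hg_0 HL) ltxx.
  have tin : 0 <= t <= e by rewrite t0 (le_trans te).
  have uin : 0 <= u <= e by rewrite u0 (le_trans ue).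
  apply: (He4 (th0 + u) (th0 - t)).
  - by move=> /addrI hh; move: tp u0; rewrite -hh; lra.
  - by rewrite ltr_norml; apply/andP; split; lra.
  - have [-> _] := hg_eq HL tin; have [-> _] := hg_eq HR uin.
    by rewrite Xt Xu slE srE h.
(* If the outgoing germ is on [A], [corner_side] gives the positive sign; if it is on [B],
   exchanging the branches changes the sign of the determinant. *)
have pbr : p = brr.
  rewrite /p; case: brr HR srE {brN} => HR srE; rewrite srE in HR.
    apply: (corner_side br brs k0 d0 e0 bil _ _ HR); last by exists r.
    by move=> x xd; apply: HdA => //; exact: lt_le_trans ddA.
  apply/negbTE; rewrite -leNgt.
  have : 0 < dir R uu * dir R oo * det2 (B' 0) (A' 0).
    apply: (corner_side brs br k0 d0 e0 _ _ _ HR).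
    - move=> w w' wd wd'; have := bil (w.2, w.1) (w'.2, w'.1).
      have sw (x : R * R) : `|(x.2, x.1)| = `|x| by rewrite !norm2E/= maxC.
      have cs (x : R * R) : chart A B (bdry th0) (x.2, x.1) = chart B A (bdry th0) x.
        by apply: pair_eta; rewrite /chart/=; ring.
      rewrite !sw !cs => /(_ wd wd'); congr (_ * _ <= _).
      by rewrite -[RHS]sw.
    - by move=> x xd; apply: HdB => //; exact: lt_le_trans ddB.
    - exists r => // w dw wr; have [a [b [ad bd fw]]] := Hq w dw wr.
      by exists b, a; split=> //; rewrite fw; apply: pair_eta; rewrite /chart/=; ring.
  by rewrite (det2C (B' 0)) mulrN oppr_gt0 [dir R uu * _]mulrC => /ltW.
exists d, e, Xl, Xr; rewrite e0 ee; split=> //.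
  by move: HL; rewrite slE brN pbr; case: (brr).
by move: HR; rewrite srE pbr; case: (brr).
Qed.

Lemma corner_germs th0 c (oo uu : bool) (e1 : R) : corner_at L (dmap D) th0 c oo uu ->
  0 < e1 -> let p := is_p_quadrant L c oo uu in
  let cR := if p then over L c else under L c in
  let cL := if p then under L c else over L c in
  exists d e Xl Xr, [/\ 0 < e <= e1,
    half_germ (fun t => bdry (th0 - t)) e d (strand_at L cL.1 cL.2) (if p then uu else oo) Xl &
    half_germ (fun t => bdry (th0 + t)) e d (strand_at L cR.1 cR.2) (if p then oo else uu) Xr].
Proof.
move=> [thc quad _] e10 p cR cL.
have br := crossing_branches gen c; rewrite -thc in br.
have [d d0|d [e [Xl [Xr [ee HL HR]]]]] :=
  corner_germs_branches (oo := oo) (uu := uu) br (double_star thc) _ e10.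
  have [r r0 Hr] := quad d d0; exists r => // w dw wr.
  have [a [b [ad bd fw]]] := Hr w dw wr; exists a, b; split=> //.
  by have -> : bdry th0 = (pt L (over L c)).1 := thc; rewrite fw.
have pE : p = (0 < dir R oo * dir R uu * det2 (tangent L ((over L c).1, (over L c).2 + 0))
    (tangent L ((under L c).1, (under L c).2 + 0))).
  by rewrite !addr0 -!surjective_pairing.
exists d, e, Xl, Xr; move: HL HR; rewrite -pE /cR /cL; clear pE cR cL; clearbody p.
by case: p => HL HR; split; [exact: ee|exact: HL|exact: HR|exact: ee|exact: HL|exact: HR].
Qed.

End BoundaryGerms.

(** * Turning and winding along the boundary *)

Section Chains.
Context {R : realType}.

(** Continuous induction: the supremum of the good points that [lo] reaches is [hi]. Intervals are
    cut at good points only, since the quantities compared later are meaningful only there; bad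
    points are isolated, so cuts are always available. *)
Lemma chain_rel (Gn : R -> Prop) (Rel : R -> R -> Prop) (lo hi : R) : lo < hi -> Gn lo -> Gn hi ->
  (forall x : R, exists2 e : R, 0 < e & forall y, y <> x -> `|y - x| < e -> Gn y) ->
  (forall a b c, Gn a -> Gn b -> Gn c -> a < b -> b < c -> Rel a b -> Rel b c -> Rel a c) ->
  (forall th, lo <= th <= hi -> exists2 e : R, 0 < e & forall a b, Gn a -> Gn b -> a < b ->
     lo <= a -> b <= hi -> th - e < a -> a <= th -> th <= b -> b < th + e -> Rel a b) ->
  Rel lo hi.
Proof.
move=> lohi Glo Ghi dense trans loc.
have dn x e : 0 < e -> exists y, [/\ x < y, y < x + e & Gn y].
  move=> e0; have [e' e'0 H] := dense x.
  pose m := Num.min e e'; have m0 : 0 < m by rewrite lt_min e0.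
  have mm := half_lt m0; have m2 : 0 < m / 2 by rewrite divr_gt0.
  move: mm; rewrite lt_min => /andP[h1 h2].
  exists (x + m / 2); split; [by rewrite ltrDl|by rewrite ltrD2l|].
  apply: H; last by rewrite addrC addKr gtr0_norm.
  by move=> h; move: m2; rewrite -(ltrD2l x) h addr0 ltxx.
pose E := [set x | [/\ lo < x, x <= hi, Gn x & Rel lo x]].
have loin : lo <= lo <= hi by rewrite lexx ltW.
have [e e0 He] := loc lo loin.
have E0 : E !=set0.
  have [hie|hie] := ltP hi (lo + e).
    exists hi; split=> //; apply: He => //; rewrite ?lexx ?(ltW lohi)//.
    by rewrite ltrBlDr ltrDl.
  have [y [y1 y2 Gy]] := dn lo e e0.
  have yhi : y <= hi by rewrite ltW// (lt_le_trans y2).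
  by exists y; split=> //; apply: He => //; rewrite ?(ltW y1)// ltrBlDr ltrDl.
have Eub : ubound E hi by move=> x [].
have supE : has_sup E by split=> //; exists hi.
pose s := sup E.
have shi : s <= hi by apply: sup_le_ub.
have los : lo <= s.
  by case: E0 => x Ex; apply: (le_trans (ltW (let: And4 h _ _ _ := Ex in h))); apply: sup_ubound => //; exists hi.
have [|e1 e10 He1] := loc s; first by rewrite los.
have [x Ex xs] := sup_adherent e10 supE.
have [lox xhi Gx Rx] := Ex.
have xs' : x <= s by apply: sup_ubound => //; exists hi.
have [hie|hie] := ltP hi (s + e1).
  move: xhi; rewrite le_eqVlt => /orP[/eqP <- //|xhi].
  apply: (trans lo x hi) => //; apply: He1 => //; exact: ltW.
have [b [b1 b2 Gb]] := dn s e1 e10.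
have xb : x < b by exact: le_lt_trans b1.
have bhi : b <= hi by rewrite ltW// (lt_le_trans b2).
have : E b.
  split=> //; first exact: lt_trans xb.
  by apply: (trans lo x b) => //; apply: He1 => //; exact: ltW.
move=> Eb; have : b <= s by apply: sup_ubound => //; exists hi.
by rewrite leNgt b1.
Qed.

End Chains.

(** * Adding up jumps over one turn of the boundary *)

Section Sums.
Context {R : realType} {C : finType} {N s : nat} (L : diagram R C N s).
Context (gen : generic_diagram L) (D : disk R) (HD : is_disk L D).
Local Notation bdry := (boundary D).

(** Exactly where the boundary point determines its point on the link, up to the choice of period,
    and hence the angles attached to it. *)
Definition simple_at (th : R) := unmarked D th /\ forall c, bdry th <> (pt L (over L c)).1.

Lemma simple_near (th0 : R) : exists2 e : R, 0 < e & forall th, th <> th0 -> `|th - th0| < e -> simple_at th.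
Proof.
have [e1 e10 He1] := marks_isolated HD th0; have [e2 e20 He2] := bdry_inj HD.
have H c : exists2 e : R, 0 < e & forall th, th <> th0 -> `|th - th0| < e -> bdry th <> (pt L (over L c)).1.
  have [cm|/eqP cm] := eqVneq (bdry th0) (pt L (over L c)).1.
    by exists e2 => // th ne h; rewrite -cm; exact: He2.
  have n0 : 0 < `|(pt L (over L c)).1 - bdry th0| by rewrite normr_gt0 subr_eq0 eq_sym; exact/eqP.
  have [e e0 He] := (ctsP _ _).1 (@bdry_cts R C N s L D HD th0) _ n0.
  by exists e => // th ne /He h e'; move: h; rewrite e' ltxx.
have [d Hd] := @choice _ _ (fun c (d : R) => 0 < d /\ forall th, th <> th0 ->
    `|th - th0| < d -> bdry th <> (pt L (over L c)).1)
  (fun i => let: ex_intro2 d d0 h := H i in ex_intro _ d (conj d0 h)).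
have [r r0 Hr] := @seq_min R _ (enum C) d (fun i _ => (Hd i).1).
exists (Num.min r e1); first by rewrite lt_min r0.
move=> th ne; rewrite lt_min => /andP[h1 h2]; split; first exact: He1.
by move=> c; apply: (Hd c).2 => //; apply: lt_le_trans h1 _; apply: Hr; rewrite mem_enum.
Qed.

Lemma link_pt_ex th : exists u : 'I_N * R, on_link u /\ xyS L u.1 u.2 = bdry th.
Proof.
have [e e0 He] := bdry_star gen HD th (@ltr01 R).
have [|j [y [u [jon jy _ _]]]] := He th; first by rewrite subrr normr0.
by exists (j, y).
Qed.

Definition link_pt th : 'I_N * R := projT1 (cid (link_pt_ex th)).

Lemma link_ptP th : on_link (link_pt th) /\ xyS L (link_pt th).1 (link_pt th).2 = bdry th.
Proof. exact: projT2 (cid (link_pt_ex th)). Qed.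

Lemma link_pt_uniq th u : simple_at th -> on_link u -> xyS L u.1 u.2 = bdry th -> u = link_pt th.
Proof.
move=> [_ sth] uon ue; have [lon le] := link_ptP th.
apply: contrapT => ne; have [|c Hc] := gen_all gen uon lon ne.
  by rewrite /pt -/(xyS L u.1 u.2) ue -le.
apply: (sth c); case: Hc => -[h _]; rewrite h; first by rewrite -ue.
by rewrite -le.
Qed.

Lemma link_pt_val (T : Type) (F : 'I_N -> R -> T) th i x :
  (forall i x, F i (x + 1) = F (monodromy L i) x) -> simple_at th -> xyS L i x = bdry th ->
  F i x = F (link_pt th).1 (link_pt th).2.
Proof.
move=> HF sth ix; have [j [y [n [y01 _ H]]]] := periodic_norm (monodromy L) i x.
have jy : xyS L j y = bdry th.
  by have := H _ _ (gen_closed gen) 0; rewrite !addr0 -ix /xyS => ->.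
have jon : on_link (j, y) by move/andP: y01.
have <- := @link_pt_uniq th (j, y) sth jon jy.
by have := H _ F HF 0; rewrite !addr0.
Qed.

Lemma tangent_period i x : tangent L (i, x + 1) = tangent L (monodromy L i, x).
Proof.
have h := (xyS_sd1 gen (monodromy L i) x).1.
have h' := @sd1_affine R (xyS L i) 1 1 x; rewrite mul1r in h'.
have {}h' := h' _ (xyS_sd1 gen i (x + 1)).1; rewrite scale1r in h'.
have e : (fun t => xyS L i (1 * t + 1)) = xyS L (monodromy L i).
  by apply/funext => t; rewrite mul1r /xyS (gen_closed gen).
by rewrite e in h'; rewrite -(sd1_derive1 h) -(sd1_derive1 h').
Qed.

Record reading (n : nat) (t : 'I_n -> R) (l : 'I_n -> letter C s) : Prop := {
  rd_mono : forall i j : 'I_n, (i < j)%N -> t i < t j;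
  rd_at : forall i, 0 < t i <= 1 /\ letter_at L D (t i) (l i);
  rd_all : forall th l', 0 < th <= 1 -> letter_at L D th l' -> exists i, th = t i }.

Section Reading.
Context (n : nat) (t : 'I_n -> R) (l : 'I_n -> letter C s) (rd : reading t l).

Definition corner_jump (nu : C -> bool -> int) (x : letter C s) : int :=
  if x is Corner c oo uu then nu c (is_p_quadrant L c oo uu) else 0.

Definition jumps (nu : C -> bool -> int) (a b : R) : int :=
  \sum_(i < n | a < t i < b) corner_jump nu (l i).

Lemma circle_inj (th th' : R) : `|th' - th| < 1 -> th' <> th -> circle th' <> circle th.
Proof.
move=> h1 ne /eqP; rewrite -subr_eq0.
have cE : circle th' - circle th = (2 * sin (pi * (th' - th))) *: circle (th + (th' - th) / 2 + 4^-1).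
  by rewrite -circle_diff; congr (circle _ - _); ring.
rewrite cE scaler_eq0 => /orP[|/eqP]; last first.
  by apply: ang_neq0; exact: circle_ang.
rewrite mulf_eq0 pnatr_eq0/= => /eqP s0.
have pos (x : R) : 0 < x -> x < 1 -> sin (pi * x) <> 0.
  move=> x0 x1 h; have : 0 < sin (pi * x).
    by apply: sin_gt0_pi; rewrite mulr_gt0 ?pi_gt0//= -[ltRHS]mulr1 ltr_pM2l ?pi_gt0.
  by rewrite h ltxx.
have n0 : 0 < `|th' - th| by rewrite normr_gt0 subr_eq0; exact/eqP.
apply: (pos _ n0 h1); case: (leP 0 (th' - th)) => k.
  by rewrite ger0_norm.
by rewrite ltr0_norm// mulrN sinN s0 oppr0.
Qed.

Lemma rd_inj i j : t i = t j -> i = j.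
Proof.
move=> e; apply/val_inj/eqP; rewrite eqn_leq; apply/andP; split; rewrite leqNgt; apply/negP => /(rd_mono rd);
by rewrite e ltxx.
Qed.

(** Letters have parameters in ]0, 1]; starting slightly after 0, at a simple point, each letter
    occurs once in the open interval ]a0, a0 + 1[, also a letter at 1. *)
Definition start_at (a0 : R) := [/\ 0 < a0, a0 < 1, simple_at a0 & forall i, a0 < t i].

Lemma start_ex : exists a0, start_at a0.
Proof.
have [r r0 Hr] := @seq_min R _ (enum 'I_n) t (fun i _ => let: conj h _ := rd_at rd i in let: conj h' _ := andP h in h').
have [e e0 He] := simple_near 0.
pose m := Num.min 1 (Num.min r e).
have m0 : 0 < m by rewrite !lt_min ltr01 r0.
have : m / 2 < m by exact: half_lt.
rewrite !lt_min => /and3P[h1 h2 h3].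
have m2 : 0 < m / 2 by rewrite divr_gt0.
exists (m / 2); split=> //.
- apply: He; last by rewrite subr0 gtr0_norm.
  by move=> h; rewrite h ltxx in m2.
- by move=> i; apply: (lt_le_trans h2); apply: Hr; rewrite mem_enum.
Qed.

Lemma marked_cases a0 th : start_at a0 -> a0 <= th <= a0 + 1 ->
  (unmarked D th /\ forall i c oo uu, th = t i -> l i <> Corner c oo uu) \/
  exists i c oo uu, [/\ th = t i, l i = Corner c oo uu & corner_at L (dmap D) th c oo uu].
Proof.
move=> [a0p a01 sa ha] /andP[th1 th2].
have [[m mm cm]|nm] := pselect (exists2 m, marks D m & circle th = circle m).
  right; have [c [oo [uu hc]]] := disk_corners HD mm.
  have [_ /(_ m mm)[m0 m1]] := disk_marks HD.
  have [i mi] := @rd_all _ _ _ rd m (Corner c oo uu) (introT andP (conj m0 m1)) (conj mm hc).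
  have thm : th = m.
    apply: contrapT => ne; apply: circle_inj ne cm.
    by have := ha i; rewrite -mi => am; rewrite ltr_norml; apply/andP; split; lra.
  have [_ hl] := rd_at rd i.
  exists i; move: hl; rewrite -mi -thm.
  case: (l i) => [c' oo' uu'|r oo'] /=; last by case=> + _; rewrite thm => /(_ mm).
  by move=> [_ h]; exists c', oo', uu'; split.
left; split; first by move=> m mm cm; apply: nm; exists m.
move=> i c oo uu thi li; have [_] := rd_at rd i; rewrite li -thi /= => -[mm _].
by apply: nm; exists th.
Qed.

Lemma unmarked_corner i th : unmarked D th -> t i = th -> forall nu, corner_jump nu (l i) = 0.
Proof.
move=> um ti nu; have [_] := rd_at rd i; case: (l i) => [c oo uu|//] /= -[mm _].
by exfalso; apply: (um (t i) mm); rewrite ti.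
Qed.

Lemma jumps_trans nu a b c : unmarked D b ->
  a < b -> b < c -> jumps nu a c = jumps nu a b + jumps nu b c.
Proof.
move=> ub ab bc; rewrite /jumps !(big_mkcond (fun i => _ < _ < _)) -big_split/=.
apply: eq_bigr => i _.
have [tb|tb|tb] := ltgtP (t i) b.
- by rewrite (lt_trans tb bc) !andbT /= addr0.
- by rewrite (lt_trans ab tb)/= add0r.
- by rewrite andbF /= addr0; case: ifP => // _; exact: unmarked_corner ub tb _.
Qed.

Lemma jumps_none nu a b : (forall th, a < th < b -> unmarked D th) -> jumps nu a b = 0.
Proof. by move=> H; rewrite /jumps big1// => i /H um; exact: unmarked_corner um erefl _. Qed.

Lemma jumps_one nu i c oo uu a b : a < t i < b -> l i = Corner c oo uu ->
  (forall th, a < th < b -> th <> t i -> unmarked D th) ->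
  jumps nu a b = nu c (is_p_quadrant L c oo uu).
Proof.
move=> ti li H; rewrite /jumps (bigD1 i)//= big1 ?addr0.
  by rewrite li.
move=> j /andP[tj ji]; apply: unmarked_corner erefl _; apply: H => //.
by move=> /rd_inj e; rewrite e eqxx in ji.
Qed.

Lemma jumps_total nu a0 : start_at a0 -> jumps nu a0 (a0 + 1) = \sum_(i < n) corner_jump nu (l i).
Proof.
move=> [a0p _ _ ha]; rewrite /jumps; apply: eq_bigl => i.
by rewrite ha /=; have [/andP[_ t1] _] := rd_at rd i; lra.
Qed.

(* Rel a b j stands for: some quantity increases by j between a and b. *)
Lemma sum_of_jumps (nu : C -> bool -> int) (a0 : R) (Rel : R -> R -> int -> Prop) :
  start_at a0 ->
  (forall a b c j k, simple_at b -> a < b -> b < c -> Rel a b j -> Rel b c k -> Rel a c (j + k)) ->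
  (forall th, a0 <= th <= a0 + 1 -> unmarked D th -> exists2 e : R, 0 < e &
    forall a b, simple_at a -> simple_at b -> a < b -> a0 <= a -> b <= a0 + 1 ->
      th - e < a -> a <= th -> th <= b -> b < th + e -> Rel a b 0) ->
  (forall th c oo uu, a0 < th < a0 + 1 -> corner_at L (dmap D) th c oo uu -> exists2 e : R, 0 < e &
    forall a b, simple_at a -> simple_at b -> a < th -> th < b -> a0 <= a -> b <= a0 + 1 ->
      th - e < a -> b < th + e -> Rel a b (nu c (is_p_quadrant L c oo uu))) ->
  Rel a0 (a0 + 1) (\sum_(i < n) corner_jump nu (l i)).
Proof.
move=> st trans smooth corner; rewrite -(jumps_total nu st).
have [a0p a01 sa ha] := st.
have sa1 : simple_at (a0 + 1).
  by case: sa => u1 u2; split; [move=> m mm; rewrite circle1; exact: u1|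
    move=> c; rewrite /boundary circle1; exact: u2].
apply: (@chain_rel R simple_at (fun a b => Rel a b (jumps nu a b)) a0 (a0 + 1)) => //.
- by rewrite ltrDl ltr01.
- exact: simple_near.
- move=> a b c _ [ub sb] _ ab bc h1 h2; rewrite (jumps_trans nu ub ab bc).
  exact: trans h1 h2.
move=> th thin; have [e1 e10 He1] := marks_isolated HD th.
have [[um _]|[i [c [oo [uu [thi li hc]]]]]] := marked_cases st thin.
  have [e e0 He] := smooth th thin um; exists (Num.min e e1); first by rewrite lt_min e0.
  move=> a b Ga Gb ab aa bb h1 h2 h3 h4.
  have me : Num.min e e1 <= e by rewrite ge_min lexx.
  have me1 : Num.min e e1 <= e1 by rewrite ge_min lexx orbT.
  rewrite jumps_none; first by apply: He => //; lra.
  move=> x /andP[ax xb]; have [->//|/eqP ne] := eqVneq x th.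
  by apply: He1 => //; rewrite ltr_norml; apply/andP; split; lra.
have ath : a0 < th by rewrite thi; exact: ha.
have tha : th < a0 + 1.
  by have [/andP[_ h] _] := rd_at rd i; rewrite thi; lra.
have [|e e0 He] := corner th c oo uu _ hc; first by rewrite ath tha.
exists (Num.min e e1); first by rewrite lt_min e0.
move=> a b Ga Gb ab aa bb h1 h2 h3 h4.
have me : Num.min e e1 <= e by rewrite ge_min lexx.
have me1 : Num.min e e1 <= e1 by rewrite ge_min lexx orbT.
have nm x : simple_at x -> x <> th.
  move=> [ux _] xth; have [_] := rd_at rd i; rewrite li /= => -[mm _].
  by apply: (ux (t i) mm); rewrite xth thi.
have ath' : a < th by rewrite lt_neqAle h2 andbT; apply/eqP; exact: nm.
have thb' : th < b by rewrite lt_neqAle h3 andbT eq_sym; apply/eqP; exact: nm.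
rewrite (@jumps_one nu i c oo uu) //; first by apply: He => //; lra.
  by rewrite -thi ath' thb'.
move=> x /andP[ax xb]; rewrite -thi => ne.
by apply: He1 => //; rewrite ltr_norml; apply/andP; split; lra.
Qed.

End Reading.
End Sums.

Ltac rlra := repeat match goal with H : ?T |- _ =>
  lazymatch T with
  | context [tangent] => clear H
  | context [dot2] => clear H
  | forall _, _ => clear H
  | half_germ _ _ _ _ _ _ => clear H
  | simple_at _ _ _ => clear H
  | ang _ _ => clear H
  end end; lra.

(** * The winding and turning identities *)

Section WindingSum.
Context {R : realType} {C : finType} {N s : nat} (L : diagram R C N s).
Context (gen : generic_diagram L) (D : disk R) (HD : is_disk L D).
Context (n : nat) (t : 'I_n -> R) (l : 'I_n -> letter C s) (rd : reading L D t l).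
Local Notation bdry := (boundary D).
Local Notation link_pt := (link_pt gen HD).

Lemma sub_ctsw (W : normedModType R) (f : R -> W) (p : R -> R) lo hi :
  (forall x, cts f x) -> (forall x, cts p x) -> ctsw lo hi (fun u => f (p u)).
Proof. by move=> cf cp; apply: cts_ctsw => u _; apply: c_comp. Qed.

(** The difference [Q] of two angles of the same vector is a multiple of 2 pi, hence constant along
    each germ. It changes only at a corner, where the boundary passes from one strand to the other:
    by W(under) - W(over) at a p-corner and by the opposite at a q-corner. *)
Lemma winding_sum (M : R * R -> R * R) (W : 'I_N -> R -> R) (psi : R -> R) (w : int)
    (om : C -> int) :
  (forall i x, cts (W i) x) -> (forall i x, ang (W i x) (M (xyS L i x))) ->
  (forall i x, W i (x + 1) = W (monodromy L i) x) ->
  (forall th, cts psi th) -> (forall th, ang (psi th) (M (bdry th))) ->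
  (forall th, psi (th + 1) = psi th + w%:~R * (2 * pi)) ->
  (forall c, W (under L c).1 (under L c).2 - W (over L c).1 (over L c).2 = (om c)%:~R * (2 * pi)) ->
  w = \sum_(i < n) corner_jump L (fun c p => if p then om c else - om c) (l i).
Proof.
move=> cW aW pW cpsi apsi ppsi Hom.
pose Q th := psi th - W (link_pt th).1 (link_pt th).2.
(* On a half germ issued from [th0], [Q] keeps the value that it has at the vertex on this
   strand. *)
have side th0 (p : R -> R) G e d i x sg X u :
    (forall x, cts p x) -> p 0 = th0 -> (forall v, G v = bdry (p v)) ->
    half_germ G e d (strand_at L i x) sg X -> 0 <= u <= e -> simple_at L D (p u) ->
    Q (p u) = psi th0 - W i x.
  move=> cp p0 GE HG /andP[u0 ue] su.
  have HGv v : 0 <= v <= u -> bdry (p v) = xyS L i (x + dir R sg * X v).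
    move=> /andP[v0 vu]; have ve : 0 <= v <= e by rewrite v0 (le_trans vu).
    by have [h _] := hg_eq HG ve; rewrite -GE h.
  have -> : Q (p u) = psi (p u) - W i (x + dir R sg * X u).
    rewrite /Q; congr (_ - _); apply/esym; apply: (link_pt_val gen HD pW su).
    by rewrite HGv// u0 lexx.
  have := @branch_int R (fun v => psi (p v) - W i (x + dir R sg * X v)) 0 u u0.
  rewrite p0 (hg_0 HG) mulr0 addr0 => ->//.
    apply: ctsw_add; first exact: sub_ctsw.
    apply: ctsw_opp; apply: (@ctsw_comp R _ _ 0 u X (fun y : R => W i (x + dir R sg * y))).
      exact: ctsw_sub (hg_cts HG).
    move=> v _; apply: c_comp => //; apply: c_add; first exact: c_cst.
    by apply: c_mul; [exact: c_cst|exact: c_id].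
  move=> v vin; apply: (ang_uniq (apsi (p v))).
  by rewrite HGv//; exact: aW.
have cpl th0 x : cts (fun u : R => th0 - u) x by apply: c_sub; [exact: c_cst|exact: c_id].
have cpr th0 x : cts (fun u : R => th0 + u) x by apply: c_add; [exact: c_cst|exact: c_id].
have [a0 st] := start_ex HD rd.
have [a0p a01 sa ha] := st.
have := @sum_of_jumps R C N s L D HD n t l rd (fun c p => if p then om c else - om c) a0
  (fun a b j => Q b - Q a = j%:~R * (2 * pi)) st.
have -> : Q (a0 + 1) - Q a0 = w%:~R * (2 * pi).
  rewrite /Q ppsi; have sa1 : simple_at L D (a0 + 1).
    by case: sa => u1 u2; split; [move=> m mm; rewrite circle1; exact: u1|
      move=> c; rewrite /boundary circle1; exact: u2].
  have -> : link_pt (a0 + 1) = link_pt a0.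
    have [h1 h2] := link_ptP gen HD (a0 + 1).
    apply: link_pt_uniq => //; rewrite h2 /boundary circle1//.
  ring.
move=> H.
have pi2 : (0 : R) < 2 * pi by rewrite mulr_gt0// pi_gt0.
have : w%:~R * (2 * pi) = (\sum_(i < n) corner_jump L (fun c p => if p then om c else - om c) (l i))%:~R * (2 * pi) :> R.
  apply: H.
  - by move=> a b c j k _ _ _ h1 h2; rewrite intrD mulrDl -h1 -h2; ring.
  - move=> th thin um; have [i [x [sg [d [e [Xl [Xr [/andP[e0 _] HL HR]]]]]]]] := smooth_germs gen HD um (@ltr01 R).
    exists e => // a b Ga Gb ab aa bb h1 h2 h3 h4.
    have := side th (fun u => th - u) _ e d i x (~~ sg) Xl (th - a) (cpl th) (subr0 _) (fun=> erefl) HL.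
    have := side th (fun u => th + u) _ e d i x sg Xr (b - th) (cpr th) (addr0 _) (fun=> erefl) HR.
    have -> : th + (b - th) = b by ring.
    have -> : th - (th - a) = a by ring.
    move=> -> //; last by lra.
    by move=> -> //; [rewrite subrr mul0r|lra].
  - move=> th c oo uu thin hc.
    have [d [e [Xl [Xr [/andP[e0 _] HL HR]]]]] := corner_germs gen HD hc (@ltr01 R).
    exists e => // a b Ga Gb h2 h3 aa bb h1 h4.
    have := side th (fun u => th - u) _ e d _ _ _ Xl (th - a) (cpl th) (subr0 _) (fun=> erefl) HL.
    have := side th (fun u => th + u) _ e d _ _ _ Xr (b - th) (cpr th) (addr0 _) (fun=> erefl) HR.
    have -> : th + (b - th) = b by ring.
    have -> : th - (th - a) = a by ring.
    move=> -> //; last by lra.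
    move=> -> //; last by lra.
    have := Hom c; case: is_p_quadrant => h; rewrite ?mulrNz ?mulNr -h; ring.
by move=> /(mulIf (lt0r_neq0 pi2)) /intr_inj.
Qed.

(** Near its start the tangents and the secants of a germ stay in a narrow cone around the initial
    direction, hence in any open half plane that contains this direction, and at acute angles with
    one another. *)
Lemma germ_cone (S T : R -> R * R) sg G e d X (m : R * R) :
  cts T 0 -> sd1 S 0 (T 0) -> half_germ G e d S sg X -> 0 < e ->
  0 < dot2 (dir R sg *: T 0) m ->
  exists2 e' : R, 0 < e' <= e &
   (forall u, 0 <= u <= e' -> 0 < dot2 (dir R sg *: T (dir R sg * X u)) m) /\
   (forall u u', 0 <= u -> u < u' -> u' <= e' -> 0 < dot2 (G u' - G u) m /\
     forall y, 0 <= y <= e' -> 0 < dot2 (dir R sg *: T (dir R sg * X y)) (G u' - G u)).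
Proof.
move=> Tc Sd HG e0; set a := T 0; set v := dir R sg *: a => vm.
have nv : `|v| = `|a| by rewrite normrZ dir_norm mul1r.
have v0 : v <> 0 by exact: dot2_neq0l vm.
have A0 : 0 < `|a| by rewrite -nv normr_gt0; exact/eqP.
(* The first bound keeps tangents and secants at acute angles; the second keeps them in the half
   plane of [m]. *)
pose ep := Num.min (`|a| / 8) (dot2 v m / (4 * (`|m| + 1))).
have m1 : 0 < `|m| + 1 by have := normr_ge0 m; lra.
have ep0 : 0 < ep by rewrite lt_min !divr_gt0// mulr_gt0.
have epa : ep <= `|a| / 8 by rewrite ge_min lexx.
have epm : 4 * (`|m| * ep) < dot2 v m.
  have : ep <= dot2 v m / (4 * (`|m| + 1)) by rewrite ge_min lexx orbT.
  by rewrite ler_pdivlMr ?mulr_gt0//; lra.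
have [r1 r10 Hr1] := (ctsP _ _).1 Tc _ ep0.
have [r2 r20 Hr2] := Sd _ ep0.
have oin : 0 <= (0 : R) <= e by rewrite lexx ltW.
have rm : 0 < Num.min r1 r2 by rewrite lt_min r10.
have [r3 r30 Hr3] := hg_cts HG oin rm.
pose e' := Num.min e (r3 / 2).
have e'0 : 0 < e' by rewrite lt_min e0 divr_gt0.
have e'e : e' <= e by rewrite ge_min lexx.
have e'r : e' < r3 by apply: le_lt_trans (half_lt r30); rewrite ge_min lexx orbT.
have Xr u : 0 <= u <= e' -> `|dir R sg * X u| < r1 /\ `|dir R sg * X u| < r2.
  move=> /andP[u0 ue]; rewrite normrM dir_norm mul1r.
  have uin : 0 <= u <= e by rewrite u0 (le_trans ue).
  have := Hr3 u uin; rewrite (hg_0 HG) !subr0 (ger0_norm u0) => /(_ (le_lt_trans ue e'r)).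
  by rewrite lt_min => /andP[].
have Tu u : 0 <= u <= e' -> `|dir R sg *: T (dir R sg * X u) - v| <= ep.
  move=> /Xr[h1 _]; rewrite -scalerBr normrZ dir_norm mul1r ltW//.
  by apply: Hr1; rewrite subr0.
exists e'; first by rewrite e'0.
split.
  move=> u uin; have h := Tu u uin; move: (dir R sg *: T _) h => w h.
  have -> : dot2 w m = dot2 v m + dot2 (w - v) m by rewrite /dot2/=; ring.
  have := dot2_le (w - v) m.
  have : `|w - v| * `|m| <= ep * `|m| by rewrite ler_wpM2r.
  rewrite -mulrA ler_norml => h1 /andP[h2 _]; lra.
move=> u u' u0 uu ue.
have uin : 0 <= u <= e' by rewrite u0 (ltW (lt_le_trans uu ue)).
have uin' : 0 <= u' <= e' by rewrite ue (le_trans u0 (ltW uu)).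
have up z : 0 <= z <= e' -> 0 <= z <= e by move=> /andP[z0 ze]; rewrite z0 (le_trans ze).
have [Gu _] := hg_eq HG (up _ uin); have [Gu' _] := hg_eq HG (up _ uin').
have dX : 0 < X u' - X u by rewrite subr_gt0; apply: (hg_mono HG) => //; exact: le_trans e'e.
have [_ hu] := Xr u uin; have [_ hu'] := Xr u' uin'.
have := Hr2 (dir R sg * X u) (dir R sg * X u'); rewrite !subr0 => /(_ hu hu').
rewrite -Gu -Gu' -mulrBr normrM dir_norm mul1r (gtr0_norm dX).
set E := _ - _ *: _ => hE.
have GE : G u' - G u = (X u' - X u) *: v + E.
  by apply: pair_eta; rewrite /E /v /= /GRing.scale/=; ring.
set dl := X u' - X u in dX hE GE.
split.
  have -> : dot2 (G u' - G u) m = dl * dot2 v m + dot2 E m.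
    by rewrite GE /dot2/= /GRing.scale/=; ring.
  have := dot2_le E m; have : `|E| * `|m| <= ep * dl * `|m| by rewrite ler_wpM2r.
  have : dl * (4 * (`|m| * ep)) < dl * dot2 v m by rewrite ltr_pM2l.
  rewrite -[2 * _ * _]mulrA ler_norml => h1 h2 /andP[h3 _].
  have : 0 <= dl * (`|m| * ep) by rewrite !mulr_ge0// ltW.
  move: h1 h2 h3; have -> : ep * dl * `|m| = dl * (`|m| * ep) by ring.
  have -> : dl * (4 * (`|m| * ep)) = 4 * (dl * (`|m| * ep)) by ring.
  move: (dl * (`|m| * ep)) (dl * dot2 v m) (dot2 E m) (`|E| * `|m|) => *; rlra.
move=> y yin; have h := Tu y yin; move: (dir R sg *: T _) h => w h.
have -> : dot2 w (G u' - G u) = dl * dot2 v v + dl * dot2 (w - v) v + dot2 w E.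
  by rewrite GE /dot2/= /GRing.scale/=; ring.
have nT : `|w| <= 2 * `|a|.
  have -> : w = (w - v) + v by apply: pair_eta; rewrite /=; ring.
  by apply: (le_trans (ler_normD _ _)); rewrite nv; lra.
have h1 : `|a| ^+ 2 <= dot2 v v by rewrite -nv; exact: dot2_ge.
have h2 := dot2_le (w - v) v; have h3 := dot2_le w E.
have h4 : `|w - v| * `|v| <= `|a| / 8 * `|a|.
  by rewrite nv ler_wpM2r//; lra.
have h5 : `|w| * `|E| <= 2 * `|a| * (`|a| / 8 * dl).
  apply: ler_pM => //; apply: (le_trans hE); rewrite ler_wpM2r//; exact: ltW.
have a2 : 0 < `|a| ^+ 2 by rewrite exprn_gt0.
move: h2 h3; rewrite -![2 * _ * _]mulrA !ler_norml => /andP[h2 _] /andP[h3 _].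
have h6 : dl * dot2 (w - v) v >= dl * (- (`|a| ^+ 2 / 4)).
  by rewrite ler_pM2l//; rewrite expr2; lra.
have h7 : dl * `|a| ^+ 2 <= dl * dot2 v v by rewrite ler_pM2l.
have h8 : 0 < dl * `|a| ^+ 2 by rewrite mulr_gt0.
have h9 : 2 * (`|w| * `|E|) <= dl * `|a| ^+ 2 / 2.
  by move: h5; rewrite expr2; lra.
rewrite mulrN mulrA in h6; lra.
Qed.

Lemma half_cone i x sg G e d X (m : R * R) : half_germ G e d (strand_at L i x) sg X -> 0 < e ->
  0 < dot2 (dir R sg *: tangent L (i, x)) m ->
  exists2 e' : R, 0 < e' <= e &
   (forall u, 0 <= u <= e' -> 0 < dot2 (dir R sg *: tangent L (i, x + dir R sg * X u)) m) /\
   (forall u u', 0 <= u -> u < u' -> u' <= e' -> 0 < dot2 (G u' - G u) m /\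
     forall y, 0 <= y <= e' -> 0 < dot2 (dir R sg *: tangent L (i, x + dir R sg * X y)) (G u' - G u)).
Proof.
move=> HG e0 vm.
apply: (@germ_cone (strand_at L i x) (fun u => tangent L (i, x + u)) sg G e d X m _ _ HG e0).
- exact: (@strand_at_cts R C N s L gen i x).
- exact: strand_at_sd1.
- by rewrite addr0.
Qed.

Lemma ang_line (a q b : R) (v w : R * R) (sg : bool) : ang a v -> ang (a + q) (dir R sg *: v) ->
  ang b w -> ang (b + q) (dir R sg *: w) /\ exists k : int, q = k%:~R * pi.
Proof.
case: sg; rewrite /dir ?scale1r => av aq bw.
  have [k hk] := ang_uniq aq av; have qk : q = k%:~R * (2 * pi) by rewrite -hk; ring.
  split; first by rewrite qk; exact: ang_int.
  by exists (2 * k); rewrite qk intrM; ring.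
have np (c : R) (z : R * R) : ang c z -> ang (c + pi) (-1 *: z).
  case=> r r0 ->; exists r => //; rewrite cosDpi sinDpi.
  by apply: pair_eta; rewrite /= /GRing.scale/=; ring.
have [k hk] := ang_uniq aq (np _ _ av).
have qk : q = pi + k%:~R * (2 * pi) by rewrite -hk; ring.
split; first by rewrite qk addrA; apply: ang_int; exact: np.
by exists (1 + 2 * k); rewrite qk intrD intrM; ring.
Qed.

(** The secant is compared with the unoriented tangent line: the arctangent does not distinguish a
    vector from its opposite, which makes [q] a multiple of pi. All tangents between the vertex and
    the current point lie in the half plane of [m], so the estimate can be moved to the vertex. *)
Lemma side_angle (tau : 'I_N -> R -> R) i x (sg : bool) (sig : R) (X : R -> R) e' u phi mu m sec :
  (forall i x, cts (tau i) x) -> (forall i x, ang (tau i x) (tangent L (i, x))) ->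
  ctsw 0 e' X -> X 0 = 0 -> 0 <= u <= e' ->
  (forall y, 0 <= y <= e' -> 0 < dot2 (dir R sg *: tangent L (i, x + sig * X y)) m) ->
  0 < dot2 (dir R sg *: tangent L (i, x + sig * X u)) sec ->
  ang phi sec -> `|phi - mu| < pi / 2 -> ang mu m ->
  let T := tangent L (i, x + sig * X u) in
  let q := phi - tau i (x + sig * X u) - atan (det2 T sec / dot2 T sec) in
  [/\ `|tau i x + q - mu| < pi / 2, ang (tau i x + q) (dir R sg *: tangent L (i, x)) &
     exists k : int, q = k%:~R * pi].
Proof.
move=> ctau atau cX X0 uin Hm Hs aphi phimu amu T q.
have /andP[u0 ue] := uin.
have ratio : det2 T sec / dot2 T sec = - (det2 sec (dir R sg *: T) / dot2 sec (dir R sg *: T)).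
  have -> : det2 sec (dir R sg *: T) = - (dir R sg * det2 T sec).
    by rewrite /det2/= /GRing.scale/=; ring.
  have -> : dot2 sec (dir R sg *: T) = dir R sg * dot2 T sec.
    by rewrite /dot2/= /GRing.scale/=; ring.
  rewrite mulNr opprK invfM mulrACA divff ?mul1r//; exact: dir_neq0.
have aT : ang (tau i (x + sig * X u) + q) (dir R sg *: T).
  have -> : tau i (x + sig * X u) + q = phi + atan (det2 sec (dir R sg *: T) / dot2 sec (dir R sg *: T)).
    by rewrite /q ratio atanN; ring.
  by apply: ang_atan => //; rewrite dot2C.
have line y := ang_line (atau i (x + sig * X u)) aT (atau i (x + sig * X y)).
have [n0 Hn] : exists n : int, forall y, 0 <= y <= u ->
    `|tau i (x + sig * X y) + q - mu - n%:~R * (2 * pi)| < pi / 2.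
  apply: (@branch_w R (fun y => tau i (x + sig * X y) + q - mu)) => //.
    apply: ctsw_add; last by apply: cts_ctsw => z _; exact: c_cst.
    apply: ctsw_add; last by apply: cts_ctsw => z _; exact: c_cst.
    apply: (@ctsw_comp R _ _ 0 u X (fun y : R => tau i (x + sig * y))); first exact: ctsw_sub cX.
    move=> v _; apply: c_comp => //; apply: c_add; first exact: c_cst.
    by apply: c_mul; [exact: c_cst|exact: c_id].
  move=> y /andP[y0 yu]; rewrite (ang_cos_gt0 (line y).1 amu); apply: Hm.
  by rewrite y0 (le_trans yu).
have near : `|tau i (x + sig * X u) + q - mu| < pi / 2.
  apply: cos_gt0_lt; first by rewrite (ang_cos_gt0 aT amu); exact: Hm.
  have -> : tau i (x + sig * X u) + q - mu = (phi - mu) - atan (det2 T sec / dot2 T sec).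
    by rewrite /q; ring.
  apply: (le_lt_trans (ler_normB _ _)).
  have : `|atan (det2 T sec / dot2 T sec)| < pi / 2.
    by rewrite ltr_norml atan_gtNpi2 atan_ltpi2.
  by have := @pi_gt0 R; lra.
have n00 : n0 = 0.
  have := Hn u; rewrite u0 lexx => /(_ isT); move: near.
  move: (_ - mu) => z; rewrite !ltr_norml => /andP[h1 h2] /andP[h3 h4].
  by apply: (@int_small R n0 (2 * pi)); have := @pi_gt0 R; lra.
have := line 0; rewrite X0 mulr0 addr0 => -[h1 h2]; split=> //.
by have := Hn 0; rewrite lexx u0 n00 mul0r subr0 X0 mulr0 addr0 => /(_ isT).
Qed.

(** The counterpart of [Q] for tangents: the angle from tangent line to secant is subtracted, and
    near a smooth point or a corner a multiple of pi remains when [eta] is small. *)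
Definition tquot (tau : 'I_N -> R -> R) (phi : R -> R) (eta th : R) : R :=
  let u := link_pt th in let sec := bdry (th + eta) - bdry th in
  phi th - tau u.1 u.2 - atan (det2 (tangent L u) sec / dot2 (tangent L u) sec).

Lemma tquotE tau phi eta th i x : (forall i x, tau i (x + 1) = tau (monodromy L i) x) ->
  simple_at L D th -> xyS L i x = bdry th ->
  tquot tau phi eta th = phi th - tau i x -
   atan (det2 (tangent L (i, x)) (bdry (th + eta) - bdry th) / dot2 (tangent L (i, x)) (bdry (th + eta) - bdry th)).
Proof.
move=> ptau sth ix; rewrite /tquot (link_pt_val gen HD ptau sth ix).
by rewrite (link_pt_val gen HD (F := fun i x => tangent L (i, x)) (tangent_period gen) sth ix) -surjective_pairing.
Qed.

Definition secant_angle (eta : R) (phi : R -> R) := forall th, 0 <= th <= 2 ->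
  cts phi th /\ ang (phi th) (bdry (th + eta) - bdry th).

(* All secants near th0 lie in one half plane, so their angle has no time to wind. *)
Lemma turning_local (tau : 'I_N -> R -> R) th0 iL xL iR xR (sL sR : bool) eL eR dL dR XL XR m :
  (forall i x, cts (tau i) x) -> (forall i x, ang (tau i x) (tangent L (i, x))) ->
  (forall i x, tau i (x + 1) = tau (monodromy L i) x) ->
  0 < eL -> 0 < eR ->
  half_germ (fun t => bdry (th0 - t)) eL dL (strand_at L iL xL) sL XL ->
  half_germ (fun t => bdry (th0 + t)) eR dR (strand_at L iR xR) sR XR ->
  0 < dot2 (- dir R sL *: tangent L (iL, xL)) m -> 0 < dot2 (dir R sR *: tangent L (iR, xR)) m ->
  exists2 e : R, 0 < e & forall a b, simple_at L D a -> simple_at L D b -> a < b ->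
    0 <= a -> b <= 2 -> th0 - e < a -> a <= th0 -> th0 <= b -> b < th0 + e ->
  exists2 eta1 : R, 0 < eta1 & forall eta phi, 0 < eta -> eta < eta1 -> secant_angle eta phi ->
  exists mu, [/\ ang mu m,
   a < th0 -> [/\ `|tau iL xL + tquot tau phi eta a - mu| < pi / 2,
      ang (tau iL xL + tquot tau phi eta a) (- dir R sL *: tangent L (iL, xL)) &
      exists k : int, tquot tau phi eta a = k%:~R * pi] &
   forall th, th = b \/ th = a /\ a = th0 -> [/\ `|tau iR xR + tquot tau phi eta th - mu| < pi / 2,
      ang (tau iR xR + tquot tau phi eta th) (dir R sR *: tangent L (iR, xR)) &
      exists k : int, tquot tau phi eta th = k%:~R * pi]].
Proof.
move=> ctau atau ptau eL0 eR0 HL HR mL mR.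
have dN (v : R * R) : - dir R sL *: v = - (dir R sL *: v) by rewrite scaleNr.
have dotNN (v w : R * R) : dot2 (- v) (- w) = dot2 v w by rewrite /dot2/=; ring.
have dotN (v w : R * R) : dot2 v (- w) = dot2 (- v) w by rewrite /dot2/=; ring.
have mL' : 0 < dot2 (dir R sL *: tangent L (iL, xL)) (- m) by rewrite dotN -dN.
have [e1 /andP[e10 e1L] [Tl Sl]] := half_cone HL eL0 mL'.
have [e2 /andP[e20 e2R] [Tr Sr]] := half_cone HR eR0 mR.
exists (Num.min e1 e2); first by rewrite lt_min e10.
move=> a b sa sb ab aa bb h1 h2 h3 h4.
have me1 : Num.min e1 e2 <= e1 by rewrite ge_min lexx.
have me2 : Num.min e1 e2 <= e2 by rewrite ge_min lexx orbT.
(* The secant at [b] must end inside the right germ, and the secant at a < th0 must not pass the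
   vertex. *)
exists (Num.min (th0 + e2 - b) (if a < th0 then th0 - a else 1)).
  rewrite lt_min subr_gt0 (lt_le_trans h4) ?lerD2l//=.
  by case: ifP => // ?; rewrite subr_gt0.
move=> eta phi eta0; rewrite lt_min => /andP[etab etaa] Hphi.
(* A secant across the vertex is the sum of one secant on each side, and the half plane of [m] is
   closed under addition. *)
have fwd th th' : a <= th -> th < th' -> th' <= th0 + e2 -> 0 < dot2 (bdry th' - bdry th) m.
  move=> ath thth thb.
  have lft x y : a <= x -> x < y -> y <= th0 -> 0 < dot2 (bdry y - bdry x) m.
    move=> ax xy y0; have [|||hh _] := Sl (th0 - y) (th0 - x); [rlra|rlra|rlra|].
    move: hh; rewrite dotN; have -> : th0 - (th0 - x) = x by ring.
    have -> : th0 - (th0 - y) = y by ring. rewrite opprB.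
    by [].
  have rgt x y : th0 <= x -> x < y -> y <= th0 + e2 -> 0 < dot2 (bdry y - bdry x) m.
    move=> ax xy y0; have [|||hh _] := Sr (x - th0) (y - th0); [rlra|rlra|rlra|].
    move: hh; have -> : th0 + (x - th0) = x by ring.
    by have -> : th0 + (y - th0) = y by ring.
  have [k1|k1] := leP th' th0; first exact: lft.
  have [k2|k2] := leP th0 th; first exact: rgt.
  have -> : bdry th' - bdry th = (bdry th' - bdry th0) + (bdry th0 - bdry th).
    by apply: pair_eta; rewrite /=; ring.
  have -> : dot2 (bdry th' - bdry th0 + (bdry th0 - bdry th)) m =
    dot2 (bdry th' - bdry th0) m + dot2 (bdry th0 - bdry th) m by rewrite /dot2/=; ring.
  by apply: addr_gt0; [apply: rgt|apply: lft].
have m0 : m <> 0 by exact: dot2_neq0r mR.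
have [mu0 amu0] := ang_ex m0.
have phin th : a <= th <= b -> 0 <= th <= 2 by move=> /andP[? ?]; apply/andP; split; rlra.
have [n0 Hn] : exists n : int, forall th, a <= th <= b -> `|phi th - mu0 - n%:~R * (2 * pi)| < pi / 2.
  apply: (@branch_w R (fun th => phi th - mu0)); first exact: ltW.
    apply: ctsw_add; last by apply: cts_ctsw => z _; exact: c_cst.
    by apply: cts_ctsw => z /phin /Hphi[].
  move=> th thin; have [_ ap] := Hphi th (phin th thin).
  rewrite (ang_cos_gt0 ap amu0); have /andP[? ?] := thin; apply: fwd; rlra.
pose mu := mu0 + n0%:~R * (2 * pi).
have amu : ang mu m by exact: ang_int.
have {}Hn th : a <= th <= b -> `|phi th - mu| < pi / 2.
  by move=> /Hn; rewrite /mu opprD addrA.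
exists mu; split=> //.
  move=> ath; rewrite ath in etaa.
  have ain : a <= a <= b by rewrite lexx ltW.
  have uin : 0 <= th0 - a <= e1 by apply/andP; split; rlra.
  have uinL : 0 <= th0 - a <= eL by apply/andP; split; rlra.
  have [Ga _] := hg_eq HL uinL.
  have thE : th0 - (th0 - a) = a by ring.
  rewrite thE in Ga.
  rewrite (tquotE phi eta ptau sa (esym Ga)) -dirN.
  have [|||_ hs] := Sl (th0 - (a + eta)) (th0 - a); [rlra|rlra|rlra|].
  apply: (side_angle ctau atau (ctsw_sub (lexx 0) e1L (hg_cts HL)) (hg_0 HL) uin _ _
    (Hphi a (phin a ain)).2 (Hn a ain) amu).
    by move=> y yin; rewrite dirN dN -dotN; exact: Tl.
  have := hs _ uin; rewrite thE; have -> : th0 - (th0 - (a + eta)) = a + eta by ring.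
  by rewrite dirN dN -dotN opprB.
have right th : simple_at L D th -> a <= th <= b -> th0 <= th -> [/\ `|tau iR xR + tquot tau phi eta th - mu| < pi / 2,
      ang (tau iR xR + tquot tau phi eta th) (dir R sR *: tangent L (iR, xR)) &
      exists k : int, tquot tau phi eta th = k%:~R * pi].
  move=> sth thin thge; have /andP[tha thb] := thin.
  have uin : 0 <= th - th0 <= e2 by apply/andP; split; rlra.
  have uinR : 0 <= th - th0 <= eR by apply/andP; split; rlra.
  have [Ga _] := hg_eq HR uinR.
  have thE : th0 + (th - th0) = th by ring.
  rewrite thE in Ga.
  rewrite (tquotE phi eta ptau sth (esym Ga)).
  have [|||_ hs] := Sr (th - th0) (th - th0 + eta); [rlra|rlra|rlra|].
  apply: (side_angle ctau atau (ctsw_sub (lexx 0) e2R (hg_cts HR)) (hg_0 HR) uin Tr _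
    (Hphi th (phin th thin)).2 (Hn th thin) amu).
  by have := hs _ uin; rewrite thE addrA thE.
move=> th [->|[-> ath]]; first by apply: right => //; rewrite lexx ltW.
by apply: right => //; [rewrite lexx ltW|rewrite ath].
Qed.

(** The witness is w - v turned clockwise by a quarter turn; both dot products equal [det2 v w]. *)
Lemma half_plane (v w : R * R) : 0 < det2 v w -> exists m, 0 < dot2 v m /\ 0 < dot2 w m.
Proof.
move=> vw; exists (w.2 - v.2, v.1 - w.1).
by split; move: vw; rewrite /dot2 /det2/= => ?; lra.
Qed.

(** At a corner the boundary turns left by less than half a turn, so the jump of [tquot] is the only
    integer k with k pi + tau(out) - tau(in) in ]0, pi[. This is the condition on [nc c] when the
    outgoing strand is the upper one; exchanging the strands gives 1 - nc c. *)
Lemma turning_sum (tau : 'I_N -> R -> R) (nc : C -> int) (eta0 : R) :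
  (forall i x, cts (tau i) x) -> (forall i x, ang (tau i x) (tangent L (i, x))) ->
  (forall i x, tau i (x + 1) = tau (monodromy L i) x) ->
  0 < eta0 -> (forall eta : R, 0 < eta -> eta < eta0 -> exists2 phi : R -> R, secant_angle eta phi &
    forall th, 0 <= th <= 1 -> phi (th + 1) = phi th + 2 * pi) ->
  (forall c, 0 < (nc c)%:~R * pi + (tau (over L c).1 (over L c).2 - tau (under L c).1 (under L c).2) < pi) ->
  2 = \sum_(i < n) corner_jump L (fun c p => if p then nc c else 1 - nc c) (l i).
Proof.
move=> ctau atau ptau eta00 Hsec Hnc.
have [a0 st] := start_ex HD rd.
have [a0p a01 sa ha] := st.
have pi0 := @pi_gt0 R.
(* The bound on [eta] depends on the interval. Composing relations takes minima, and a secant length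
   is chosen only when the whole turn is available. *)
pose Rel a b (j : int) := exists2 eta1 : R, 0 < eta1 & forall eta phi, 0 < eta -> eta < eta1 ->
  secant_angle eta phi -> tquot tau phi eta b - tquot tau phi eta a = j%:~R * pi.
have [|||eta1 eta10 Heta] :=
    @sum_of_jumps R C N s L D HD n t l rd (fun c p => if p then nc c else 1 - nc c) a0 Rel st.
- move=> a b c j k _ _ _ [e1 e10 H1] [e2 e20 H2].
  exists (Num.min e1 e2); first by rewrite lt_min e10.
  move=> eta phi h0; rewrite lt_min => /andP[h1 h2] hs.
  by rewrite intrD mulrDl -(H1 eta phi)// -(H2 eta phi)//; ring.
- move=> th thin um; have [i [x [sg [d [e [Xl [Xr [/andP[e0 _] HL HR]]]]]]]] := smooth_germs gen HD um (@ltr01 R).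
  pose v := dir R sg *: tangent L (i, x).
  have v0 : v <> 0.
    move=> /eqP; rewrite scaler_eq0 (negPf (dir_neq0 sg))/= => /eqP.
    exact: (gen_legendrian gen i x).1.
  have vv := dot2_gt0 v0.
  have [|e' e'0 He'] := turning_local ctau atau ptau e0 e0 HL HR _ vv.
    by rewrite dirN opprK.
  exists e' => // a b Ga Gb ab aa bb h1 h2 h3 h4.
  have [||eta1 eta10 Heta] := He' a b Ga Gb ab _ _ h1 h2 h3 h4; [rlra|rlra|].
  exists eta1 => // eta phi h5 h6 /(Heta eta phi h5 h6)[mu [amu HLa HRb]].
  rewrite mul0r dirN opprK in HLa *.
  have [B1 B2 _] := HRb b (or_introl erefl).
  have [A1 A2] : `|tau i x + tquot tau phi eta a - mu| < pi / 2 /\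
      ang (tau i x + tquot tau phi eta a) (dir R sg *: tangent L (i, x)).
    have [ath|ath] := ltP a th; first by have [] := HLa ath.
    have ea : a = th by apply/eqP; rewrite eq_le h2.
      by have [K1 K2 _] := HRb a (or_intror (conj erefl ea)).
  have := ang_uniq_lt B2 A2; have -> (x1 y z : R) : x1 + y - (x1 + z) = y - z by ring.
  have ab2 : `|tquot tau phi eta b - tquot tau phi eta a| < 2 * pi.
    move: A1 B1; rewrite !ltr_norml => /andP[k1 k2] /andP[k3 k4].
    by apply/andP; split; rlra.
  by move=> /(_ ab2) /addrI ->; rewrite subrr.
- move=> th c oo uu thin hc.
  have [d [e [Xl [Xr [/andP[e0 _] HL HR]]]]] := corner_germs gen HD hc (@ltr01 R).
  have Dn0 := gen_transverse gen c.
  set p := is_p_quadrant L c oo uu in HL HR *.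
  set cR := if p then over L c else under L c in HR.
  set cL := if p then under L c else over L c in HL.
  set sL := (if p then uu else oo) in HL; set sR := (if p then oo else uu) in HR.
  pose vi := - dir R sL *: tangent L (cL.1, cL.2).
  pose vo := dir R sR *: tangent L (cR.1, cR.2).
  (* A corner fills one quadrant only, hence is convex: the outgoing direction is to the left of the
     incoming one. *)
  have Dio : 0 < det2 vi vo.
    rewrite /vi /vo /sL /sR /cL /cR -!surjective_pairing.
    have E1 (x y : bool) (u w : R * R) : det2 (- dir R x *: u) (dir R y *: w) =
       dir R x * dir R y * det2 w u by rewrite /det2/= /GRing.scale/=; ring.
    case: ifP => pp; rewrite E1.
      by move: pp; rewrite /p /is_p_quadrant [dir R uu * _]mulrC.
    rewrite det2C mulrN oppr_gt0 lt_neqAle.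
    move/negbT: pp; rewrite /p /is_p_quadrant -leNgt => ->.
    by rewrite !mulf_neq0 ?dir_neq0.
  have [m [mL mR]] := half_plane Dio.
  have [e' e'0 He'] := turning_local ctau atau ptau e0 e0 HL HR mL mR.
  exists e' => // a b Ga Gb h2 h3 aa bb h1 h4.
  have [||eta1 eta10 Heta] := He' a b Ga Gb (lt_trans h2 h3) _ _ h1 (ltW h2) (ltW h3) h4; [rlra|rlra|].
  exists eta1 => // eta phi h5 h6 /(Heta eta phi h5 h6)[mu [amu HLa HRb]].
  have [B1 B2 [kb hkb]] := HRb b (or_introl erefl).
  have [A1 A2 [ka hka]] := HLa h2.
  have sn : 0 < sin ((tau cR.1 cR.2 + tquot tau phi eta b) - (tau cL.1 cL.2 + tquot tau phi eta a)).
    by rewrite (ang_sin_gt0 A2 B2).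
  have bd : - pi < (tau cR.1 cR.2 + tquot tau phi eta b) - (tau cL.1 cL.2 + tquot tau phi eta a) < pi.
    move: A1 B1; rewrite !ltr_norml => /andP[k1 k2] /andP[k3 k4].
    by apply/andP; split; rlra.
  have /andP[bd1 bd2] := bd.
  have [|j1 j2] := sin_gt0_lt sn bd1; first by rlra.
  have qE : tquot tau phi eta b - tquot tau phi eta a = (kb - ka)%:~R * pi.
    by rewrite hkb hka intrB mulrBl.
  rewrite qE; congr (_%:~R * _).
  have /andP[i1 i2] := Hnc c.
  have : kb - ka - (if p then nc c else 1 - nc c) = 0.
    apply: (@int_small R _ pi); rewrite intrB mulrBl -qE;
    move: j1 j2; rewrite /cR /cL; case: (p); rewrite ?intrB ?mulrBl ?mul1r; rlra.
  exact: subr0_eq.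
have em : 0 < Num.min eta0 eta1 by rewrite lt_min eta00.
have eh0 : 0 < Num.min eta0 eta1 / 2 by rewrite divr_gt0.
have := half_lt em; rewrite lt_min; set eta := _ / 2 in eh0 * => /andP[k1 k2].
have [phi Hphi per] := Hsec eta eh0 k1.
have := Heta eta phi eh0 k2 Hphi.
have sa1 : simple_at L D (a0 + 1).
  by case: sa => u1 u2; split; [move=> m mm; rewrite circle1; exact: u1|
    move=> c; rewrite /boundary circle1; exact: u2].
have le1 : link_pt (a0 + 1) = link_pt a0.
  have [h1 h2] := link_ptP gen HD (a0 + 1).
  by apply: link_pt_uniq => //; rewrite h2 /boundary circle1.
have -> : tquot tau phi eta (a0 + 1) = tquot tau phi eta a0 + 2 * pi.
  rewrite /tquot le1 per ?(ltW a0p) ?(ltW a01)//.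
  have -> : a0 + 1 + eta = a0 + eta + 1 by ring.
  by rewrite /boundary !circle1; ring.
rewrite addrAC subrr add0r => h.
have : (2 : int)%:~R * pi = (\sum_(i < n) corner_jump L (fun c p => if p then nc c else 1 - nc c) (l i))%:~R * pi :> R.
  by rewrite -h.
by move=> /(mulIf (lt0r_neq0 pi0)) /intr_inj.
Qed.

End WindingSum.

(** * Angles along the figure-eight *)

Section FigureEight.
Context {R : realType}.
Implicit Types (v w : R * R).

Lemma ang_unscale (k a : R) v : 0 < k -> ang a (k *: v) -> ang a v.
Proof.
move=> k0 /(ang_scale (k := k^-1)); rewrite invr_gt0 scalerA mulVf ?gt_eqF// scale1r.
exact.
Qed.

(* Half-angle formula for the angle in ]-pi, pi[; on the cut, the negative real
   axis, the division by 0 makes it 0. *)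
Definition slit v : R := 2 * atan (v.2 / (Num.sqrt (dot2 v v) + v.1)).

Lemma slit_pos v : v.2 != 0 \/ 0 < v.1 -> 0 < Num.sqrt (dot2 v v) + v.1.
Proof.
case=> [v2|v1]; last by have := sqrtr_ge0 (dot2 v v); lra.
have : `|v.1| < Num.sqrt (dot2 v v).
  rewrite -sqrtr_sqr ltr_sqrt /dot2.
    by rewrite -!expr2 ltrDl lt_def sqrf_eq0 v2 sqr_ge0.
  by rewrite -!expr2 ltr_wpDl ?sqr_ge0// lt_def sqrf_eq0 v2 sqr_ge0.
by rewrite ltr_norml => /andP[h _]; lra.
Qed.

Lemma slit_ang v : v.2 != 0 \/ 0 < v.1 -> ang (slit v) v.
Proof.
move=> /slit_pos; rewrite /slit; set r := Num.sqrt _ => s0.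
have rr : r ^+ 2 = v.1 ^+ 2 + v.2 ^+ 2.
  by rewrite sqr_sqrtr /dot2 -!expr2// addr_ge0// sqr_ge0.
pose u : R * R := (r + v.1, v.2).
have au : ang (atan (v.2 / (r + v.1))) u.
  have := @ang_atan R 0 (1, 0) u; rewrite /dot2 /det2/= !(mul1r, mul0r, addr0, subr0) add0r.
  by apply=> //; exists 1; rewrite // cos0 sin0 mulr1 mulr0.
apply: (@ang_unscale (2 * (r + v.1))); first by rewrite mulr_gt0.
have := ang_mul au au.
have -> (x : R) : x + x = 2 * x by ring.
suff -> : (2 * (r + v.1)) *: v = cmul u u by [].
apply: pair_eta; rewrite /= /GRing.scale/=; last by ring.
have -> : (r + v.1) * (r + v.1) - v.2 * v.2 = r ^+ 2 + 2 * r * v.1 + v.1 ^+ 2 - v.2 ^+ 2 by ring.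
by rewrite rr; ring.
Qed.

Lemma slit_cts (V : normedModType R) (f : V -> R * R) x :
  cts f x -> (f x).2 != 0 \/ 0 < (f x).1 -> cts (fun y => slit (f y)) x.
Proof.
move=> cf /slit_pos s0; rewrite /slit; apply: c_mul; first exact: c_cst.
apply: c_atan; apply: c_mul; first exact: c_snd.
apply: c_inv; first by rewrite gt_eqF.
by apply: c_add; [apply: c_sqrt; exact: c_dot|exact: c_fst].
Qed.

Lemma slit_conj v : slit (v.1, - v.2) = - slit v.
Proof. by rewrite /slit/= /dot2/= mulrNN mulNr atanN mulrN. Qed.

Lemma slit_obtuse : pi / 2 < slit (- 2, 1) < pi.
Proof.
rewrite /slit /dot2/=; set r := Num.sqrt _.
have rr : r ^+ 2 = 5 by rewrite sqr_sqrtr; lra.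
have r0 : 0 <= r by exact: sqrtr_ge0.
have r2 : 2 < r by nra.
have r3 : r < 3 by nra.
have h : 1 < 1 / (r + - 2) by rewrite ltr_pdivlMr; lra.
have := lt_atan h; rewrite atan1 => h1; have := atan_ltpi2 (1 / (r + - 2)).
move: h1; set t := atan _ => h1 h2; apply/andP; split; lra.
Qed.

Lemma sin_cos2 (x : R) : sin x ^+ 2 + cos x ^+ 2 = 1.
Proof. by rewrite addrC; exact: cos2Dsin2. Qed.

Lemma sin2x (t : R) : sin (4 * pi * t) = 2 * sin (2 * pi * t) * cos (2 * pi * t).
Proof. have -> : 4 * pi * t = 2 * pi * t + 2 * pi * t by ring.
by rewrite sinD; ring. Qed.

Lemma cos2x (t : R) : cos (4 * pi * t) = 2 * cos (2 * pi * t) ^+ 2 - 1.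
Proof.
have -> : 4 * pi * t = 2 * pi * t + 2 * pi * t by ring.
by rewrite cosD; have := sin_cos2 (2 * pi * t); nra.
Qed.

Lemma fig8E (t : R) : fig8 t = (sin (2 * pi * t), 2 * sin (2 * pi * t) * cos (2 * pi * t)).
Proof. by rewrite /fig8 sin2x. Qed.

Lemma trig_inj (t t' : R) : cos (2 * pi * t) = cos (2 * pi * t') ->
  sin (2 * pi * t) = sin (2 * pi * t') -> exists n : int, t' = t + n%:~R.
Proof.
move=> hc hs; have := @ang_uniq R (2 * pi * t') (2 * pi * t) (cos (2 * pi * t), sin (2 * pi * t)).
case; [by rewrite hc hs; exact: ang_unit|exact: ang_unit|move=> n hn; exists n].
have p0 : 2 * pi != 0 :> R by rewrite mulf_neq0 ?gt_eqF ?pi_gt0.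
move: hn; move: (n%:~R : R) => m hm; apply/eqP; rewrite -subr_eq0.
have : 2 * pi * (t' - (t + m)) = 0.
  have -> : 2 * pi * (t' - (t + m)) = (2 * pi * t' - 2 * pi * t) - m * (2 * pi) by ring.
  by rewrite hm subrr.
by move=> /eqP; rewrite mulf_eq0 (negPf p0).
Qed.

Lemma fig8_inj (t t' : R) : fig8 t = fig8 t' -> (exists n : int, t' = t + n%:~R) \/
  sin (2 * pi * t) = 0 /\ sin (2 * pi * t') = 0.
Proof.
rewrite !fig8E => -[hs]; have [s0|s0] := eqVneq (sin (2 * pi * t)) 0.
  by right; rewrite -hs.
rewrite -hs => hc; left; apply: trig_inj => //.
by apply: (mulfI s0); lra.
Qed.

(** A positive sine forbids the values - pi / 2 and 3 pi / 2, between which [f] is therefore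
    confined; there, pi is the only point with cosine - 1. *)
Lemma half_turn (f : R -> R) : (forall x : R, 0 <= x <= 1 -> cts f x) -> f 0 = 0 ->
  (forall x : R, 0 < x < 1 -> 0 < sin (f x)) -> cos (f 1) = - 1 -> f 1 = pi.
Proof.
move=> cf f0 Hs c1; have p0 := @pi_gt0 R.
have Hv (v : R) : sin v < 0 -> cos v = 0 -> forall x : R, 0 <= x <= 1 -> f x <> v.
  move=> sv cv x /andP[x0 x1] fx.
  have [/eqP xx|xn0] := eqVneq x 0; first by move: sv; rewrite -fx (eqP xx) f0 sin0 ltxx.
  have [/eqP xx|xn1] := eqVneq x 1.
    by move: cv; rewrite -fx (eqP xx) c1 => /eqP; rewrite oppr_eq0 oner_eq0.
  have := Hs x; rewrite fx [x < 1]lt_neqAle x1 xn1 [0 < x]lt_neqAle eq_sym xn0 x0 => /(_ isT).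
  by move=> h; have := lt_trans h sv; rewrite ltxx.
have sp : sin (pi / 2) = 1 :> R by exact: sin_pihalf.
have cp : cos (pi / 2) = 0 :> R by exact: cos_pihalf.
have cr (h : R -> R) : (forall x : R, 0 <= x <= 1 -> cts h x) -> forall x : R, 0 <= x <= 1 -> cts (fun y : R => h (1 - y)) x.
  move=> ch x /andP[x0 x1]; apply: (c_comp (f := fun y : R => 1 - y)).
    by apply: c_sub; [exact: c_cst|exact: c_id].
  by apply: ch; apply/andP; split; lra.
have in1 (x : R) : 0 <= x <= 1 -> 0 <= 1 - x <= 1 by move=> /andP[? ?]; apply/andP; split; lra.
have oin : 0 <= (0 : R) <= 1 by rewrite lexx ler01.
have lo : - (pi / 2) < f 1.
  have := @ctsw_ivt R (fun x : R => f (1 - x) + pi / 2) 0 1 ler01.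
  rewrite subrr f0 add0r => H; have : 0 < f (1 - 0) + pi / 2; last by rewrite subr0; lra.
  apply: H => //; last by rewrite divr_gt0.
    apply: cts_ctsw => x xin; apply: c_add; last exact: c_cst.
    exact: cr.
  move=> x /in1 xin h; apply: (Hv (- (pi / 2)) _ _ (1 - x) xin); rewrite ?sinN ?cosN ?sp ?cp//; lra.
have hi : f 1 < 3 * (pi / 2).
  have e3 : 3 * (pi / 2) = pi / 2 + pi :> R by field.
  have := @ctsw_ivt R (fun x : R => 3 * (pi / 2) - f (1 - x)) 0 1 ler01.
  rewrite subrr f0 subr0 => H; have : 0 < 3 * (pi / 2) - f (1 - 0); last by rewrite subr0; lra.
  apply: H => //; last by rewrite mulr_gt0// divr_gt0.
    apply: cts_ctsw => x xin; apply: c_sub; first exact: c_cst.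
    exact: cr.
  move=> x /in1 xin h; apply: (Hv (3 * (pi / 2)) _ _ (1 - x) xin); rewrite ?e3 ?sinDpi ?cosDpi ?sp ?cp ?oppr0//; lra.
have [n hn] : exists n : int, f 1 - pi = n%:~R * (2 * pi).
  apply: (@ang_uniq R _ _ (cos pi, sin pi)); last exact: ang_unit.
  exists 1 => //; rewrite cospi sinpi !mul1r c1; congr pair; apply/esym.
  have := sin_cos2 (f 1); rewrite c1 sqrrN expr1n => hh.
  by apply/eqP; rewrite -sqrf_eq0; apply/eqP; lra.
have n0 : n = 0 by apply: (@int_small R n (2 * pi)); lra.
by move: hn; rewrite n0 mul0r => /eqP; rewrite subr_eq0 => /eqP.
Qed.

Lemma scale_comb (k : R) (u a b : R * R) :
  k *: (u.1 *: a + u.2 *: b) = (k *: u).1 *: a + (k *: u).2 *: b.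
Proof. by rewrite scalerDr !scalerA. Qed.

Lemma c_alin (V : normedModType R) (F G : V -> R * R) x :
  cts F x -> cts G x -> cts (fun y => alin (F y) (G y)) x.
Proof.
move=> cF cG; rewrite /alin; apply: c_pair; (apply: c_mul; last exact: c_cst).
  by apply: c_add; [exact: c_fst|exact: c_snd].
by apply: c_sub; [exact: c_snd|exact: c_fst].
Qed.

Section Eight.
Variables (h A B : R * R -> R * R) (rho drho : R -> R).
Hypotheses (h_sd2 : forall w, sd2 h w (A w) (B w)) (h_det : forall w, 0 < det2 (A w) (B w)).
Hypotheses (A_cts : forall w, cts A w) (B_cts : forall w, cts B w).
Hypotheses (h_inj : forall w w', h w = h w' -> w = w').
Hypotheses (rho_sdr : forall x : R, sdr rho x (drho x)) (drho_cts : forall x : R, cts drho x).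
Hypotheses (prho : forall x : R, rho (x + 1) = rho x + 1) (irho : forall x : R, 0 < drho x).

Let Co (x : R) : R := cos (2 * pi * rho x).
Let q (x : R) : R * R := fig8 (rho x).
(** With S and C the sine and cosine, the standard figure-eight is (S, 2 S C) and its velocity is 2
    pi (C, 4 C^2 - 2), a function of C alone. [V] is its image by the differential of [h]. The
    double point is at S = 0, that is, C = 1 and C = - 1. *)
Let u0 (C : R) : R * R := (C, 4 * C ^+ 2 - 2).
Let V (x : R) : R * R := (u0 (Co x)).1 *: A (q x) + (u0 (Co x)).2 *: B (q x).

Lemma rho_cts x : cts rho x.
Proof. exact: is_derive_cts (sdr_is_derive (rho_sdr x)). Qed.

Lemma rho_inj x x' : rho x = rho x' -> x = x'.
Proof.
move=> e; have [|||c [_ _]] := @mvt_between R rho drho x (`|x' - x| + 1) _ x x'.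
- by move=> y _; exact: sdr_is_derive (rho_sdr y).
- by rewrite subrr normr0 ltr_wpDl.
- by rewrite ltrDl.
move=> hh; move: hh; rewrite e subrr => /esym/eqP; rewrite mulf_eq0 gt_eqF// subr_eq0 => /eqP //.
Qed.

Lemma rho_int x (n : int) : rho (x + n%:~R) = rho x + n%:~R.
Proof.
have H (m : nat) y : rho (y + m%:R) = rho y + m%:R.
  elim: m => [|m IH]; first by rewrite !addr0.
  by rewrite -!natr1 !addrA prho IH.
case: n => m; first exact: H.
rewrite NegzE mulrNz; have := H m.+1 (x - m.+1%:R); rewrite subrK => ->.
by rewrite addrK.
Qed.

Lemma rho_surj (v : R) : exists2 x : R, 0 <= x < 1 & exists n : int, rho x = v + n%:~R.
Proof.
have /andP[n1 n2] := Num.Theory.floor_itv (v - rho 0).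
set n := Num.floor _ in n1 n2; have r1 : rho 1 = rho 0 + 1 by rewrite -prho add0r.
rewrite intrD in n2.
have {}n2 : v - rho 0 < n%:~R + 1 by exact: n2.
have [||x xin xv] := @IVT R rho 0 1 (v - n%:~R) ler01.
- apply: continuous_subspaceT => y; exact: rho_cts.
- by rewrite r1 ge_min le_max; apply/andP; split; apply/orP; [left|right]; lra.
exists x; last by exists (- n); rewrite mulrNz.
move: xin; rewrite in_itv/= => /andP[-> x1]; rewrite lt_neqAle x1 andbT.
by apply/negP => /eqP x1'; move: xv; rewrite x1' r1; lra.
Qed.

Lemma h_cts w : cts h w.
Proof. exact: sd2_cts (h_sd2 w). Qed.

Lemma eight_sd1 x : sd1 (fun x => h (q x)) x ((2 * pi * drho x) *: V x).
Proof.
have e : (2 * pi * drho x) *: V x =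
  ((2 * pi * drho x) *: u0 (Co x)).1 *: A (q x) + ((2 * pi * drho x) *: u0 (Co x)).2 *: B (q x).
  exact: scale_comb.
rewrite e; apply: (@sd1_comp R h q x (q x) (A (q x)) (B (q x)) ((2 * pi * drho x) *: u0 (Co x)) erefl (h_sd2 (q x))).
have D (k y : R) : is_derive y (1 : R) (fun y : R => sin (k * rho y)) (k * drho y * cos (k * rho y)).
  have := @is_derive1_comp R sin (fun y => k * rho y) y _ _ (is_derive_sin _) (is_deriveZ k (sdr_is_derive (rho_sdr y))).
  by rewrite /comp => d; apply: is_derive_eq; rewrite mulrC.
have CD (k y : R) : cts (fun y : R => k * drho y * cos (k * rho y)) y.
  apply: c_mul; first by apply: c_mul => //; exact: c_cst.
  by apply: c_cos; apply: c_mul; [exact: c_cst|exact: rho_cts].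
apply/sd1P; split.
  have := @sdr_of R _ (fun y => 2 * pi * drho y * cos (2 * pi * rho y)) x 1 ltr01 (fun y _ => D _ y) (CD _ x).
  by [].
have := @sdr_of R _ (fun y => 4 * pi * drho y * cos (4 * pi * rho y)) x 1 ltr01 (fun y _ => D _ y) (CD _ x).
by rewrite cos2x /q/= /GRing.scale/= /Co; congr (sdr _ _ _); ring.
Qed.

Lemma q_cts x : cts q x.
Proof.
apply: c_pair; apply: c_sin; apply: c_mul; try exact: c_cst; exact: rho_cts.
Qed.

Lemma Co_cts x : cts Co x.
Proof. by apply: c_cos; apply: c_mul; [exact: c_cst|exact: rho_cts]. Qed.

Lemma Co_per x : Co (x + 1) = Co x.
Proof. by rewrite /Co prho mulrDr mulr1 [2 * pi]mulr_natl cosD2pi. Qed.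

Lemma q_per x : q (x + 1) = q x.
Proof. by rewrite /q !fig8E prho mulrDr mulr1 [2 * pi]mulr_natl cosD2pi sinD2pi. Qed.

Lemma Co_q0 x : Co x ^+ 2 = 1 -> q x = 0.
Proof.
rewrite /q fig8E /Co => C1; have := sin_cos2 (2 * pi * rho x); rewrite C1 => S0.
have s0 : sin (2 * pi * rho x) = 0 by apply/eqP; rewrite -sqrf_eq0; apply/eqP; lra.
by rewrite s0 mulr0 mul0r.
Qed.

(** Halved so as to lie in the unit disk, on which the lifts of angles are available. *)
Let qh (x : R) : R * R := 2^-1 *: q x.

Lemma qhK x : 2 *: qh x = q x.
Proof. by rewrite /qh scalerA divff ?scale1r. Qed.

Lemma qh_cts x : cts qh x.
Proof. by apply: c_scale; [exact: c_cst|exact: q_cts]. Qed.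

Lemma qh_disk x : disk2 (qh x).
Proof.
rewrite /disk2 /qh /q /= /GRing.scale/= sin2x; have := sin_cos2 (2 * pi * rho x).
set S := sin _; set C := cos _ => SC.
have -> : (2^-1 * S) ^+ 2 + (2^-1 * (2 * S * C)) ^+ 2 = S ^+ 2 * (1 + 4 * C ^+ 2) / 4 by field.
have -> : S ^+ 2 = 1 - C ^+ 2 by lra.
have := sqr_ge0 C; have := sqr_ge0 S; set c := C ^+ 2 => h1 h2; nra.
Qed.

Lemma double_cts (W : normedModType R) (f : R * R -> W) w : cts f (2 *: w) -> cts (fun w => f (2 *: w)) w.
Proof. by move=> cf; apply: c_comp => //; apply: c_scale; [exact: c_cst|exact: c_id]. Qed.

Lemma V_cts x : cts V x.
Proof.
have cu : cts (fun x => u0 (Co x)) x.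
  apply: c_pair; first exact: Co_cts.
  by apply: c_sub; last exact: c_cst; apply: c_mul; [exact: c_cst|apply: c_exp; exact: Co_cts].
apply: c_add; apply: c_scale.
- exact: c_fst.
- by apply: c_comp => //; exact: q_cts.
- exact: c_snd.
- by apply: c_comp => //; exact: q_cts.
Qed.

(** The angle is a sum of three terms: [al], the angle of the complex-linear part of the
    differential of [h], lifted on the disk; [lam], that of the standard velocity; and a correction
    [t] below a quarter turn. Each depends only on [q] and [Co], whence the periodicity, and [al]
    cancels at the double point because [q] is 0 on both passages. *)
Lemma eight_angle : exists tau0 : R -> R, [/\ forall x : R, cts tau0 x,
   forall x : R, ang (tau0 x) (V x), forall x : R, tau0 (x + 1) = tau0 x &
   forall x0 x1 : R, Co x0 = 1 -> Co x1 = - 1 -> - (2 * pi) < tau0 x1 - tau0 x0 < - pi].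
Proof.
pose a w := alin (A (2 *: w)) (B (2 *: w)).
have ca w : cts a w.
  have cA := double_cts (@A_cts (2 *: w)); have cB := double_cts (@B_cts (2 *: w)).
  exact: c_alin.
have [w _|al Hal] := star_lift (@compact_disk R) (@disk0 R) (@disk_star R) (fun w _ => ca w).
  exact: alin_neq0 (h_det _).
pose U x := cmul (a (qh x)) (u0 (Co x)).
have u0n (C : R) : u0 C <> 0.
  by case=> C0; rewrite C0 => /eqP; rewrite expr0n/= mulr0 sub0r oppr_eq0 pnatr_eq0.
have UV x : 0 < dot2 (U x) (V x).
  by rewrite dot2C /U /a qhK; apply: lin_pos_gt0; [exact: h_det|exact: u0n].
have cu x : cts (fun x => u0 (Co x)) x.
  apply: c_pair; first exact: Co_cts.
  by apply: c_sub; last exact: c_cst; apply: c_mul; [exact: c_cst|apply: c_exp; exact: Co_cts].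
have cU x : cts U x.
  by apply: c_cmul => //; apply: c_comp; [exact: qh_cts|exact: ca].
pose t x := atan (det2 (U x) (V x) / dot2 (U x) (V x)).
(* A quarter turn takes [u0 C] to (2 - 4 C^2, C), which avoids the cut of [slit]: its second
   coordinate vanishes only at C = 0, where the first is 2. *)
pose lam (C : R) := slit (2 - 4 * C ^+ 2, C) - pi / 2.
have sl (C : R) : (2 - 4 * C ^+ 2, C).2 != 0 \/ 0 < (2 - 4 * C ^+ 2, C).1.
  by have [->|] := eqVneq C 0; [right; rewrite /= expr0n/=; lra|left].
have alam (C : R) : ang (lam C) (u0 C).
  have := ang_mul (slit_ang (sl C)) (ang_unit (- (pi / 2))).
  rewrite cosN sinN cos_pihalf sin_pihalf; congr (ang _ _).
  by apply: pair_eta; rewrite /=; ring.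
exists (fun x => al (qh x) + lam (Co x) + t x); split.
- move=> x; apply: c_add.
    apply: c_add.
      by apply: c_comp; [exact: qh_cts|exact: (Hal _ (qh_disk x)).1].
    apply: c_sub; last exact: c_cst.
    apply: (slit_cts (f := fun x => (2 - 4 * Co x ^+ 2, Co x))); last exact: sl.
    apply: c_pair; last exact: Co_cts.
    by apply: c_sub; first exact: c_cst; apply: c_mul; [exact: c_cst|apply: c_exp; exact: Co_cts].
  have cV := @V_cts x; apply: c_atan; apply: c_mul; first exact: c_det.
  by apply: c_inv; [rewrite gt_eqF|exact: c_dot].
- move=> x; apply: ang_atan => //; apply: ang_mul => //.
  exact: (Hal _ (qh_disk x)).2.
- by move=> x; rewrite /t /U /V /qh Co_per q_per.
move=> x0 x1 C0 C1; set D := _ - _.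
have q0 : q x0 = 0 by apply: Co_q0; rewrite C0 expr1n.
have q1 : q x1 = 0 by apply: Co_q0; rewrite C1 sqrrN expr1n.
have sD : 0 < sin D.
  have at_ x : ang (al (qh x) + lam (Co x) + t x) (V x).
    by apply: ang_atan => //; apply: ang_mul => //; exact: (Hal _ (qh_disk x)).2.
  rewrite (ang_sin_gt0 (at_ x0) (at_ x1)) /V q0 q1 C0 C1 /u0/= sqrrN expr1n.
  have := h_det 0; rewrite /det2/= /GRing.scale/= => ?; lra.
have t0 x : - (pi / 2) < t x < pi / 2 by rewrite /t atan_gtNpi2 atan_ltpi2.
(* The main term is in ]- 2 pi, - pi[ and the corrections add less than pi, so D + 2 pi is in ]- pi,
   2 pi[; its positive sine leaves ]0, pi[. *)
have DE : D = - (2 * slit (- 2, 1)) + (t x1 - t x0).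
  rewrite /D /qh q0 q1 /lam C0 C1 sqrrN expr1n.
  have -> : 2 - 4 * 1 = - 2 :> R by lra.
  have -> : slit (- 2, - 1) = - slit (- 2, 1) by rewrite -slit_conj.
  ring.
have /andP[s1 s2] := slit_obtuse; have /andP[a1 a2] := t0 x0; have /andP[a3 a4] := t0 x1.
have sD2 : 0 < sin (D + 2 * pi) by rewrite [2 * pi]mulr_natl sinD2pi.
have p0 := @pi_gt0 R.
move: DE a1 a2 a3 a4 s1 s2; move: (t x1) (t x0) (slit _) => y1 y0 y DE *.
have [||k1 k2] := sin_gt0_lt sD2; [lra|lra|].
apply/andP; split; lra.
Qed.

(** Since [h] is injective and preserves orientation, h - h P has the single zero [P], of positive
    sign. The quotient by the identity minus [P] thus has an angle on the disk: winding around h P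
    reduces to winding of the standard curve around [P]. *)
Lemma eight_factor (P : R * R) : disk2 (2^-1 *: P) -> (forall x, 1 / 4 <= `|q x - P|) ->
  exists E : R * R -> R, forall x, cts E (qh x) /\
    ang (E (qh x)) (cmul (h (q x) - h P) (conj2 (q x - P))).
Proof.
move=> dP far; pose z : R * R := 2^-1 *: P.
have zK : 2 *: z = P by rewrite /z scalerA divff ?scale1r.
pose g w := h (2 *: w) - h P.
have cg w : cts g w.
  by apply: c_sub; [apply: double_cts; exact: h_cts|exact: c_cst].
have gz w : disk2 w -> g w = 0 -> w \in [:: z].
  move=> _ /eqP; rewrite /g subr_eq0 => /eqP /h_inj wP; rewrite mem_seq1 /z -wP scalerA mulVf ?scale1r//.
have r0 : 0 < 1 / 8 :> R by lra.
have [z'|E HE] := factor_lift (@compact_disk R) (@disk0 R) (@disk_star R) r0 (isT : uniq [:: z]) (fun w _ => cg w) gz.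
  rewrite mem_seq1 => /eqP ->; exists (fun=> 2 *: alin (A P) (B P)); split.
  - by move=> w; exact: c_cst.
  - move=> /eqP; rewrite scaler_eq0 pnatr_eq0/= => /eqP; exact: alin_neq0 (h_det P).
  have [r rp Hr] := sd2_pos (h_sd2 P) (h_det P).
  exists (r / 2); first by rewrite divr_gt0.
  move=> w wr wz; have dbl : 2 *: w - P = 2 *: (w - z) by rewrite scalerBr zK.
  have -> : cmul (2 *: alin (A P) (B P)) (w - z) = cmul (alin (A P) (B P)) (2 *: w - P).
    by rewrite dbl; apply: pair_eta; rewrite /= /GRing.scale/=; ring.
  apply: Hr; first by rewrite dbl normrZ ger0_norm//; lra.
  move=> /eqP; rewrite -subr_eq0 dbl scaler_eq0 pnatr_eq0/= subr_eq0 => /eqP //.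
exists E => x; have [cE aE] := HE _ (qh_disk x); split=> //.
apply: (@ang_unscale (2^-1)); first by rewrite invr_gt0.
have := aE; rewrite /= cmul1r /g qhK.
have -> : conj2 (qh x - z) = 2^-1 *: conj2 (q x - P).
  by rewrite /qh /z -scalerBr; apply: pair_eta; rewrite /= /GRing.scale/=; ring.
have -> v w : cmul v (2^-1 *: w) = 2^-1 *: cmul v w :> R * R.
  by apply: pair_eta; rewrite /= /GRing.scale/=; ring.
apply=> z'; rewrite mem_seq1 => /eqP ->.
rewrite /qh /z -scalerBr normrZ ger0_norm ?invr_ge0//; have := far x; lra.
Qed.

Let PA : R * R := (1 / 2, 0).
Let PB : R * R := (- (1 / 2), 0).

Lemma q_far x : 1 / 4 <= `|q x - PA| /\ 1 / 4 <= `|q x - PB|.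
Proof.
rewrite /q fig8E; have := sin_cos2 (2 * pi * rho x).
move: (sin _) (cos _) => S C SC.
have H (p : R) : p = 1 / 2 \/ p = - (1 / 2) -> 1 / 4 <= `|(S, 2 * S * C) - (p, 0)|.
  move=> pp; rewrite leNgt; apply/negP; rewrite norm2_lt/= subr0 !ltr_norml => /andP[/andP[h1 h2] /andP[h3 h4]].
  have [s1 s2] : 1 / 16 < S ^+ 2 /\ S ^+ 2 < 9 / 16.
    by case: pp h1 h2 => -> h1 h2; split; nra.
  have k1 : (2 * S * C) ^+ 2 < 1 / 16 by nra.
  have k2 : (2 * S * C) ^+ 2 = 4 * S ^+ 2 * (1 - S ^+ 2).
    have -> : 1 - S ^+ 2 = C ^+ 2 by lra.
    by ring.
  move: k1; rewrite k2; move: (S ^+ 2) s1 s2 => y *; nra.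
by split; apply: H; [left|right].
Qed.

(** The displayed vector is the complex number q^2 - 1 / 4 = (q - 1 / 2) (q + 1 / 2) for q = S + 2 i
    S C, written in C alone. Its angle is thus a function on [-1, 1]. It is 3 / 4 at C = 0, its
    imaginary part has the sign of C inside, and it is - 1 / 4 at both ends, so the angle is pi at 1
    and - pi at - 1. *)
Lemma eight_core : exists Lam : R -> R, [/\ forall c : R, -1 <= c <= 1 -> cts Lam c,
  forall c : R, -1 <= c <= 1 -> ang (Lam c) ((1 - c ^+ 2) * (1 - 4 * c ^+ 2) - 1 / 4, 4 * (1 - c ^+ 2) * c) &
  Lam (- 1) - Lam 1 = - (2 * pi)].
Proof.
pose g (c : R) : R * R := ((1 - c ^+ 2) * (1 - 4 * c ^+ 2) - 1 / 4, 4 * (1 - c ^+ 2) * c).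
have cg c : cts g c.
  have c2 (k : R) x : cts (fun c : R => 1 - k * c ^+ 2) x.
    apply: c_sub; first exact: c_cst; apply: c_mul; first exact: c_cst.
    by apply: c_exp; exact: c_id.
  have c1 : cts (fun c : R => 1 - c ^+ 2) c.
    by apply: (c_eq _ (c2 1 c)) => y; rewrite mul1r.
  apply: c_pair; first by apply: c_sub; [exact: c_mul|exact: c_cst].
  by apply: c_mul; [apply: c_mul; [exact: c_cst|exact: c1]|exact: c_id].
have K0 : `[-1, 1]%classic (0 : R) by rewrite /= in_itv/=; apply/andP; split; lra.
have Kst (w t : R) : `[-1, 1]%classic w -> 0 <= t <= 1 -> `[-1, 1]%classic (t *: w).
  rewrite /= !in_itv/= => /andP[w1 w2] /andP[t0 t1]; rewrite /GRing.scale/=; apply/andP; split; nra.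
have g0 (w : R) : `[-1, 1]%classic w -> g w <> 0.
  move=> _ [] e1 /eqP; rewrite !mulf_eq0 pnatr_eq0/= => /orP[/eqP h1|/eqP h1].
    by move: e1; rewrite h1; lra.
  by move: e1; rewrite h1 expr0n/=; lra.
have [w _|lam Hlam] := star_lift (@segment_compact R (- 1) 1) K0 Kst _ g0.
  exact: cg.
have inI (c : R) : -1 <= c <= 1 -> `[-1, 1]%classic c by rewrite /= in_itv.
have [n hn] : exists n : int, lam 0 - 0 = n%:~R * (2 * pi).
  apply: (@ang_uniq R _ _ (g 0)); first exact: (Hlam 0 K0).2.
  by exists (3 / 4); [lra|rewrite /g cos0 sin0; congr pair; rewrite ?expr0n/=; lra].
pose Lam c := lam c - lam 0.
have aL (c : R) : -1 <= c <= 1 -> ang (Lam c) (g c).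
  move=> cin; have := ang_int (- n) (Hlam c (inI c cin)).2.
  by rewrite /Lam mulrNz mulNr -hn subr0.
have cL (c : R) : -1 <= c <= 1 -> cts Lam c.
  by move=> cin; apply: c_sub; [exact: (Hlam c (inI c cin)).1|exact: c_cst].
exists Lam; split=> //.
have sinL (c : R) : -1 <= c <= 1 -> (0 < sin (Lam c)) = (0 < (g c).2).
  move=> /aL [r r0 ->]; by rewrite /= pmulr_rgt0.
have cosL (c : R) : c ^+ 2 = 1 -> -1 <= c <= 1 -> cos (Lam c) = - 1.
  move=> cc /aL [r r0]; rewrite /g cc subrr !(mul0r, mulr0) => -[h1 h2].
  have := sin_cos2 (Lam c).
  have -> : sin (Lam c) = 0 by apply/eqP; move/esym/eqP: h2; rewrite mulf_eq0 gt_eqF.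
  have : cos (Lam c) < 0 by rewrite -(pmulr_rlt0 _ r0) -h1; lra.
  move: (cos _) => y; nra.
have L0 : Lam 0 = 0 by rewrite /Lam subrr.
have e1 : Lam 1 = pi.
  apply: half_turn => //.
  - by move=> x /andP[x0 x1]; apply: cL; apply/andP; split; lra.
  - move=> x /andP[x0 x1]; rewrite sinL; last by apply/andP; split; lra.
    by rewrite /= mulr_gt0//; nra.
  - by apply: cosL; [rewrite expr1n|apply/andP; split; lra].
have e2 : - Lam (- 1) = pi.
  apply: (@half_turn (fun x => - Lam (- x))).
  - move=> x /andP[x0 x1]; apply: c_opp; apply: (c_comp (f := fun x : R => - x)).
      by apply: c_opp; exact: c_id.
    by apply: cL; apply/andP; split; lra.
  - by rewrite oppr0 L0 oppr0.
  - move=> x /andP[x0 x1]; have [|r r0] := ang_conj (@aL (- x) _); first by apply/andP; split; lra.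
    rewrite /conj2/= sqrrN => -[_ e]; rewrite -(pmulr_rgt0 _ r0) -e mulrN opprK mulr_gt0//; nra.
  - by rewrite cosN; apply: cosL; [rewrite sqrrN expr1n|apply/andP; split; lra].
lra.
Qed.

(** The terms from [eight_factor] depend on [q] only and cancel between the two passages through the
    double point; what is left is the full turn of [Lam]. *)
Lemma eight_winding : exists W0 : R -> R, [/\ forall x : R, cts W0 x,
   forall x : R, ang (W0 x) (cmul (h (q x) - h PA) (h (q x) - h PB)), forall x : R, W0 (x + 1) = W0 x &
   forall x0 x1 : R, Co x0 = 1 -> Co x1 = - 1 -> W0 x1 - W0 x0 = - (2 * pi)].
Proof.
have [Lam [cL aL dL]] := eight_core.
have dk (p : R) : p ^+ 2 <= 1 -> disk2 (2^-1 *: ((p, 0) : R * R)).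
  rewrite /disk2 /= /GRing.scale/= => pp; rewrite mulr0 expr0n/= addr0 exprMn; lra.
have [||EA HA] := @eight_factor PA; [by apply: dk; lra|by move=> x; exact: (q_far x).1|].
have [||EB HB] := @eight_factor PB; [by apply: dk; lra|by move=> x; exact: (q_far x).2|].
have Cin x : -1 <= Co x <= 1 by rewrite cos_geN1 cos_le1.
exists (fun x => Lam (Co x) + (EA (qh x) + EB (qh x))); split.
- move=> x; apply: c_add; first by apply: c_comp; [exact: Co_cts|exact: cL].
  by apply: c_add; apply: c_comp; [exact: qh_cts|exact: (HA x).1|exact: qh_cts|exact: (HB x).1].
- move=> x; have := ang_mul (aL _ (Cin x)) (ang_mul (HA x).2 (HB x).2).
  have dpos P : 1 / 4 <= `|q x - P| -> 0 < dot2 (q x - P) (q x - P).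
    by move=> hP; apply: dot2_gt0 => e; move: hP; rewrite e normr0; lra.
  have [fA fB] := q_far x.
  have -> : ((1 - Co x ^+ 2) * (1 - 4 * Co x ^+ 2) - 1 / 4, 4 * (1 - Co x ^+ 2) * Co x) =
     cmul (q x - PA) (q x - PB).
    have -> : q x = (sin (2 * pi * rho x), 2 * sin (2 * pi * rho x) * Co x) by rewrite /q fig8E.
    have := sin_cos2 (2 * pi * rho x); rewrite -/(Co x).
    move: (sin _) (Co x) => S C SC; have -> : C ^+ 2 = 1 - S ^+ 2 by lra.
    have C2 : C * C = 1 - S ^+ 2 by rewrite -expr2; lra.
    apply: pair_eta; rewrite /=; last by ring.
    have -> : (S - 1 / 2) * (S - - (1 / 2)) - (2 * S * C - 0) * (2 * S * C - 0) =
       S ^+ 2 - 1 / 4 - 4 * S ^+ 2 * (C * C) by field.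
    by rewrite C2; field.
  have idn (u v a b : R * R) : cmul (cmul u v) (cmul (cmul a (conj2 u)) (cmul b (conj2 v))) =
     (dot2 u u * dot2 v v) *: cmul a b.
    by apply: pair_eta; rewrite /dot2/= /GRing.scale/=; ring.
  rewrite idn => /ang_unscale; apply; rewrite mulr_gt0//; exact: dpos.
- by move=> x; rewrite /qh Co_per q_per.
move=> x0 x1 C0 C1; rewrite /qh C0 C1.
rewrite (@Co_q0 x0) ?C0 ?expr1n// (@Co_q0 x1) ?C1 ?sqrrN ?expr1n// -dL; ring.
Qed.

Lemma Co_uniq x x' : Co x = Co x' -> Co x ^+ 2 = 1 -> exists n : int, x' = x + n%:~R.
Proof.
move=> CC C1; have s0 y : Co y ^+ 2 = 1 -> sin (2 * pi * rho y) = 0.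
  by move=> /Co_q0; rewrite /q fig8E => -[].
have [|n hn] := trig_inj CC; first by rewrite !s0// -CC.
by exists n; apply: rho_inj; rewrite rho_int.
Qed.

Lemma eight_double x0 x1 x x' : Co x0 = 1 -> Co x1 = - 1 -> h (q x) = h (q x') ->
  (exists n : int, x' = x + n%:~R) \/ exists n m : int,
  (x = x0 + n%:~R /\ x' = x1 + m%:~R) \/ (x = x1 + n%:~R /\ x' = x0 + m%:~R).
Proof.
move=> C0 C1 /h_inj /fig8_inj [[n /esym hn]|[s0 s0']].
  by left; exists n; apply: rho_inj; rewrite rho_int.
have H y : sin (2 * pi * rho y) = 0 -> Co y = 1 \/ Co y = - 1.
  move=> sy; have := sin_cos2 (2 * pi * rho y); rewrite sy expr0n/= add0r => /eqP.
  by rewrite sqrf_eq1 => /orP[/eqP|/eqP]; [left|right].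
have E (y z v : R) : v ^+ 2 = 1 -> Co y = v -> Co z = v -> exists n : int, z = y + n%:~R.
  by move=> vv yv zv; apply: Co_uniq; rewrite yv ?zv.
have e1 : (1 : R) ^+ 2 = 1 by rewrite expr1n.
have e2 : (- 1 : R) ^+ 2 = 1 by rewrite sqrrN expr1n.
have [cx|cx] := H x s0; have [cx'|cx'] := H x' s0'.
- by left; exact: E e1 _ _.
- right; have [n hn] := E _ _ _ e1 C0 cx; have [m hm] := E _ _ _ e2 C1 cx'.
  by exists n, m; left.
- right; have [n hn] := E _ _ _ e2 C1 cx; have [m hm] := E _ _ _ e1 C0 cx'.
  by exists n, m; right.
- by left; exact: E e2 _ _.
Qed.

Lemma Co_ex : (exists2 x : R, 0 <= x < 1 & Co x = 1) /\ (exists2 x : R, 0 <= x < 1 & Co x = - 1).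
Proof.
have H (v : R) : exists2 x : R, 0 <= x < 1 & Co x = cos (2 * pi * v).
  have [x xin [n hn]] := rho_surj v; exists x => //.
  by rewrite /Co hn mulrDr [_ * n%:~R]mulrC cosDint.
split; first by have := H 0; rewrite mulr0 cos0.
have := H (1 / 2); have -> : 2 * pi * (1 / 2) = pi :> R by field.
by rewrite cospi.
Qed.

End Eight.

(** The labels [x0] and [x1] of the two passages through the double point are ordered: both angles
    decrease from [x0] to [x1]. *)
Record eight_angles (c dc : R -> R * R) (P Q : R * R) (x0 x1 : R) (tau W : R -> R) : Prop := {
  ea_sd1 : forall x, sd1 c x (dc x);
  ea_cts : forall x, cts dc x;
  ea_tau : forall x, cts tau x /\ ang (tau x) (dc x);
  ea_W : forall x, cts W x /\ ang (W x) (cmul (c x - P) (c x - Q));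
  ea_per : forall x, [/\ c (x + 1) = c x, tau (x + 1) = tau x & W (x + 1) = W x];
  ea_x : [/\ 0 <= x0 < 1, 0 <= x1 < 1, x0 <> x1 & c x0 = c x1];
  ea_double : forall x x', c x = c x' ->
    (exists n : int, x' = x + n%:~R) \/ exists n m : int,
    (x = x0 + n%:~R /\ x' = x1 + m%:~R) \/ (x = x1 + n%:~R /\ x' = x0 + m%:~R);
  ea_turn : - (2 * pi) < tau x1 - tau x0 < - pi;
  ea_wind : W x1 - W x0 = - (2 * pi) }.

Lemma figure_eight_angles (c : R -> R * R) : figure_eight c ->
  exists dc P Q x0 x1 tau W, eight_angles c dc P Q x0 x1 tau W.
Proof.
case=> h [rho [[sh [[h' [_ hK _]] hjac]] srho prho irho cE]].
pose A w : R * R := 'D_((1, 0) : R * R) h w.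
pose B w : R * R := 'D_((0, 1) : R * R) h w.
have hsd w : sd2 h w (A w) (B w).
  by apply: (@smooth_sd2 R h setT) => //; exact: openT.
have cA w : cts A w by exact: (smooth_derive _ sh (I : setT w)).2.
have cB w : cts B w by exact: (smooth_derive _ sh (I : setT w)).2.
have hinj w w' : h w = h w' -> w = w' by move=> /(congr1 h'); rewrite !hK.
have rsd (x : R) : sdr rho x (derive1 rho x) by exact: smooth_sdr.
have cr (y : R) : cts (derive1 rho) y.
  apply: (@c_eq _ _ _ ('D_1 rho : R -> R)); first by move=> z; rewrite derive1E.
  exact: (smooth_derive _ srho (I : setT y)).2.
have {cE} -> : c = fun x => h (fig8 (rho x)) by exact/funext.
have [[x0 x0in C0] [x1 x1in C1]] := Co_ex rsd prho.
have [tau [ct at_ pt tt]] := eight_angle hjac cA cB rsd prho.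
have [W [cW aW pW tW]] := eight_winding hsd hjac hinj rsd prho.
pose V x := cos (2 * pi * rho x) *: A (fig8 (rho x)) + (4 * cos (2 * pi * rho x) ^+ 2 - 2) *: B (fig8 (rho x)).
exists (fun x => (2 * pi * derive1 rho x) *: V x), (h (1 / 2, 0)), (h (- (1 / 2), 0)), x0, x1, tau, W.
have cq := q_cts rsd.
split.
- exact: eight_sd1.
- by move=> x; apply: c_scale; [apply: c_mul; [exact: c_cst|exact: cr]|exact: (V_cts cA cB rsd)].
- by move=> x; split=> //; apply: ang_scale (at_ x); rewrite !mulr_gt0// pi_gt0.
- by move=> x; split.
- by move=> x; rewrite q_per.
- split=> //.
    by move=> e; move: C1; rewrite -e C0; lra.
  by rewrite (@Co_q0 rho x0) ?C0 ?expr1n// (@Co_q0 rho x1) ?C1 ?sqrrN ?expr1n.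
- by move=> x x'; exact: (eight_double hinj rsd prho irho C0 C1).
- exact: tt.
- exact: tW.
Qed.
End FigureEight.

(** * The neighborhood of the unknot *)

Lemma abs_prod (R : realType) (x y u v : R) : `|x| <= u -> `|y| <= v -> - (u * v) <= x * y <= u * v.
Proof. by move=> hx hy; rewrite -ler_norml normrM ler_pM. Qed.

(** Estimate for [second_difference]. The expression splits into nine error terms, each at most s M
    ep, whence the constant 9. *)
Lemma second_difference_bound (R : realType) (P Q A B T s M ep x t z1 z2 z3 z4 p1 p2 q3 q4 l1 l2 : R) :
  0 < s -> 0 < ep -> ep <= 1 -> 0 <= x <= s -> 0 <= t <= s ->
  `|P| + 1 <= M -> `|Q| + 1 <= M -> `|A| + `|B| <= M -> 1 <= M ->
  `|p1 - P| <= ep -> `|p2 - P| <= ep -> `|q3 - Q| <= ep -> `|q4 - Q| <= ep -> `|l1 - T| <= ep ->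
  `|z1 - (x * A + s * B)| <= ep * s -> `|z2 - (x * A + 0 * B)| <= ep * s ->
  `|z3 - (s * A + t * B)| <= ep * s -> `|z4 - (0 * A + t * B)| <= ep * s ->
  (z1 * p1 - l1 * s) - (z2 * p2 - l2 * 0) = z3 * q3 - z4 * q4 ->
  `|P * B - Q * A - T| <= 9 * M * ep.
Proof.
move=> s0 ep0 ep1 /andP[x0 xs] /andP[t0 ts] PM QM AM M1 hp1 hp2 hq3 hq4 hl hz1 hz2 hz3 hz4 E.
have big (p q : R) : `|q| + 1 <= M -> `|p - q| <= ep -> `|p| <= M.
  move=> qM pq; have := ler_normD (p - q) q; rewrite subrK; lra.
have lin (x' t' : R) : 0 <= x' <= s -> 0 <= t' <= s -> `|x' * A + t' * B| <= s * M.
  move=> /andP[a1 a2] /andP[b1 b2]; apply: (le_trans (ler_normD _ _)); rewrite !normrM (ger0_norm a1) (ger0_norm b1).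
  have : x' * `|A| <= s * `|A| by rewrite ler_wpM2r.
  have : t' * `|B| <= s * `|B| by rewrite ler_wpM2r.
  have : s * (`|A| + `|B|) <= s * M by rewrite ler_wpM2l// ltW.
  by rewrite mulrDr; lra.
have s1 : 0 <= s <= s by rewrite lexx ltW.
have s2 : 0 <= (0 : R) <= s by rewrite lexx ltW.
have xin : 0 <= x <= s by rewrite x0.
have tin : 0 <= t <= s by rewrite t0.
have k1 := abs_prod hz1 (big _ _ PM hp1); have k2 := abs_prod (lin x s xin s1) hp1.
have k3 := abs_prod hz2 (big _ _ PM hp2); have k4 := abs_prod (lin x 0 xin s2) hp2.
have k5 := abs_prod hz3 (big _ _ QM hq3); have k6 := abs_prod (lin s t s1 tin) hq3.
have k7 := abs_prod hz4 (big _ _ QM hq4); have k8 := abs_prod (lin 0 t s2 tin) hq4.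
have sM : `|s| <= s * M by rewrite (gtr0_norm s0) ler_peMr// ltW.
have k9 := abs_prod sM hl.
have e1 : ep * s * M = s * M * ep by ring.
rewrite e1 in k1 k3 k5 k7.
rewrite -(ler_pM2l s0) -{1}(gtr0_norm s0) -normrM ler_norml.
have -> : s * (9 * M * ep) = 9 * (s * M * ep) by ring.
have F : s * (P * B - Q * A - T) =
    - ((z1 - (x * A + s * B)) * p1) - (x * A + s * B) * (p1 - P)
    + (z2 - (x * A + 0 * B)) * p2 + (x * A + 0 * B) * (p2 - P) + s * (l1 - T)
    + (z3 - (s * A + t * B)) * q3 + (s * A + t * B) * (q3 - Q)
    - (z4 - (0 * A + t * B)) * q4 - (0 * A + t * B) * (q4 - Q)
    + ((z1 * p1 - l1 * s) - (z2 * p2 - l2 * 0) - (z3 * q3 - z4 * q4)) by ring.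
rewrite F E subrr addr0.
move: k1 k2 k3 k4 k5 k6 k7 k8 k9; move: (_ * p1) (_ * (p1 - P)) (_ * p2) (_ * (p2 - P)) (_ * q3) (_ * (q3 - Q)) (_ * q4) (_ * (q4 - Q)) (s * (l1 - T)) (s * M * ep).
move=> a1 a2 a3 a4 a5 a6 a7 a8 a9 K /andP[? ?] /andP[? ?] /andP[? ?] /andP[? ?] /andP[? ?] /andP[? ?] /andP[? ?] /andP[? ?] /andP[? ?].
by apply/andP; split; lra.
Qed.

Section Neighborhood.
Context {R : realType} (e : R) (Phi : R * R * R -> R * R * R).
Hypothesis nbh : unknot_neighborhood e Phi.

Definition sheet (q : R * R) : R * R := (Phi (q, 0)).1.
Definition height (p : R * R * R) : R := (Phi p).2.
Definition dsheet (v q : R * R) : R * R := ('D_((v, 0) : R * R * R) Phi (q, 0)).1.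
Local Notation D1 := (dsheet (1, 0)).
Local Notation D2 := (dsheet (0, 1)).

Lemma tube0 (q : R * R) : `|q.2| < e -> tube e (q, 0).
Proof. by move=> qe; split => //=; rewrite normr0; exact: nbh_pos nbh. Qed.

Lemma c_slice (V : normedModType R) (f : V -> R * R) x : cts f x -> cts (fun y => (f y, 0 : R)) x.
Proof. by move=> cf; apply: c_pair => //; exact: c_cst. Qed.

Lemma dsheet_cts v q : `|q.2| < e -> cts (dsheet v) q.
Proof.
move=> qe; apply: c_fst.
apply: (c_comp (f := fun q : R * R => (q, 0 : R)) (g := ('D_((v, 0) : R * R * R) Phi : _ -> R * R * R))).
  by apply: c_slice; exact: c_id.
exact: (smooth_derive _ (nbh_smooth nbh) (tube0 qe)).2.
Qed.

Lemma sheet_derive v q : `|q.2| < e -> is_derive q v sheet (dsheet v q).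
Proof.
move=> qe; have H := (smooth_derive ((v, 0) : R * R * R) (nbh_smooth nbh) (tube0 qe)).1.
apply: (is_derive_affine (f := fun p => (Phi p).1) (i := fun q : R * R => (q, 0 : R)) (u := (v, 0))).
  by move=> h; apply: injective_projections => //=; rewrite scaler0 addr0.
exact: is_derive_fst H.
Qed.

Lemma strip_ball (q : R * R) : `|q.2| < e -> exists2 r : R, 0 < r &
  forall w : R * R, `|w - q| < r -> `|w.2| < e.
Proof.
move=> qe; exists (e - `|q.2|); first by rewrite subr_gt0.
move=> w; rewrite norm2_lt => /andP[_ /= h].
by have := ler_normD q.2 (w.2 - q.2); rewrite addrC subrK => h'; lra.
Qed.

Lemma sheet_sd2 q : `|q.2| < e -> sd2 sheet q (D1 q) (D2 q).
Proof.
move=> qe; have [r r0 Hr] := strip_ball qe.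
apply: (@sd2_of _ sheet D1 D2 q r r0).
- by move=> w /Hr we; exact: sheet_derive.
- by move=> w /Hr we; exact: sheet_derive.
- exact: dsheet_cts.
- exact: dsheet_cts.
Qed.

Lemma sheet_cts q : `|q.2| < e -> cts sheet q.
Proof. by move=> /sheet_sd2 /sd2_cts. Qed.

Lemma sheet_det q : `|q.2| < e -> 0 < det2 (D1 q) (D2 q).
Proof.
move=> qe; have := nbh_immersion nbh qe.
have E v : 'D_v (fun q' : R * R => (Phi (q', 0)).1 : R * R) q = dsheet v q.
  by apply: (@derive_val _ _ _ _ _ _ _ (sheet_derive v qe)).
suff -> : Defs.jacobian (fun q' : R * R => (Phi (q', 0)).1 : R * R) q = det2 (D1 q) (D2 q) by [].
by rewrite /Defs.jacobian; congr det2; exact: E.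
Qed.

Lemma sheet_period (x y : R) (n : int) : `|y| < e -> sheet (x + n%:~R, y) = sheet (x, y).
Proof.
move=> ye.
have H1 t : sheet (t + 1, y) = sheet (t, y).
  by rewrite /sheet (nbh_period nbh (p := (t, y, 0))) //; exact: tube0.
have H (m : nat) t : sheet (t + m%:R, y) = sheet (t, y).
  by elim: m => [|m IH]; [rewrite addr0|rewrite -natr1 addrA H1].
case: n => m; first exact: H.
by rewrite NegzE mulrNz -(H m.+1) subrK.
Qed.

Lemma sheet_cover (x y z : R) : `|y| < e -> `|z| < e -> (Phi (x, y, z)).1 = sheet (x, y).
Proof. by move=> ye ze; exact: (nbh_cover nbh (p := (x, y, z))). Qed.

Definition dheight (v p : R * R * R) : R := ('D_v Phi p).2.
Local Notation Hz := (dheight (0, 0, 1)).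

Lemma dheight_cts v p : tube e p -> cts (dheight v) p.
Proof. by move=> pe; apply: c_snd; exact: (smooth_derive _ (nbh_smooth nbh) pe).2. Qed.

Lemma height_cts p : tube e p -> cts height p.
Proof. by move=> pe; apply: c_snd; exact: smooth_cts (nbh_smooth nbh) pe. Qed.

Lemma height_derive v p : tube e p -> is_derive p v height (dheight v p).
Proof. by move=> pe; apply: is_derive_snd; exact: (smooth_derive _ (nbh_smooth nbh) pe).1. Qed.

Lemma vertical p : tube e p -> ('D_((0, 0, 1) : R * R * R) Phi p).1 = 0.
Proof.
move=> pe; have H := is_derive_fst (smooth_derive ((0, 0, 1) : R * R * R) (nbh_smooth nbh) pe).1.
have H0 : is_derive p ((0, 0, 1) : R * R * R) (fun p => (Phi p).1) 0.
  apply/is_deriveQ; apply/cvgrPdist_le => eps eps0; case: p pe {H} => [[x y] z] [/= ye ze].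
  apply/nbhs_ballP; exists (e - `|z|) => /=; first by rewrite subr_gt0.
  move=> h; rewrite -ball_normE /ball_/= sub0r normrN => hd _.
  have -> : h *: ((0, 0, 1) : R * R * R) + (x, y, z) = (x, y, h + z).
    apply: injective_projections; last by rewrite /= [h *: _]mulr1.
    by apply: injective_projections; rewrite /= scaler0 add0r.
  have he : `|h + z| < e by have := ler_normD h z; lra.
  by rewrite !sheet_cover// subrr scaler0 subrr normr0 ltW.
by rewrite -(@derive_val _ _ _ _ _ _ _ H) (@derive_val _ _ _ _ _ _ _ H0).
Qed.

(** Evaluating the contact condition on the vertical vector identifies the conformal factor with the
    vertical derivative of the height, because [Phi] covers a map of (x, y). *)
Lemma contact_vertical p : tube e p -> Hz p != 0 /\
  forall v : R * R, dheight (v, 0) p = (Phi p).1.2 * ('D_((v, 0) : R * R * R) Phi p).1.1 - Hz p * p.1.2 * v.1.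
Proof.
move=> pe; have [lam Hl] := nbh_contact nbh; have [l0 hl] := Hl p pe.
have lE : Hz p = lam p.
  have := hl (0, 0, 1); have := vertical pe; rewrite /dheight /contact_form.
  move: ('D_(0, 0, 1) Phi p) => d; move: (Phi p) => P d0.
  by rewrite d0 [LHS]/= mulr0 subr0 => ->; rewrite /= mulr0 subr0 mulr1.
rewrite lE; split=> // v.
have := hl (v, 0); rewrite /contact_form /dheight.
move: ('D_(v, 0) Phi p) => d; move: (Phi p) (lam p) => P l.
rewrite [(v, 0).2]/= [(v, 0).1]/= sub0r => h.
by rewrite -[LHS](subrK (P.1.2 * d.1.1)) h; ring.
Qed.

(* In the second difference of B over a small square, l only shows up when
   the horizontal derivative is used: this isolates l (a, 0). *)
Lemma second_difference (X1 X2 y B l : R * R -> R) (a Ya Yb r0 : R) :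
  0 < r0 -> (forall w : R * R, `|w - (a, 0)| < r0 ->
     is_derive w ((1, 0) : R * R) B (y w * X1 w - l w * w.2) /\
     is_derive w ((0, 1) : R * R) B (y w * X2 w)) ->
  cts X1 (a, 0) -> cts X2 (a, 0) -> cts l (a, 0) -> y (a, 0) = 0 -> sd2r y (a, 0) Ya Yb ->
  l (a, 0) = X1 (a, 0) * Yb - Ya * X2 (a, 0).
Proof.
rewrite [Ya * _]mulrC.
move=> r00 HB /ctsP c1 /ctsP c2 /ctsP c3 y0 Hy.
set P := X1 (a, 0); set Q := X2 (a, 0); set T := l (a, 0).
pose M := `|P| + `|Q| + `|Ya| + `|Yb| + 1.
have nP := normr_ge0 P; have nQ := normr_ge0 Q; have nA := normr_ge0 Ya; have nB := normr_ge0 Yb.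
have M1 : 1 <= M by rewrite /M; lra.
have M0 : 0 < M by lra.
have MP : `|P| + 1 <= M by rewrite /M; lra.
have MQ : `|Q| + 1 <= M by rewrite /M; lra.
have MA : `|Ya| + `|Yb| <= M by rewrite /M; lra.
suff H (ep : R) : 0 < ep -> ep <= 1 -> `|P * Yb - Q * Ya - T| <= 9 * M * ep.
  apply/eqP; rewrite eq_sym -subr_eq0 -normr_le0 leNgt; apply/negP; set n := `|_| => n0.
  pose ep := Num.min 1 (n / (18 * M)).
  have ep0 : 0 < ep by rewrite lt_min ltr01 divr_gt0// mulr_gt0.
  have ep1 : ep <= 1 by rewrite ge_min lexx.
  have : ep <= n / (18 * M) by rewrite ge_min lexx orbT.
  rewrite ler_pdivlMr ?mulr_gt0// => h; have := H ep ep0 ep1; rewrite -/n => h'.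
  have e2 : ep * (18 * M) = 2 * (9 * M * ep) by ring.
  by rewrite e2 in h; move: h h' n0; move: (9 * M * ep) (n) => *; lra.
move=> ep0 ep1.
have [d1 d10 H1] := c1 ep ep0; have [d2 d20 H2] := c2 ep ep0; have [d3 d30 H3] := c3 ep ep0.
have [d4 d40 H4] := Hy ep ep0.
pose m := Num.min r0 (Num.min d1 (Num.min d2 (Num.min d3 d4))).
have m0 : 0 < m by rewrite !lt_min r00 d10 d20 d30.
pose s := m / 2.
have s0 : 0 < s by rewrite divr_gt0.
have sm : s < m by exact: half_lt.
have near (x t : R) : a <= x <= a + s -> 0 <= t <= s -> `|(x, t) - ((a, 0) : R * R)| <= s.
  move=> /andP[x1 x2] /andP[t1 t2]; rewrite norm2_le /= subr0 !ler_norml.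
  by apply/andP; split; apply/andP; split; lra.
have nearm (x t : R) : a <= x <= a + s -> 0 <= t <= s -> `|(x, t) - ((a, 0) : R * R)| < m.
  by move=> hx ht; apply: le_lt_trans (near x t hx ht) sm.
have est (x t : R) : a <= x <= a + s -> 0 <= t <= s ->
    [/\ `|X1 (x, t) - P| <= ep, `|X2 (x, t) - Q| <= ep, `|l (x, t) - T| <= ep &
     `|y (x, t) - ((x - a) * Ya + t * Yb)| <= ep * s].
  move=> hx ht; have := nearm x t hx ht; rewrite /m !lt_min => /and5P[_ k1 k2 k3 k4].
  split; [exact: ltW (H1 _ k1)|exact: ltW (H2 _ k2)|exact: ltW (H3 _ k3)|].
  have := H4 (a, 0) (x, t); rewrite subrr normr0 => /(_ d40 k4); rewrite y0 subr0 /= subr0.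
  move=> h; apply: (le_trans h); rewrite ler_wpM2l ?(ltW ep0)//; exact: near.
have oin : 0 <= (0 : R) <= s by rewrite lexx ltW.
have sin_ : 0 <= s <= s by rewrite lexx ltW.
have ain : a <= a <= a + s by rewrite lexx lerDl ltW.
have asin_ : a <= a + s <= a + s by rewrite lexx lerDl ltW.
have dB (x t : R) : a <= x <= a + s -> 0 <= t <= s ->
    is_derive x 1 (fun x : R => B (x, t)) (y (x, t) * X1 (x, t) - l (x, t) * t) /\
    is_derive t 1 (fun t : R => B (x, t)) (y (x, t) * X2 (x, t)).
  move=> hx ht; have := nearm x t hx ht; rewrite /m !lt_min => /and5P[/HB[h1 h2] _ _ _ _].
  split.
    apply: (is_derive_affine (f := B) (i := fun x : R => (x, t)) (u := (1, 0)) _ h1) => h.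
    by apply: injective_projections; rewrite /= ?scaler0 ?add0r.
  apply: (is_derive_affine (f := B) (i := fun t : R => (x, t)) (u := (0, 1)) _ h2) => h.
  by apply: injective_projections; rewrite /= ?scaler0 ?add0r.
have mvt (g dg : R -> R) (x0 : R) : (forall x, x0 <= x <= x0 + s -> is_derive x 1 g (dg x)) ->
    exists2 c : R, x0 <= c <= x0 + s & g (x0 + s) - g x0 = dg c * s.
  move=> H; have x0s : x0 < x0 + s by rewrite ltrDl.
  have [|c|c] := @MVT_segment R g dg x0 (x0 + s) (ltW x0s).
  - by move=> x; rewrite in_itv/= => /andP[? ?]; apply: H; rewrite !ltW.
  - apply: continuous_in_subspaceT => x; rewrite inE/= in_itv/= => xst.
    exact: is_derive_cts (H x xst).
  - by rewrite in_itv/= => cst ->; exists c => //; rewrite addrAC subrr add0r.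
(* The second difference over the square is computed by the mean value theorem in each of the two
   directions. Equating the results replaces the symmetry of second derivatives. *)
have [|xi xin E1] := mvt (fun x => B (x, s) - B (x, 0))
    (fun x => (y (x, s) * X1 (x, s) - l (x, s) * s) - (y (x, 0) * X1 (x, 0) - l (x, 0) * 0)) a.
  by move=> x hx; apply: is_deriveB; [exact: (dB x s hx sin_).1|exact: (dB x 0 hx oin).1].
have [|et etin E2] := mvt (fun t => B (a + s, t) - B (a, t))
    (fun t => y (a + s, t) * X2 (a + s, t) - y (a, t) * X2 (a, t)) 0.
  move=> t; rewrite add0r => ht; apply: is_deriveB; [exact: (dB _ t asin_ ht).2|exact: (dB _ t ain ht).2].
rewrite add0r in etin E2.
have E : (y (xi, s) * X1 (xi, s) - l (xi, s) * s) - (y (xi, 0) * X1 (xi, 0) - l (xi, 0) * 0) =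
    y (a + s, et) * X2 (a + s, et) - y (a, et) * X2 (a, et).
  by apply: (mulIf (lt0r_neq0 s0)); rewrite -E1 -E2; ring.
have [f1 _ f3 f4] := est xi s xin sin_; have [g1 _ _ g4] := est xi 0 xin oin.
have [_ i2 _ i4] := est (a + s) et asin_ etin; have [_ j2 _ j4] := est a et ain etin.
rewrite subrr in j4; rewrite addrAC subrr add0r in i4.
have xin' : 0 <= xi - a <= s by rewrite subr_ge0 lerBlDl.
apply: (second_difference_bound s0 ep0 ep1 xin' etin MP MQ MA M1 f1 g1 i2 j2 f3 f4 g4 i4 j4 E).
Qed.

(** The exterior derivative of the contact condition, read on the zero section: the conformal factor
    there is the Jacobian of the covered immersion. *)
Lemma contact_factor (x : R) : Hz (x, 0, 0) = det2 (D1 (x, 0)) (D2 (x, 0)).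
Proof.
have e0 : 0 < e := nbh_pos nbh.
have x0e : `|((x, 0) : R * R).2| < e by rewrite normr0.
have slice w : `|w - ((x, 0) : R * R)| < e -> `|w.2| < e.
  by rewrite norm2_lt /= subr0 => /andP[].
pose X (w : R * R) := (sheet w).1; pose Y0 := (sheet (x, 0)).2.
pose y (w : R * R) := (sheet w).2 - Y0.
(* Subtracting Y0 times the abscissa makes the coefficient [y] vanish at the base point, as
   [second_difference] requires. *)
pose B (w : R * R) := height (w, 0) - Y0 * X w.
have dX v w : `|w.2| < e -> is_derive w v X (dsheet v w).1.
  by move=> we; exact: is_derive_fst (sheet_derive v we).
have dH v w : `|w.2| < e -> is_derive w v (fun w => height (w, 0)) (dheight (v, 0) (w, 0)).
  move=> we; apply: (is_derive_affine (f := height) (i := fun q : R * R => (q, 0 : R)) (u := (v, 0))).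
    by move=> h; apply: injective_projections => //=; rewrite scaler0 addr0.
  by apply: height_derive; exact: tube0.
have dB v w : `|w.2| < e -> is_derive w v B (y w * (dsheet v w).1 - Hz (w, 0) * w.2 * v.1).
  move=> we; have := is_deriveB (dH v w we) (is_deriveZ Y0 (dX v w we)).
  have [_ cv] := contact_vertical (tube0 we).
  suff -> : y w * (dsheet v w).1 - Hz (w, 0) * w.2 * v.1 = dheight (v, 0) (w, 0) - Y0 *: (dsheet v w).1 by [].
  by rewrite cv /y /dsheet /sheet /GRing.scale/=; ring.
have cD v : cts (fun w => (dsheet v w).1) (x, 0) by apply: c_fst; exact: dsheet_cts.
have cHz : cts (fun w => Hz (w, 0)) (x, 0).
  apply: (c_comp (f := fun q : R * R => (q, 0 : R)) (g := Hz)); first by apply: c_slice; exact: c_id.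
  by apply: dheight_cts; exact: tube0.
have sdY : sd2r y (x, 0) (D1 (x, 0)).2 (D2 (x, 0)).2.
  have /sd2P[_ H] := sheet_sd2 x0e; move=> ep /H[d d0 Hd]; exists d => // w w' h h'.
  by rewrite /y opprB addrA subrK; exact: Hd.
rewrite /det2; apply: (@second_difference (fun w => (D1 w).1) (fun w => (D2 w).1) y B (fun w => Hz (w, 0)) x _ _ e e0 _ (cD _) (cD _) cHz (subrr _) sdY).
move=> w /slice we; split.
  by have := dB (1, 0) w we; rewrite [(1, 0).1]/= mulr1.
by have := dB (0, 1) w we; rewrite [(0, 1).1]/= mulr0 subr0.
Qed.

(** The factor vanishes nowhere in the tube and is a Jacobian, hence positive, on the zero section;
    each point is joined to the zero section by scaling y and z. *)
Lemma contact_pos p : tube e p -> 0 < Hz p.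
Proof.
move=> [pe1 pe2]; pose f (t : R) : R * R * R := (p.1.1, t * p.1.2, t * p.2).
have tf (t : R) : 0 <= t <= 1 -> tube e (f t).
  move=> /andP[t0 t1]; split; rewrite /= normrM (ger0_norm t0).
    by apply: le_lt_trans pe1; rewrite ler_piMl.
  by apply: le_lt_trans pe2; rewrite ler_piMl.
have in1 (x : R) : 0 <= x <= 1 -> 0 <= 1 - x <= 1 by move=> /andP[? ?]; apply/andP; split; lra.
have -> : p = f (1 - 0).
  rewrite subr0 /f !mul1r; by case: (p) => [[? ?] ?].
apply: (@ctsw_ivt R (fun t => Hz (f (1 - t))) 0 1) => //.
- apply: cts_ctsw => t /in1 tin; apply: (c_comp (f := fun t : R => f (1 - t)) (g := Hz)); last exact: dheight_cts (tf _ tin).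
  have cm (c : R) : cts (fun t : R => (1 - t) * c) t.
    by apply: c_mul; [apply: c_sub; [exact: c_cst|exact: c_id]|exact: c_cst].
  by apply: c_pair => //; apply: c_pair => //; exact: c_cst.
- by move=> t /in1 /tf /contact_vertical[h _]; apply/eqP.
- rewrite subrr /f !mul0r contact_factor; apply: sheet_det; rewrite normr0; exact: nbh_pos nbh.
- by rewrite lexx ler01.
Qed.

(** This is what carries the over- and understrands of the braid to those of its closure. *)
Lemma height_mono (x y z z' : R) : `|y| < e -> `|z| < e -> `|z'| < e -> z < z' ->
  height (x, y, z) < height (x, y, z').
Proof.
move=> ye ze ze' zz.
have H (t : R) : `|t - 0| < e -> is_derive t 1 (fun t => height (x, y, t)) (Hz (x, y, t)).
  rewrite subr0 => te; apply: (is_derive_affine (f := height) (i := fun t : R => (x, y, t)) (u := (0, 0, 1))).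
    move=> h; apply: injective_projections => //=.
    by apply: injective_projections; rewrite /= scaler0 add0r.
  by apply: height_derive; split.
have [||c [ce _ E]] := mvt_between H (s := z) (t := z'); rewrite ?subr0//.
rewrite -subr_gt0 E mulr_gt0 ?subr_gt0//; apply: contact_pos; split => //=.
by move: ce; rewrite subr0.
Qed.

End Neighborhood.

(** * Uniform estimates near the core of the annulus *)

Section Uniform.
Context {R : realType} (e : R) (Phi : R * R * R -> R * R * R).
Hypothesis nbh : unknot_neighborhood e Phi.
Local Notation sheet := (sheet Phi).
Local Notation height := (height Phi).
Local Notation D1 := (dsheet Phi (1, 0)).
Local Notation D2 := (dsheet Phi (0, 1)).

Definition core (x : R) : R * R := sheet (x, 0).
(** Velocity of the image of a graph over the x-axis with value [y] and derivative [w] at [x]. *)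
Definition slope (x y w : R) : R * R := D1 (x, y) + w *: D2 (x, y).

Context (dc : R -> R * R) (P Q : R * R) (x0 x1 : R) (tau W : R -> R).
Hypothesis ea : eight_angles core dc P Q x0 x1 tau W.
Definition quadr (p : R * R) : R * R := cmul (p - P) (p - Q).

Lemma e_pos : 0 < e. Proof. exact: nbh_pos nbh. Qed.

Lemma dcE x : dc x = D1 (x, 0).
Proof.
have e0 : `|((x, 0) : R * R).2| < e by rewrite normr0 e_pos.
have H : sd1 (fun t : R => (t, 0) : R * R) x (1, 0).
  move=> ep ep0; exists 1 => // s t _ _.
  have -> : (t, 0) - (s, 0) - (t - s) *: (1, 0) = 0 :> R * R.
    by apply: pair_eta; rewrite /= /GRing.scale/=; ring.
  by rewrite normr0 mulr_ge0// ltW.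
have := sd1_comp (erefl : (fun t : R => (t, 0) : R * R) x = (x, 0)) (sheet_sd2 nbh e0) H.
rewrite [(1, 0).1]/= [(1, 0).2]/= scale1r scale0r addr0 => h.
by rewrite -(sd1_derive1 h) -(sd1_derive1 (ea_sd1 ea x)).
Qed.

Lemma slope0 x : slope x 0 0 = dc x.
Proof. by rewrite /slope scale0r addr0 dcE. Qed.

Lemma c_slope (V : normedModType R) (x y w : V -> R) v :
  cts x v -> cts y v -> cts w v -> `|y v| < e -> cts (fun v => slope (x v) (y v) (w v)) v.
Proof.
move=> cx cy cw ye.
have cD u : cts (fun v => dsheet Phi u (x v, y v)) v.
  apply: (c_comp (f := fun v => (x v, y v)) (g := dsheet Phi u)); first exact: c_pair.
  exact: (dsheet_cts nbh).
by apply: c_add; [exact: cD|apply: c_scale; [exact: cw|exact: cD]].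
Qed.

Lemma c_sheet (V : normedModType R) (x y : V -> R) v :
  cts x v -> cts y v -> `|y v| < e -> cts (fun v => sheet (x v, y v)) v.
Proof.
move=> cx cy ye; apply: (c_comp (f := fun v => (x v, y v)) (g := sheet)); first exact: c_pair.
exact: (sheet_cts nbh).
Qed.

Lemma c_quadr (V : normedModType R) (f : V -> R * R) v : cts f v -> cts (fun v => quadr (f v)) v.
Proof. by move=> cf; apply: c_cmul; apply: c_sub => //; exact: c_cst. Qed.

Lemma dc_pos x : 0 < dot2 (dc x) (dc x).
Proof. by apply: dot2_gt0; exact: ang_neq0 (ea_tau ea x).2. Qed.

Lemma quadr_pos x : 0 < dot2 (quadr (core x)) (quadr (core x)).
Proof. by apply: dot2_gt0; exact: ang_neq0 (ea_W ea x).2. Qed.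

Definition unit_seg : set R := `[0, 1]%classic.

Lemma unit_segP (x : R) : unit_seg x <-> 0 <= x <= 1.
Proof. by rewrite /unit_seg /= in_itv. Qed.

Lemma near_core : exists2 d : R, 0 < d <= e & forall x y w : R, 0 <= x <= 1 -> `|y| < d -> `|w| < d ->
  0 < dot2 (dc x) (slope x y w) /\ 0 < dot2 (quadr (core x)) (quadr (sheet (x, y))).
Proof.
pose Pr (x d : R) := d <= e /\ forall y w : R, `|y| < d -> `|w| < d ->
  0 < dot2 (dc x) (slope x y w) /\ 0 < dot2 (quadr (core x)) (quadr (sheet (x, y))).
have [||d d0 Hd] := @unif_delta R R unit_seg Pr (@segment_compact R 0 1).
- move=> x d d' d'0 dd [de H]; split; first exact: le_trans de.
  by move=> y w yd wd; apply: H; [exact: lt_le_trans dd|exact: lt_le_trans dd].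
- move=> x _.
  have fe : `|((x, 0, 0) : R * R * R).1.2| < e by rewrite normr0 e_pos.
  have cx : cts (fun p : R * R * R => p.1.1) (x, 0, 0) by apply: c_fst; apply: c_fst; exact: c_id.
  have cy : cts (fun p : R * R * R => p.1.2) (x, 0, 0) by apply: c_snd; apply: c_fst; exact: c_id.
  have cw : cts (fun p : R * R * R => p.2) (x, 0, 0) by apply: c_snd; exact: c_id.
  have [r1 r10 H1] : exists2 r : R, 0 < r & forall p : R * R * R, `|p - (x, 0, 0)| < r ->
      0 < dot2 (dc p.1.1) (slope p.1.1 p.1.2 p.2).
    apply: c_pos; last by rewrite /slope /= scale0r addr0 -dcE; exact: dc_pos.
    apply: c_dot; last exact: c_slope.
    by apply: (c_comp (f := fun p : R * R * R => p.1.1) (g := dc)) => //; exact: (ea_cts ea).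
  have [r2 r20 H2] : exists2 r : R, 0 < r & forall p : R * R * R, `|p - (x, 0, 0)| < r ->
      0 < dot2 (quadr (core p.1.1)) (quadr (sheet (p.1.1, p.1.2))).
    apply: c_pos; last exact: quadr_pos.
    apply: c_dot; apply: c_quadr; last exact: c_sheet.
    by apply: c_sheet => //; exact: c_cst.
  exists (Num.min e (Num.min r1 r2)); first by rewrite !lt_min e_pos r10.
  move=> y _ yx; split; first by rewrite ge_min lexx.
  move=> t w; rewrite !lt_min => /and3P[_ t1 t2] /and3P[_ w1 w2].
  move: yx; rewrite !lt_min => /and3P[_ yx1 yx2].
  have nrm (r : R) : `|y - x| < r -> `|t| < r -> `|w| < r -> `|((y, t), w) - ((x, 0), 0)| < r.
    move=> k1 k2 k3; rewrite (_ : `|_| = Num.max `|(y, t) - (x, 0)| `|w - 0|)// gt_max norm2_lt /=.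
    by rewrite !subr0 k1 k2.
  by split; [exact: (H1 (y, t, w) (nrm _ yx1 t1 w1))|exact: (H2 (y, t, w) (nrm _ yx2 t2 w2))].
have K0 : unit_seg (0 : R) by rewrite unit_segP lexx ler01.
exists d; first by rewrite d0 (Hd 0 K0).1.
by move=> x y w xin; apply: (Hd x _).2; rewrite unit_segP.
Qed.

Hypotheses (x0in : 0 < x0 < 1) (x1in : 0 < x1 < 1).

Lemma int_unit (x y : R) (n : int) : 0 < y < 1 -> 0 <= x <= 1 -> x = y + n%:~R -> x = y.
Proof.
move=> /andP[y0 y1] /andP[a0 a1] xy; suff n0 : n = 0 by rewrite xy n0 addr0.
by apply: (@int_small R n 1); rewrite mulr1; lra.
Qed.

(** Compactness in the pair of parameters. Pairs with distinct core points stay distinct nearby;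
    pairs equal modulo the period are handled by local injectivity of the immersion; the remaining
    pairs are the two passages through the double point. *)
Lemma sheet_double (r : R) : 0 < r -> exists2 d : R, 0 < d <= e &
  forall x y x' y' : R, 0 <= x <= 1 -> 0 <= x' <= 1 -> `|y| < d -> `|y'| < d -> sheet (x, y) = sheet (x', y') ->
  [\/ (exists n : int, x' = x + n%:~R) /\ y = y', `|x - x0| < r /\ `|x' - x1| < r | `|x - x1| < r /\ `|x' - x0| < r].
Proof.
move=> r0.
pose Pr (p : R * R) (d : R) := d <= e /\ forall y y' : R, `|y| < d -> `|y'| < d -> sheet (p.1, y) = sheet (p.2, y') ->
  [\/ (exists n : int, p.2 = p.1 + n%:~R) /\ y = y', `|p.1 - x0| < r /\ `|p.2 - x1| < r | `|p.1 - x1| < r /\ `|p.2 - x0| < r].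
pose K : set (R * R) := unit_seg `*` unit_seg.
have [||[a b] [/unit_segP /= ain /unit_segP /= bin]|d d0 Hd] := @unif_delta R (R * R)%type K Pr _.
- exact: compact_setX (@segment_compact R 0 1) (@segment_compact R 0 1).
- move=> p d d' d'0 dd [de H]; split; first exact: le_trans de.
  by move=> y w yd wd; apply: H; [exact: lt_le_trans dd|exact: lt_le_trans dd].
- have [cab|cab] := pselect (core a = core b); last first.
    pose g (p : (R * R) * (R * R)) := sheet (p.1.1, p.1.2) - sheet (p.2.1, p.2.2).
    have cg : cts g ((a, 0), (b, 0)).
      apply: c_sub; apply: c_sheet; rewrite /= ?normr0 ?e_pos//.
      - by apply: c_fst; apply: c_fst; exact: c_id.
      - by apply: c_snd; apply: c_fst; exact: c_id.
      - by apply: c_fst; apply: c_snd; exact: c_id.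
      - by apply: c_snd; apply: c_snd; exact: c_id.
    have [|d d0 Hd] := c_pos (c_dot cg cg).
      by apply: dot2_gt0 => /eqP; rewrite subr_eq0 => /eqP.
    exists (Num.min e d); first by rewrite lt_min e_pos.
    move=> [a' b'] _; rewrite norm2_lt /= !lt_min => /andP[/andP[_ a'd] /andP[_ b'd]].
    split; first by rewrite ge_min lexx.
    move=> y y'; rewrite !lt_min => /andP[_ yd] /andP[_ yd'] E.
    have := Hd ((a', y), (b', y')); rewrite /g /= E subrr /dot2 /= !mulr0 addr0 ltxx => H.
    suff : false by []; apply: H.
    rewrite (_ : `|_| = Num.max `|(a', y) - (a, 0)| `|(b', y') - (b, 0)|)// gt_max !norm2_lt /=.
    by rewrite !subr0 a'd yd b'd yd'.
  have [[n bn]|[n [m [[an bm]|[an bm]]]]] := ea_double ea cab.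
  + have fe : `|((a, 0) : R * R).2| < e by rewrite normr0 e_pos.
    have [k [d [k0 d0 Hk]]] := sd2_bilip (sheet_sd2 nbh fe) (lt0r_neq0 (sheet_det nbh fe)).
    exists (Num.min e d); first by rewrite lt_min e_pos.
    move=> [a' b'] _; rewrite norm2_lt /= !lt_min => /andP[/andP[_ a'd] /andP[_ b'd]].
    split; first by rewrite ge_min lexx.
    move=> y y'; rewrite !lt_min => /andP[ye yd] /andP[ye' yd'] E; apply: Or31.
    have E' : sheet (b' - n%:~R, y') = sheet (a', y).
      by rewrite E -(sheet_period nbh (b' - n%:~R) n ye') subrK.
    have := Hk (a', y) (b' - n%:~R, y'); rewrite E' subrr normr0 !norm2_lt /= !subr0 a'd yd yd' => /(_ isT).
    have -> : b' - n%:~R - a = b' - b by rewrite bn; ring.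
    rewrite b'd => /(_ isT); rewrite pmulr_rle0// normr_le0 subr_eq0 => /eqP[h1 h2].
    by split; [exists n; rewrite -h1 subrK|].
  + have ax := int_unit x0in ain an; have bx := int_unit x1in bin bm.
    exists (Num.min e r); first by rewrite lt_min e_pos.
    move=> [a' b'] _; rewrite norm2_lt /= !lt_min => /andP[/andP[_ a'd] /andP[_ b'd]].
    split; first by rewrite ge_min lexx.
    by move=> y y' _ _ _; apply: Or32; rewrite -ax -bx.
  + have ax := int_unit x1in ain an; have bx := int_unit x0in bin bm.
    exists (Num.min e r); first by rewrite lt_min e_pos.
    move=> [a' b'] _; rewrite norm2_lt /= !lt_min => /andP[/andP[_ a'd] /andP[_ b'd]].
    split; first by rewrite ge_min lexx.
    by move=> y y' _ _ _; apply: Or33; rewrite -ax -bx.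
have K0 : K ((0, 0) : R * R) by split; rewrite unit_segP lexx ler01.
exists d; first by rewrite d0 (Hd _ K0).1.
by move=> x y x' y' xin xin'; apply: (Hd (x, x') _).2; split; apply/unit_segP.
Qed.

Lemma dc_per x : dc (x + 1) = dc x.
Proof.
have h' := @sd1_affine R core 1 1 x; rewrite mul1r in h'.
have {}h' := h' _ (ea_sd1 ea (x + 1)); rewrite scale1r in h'.
have E : (fun t => core (1 * t + 1)) = core by apply/funext => t; rewrite mul1r; have [] := ea_per ea t.
by rewrite E in h'; rewrite -(sd1_derive1 h') -(sd1_derive1 (ea_sd1 ea x)).
Qed.

Let Z0 := height (x0, 0, 0).
Let Z1 := height (x1, 0, 0).

Lemma heights_differ : Z0 <> Z1.
Proof.
move=> ZZ; have [_ _ xx cc] := ea_x ea.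
have te (x : R) : tube e (x, 0, 0) by split; rewrite /= normr0 e_pos.
have [|n] := nbh_inj nbh (te x0) (te x1).
  by apply: injective_projections; [exact: cc|exact: ZZ].
move=> [] /= h; apply: xx; apply/esym; apply: (int_unit x0in _ h).
by have /andP[? ?] := x1in; rewrite !ltW.
Qed.

Lemma turn_det : 0 < det2 (dc x0) (dc x1).
Proof.
rewrite -(ang_sin_gt0 (ea_tau ea x0).2 (ea_tau ea x1).2).
have /andP[h1 h2] := ea_turn ea; move: (tau x1 - tau x0) h1 h2 => D h1 h2.
by rewrite -(sinD2pi D) -[pi *+ 2]mulr_natl; apply: sin_gt0_pi; apply/andP; split; lra.
Qed.

(** All quantities are continuous and have the required sign or value on the core at (x0, x1), so
    one radius serves for all. Half the distance of [x0] and [x1] keeps the two neighborhoods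
    disjoint. *)
Lemma near_double (eta : R) : 0 < eta -> exists2 r : R, 0 < r <= `|x1 - x0| / 2 &
  forall x y w z x' y' w' z' : R, `|x - x0| < r -> `|x' - x1| < r -> `|y| < r -> `|w| < r -> `|z| < r ->
   `|y'| < r -> `|w'| < r -> `|z'| < r ->
  [/\ 0 < det2 (slope x y w) (slope x' y' w'),
   `|(tau x' - tau x) - (tau x1 - tau x0)| < eta, `|(W x' - W x) + 2 * pi| < eta &
   0 < (height (x', y', z') - height (x, y, z)) * (Z1 - Z0)].
Proof.
move=> eta0; have h0 : 0 < eta / 2 by rewrite divr_gt0.
have [t0 t00 T0] := (ctsP _ _).1 (ea_tau ea x0).1 _ h0.
have [t1 t10 T1] := (ctsP _ _).1 (ea_tau ea x1).1 _ h0.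
have [w0 w00 W0] := (ctsP _ _).1 (ea_W ea x0).1 _ h0.
have [w1 w10 W1] := (ctsP _ _).1 (ea_W ea x1).1 _ h0.
have te (x : R) : tube e (x, 0, 0) by split; rewrite /= normr0 e_pos.
have zz : 0 < `|Z1 - Z0| / 2.
  by rewrite divr_gt0// normr_gt0 subr_eq0; apply/negP => /eqP h; exact: heights_differ.
have [k0 k00 K0] := (ctsP _ _).1 (height_cts nbh (te x0)) _ zz.
have [k1 k10 K1] := (ctsP _ _).1 (height_cts nbh (te x1)) _ zz.
pose g (p : (R * R * R) * (R * R * R)) := det2 (slope p.1.1.1 p.1.1.2 p.1.2) (slope p.2.1.1 p.2.1.2 p.2.2).
have [||l l0 Hl] := @c_pos R _ g ((x0, 0, 0), (x1, 0, 0)).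
- apply: c_det; apply: c_slope; rewrite /= ?normr0 ?e_pos//.
  - by apply: c_fst; apply: c_fst; apply: c_fst; exact: c_id.
  - by apply: c_snd; apply: c_fst; apply: c_fst; exact: c_id.
  - by apply: c_snd; apply: c_fst; exact: c_id.
  - by apply: c_fst; apply: c_fst; apply: c_snd; exact: c_id.
  - by apply: c_snd; apply: c_fst; apply: c_snd; exact: c_id.
  - by apply: c_snd; apply: c_snd; exact: c_id.
- by rewrite /g [_.1]/= [_.2]/= !slope0; exact: turn_det.
have xx : 0 < `|x1 - x0| / 2.
  by have [_ _ h _] := ea_x ea; rewrite divr_gt0// normr_gt0 subr_eq0; apply/negP => /eqP /esym.
exists (Num.min (`|x1 - x0| / 2) (Num.min l (Num.min (Num.min t0 t1) (Num.min (Num.min w0 w1) (Num.min k0 k1))))).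
  by rewrite !lt_min xx l0 t00 t10 w00 w10 k00 k10 ge_min lexx.
move=> x y w z x' y' w' z'; rewrite !lt_min.
move=> /and3P[_ xl /and3P[/andP[xt _] /andP[xw _] /andP[xk _]]].
move=> /and3P[_ xl' /and3P[/andP[_ xt'] /andP[_ xw'] /andP[_ xk']]].
move=> /and3P[_ yl /and3P[_ _ /andP[yk _]]] /and3P[_ wl _] /and3P[_ _ /and3P[_ _ /andP[zk _]]].
move=> /and3P[_ yl' /and3P[_ _ /andP[_ yk']]] /and3P[_ wl' _] /and3P[_ _ /and3P[_ _ /andP[_ zk']]].
have nrm (a b c a0 r : R) : `|a - a0| < r -> `|b| < r -> `|c| < r -> `|((a, b), c) - ((a0, 0), 0)| < r.
  move=> h1 h2 h3; rewrite (_ : `|_| = Num.max `|(a, b) - (a0, 0)| `|c - 0|)// gt_max norm2_lt /=.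
  by rewrite !subr0 h1 h2 h3.
have tri (a b a0 b0 c : R) : `|a - a0| < c / 2 -> `|b - b0| < c / 2 -> `|(b - a) - (b0 - a0)| < c.
  by rewrite !ltr_norml => /andP[? ?] /andP[? ?]; apply/andP; split; lra.
split.
- apply: (Hl ((x, y, w), (x', y', w'))).
  rewrite (_ : `|_| = Num.max `|(x, y, w) - (x0, 0, 0)| `|(x', y', w') - (x1, 0, 0)|)// gt_max.
  by rewrite !nrm.
- by apply: tri; [exact: T0|exact: T1].
- by have := tri _ _ _ _ _ (W0 x xw) (W1 x' xw'); rewrite (ea_wind ea) opprK.
have := tri _ _ _ _ _ (K0 (x, y, z) (nrm _ _ _ _ _ xk yk zk)) (K1 (x', y', z') (nrm _ _ _ _ _ xk' yk' zk')).
rewrite -/Z0 -/Z1; move: (height _ - _) (Z1 - Z0) zz => a b; case: (ltrP 0 b) => b0 _.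
  rewrite (gtr0_norm b0) ltr_norml => /andP[h1 h2]; rewrite mulr_gt0//; lra.
move=> h; have bn : b < 0.
  by rewrite lt_neqAle b0 andbT; apply/negP => /eqP b1; move: h; rewrite b1 normr0 ltNge normr_ge0.
by move: h; rewrite (ltr0_norm bn) ltr_norml => /andP[h1 h2]; rewrite nmulr_rgt0//; lra.
Qed.

End Uniform.

(** * Scaling factors that bring the strands close to the core *)

Section Scale.
Context {R : realType}.

Lemma smooth_derive1 (f : R -> R) : smooth_on f setT -> smooth_on (derive1 f : R -> R) setT.
Proof.
move=> sf n; have := sf n.+1 => /= -[_ /(_ 1)[_ H]].
by have -> : (derive1 f : R -> R) = 'D_1 f by apply/funext => x; rewrite derive1E.
Qed.

Lemma segment_bounded (f : R -> R) : (forall x, cts f x) ->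
  exists2 d : R, 0 < d & forall x : R, 0 <= x <= 1 -> `|f x| * d < 1.
Proof.
move=> cf; have [||d d0 Hd] := @unif_delta R R `[0, 1]%classic (fun x d => `|f x| * d < 1) (@segment_compact R 0 1).
- by move=> x d d' d'0 dd; apply: le_lt_trans; rewrite ler_wpM2l.
- move=> x _; have [r r0 Hr] := (ctsP _ _).1 (cf x) 1 ltr01.
  have p0 : 0 < `|f x| + 1 by rewrite ltr_wpDl.
  exists (Num.min r (`|f x| + 1)^-1); first by rewrite lt_min r0 invr_gt0.
  move=> y _; rewrite lt_min => /andP[/Hr yx _].
  have fy : `|f y| < `|f x| + 1 by have := ler_normD (f y - f x) (f x); rewrite subrK; lra.
  set m := Num.min _ _.
  have m0 : 0 < m by rewrite lt_min r0 invr_gt0.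
  apply: (@lt_le_trans _ _ ((`|f x| + 1) * m)); first by rewrite ltr_pM2r.
  have : m <= (`|f x| + 1)^-1 by rewrite ge_min lexx orbT.
  by move=> h; apply: (le_trans (ler_wpM2l (ltW p0) h)); rewrite divff ?gt_eqF.
by exists d => // x xin; apply: Hd; rewrite /= in_itv.
Qed.

Lemma small_scale (N : nat) (z : 'I_N -> R -> R) (d : R) : (forall i, smooth_on (z i : R -> R) setT) -> 0 < d ->
  exists2 sc0 : R, 0 < sc0 & forall sc : R, 0 < sc -> sc < sc0 -> forall i (x : R), 0 <= x <= 1 ->
  [/\ `|sc * z i x| < d, `|sc * derive1 (z i) x| < d & `|sc * derive1 (derive1 (z i)) x| < d].
Proof.
move=> sz d0.
have B f : smooth_on (f : R -> R) setT -> exists2 c : R, 0 < c & forall sc : R, 0 < sc -> sc < c ->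
    forall x : R, 0 <= x <= 1 -> `|sc * f x| < d.
  move=> sf; have [c c0 Hc] := segment_bounded (fun x => smooth_cts sf (I : setT x)).
  exists (d * c); first by rewrite mulr_gt0.
  move=> sc s0 sdc x /Hc fx; rewrite normrM (gtr0_norm s0).
  have [f0|f0] := eqVneq (`|f x|) 0; first by rewrite f0 mulr0.
  have fp : 0 < `|f x| by rewrite lt_def f0 normr_ge0.
  have : sc * `|f x| < d * c * `|f x| by rewrite ltr_pM2r.
  move=> h; apply: (lt_le_trans h); rewrite -mulrA ger_pMr// mulrC ltW//.
have H i : exists c : R, 0 < c /\ forall sc : R, 0 < sc -> sc < c -> forall x : R, 0 <= x <= 1 ->
    [/\ `|sc * z i x| < d, `|sc * derive1 (z i) x| < d & `|sc * derive1 (derive1 (z i)) x| < d].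
  have s1 := smooth_derive1 (sz i); have s2 := smooth_derive1 s1.
  have [a a0 Ha] := B _ (sz i); have [b b0 Hb] := B _ s1; have [c c0 Hc] := B _ s2.
  exists (Num.min a (Num.min b c)); split; first by rewrite !lt_min a0 b0.
  move=> sc s0; rewrite !lt_min => /and3P[sa sb sc'] x xin.
  by split; [exact: Ha|exact: Hb|exact: Hc].
have [cc Hcc] := choice H.
have [c c0 Hc] := @seq_min R _ (enum 'I_N) cc (fun i _ => (Hcc i).1).
exists c => // sc s0 sc_c i x xin; apply: (Hcc i).2 => //.
by apply: lt_le_trans sc_c _; apply: Hc; rewrite mem_enum.
Qed.

End Scale.

Section Ranges.
Context {R : realType}.

(** The margin keeps [t] in ]- 2 pi, - pi[; the two tilts add less than pi, and the positive sine
    brings the total back into the same interval. *)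
Lemma turn_range (D0 t a a' : R) : - (2 * pi) < D0 < - pi -> `|t - D0| < D0 + 2 * pi ->
  `|t - D0| < - pi - D0 -> `|a| < pi / 2 -> `|a'| < pi / 2 -> 0 < sin (t + (a' - a)) ->
  - (2 * pi) < t + (a' - a) < - pi.
Proof.
rewrite !ltr_norml => /andP[? ?] /andP[? ?] /andP[? ?] /andP[? ?] /andP[? ?] s0.
have s2 : 0 < sin (t + (a' - a) + 2 * pi) by rewrite [2 * pi]mulr_natl sinD2pi.
have [||? ?] := sin_gt0_lt s2; [lra|lra|].
by apply/andP; split; lra.
Qed.

Lemma wind_range (t a a' : R) (n : int) : `|t + 2 * pi| < pi -> `|a| < pi / 2 -> `|a'| < pi / 2 ->
  t + (a' - a) = n%:~R * (2 * pi) -> t + (a' - a) = - (2 * pi).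
Proof.
rewrite !ltr_norml => /andP[? ?] /andP[? ?] /andP[? ?] E.
have E2 : (n + 1)%:~R * (2 * pi) = t + (a' - a) + 2 * pi by rewrite intrD E; ring.
have n1 : n + 1 = 0.
  by apply: (@int_small R _ (2 * pi)); rewrite E2; lra.
by move: E2; rewrite n1 mul0r; lra.
Qed.

Lemma atan_bound (x : R) : `|atan x| < pi / 2.
Proof. by rewrite ltr_norml atan_gtNpi2 atan_ltpi2. Qed.

Lemma regroup (a b c d : R) : (a + b) - (c + d) = (a - c) + (b - d).
Proof. by ring. Qed.

Lemma same_sign (a b c d : R) : a < b -> 0 < (b - a) * (d - c) -> c < d.
Proof. by move=> ab; rewrite pmulr_rgt0 subr_gt0. Qed.

Lemma det2_shear (A B : R * R) (s t : R) : det2 (A + s *: B) (A + t *: B) = (t - s) * det2 A B.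
Proof. by rewrite /det2/= /GRing.scale/=; ring. Qed.

Lemma flip_range (a b : R) : - (2 * pi) < b - a < - pi -> 0 < - pi + (a - b) < pi.
Proof. by move=> /andP[? ?]; apply/andP; split; lra. Qed.

Lemma double_range (D : R) : - (2 * pi) < D < - pi -> 0 < 2 * pi + D < pi.
Proof. by move=> /andP[? ?]; apply/andP; split; lra. Qed.

Lemma braid_range (t a a' : R) : `|a| < pi / 2 -> `|a'| < pi / 2 -> 0 < sin ((t + a') - (t + a)) ->
  0 < pi + ((t + a) - (t + a')) < pi.
Proof.
have p0 := @pi_gt0 R.
rewrite !ltr_norml => /andP[? ?] /andP[? ?] sn; have [||? ?] := sin_gt0_lt sn; [lra|lra|].
by apply/andP; split; lra.
Qed.

Lemma sdr_scale (f : R -> R) (x a c : R) : sdr f x a -> sdr (fun t => c * f t) x (c * a).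
Proof.
move=> H e e0; have c1 : 0 < `|c| + 1 by rewrite ltr_wpDl.
have [|d d0 Hd] := H (e / (`|c| + 1)); first by rewrite divr_gt0.
exists d => // s t hs ht; have := Hd s t hs ht => h.
have -> : c * f t - c * f s - (t - s) * (c * a) = c * (f t - f s - (t - s) * a) by ring.
rewrite normrM; apply: (le_trans (ler_wpM2l (normr_ge0 c) h)).
rewrite mulrA ler_wpM2r// mulrCA ger_pMr// ler_pdivrMr// mul1r lerDl//.
Qed.

Lemma sdr_id (x : R) : sdr (fun t => t) x 1.
Proof. by move=> e e0; exists 1 => // s t _ _; rewrite mulr1 subrr normr0 mulr_ge0// ltW. Qed.

Lemma sd1_near (f g : R -> R * R) (x r : R) a : 0 < r -> (forall t, `|t - x| < r -> f t = g t) ->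
  sd1 f x a -> sd1 g x a.
Proof.
move=> r0 fg H e e0; have [d d0 Hd] := H e e0; exists (Num.min d r); first by rewrite lt_min d0.
move=> s t; rewrite !lt_min => /andP[sd sr] /andP[td tr].
by rewrite -!fg//; exact: Hd.
Qed.

End Ranges.

(** * Crossings of the closure *)

Section Closure.
Context {R : realType} (N : nat) (beta : seq 'I_N.-1) (z : 'I_N -> R -> R) (mu : {perm 'I_N})
  (xs : 'I_(size beta) -> R) (e : R) (Phi : R * R * R -> R * R * R) (b' b sc d : R)
  (ov un : closure_chord N (size beta) -> 'I_N * R).
Let L := closure_diagram Phi z mu b' b sc ov un.
Hypotheses (rep : represents beta z mu xs) (nbh : unknot_neighborhood e Phi).
Hypotheses (sc0 : 0 < sc) (de : d <= e).
Hypothesis small : forall i (x : R), 0 <= x <= 1 ->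
  [/\ `|sc * z i x| < d, `|sc * derive1 (z i) x| < d & `|sc * derive1 (derive1 (z i)) x| < d].
Local Notation ys i x := (sc * derive1 (z i) x).
Local Notation ws i x := (sc * derive1 (derive1 (z i)) x).
Local Notation sheet := (sheet Phi).
Local Notation height := (height Phi).
Local Notation slope := (slope Phi).

Lemma strand_sheet i x : 0 <= x <= 1 -> xyS L i x = sheet (x, ys i x).
Proof.
move=> xin; have [h1 h2 _] := small i xin.
by rewrite /xyS /=; apply: (sheet_cover nbh); exact: lt_le_trans de.
Qed.

Lemma strand_tangent i x : 0 <= x <= 1 -> tangent L (i, x) = slope x (ys i x) (ws i x).
Proof.
move=> xin; have [h1 h2 _] := small i xin.
have s0 := rep_smooth rep i; have s1 := smooth_derive1 s0.
have ye : `|((x, ys i x) : R * R).2| < e by exact: lt_le_trans de.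
have sG : sd1 (fun t : R => (t, ys i t) : R * R) x (1, ws i x).
  by apply/sd1P; split; [exact: sdr_id|apply: sdr_scale; exact: smooth_sdr].
have H := sd1_comp (erefl : (fun t : R => (t, ys i t) : R * R) x = (x, ys i x)) (sheet_sd2 nbh ye) sG.
rewrite [(1, ws i x).1]/= [(1, ws i x).2]/= scale1r in H.
apply: (@sd1_derive1 R (xyS L i)).
have cb (f : R -> R) : smooth_on (f : R -> R) setT -> `|sc * f x| < d -> exists2 r : R, 0 < r & forall t : R, `|t - x| < r -> `|sc * f t| < e.
  move=> sf fx; have cf : cts (fun t => e - `|sc * f t|) x.
    apply: c_sub; first exact: c_cst; apply: c_norm; apply: c_mul; first exact: c_cst.
    exact: smooth_cts sf I.
  have [|r r0 Hr] := c_pos cf; first by rewrite subr_gt0 (lt_le_trans fx).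
  by exists r => // t /Hr; rewrite subr_gt0.
have [r1 r10 Hr1] := cb _ s0 h1; have [r2 r20 Hr2] := cb _ s1 h2.
apply: (@sd1_near R (fun t => sheet (t, ys i t)) _ x (Num.min r1 r2) _ _ _ H).
  by rewrite lt_min r10.
move=> t; rewrite lt_min => /andP[/Hr1 t1 /Hr2 t2].
by rewrite /xyS /= (sheet_cover nbh).
Qed.

Variables (dc : R -> R * R) (P Q : R * R) (x0 x1 : R) (tau W : R -> R) (r eta : R).
Hypothesis ea : eight_angles (core Phi) dc P Q x0 x1 tau W.
Hypotheses (x0in : 0 < x0 < 1) (x1in : 0 < x1 < 1).
Hypothesis lab : closure_labels xs L.
Local Notation quadr := (quadr P Q).
Local Notation core := (core Phi).
Hypothesis Hcore : forall x y w : R, 0 <= x <= 1 -> `|y| < d -> `|w| < d ->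
  0 < dot2 (dc x) (slope x y w) /\ 0 < dot2 (quadr (core x)) (quadr (sheet (x, y))).
Hypothesis Hdouble : forall x y x' y' : R, 0 <= x <= 1 -> 0 <= x' <= 1 -> `|y| < d -> `|y'| < d ->
  sheet (x, y) = sheet (x', y') ->
  [\/ (exists n : int, x' = x + n%:~R) /\ y = y', `|x - x0| < r /\ `|x' - x1| < r | `|x - x1| < r /\ `|x' - x0| < r].
Hypotheses (rx : r <= `|x1 - x0| / 2) (dr : d <= r).
Hypotheses (eta_pi : eta <= pi) (eta_l : eta <= tau x1 - tau x0 + 2 * pi) (eta_r : eta <= - pi - (tau x1 - tau x0)).
Let Z0 := height (x0, 0, 0).
Let Z1 := height (x1, 0, 0).
Hypothesis Hnear : forall x y w z x' y' w' z' : R, `|x - x0| < r -> `|x' - x1| < r -> `|y| < r -> `|w| < r -> `|z| < r ->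
   `|y'| < r -> `|w'| < r -> `|z'| < r ->
  [/\ 0 < det2 (slope x y w) (slope x' y' w'),
   `|(tau x' - tau x) - (tau x1 - tau x0)| < eta, `|(W x' - W x) + 2 * pi| < eta &
   0 < (height (x', y', z') - height (x, y, z)) * (Z1 - Z0)].
Let gen := lab_generic lab.

(** Angle from the core to the strand, below a quarter turn: added to the periodic angle of the core
    it gives one for the strand. [shift] does the same for the winding. *)
Definition tilt i x : R := atan (det2 (dc x) (tangent L (i, x)) / dot2 (dc x) (tangent L (i, x))).
Definition shift i x : R :=
  atan (det2 (quadr (core x)) (quadr (xyS L i x)) / dot2 (quadr (core x)) (quadr (xyS L i x))).

Lemma tangent_per i x : tangent L (i, x + 1) = tangent L (mu i, x).
Proof. exact: (tangent_period gen). Qed.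

Lemma xyS_per i x : xyS L i (x + 1) = xyS L (mu i) x.
Proof. by rewrite /xyS (gen_closed gen). Qed.

Lemma tilt_bound i x : `|tilt i x| < pi / 2. Proof. exact: atan_bound. Qed.
Lemma shift_bound i x : `|shift i x| < pi / 2. Proof. exact: atan_bound. Qed.

Lemma strand_pos i x : 0 < dot2 (dc x) (tangent L (i, x)) /\ 0 < dot2 (quadr (core x)) (quadr (xyS L i x)).
Proof.
have [j [y [n [/andP[y0 y1] _ H]]]] := periodic_norm mu i x.
have F1 i' x' : (0 < dot2 (dc (x' + 1)) (tangent L (i', x' + 1))) = (0 < dot2 (dc x') (tangent L (mu i', x'))).
  by rewrite (dc_per ea) tangent_per.
have F2 i' x' : (0 < dot2 (quadr (core (x' + 1))) (quadr (xyS L i' (x' + 1)))) =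
    (0 < dot2 (quadr (core x')) (quadr (xyS L (mu i') x'))).
  by rewrite xyS_per; have [-> _ _] := ea_per ea x'.
have := H bool (fun i x => 0 < dot2 (quadr (core x)) (quadr (xyS L i x))) F2 0.
have := H bool (fun i x => 0 < dot2 (dc x) (tangent L (i, x))) F1 0.
rewrite !addr0 => -> ->.
have yin : 0 <= y <= 1 by rewrite y0 ltW.
have [_ h2 h3] := small j yin.
by rewrite (strand_tangent j yin) (strand_sheet j yin); exact: Hcore.
Qed.

Lemma tilt_ang i x : ang (tau x + tilt i x) (tangent L (i, x)).
Proof. by apply: ang_atan; [exact: (strand_pos i x).1|exact: (ea_tau ea x).2]. Qed.

Lemma shift_ang i x : ang (W x + shift i x) (quadr (xyS L i x)).
Proof. by apply: ang_atan; [exact: (strand_pos i x).2|exact: (ea_W ea x).2]. Qed.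

Lemma tilt_cts i (x : R) : cts (fun x => tau x + tilt i x) x.
Proof.
have c1 : cts dc x by exact: (ea_cts ea).
have c2 := (xyS_sd1 gen i x).2.
apply: c_add; first exact: (ea_tau ea x).1.
apply: c_atan; apply: c_mul; first exact: c_det.
by apply: c_inv; [rewrite gt_eqF// (strand_pos i x).1|exact: c_dot].
Qed.

Lemma shift_cts i (x : R) : cts (fun x => W x + shift i x) x.
Proof.
have c1 : cts (fun x => quadr (core x)) x by apply: c_quadr; exact: sd1_cts (ea_sd1 ea x).
have c2 : cts (fun x => quadr (xyS L i x)) x by apply: c_quadr; exact: sd1_cts (xyS_sd1 gen i x).1.
apply: c_add; first exact: (ea_W ea x).1.
apply: c_atan; apply: c_mul; first exact: c_det.
by apply: c_inv; [rewrite gt_eqF// (strand_pos i x).2|exact: c_dot].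
Qed.

Lemma tilt_per i x : tau (x + 1) + tilt i (x + 1) = tau x + tilt (mu i) x.
Proof. by have [_ tp _] := ea_per ea x; rewrite tp /tilt (dc_per ea) tangent_per. Qed.

Lemma shift_per i x : W (x + 1) + shift i (x + 1) = W x + shift (mu i) x.
Proof. by have [cx _ wp] := ea_per ea x; rewrite wp /shift cx xyS_per. Qed.

Lemma far_apart x : `|x - x0| < r -> `|x - x1| < r -> False.
Proof.
move=> h1 h2; have := ler_normD (x1 - x) (x - x0); rewrite addrA subrK [`|x1 - x|]distrC => h.
by have := rx; lra.
Qed.

Lemma in_seg (x : R) : 0 <= x < 1 -> 0 <= x <= 1.
Proof. by move=> /andP[-> /ltW]. Qed.

Lemma same_level i j x : 0 <= x < 1 -> xyS L i x = xyS L j x -> derive1 (z i) x = derive1 (z j) x.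
Proof.
move=> /in_seg xin; rewrite !strand_sheet// => E.
have [_ yi _] := small i xin; have [_ yj _] := small j xin.
have [[_ h]|[h1 h2]|[h1 h2]] := Hdouble xin xin yi yj E.
- by apply: (mulfI (lt0r_neq0 sc0)).
- by have := far_apart h1 h2.
- by have := far_apart h2 h1.
Qed.

Lemma strand_height i x : (pt L (i, x)).2 = height (x, ys i x, sc * z i x).
Proof. by []. Qed.

(** [rep_crossing] names the only pair of strands that meet at [xs k], and [height_mono] shows that
    the one with larger z is the upper one in the closure. *)
Lemma braid_pair k i j : xyS L i (xs k) = xyS L j (xs k) -> (pt L (j, xs k)).2 < (pt L (i, xs k)).2 ->
  derive1n 2 (z i) (xs k) < derive1n 2 (z j) (xs k) /\
  forall i' j', i' != j' -> xyS L i' (xs k) = xyS L j' (xs k) -> (i' = i /\ j' = j) \/ (i' = j /\ j' = i).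
Proof.
move=> E hh; have /andP[k0 k1] := rep_range rep k.
have kin : 0 <= xs k < 1 by rewrite ltW.
have [i0 [j0 [_ lt2 ltz uniq _]]] := rep_crossing rep k.
have ij : i != j by apply/negP => /eqP ije; move: hh; rewrite ije ltxx.
have [[ii jj]|[ii jj]] := uniq i j ij (same_level kin E); subst i j.
  split=> // i' j' nij /(same_level kin); exact: uniq.
exfalso; move: hh; rewrite !strand_height.
have [zi yi _] := small i0 (in_seg kin); have [zj _ _] := small j0 (in_seg kin).
have -> : ys j0 (xs k) = ys i0 (xs k) by rewrite (same_level kin E).
have lt (y : R) : `|y| < d -> `|y| < e by move=> h; exact: lt_le_trans de.
have := @height_mono R e Phi nbh (xs k) (ys i0 (xs k)) _ _ (lt _ yi) (lt _ zj) (lt _ zi).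
rewrite ltr_pM2l// => /(_ ltz) h1 h2; by have := lt_trans h1 h2; rewrite ltxx.
Qed.

Lemma chord_pts c : [/\ 0 <= (over L c).2 < 1, 0 <= (under L c).2 < 1,
  xyS L (over L c).1 (over L c).2 = xyS L (under L c).1 (under L c).2 &
  (pt L (under L c)).2 < (pt L (over L c)).2].
Proof.
have [[ovl ovr] [unl unr]] := gen_on gen c; have [h1 h2] := gen_chord gen c.
by rewrite ovl ovr unl unr; split.
Qed.

(** Both velocities have the same horizontal part, so their determinant is the difference of the
    second derivatives of the fronts times a positive Jacobian. *)
Lemma braid_det l : 0 < det2 (tangent L (over L (inl l))) (tangent L (under L (inl l))).
Proof.
have [ovin unin E hh] := chord_pts (inl l); have [ovl unl] := lab_braid lab l.
move: ovl unl ovin unin E hh; case: (over L _) => i x; case: (under L _) => j x' /= -> -> xin _ E hh.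
have [lt2 _] := braid_pair E hh; have yy := same_level xin E.
rewrite !strand_tangent ?in_seg// -yy /slope.
have [_ yi _] := small i (in_seg xin).
have := @sheet_det R e Phi nbh (xs l, ys i (xs l)) (lt_le_trans yi de).
have lt2' : ws i (xs l) < ws j (xs l) by rewrite ltr_pM2l.
move: (dsheet _ _ _) (dsheet _ _ _) => B A AB.
have -> : det2 (A + ws i (xs l) *: B) (A + ws j (xs l) *: B) = (ws j (xs l) - ws i (xs l)) * det2 A B.
  exact: det2_shear.
by rewrite mulr_gt0// subr_gt0.
Qed.

(** A chord with both ends over the same parameter would sit at a crossing of the braid, which
    already carries a label, and distinct chords have distinct double points. *)
Lemma eight_apart i j x y : over L (inr (i, j)) = (i, x) -> under L (inr (i, j)) = (j, y) -> x <> y.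
Proof.
move=> oE uE xy; have [xin _ E hh] := chord_pts (inr (i, j)).
rewrite oE uE -xy [_.1]/= [_.2]/= in xin E hh.
have ij : i != j by apply/negP => /eqP ije; move: hh; rewrite ije ltxx.
have [k xk] := rep_only rep xin ij (same_level xin E).
have [_ _ E' hh'] := chord_pts (inl k); have [ovl unl] := lab_braid lab k.
have pE : (pt L (over L (inl k))).1 = (pt L (over L (inr (i, j)))).1.
  have hk : (pt L ((under L (inl k)).1, xs k)).2 < (pt L ((over L (inl k)).1, xs k)).2.
    by rewrite -{1}unl -ovl -!surjective_pairing.
  rewrite ovl unl in E'; have [_ H] := braid_pair E' hk.
  rewrite oE xk; change (xyS L (over L (inl k)).1 (over L (inl k)).2 = xyS L i (xs k)); rewrite ovl.
  rewrite xk in E.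
  by have [[-> _]|[-> _]] := H i j ij E.
by have := gen_double gen pE.
Qed.

Lemma eight_range i x j y : 0 <= x < 1 -> 0 <= y < 1 -> xyS L i x = xyS L j y ->
  `|x - x0| < r -> `|y - x1| < r ->
  [/\ - (2 * pi) < (tau y + tilt j y) - (tau x + tilt i x) < - pi,
     (W y + shift j y) - (W x + shift i x) = - (2 * pi) &
     0 < ((pt L (j, y)).2 - (pt L (i, x)).2) * (Z1 - Z0)].
Proof.
move=> /in_seg xin /in_seg yin E hx hy.
have [a1 a2 a3] := small i xin; have [b1 b2 b3] := small j yin.
have lt (t : R) : `|t| < d -> `|t| < r by move=> h; exact: lt_le_trans dr.
have [h1 h2 h3 h4] := Hnear hx hy (lt _ a2) (lt _ a3) (lt _ a1) (lt _ b2) (lt _ b3) (lt _ b1).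
have E1 : (tau y + tilt j y) - (tau x + tilt i x) = (tau y - tau x) + (tilt j y - tilt i x) by exact: regroup.
have E2 : (W y + shift j y) - (W x + shift i x) = (W y - W x) + (shift j y - shift i x) by exact: regroup.
split => //.
- rewrite E1; apply: (turn_range (ea_turn ea)).
  + exact: lt_le_trans h2 eta_l.
  + exact: lt_le_trans h2 eta_r.
  + exact: tilt_bound.
  + exact: tilt_bound.
  + by rewrite -E1 (ang_sin_gt0 (tilt_ang i x) (tilt_ang j y)) !strand_tangent.
- have := shift_ang j y; rewrite -E => aj.
  have [n hn] := ang_uniq aj (shift_ang i x).
  rewrite E2 in hn *; apply: (wind_range (lt_le_trans h3 eta_pi) _ _ hn); exact: shift_bound.
Qed.

(** [Z0] and [Z1] are the heights of the core on its two passages through the double point; by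
    closeness, the N^2 crossings around it inherit their order. *)
Definition turn_jump (c : closure_chord N (size beta)) : int :=
  if c is inl _ then 1 else if Z0 < Z1 then 2 else - 1.
Definition wind_jump (c : closure_chord N (size beta)) : int :=
  if c is inl _ then 0 else if Z0 < Z1 then 1 else - 1.

Lemma jump_relation c : turn_jump c = 1 + (if Z0 < Z1 then 1 else 2) * wind_jump c.
Proof. by rewrite /turn_jump /wind_jump; case: c => // _; case: ifP. Qed.

(** At a crossing of the braid the two angles differ from a common core angle by less than a quarter
    turn. At a crossing of the figure-eight one end is near [x0] and the other near [x1], and the
    sign of Z1 - Z0 tells near which of them the overstrand is. *)
Lemma chord_jumps c : let o := over L c in let u := under L c in
  0 < (turn_jump c)%:~R * pi + ((tau o.2 + tilt o.1 o.2) - (tau u.2 + tilt u.1 u.2)) < pi /\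
  (W u.2 + shift u.1 u.2) - (W o.2 + shift o.1 o.2) = (wind_jump c)%:~R * (2 * pi).
Proof.
have p0 := @pi_gt0 R.
have [ovin unin E hh] := chord_pts c; case: c ovin unin E hh => [l|[i j]].
  have [ovl unl] := lab_braid lab l; have := braid_det l.
  move: ovl unl; case: (over L _) => i x; case: (under L _) => j x' /= -> -> dp xin _ E hh.
  have sn : 0 < sin ((tau (xs l) + tilt j (xs l)) - (tau (xs l) + tilt i (xs l))).
    by rewrite (ang_sin_gt0 (tilt_ang i _) (tilt_ang j _)).
  have := shift_ang j (xs l); rewrite -E => aj.
  split; first by rewrite mul1r; apply: braid_range sn; exact: tilt_bound.
  rewrite mul0r; apply/eqP; rewrite subr_eq0; apply/eqP.
  apply: (ang_uniq_lt aj (shift_ang i _)).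
  move: (shift_bound i (xs l)) (shift_bound j (xs l)); rewrite !ltr_norml => /andP[? ?] /andP[? ?].
  by apply/andP; split; lra.
have [ovi unj] := lab_fig8 lab i j; have ap := @eight_apart i j.
move: ovi unj ap; case: (over L _) => i' x; case: (under L _) => j' y /= -> -> ap xin yin E hh.
have [_ yi _] := small i (in_seg xin); have [_ yj _] := small j (in_seg yin).
have E' := E; rewrite !strand_sheet ?in_seg// in E'.
have [[[n xy] _]|[hx hy]|[hx hy]] := Hdouble (in_seg xin) (in_seg yin) yi yj E'.
- have n0 : n = 0.
    apply: (@int_small R n 1); move: xin yin => /andP[? ?] /andP[? ?]; rewrite mulr1; lra.
  by have := ap x y erefl erefl; rewrite xy n0 addr0.
- have [h1 h3 h4] := eight_range xin yin E hx hy.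
  have Zn : (Z0 < Z1) = false.
    apply/negbTE; rewrite -leNgt ltW//; apply: (same_sign hh).
    by rewrite -mulrNN !opprB.
  rewrite Zn mulN1r mulrNz mulN1r h3; split=> //.
  exact: flip_range.
- have [h1 h3 h4] := eight_range yin xin (esym E) hy hx.
  have Zp : Z0 < Z1 by exact: same_sign hh h4.
  rewrite Zp; split; first exact: double_range.
  by rewrite mul1r -opprB h3 opprK.
Qed.

End Closure.

(** * Counting p-corners *)

Section CornerCount.
Context {R : realType} {C : finType} {N s : nat} (L : diagram R C N s).

(* Angles tau of the tangents and W of quadr along the link.  At a crossing c
   the boundary of a disk turns by nc c half turns more than tau predicts at a
   p-corner, and winds by om c turns more than W predicts. *)
Record link_angles (P Q : R * R) (kappa : nat) (tau W : 'I_N -> R -> R) (nc om : C -> int) : Prop := {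
  la_tau_cts : forall i x, cts (tau i) x;
  la_tau : forall i x, ang (tau i x) (tangent L (i, x));
  la_tau_per : forall i x, tau i (x + 1) = tau (monodromy L i) x;
  la_W_cts : forall i x, cts (W i) x;
  la_W : forall i x, ang (W i x) (quadr P Q (xyS L i x));
  la_W_per : forall i x, W i (x + 1) = W (monodromy L i) x;
  la_nc : forall c, 0 < (nc c)%:~R * pi + (tau (over L c).1 (over L c).2 - tau (under L c).1 (under L c).2) < pi;
  la_om : forall c, W (under L c).1 (under L c).2 - W (over L c).1 (over L c).2 = (om c)%:~R * (2 * pi);
  la_rel : forall c, nc c = 1 + kappa%:Z * om c }.

Context (gen : generic_diagram L) (D : disk R) (HD : is_disk L D).

Lemma circle_surj (w : R * R) : dot2 w w = 1 -> exists th, w = circle th.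
Proof.
move=> ww; have w0 : w <> 0 by move=> h; move: ww; rewrite h /dot2/= mulr0 addr0 => /eqP; rewrite eq_sym oner_eq0.
have [a [r r0 wE]] := ang_ex w0; exists (a / (2 * pi)).
have p0 : 2 * pi != 0 :> R by rewrite mulf_neq0 ?gt_eqF ?pi_gt0.
rewrite /circle [_ * (a / _)]mulrC divfK//.
have rr : r * r = 1.
  by rewrite -ww wE /dot2/= -[LHS]mulr1 -(cos2Dsin2 a) !expr2; ring.
have r1 : r = 1 by nra.
by rewrite wE r1 !mul1r.
Qed.

Lemma sd2_near (f g : R * R -> R * R) (x : R * R) (r : R) a b : 0 < r -> (forall t, `|t - x| < r -> f t = g t) ->
  sd2 f x a b -> sd2 g x a b.
Proof.
move=> r0 fg H e e0; have [d d0 Hd] := H e e0; exists (Num.min d r); first by rewrite lt_min d0.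
move=> v w; rewrite !lt_min => /andP[vd vr] /andP[wd wr].
by rewrite -!fg//; exact: Hd.
Qed.

Let f w := dmap D (retract w).

Lemma fE w : disk2 w -> f w = dmap D w.
Proof. by move=> dw; rewrite /f retract_id. Qed.

Lemma interior_sd2 w : dot2 w w < 1 -> exists a b, sd2 f w a b /\ 0 < det2 a b.
Proof.
move=> w1; have dw : disk2 w by apply/disk2E; exact: ltW.
have [m _ e|F [p [q [r [HF D0 r0 Fr]]]]] := disk_local HD dw.
  by move: w1; rewrite e dot2_circle ltxx.
exists p, q; split=> //.
have [||r' r'0 Hr'] := @c_pos R _ (fun w => 1 - dot2 w w) w.
- by apply: c_sub; [exact: c_cst|apply: c_dot; exact: c_id].
- by rewrite subr_gt0.
apply: (@sd2_near F f w (Num.min r r') p q) => //; first by rewrite lt_min r0.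
move=> t; rewrite lt_min => /andP[tr /Hr']; rewrite subr_gt0 => t1.
have dt : disk2 t by apply/disk2E; exact: ltW.
by rewrite fE// Fr.
Qed.

Lemma f_cts w : cts f w.
Proof. by apply: c_ext; exact: disk_cont HD. Qed.

Lemma boundary_winding P : (forall i x, xyS L i x <> P) ->
  exists psi : R -> R, exists n : nat, forall th, [/\ cts psi th, ang (psi th) (boundary D th - P) &
    psi (th + 1) = psi th + n%:R * (2 * pi)].
Proof.
move=> LP; have [w|w dw fP|psi [n H]] := @winding_pos R f P; first exact: f_cts.
  have w1 : dot2 w w < 1.
    have /disk2E := dw; rewrite le_eqVlt => /orP[/eqP|//] /circle_surj[th wE].
    have [i [x ix]] := disk_boundary HD th.
    by case: (LP i x); rewrite /xyS -ix -fP wE fE//; exact: circle_disk.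
  by split=> //; exact: interior_sd2.
exists psi, n => th; have [h1 h2 h3] := H th; split=> //.
by rewrite /boundary -fE//; exact: circle_disk.
Qed.

Lemma boundary_secants : exists2 eta0 : R, 0 < eta0 & forall eta : R, 0 < eta -> eta < eta0 ->
  exists2 phi : R -> R, secant_angle D eta phi & forall th, 0 <= th <= 1 -> phi (th + 1) = phi th + 2 * pi.
Proof.
have [d d0 Hd] := disk_inj HD.
have o1 : dot2 (0 : R * R) 0 < 1 by rewrite /dot2/= mulr0 addr0 ltr01.
have [a [b [sf ab]]] := interior_sd2 o1.
have [r r0 Hr] := sd2_pos sf ab.
have [||eta0 eta00 H] := @secant_lift R f d (alin a b) r (@f_cts) d0 _ (alin_neq0 ab) r0.
- by move=> w w' dw dw' ne h; rewrite !fE//; exact: Hd.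
- by move=> v vr v0; have := Hr v; rewrite !subr0 => /(_ vr v0).
exists eta0 => // eta h1 h2; have [phi [p1 p2]] := H eta h1 h2; exists phi => //.
move=> th /p1[k1 k2]; split=> //.
by rewrite /boundary -!fE//; exact: circle_disk.
Qed.

Lemma p_corners_le2 P Q kappa tau W nc om w : link_angles P Q kappa tau W nc om ->
  reads L D w -> (count (is_p_letter L) w <= 2)%N.
Proof.
move=> la [n [t [l [-> tmono tl tall]]]].
have rd : reading L D t l by split.
have LPQ i x : xyS L i x <> P /\ xyS L i x <> Q.
  have := ang_neq0 (la_W la i x); rewrite /quadr => h.
  by split=> e; apply: h; rewrite e subrr; apply: pair_eta; rewrite /=; ring.
have [pA [nA HA]] := boundary_winding (fun i x => (LPQ i x).1).
have [pB [nB HB]] := boundary_winding (fun i x => (LPQ i x).2).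
have wS := @winding_sum R C N s L gen D HD n t l rd (quadr P Q) W (fun th => pA th + pB th) (nA + nB)%N om
  (la_W_cts la) (la_W la) (la_W_per la).
have {}wS : ((nA + nB)%N : int) = \sum_(i < n) corner_jump L (fun c p => if p then om c else - om c) (l i).
  apply: wS.
  - by move=> th; have [? _ _] := HA th; have [? _ _] := HB th; apply: c_add.
  - by move=> th; have [_ ? _] := HA th; have [_ ? _] := HB th; exact: ang_mul.
  - move=> th; have [_ _ ->] := HA th; have [_ _ ->] := HB th.
    by rewrite PoszD intrD mulrDl -!pmulrn; ring.
  - exact: la_om la.
have [eta0 eta00 Hs] := boundary_secants.
have tS := @turning_sum R C N s L gen D HD n t l rd tau nc eta0 (la_tau_cts la) (la_tau la) (la_tau_per la)
  eta00 Hs (la_nc la).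
have cE : count (is_p_letter L) [seq l i | i : 'I_n] = (\sum_(i < n) is_p_letter L (l i))%N.
  rewrite -sum1_count /image_mem big_map big_enum_cond /= big_mkcond.
  by apply: eq_bigr => i _; case: is_p_letter.
(* Verified corner by corner. Since nA + nB counts preimages of [P] and [Q], the second term is
   nonnegative. *)
have E : (2 : int) = (count (is_p_letter L) [seq l i | i : 'I_n])%:Z + kappa%:Z * (nA + nB)%N.
  rewrite tS cE wS mulr_sumr (big_morph Posz PoszD (erefl (0%N : int))) -big_split /=; apply: eq_bigr => i _.
  case: (l i) => [c o u|r o] /=; last by rewrite mulr0.
  by case: is_p_quadrant; rewrite /= (la_rel la) ?mulrN; ring.
lia.
Qed.

End CornerCount.

(** * Brackets with the zero series *)

Section Series.
Context {K : fieldType} {C : finType} {s : nat} (dq : C -> int).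

Lemma zero_in_sft : in_sft dq (@zeroS K C s).
Proof.
split=> [m|d]; first by rewrite /zeroS eqxx.
by apply: (@sub_finite_set _ _ set0) => // m /= []; rewrite /zeroS eqxx.
Qed.

Lemma comm_in_sft (a : sft_series K C s) : in_comm dq a -> in_sft dq a.
Proof. by move=> [h1 h2 _]; split=> // d; apply: sub_finite_set h2 => m /= []. Qed.

Lemma parity_in_sft (a : sft_series K C s) : in_sft dq a -> in_sft dq (parityS dq a).
Proof.
have nz m : parityS dq a m != 0 -> a m != 0.
  by apply: contraNneq => e; rewrite /parityS e mulr0.
move=> [h1 h2]; split=> [m /nz|d]; first exact: h1.
by apply: sub_finite_set (h2 d) => m /= [/nz].
Qed.

Lemma bracket_zero br (a : sft_series K C s) : is_sft_bracket dq br -> in_sft dq a ->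
  br (@zeroS K C s) a = @zeroS K C s.
Proof.
move=> Hbr ha; have := br_linl Hbr 1 zero_in_sft zero_in_sft ha.
have -> : addS (scaleS 1 (@zeroS K C s)) (@zeroS K C s) = @zeroS K C s.
  by apply/funext => m; rewrite /addS /scaleS /zeroS mulr0 addr0.
move=> h; apply/funext => m; have := congr1 (fun f => f m) h.
rewrite /addS /scaleS mul1r => /eqP; rewrite -subr_eq0 opprD addrA subrr add0r oppr_eq0.
by move=> /eqP.
Qed.

Lemma foldl_bracket_zero br (r : seq (sft_series K C s)) : is_sft_bracket dq br ->
  (forall a, List.In a r -> in_sft dq a) ->
  foldl br (@zeroS K C s) r = @zeroS K C s.
Proof.
move=> Hbr; elim: r => //= a r IH H; rewrite (bracket_zero Hbr); last by apply: H; left.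
by apply: IH => b hb; apply: H; right.
Qed.

End Series.

Section Assembly.
Context {R : realType} {K : fieldType} {C : finType} {N s : nat} (L : diagram R C N s).

(** The set of disk classes is empty, so the value is 0 whatever the convention for infinite
    sums. *)
Lemma hamiltonian_zero (P Q : R * R) kappa tau W nc om (k : nat) : generic_diagram L ->
  link_angles L P Q kappa tau W nc om -> (3 <= k)%N -> hamiltonian K L k = @zeroS K C s.
Proof.
move=> gen la k3; have E : disks_with L k = set0.
  apply/seteqP; split=> // cl [D [w [HD _ rw ck]]].
  by have := p_corners_le2 gen HD la rw; rewrite ck leqNgt k3.
by apply/funext => m; rewrite /hamiltonian E fsbig_set0.
Qed.

Lemma strict_of_angles (P Q : R * R) kappa tau W nc om br : generic_diagram L ->
  link_angles L P Q kappa tau W nc om -> is_sft_bracket (qdeg L) br -> strict (K := K) L br.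
Proof.
move=> gen la Hbr k x k3 xin; rewrite /ell (hamiltonian_zero gen la k3).
apply: (foldl_bracket_zero Hbr) => a.
rewrite /image_mem; elim: (enum _) => //= i r IH [<-|]; last exact: IH.
have xi := comm_in_sft (xin i); case: ifP => // _; exact: parity_in_sft.
Qed.

End Assembly.

Lemma closure_angles (R : realType) (N : nat) (beta : seq 'I_N.-1) (z : 'I_N -> R -> R) (mu : {perm 'I_N})
    (xs : 'I_(size beta) -> R) (e : R) (Phi : R * R * R -> R * R * R) (b' b : R) :
  represents beta z mu xs -> unknot_neighborhood e Phi -> insertion Phi xs b' b ->
  exists2 sc0 : R, 0 < sc0 & forall sc : R, 0 < sc -> sc < sc0 ->
  forall ov un : closure_chord N (size beta) -> 'I_N * R,
    let L := closure_diagram Phi z mu b' b sc ov un in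
    closure_labels xs L -> exists P Q kappa tau W nc om, link_angles L P Q kappa tau W nc om.
Proof.
move=> rep nbh ins.
have [dc [P [Q [x0 [x1 [tau [W ea]]]]]]] := figure_eight_angles (nbh_fig8 nbh).
have [/andP[x00 x01] /andP[x10 x11] xx cc] := ea_x ea.
have [b'0 bb b1 _] := ins_order ins.
have oin : 0 <= (0 : R) <= b by rewrite lexx (ltW (lt_trans b'0 bb)).
(* Parameter 0 belongs to the inserted part, which is away from the double point. Hence both
   passages are interior to the period and their small neighborhoods do not wrap around. *)
have x0in : 0 < x0 < 1.
  rewrite x01 andbT lt_neqAle x00 andbT; apply/negP => /eqP e0.
  by apply: xx; move: cc; rewrite -e0 => c0; apply: (ins_away ins oin) c0; rewrite x10.
have x1in : 0 < x1 < 1.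
  rewrite x11 andbT lt_neqAle x10 andbT; apply/negP => /eqP e1.
  by apply: xx; move: cc; rewrite -e1 => c0; apply/esym; apply: (ins_away ins oin) (esym c0); rewrite x00.
have /andP[D1 D2] := ea_turn ea.
(* The distances from the turn between the two passages to the ends of ]- 2 pi, - pi[, and the
   margin pi that identifies the winding. *)
pose eta := Num.min pi (Num.min (tau x1 - tau x0 + 2 * pi) (- pi - (tau x1 - tau x0))).
have eta0 : 0 < eta by rewrite !lt_min pi_gt0 subr_gt0 D2 -[2 * pi]opprK subr_gt0 D1.
have [e1 e2 e3] : [/\ eta <= pi, eta <= tau x1 - tau x0 + 2 * pi & eta <= - pi - (tau x1 - tau x0)].
  by rewrite /eta !ge_min !lexx !orbT.
have [r /andP[r0 rx] Hr] := near_double nbh ea x0in x1in eta0.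
have [d1 /andP[d10 d1e] H1] := near_core nbh ea.
have [d2 /andP[d20 d2e] H2] := sheet_double nbh ea x0in x1in r0.
pose d := Num.min d1 (Num.min d2 r).
have d0 : 0 < d by rewrite !lt_min d10 d20.
have dd1 : d <= d1 by rewrite ge_min lexx.
have dd2 : d <= d2 by rewrite !ge_min lexx orbT.
have ddr : d <= r by rewrite !ge_min lexx !orbT.
have de : d <= e by exact: le_trans d1e.
have [sc0 sc00 Hsc] := small_scale (rep_smooth rep) d0.
exists sc0 => // sc s0 ssc ov un L lab.
have sm := Hsc sc s0 ssc.
have H1' (x y w : R) : 0 <= x <= 1 -> `|y| < d -> `|w| < d -> 0 < dot2 (dc x) (slope Phi x y w) /\
    0 < dot2 (quadr P Q (core Phi x)) (quadr P Q (sheet Phi (x, y))).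
  by move=> xin yd wd; apply: H1 => //; exact: lt_le_trans dd1.
have H2' (x y x' y' : R) (xin : 0 <= x <= 1) (xin' : 0 <= x' <= 1) (yd : `|y| < d) (yd' : `|y'| < d) :=
  H2 x y x' y' xin xin' (lt_le_trans yd dd2) (lt_le_trans yd' dd2).
have J := chord_jumps rep nbh s0 de sm ea lab H1' H2' rx ddr e1 e2 e3 Hr.
exists P, Q, (if height Phi (x0, 0, 0) < height Phi (x1, 0, 0) then 1%N else 2%N).
exists (fun i x => tau x + tilt z mu Phi b' b sc ov un dc i x).
exists (fun i x => W x + shift z mu Phi b' b sc ov un P Q i x).
exists (turn_jump Phi x0 x1), (wind_jump Phi x0 x1); split.
- exact: (tilt_cts rep nbh de sm ea lab H1').
- exact: (tilt_ang rep nbh de sm ea lab H1').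
- exact: (tilt_per ea lab).
- exact: (shift_cts rep nbh de sm ea lab H1').
- exact: (shift_ang rep nbh de sm ea lab H1').
- exact: (shift_per ea lab).
- by move=> c; exact: (J c).1.
- by move=> c; exact: (J c).2.
- by move=> c; rewrite jump_relation; case: ifP.
Qed.

(* "After scaling y, z to be small" is "for every
   sufficiently small scaling factor sc". *)
Theorem proposition3p9 (R : realType) (K : fieldType) (N : nat)
    (beta : seq 'I_N.-1)
    (charK : [pchar K] =i pred0) (N_gt0 : (0 < N)%N)
    (adm : admissible R beta) :
  forall (z : 'I_N -> R -> R) (mu : {perm 'I_N}) (xs : 'I_(size beta) -> R)
         (e : R) (Phi : R * R * R -> R * R * R) (b' b : R),
    represents beta z mu xs ->
    unknot_neighborhood e Phi ->
    insertion Phi xs b' b ->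
  exists2 sc0 : R, 0 < sc0 &
  forall sc : R, 0 < sc -> sc < sc0 ->
  forall ov un : closure_chord N (size beta) -> 'I_N * R,
    let L := closure_diagram Phi z mu b' b sc ov un in
    closure_labels xs L ->
  forall br : sft_series K (closure_chord N (size beta)) N ->
              sft_series K (closure_chord N (size beta)) N ->
              sft_series K (closure_chord N (size beta)) N,
    is_sft_bracket (qdeg L) br ->
    strict L br.
Proof.
move=> z mu xs e Phi b' b rep nbh ins.
have [sc0 sc00 H] := closure_angles rep nbh ins; exists sc0 => // sc s0 ssc ov un L lab br Hbr.
have [P [Q [kappa [tau [W [nc [om la]]]]]]] := H sc s0 ssc ov un lab.
exact: strict_of_angles (lab_generic lab) la Hbr.
Qed.
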